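(* Let $(A,\mathfrak m)$ be an excellent two-dimensional normal local ring containing an algebraically closed field $k\cong A/\mathfrak m$, and let $X\to\operatorname{Spec}A$ be a resolution of singularities with maximal ideal cycle $M$. Let $I=I_Z$ be an integrally closed $\mathfrak m$-primary ideal represented by the cycle $Z$ on $X$, and assume that $\mathfrak m\mathcal O_X=\mathcal O_X(-M)$. Then $$-MZ+1\ \ge\ \mu_A(I)\ \ge\ -MZ+1-p_g(A).$$ More precisely, $$\ell_A(I/\overline{I\mathfrak m})=-MZ+1-\varepsilon(Z,M),$$ and the equality $\mu_A(I)=-MZ+1$ holds if $\overline{I\mathfrak m}=fI+g\mathfrak m$ for general elements $f\in\mathfrak m$ and $g\in I$.
   Context: A cycle is a divisor on $X$ supported in the exceptional divisor $E$ (the preimage of $\mathfrak m$); $MZ$ is the intersection number. The maximal ideal cycle $M$ is the largest cycle with $\mathfrak m\mathcal O_X\subset\mathcal O_X(-M)$. For a cycle $Z$, $I_Z=H^0(X,\mathcal O_X(-Z))$. $I$ is represented by $Z$ on $X$ if $I\mathcal O_X=\mathcal O_X(-Z)$ is invertible and $I=I_Z$. $\mu_A(I)=\ell_A(I/\mathfrak mI)$ is the minimal number of generators, $\overline J$ is the integral closure of $J$, and $p_g(A)=\ell_A(H^1(X,\mathcal O_X))$ is the geometric genus. For cycles $Z_1,Z_2$ with $\mathcal O_X(-Z_1),\mathcal O_X(-Z_2)$ generated by global sections, elements $f_1\in I_{Z_1}$, $f_2\in I_{Z_2}$ are called general if the sequence $0\to\mathcal O_X\to\mathcal O_X(-Z_1)\oplus\mathcal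 O_X(-Z_2)\to\mathcal O_X(-Z_1-Z_2)\to0$, with maps $u\mapsto(f_1u,f_2u)$ and $(a,b)\mapsto -f_2a+f_1b$, is exact; such elements exist. One sets $\varepsilon(Z_1,Z_2)=\ell_A\bigl(I_{Z_1+Z_2}/(f_1I_{Z_2}+f_2I_{Z_1})\bigr)$, which is independent of the choice of general elements. ''General elements $f\in\mathfrak m$, $g\in I$'' is in this sense, for the cycles $M$ and $Z$. *)

(* Defs.v *)
From HB Require Import structures.
From mathcomp Require Import all_boot all_order all_algebra.
From mathcomp Require Import all_classical all_reals.

Set Implicit Arguments.
Unset Strict Implicit.
Unset Printing Implicit Defensive.

Import Order.TTheory GRing.Theory Num.Theory.

Local Open Scope classical_set_scope.
Local Open Scope ring_scope.

(** * Commutative algebra of a subring [S : set T] of an ambient commutative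
    ring [T].  Working with subsets lets the same definitions apply to a ring
    given as a type ([S := setT]) and to the local rings of a scheme seen
    inside its function field. *)

Section Modules.
Variables (T : comNzRingType) (V : lmodType T) (S : set T).

Definition submodule (N : set V) : Prop :=
  [/\ N 0, forall x y, N x -> N y -> N (x + y)
    & forall a x, S a -> N x -> N (a *: x)].

Definition span (G : set V) : set V :=
  [set x | forall N, submodule N -> G `<=` N -> N x].

Definition submodule_chain (N' N : set V) (n : nat) : Prop :=
  exists C : nat -> set V,
    [/\ C 0%N = N', C n = N, forall i, (i <= n)%N -> submodule (C i)
      & forall i, (i < n)%N -> C i `<` C i.+1].

(** The length of [N / N'], for submodules [N' `<=` N]: the supremum of the
    lengths of the strict chains of submodules from [N'] to [N]. *)
Definition length (N N' : set V) : \bar int :=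
  xget +oo%E [set l | exists n : nat,
    [/\ l = (n%:Z)%:E, submodule_chain N' N n
      & forall n', submodule_chain N' N n' -> (n' <= n)%N]].

End Modules.

Section Rings.
Variable T : comNzRingType.
Implicit Types (S R J P : set T).

Definition subring S : Prop :=
  [/\ S 1, forall x y, S x -> S y -> S (x - y)
    & forall x y, S x -> S y -> S (x * y)].

Definition adjoin S (G : set T) : set T :=
  [set x | forall S', subring S' -> S `<=` S' -> G `<=` S' -> S' x].

Definition ideal S J : Prop := J `<=` S /\ @submodule T T^o S J.

Definition ideal_span S (G : set T) : set T := @span T T^o S G.

Definition ideal_mul S J1 J2 : set T :=
  ideal_span S [set z | exists x y, [/\ J1 x, J2 y & z = x * y]].

Fixpoint ideal_exp S J (n : nat) : set T :=
  if n is n'.+1 then ideal_mul S J (ideal_exp S J n') else S.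

Definition prime_ideal S P : Prop :=
  [/\ ideal S P, ~ P 1
    & forall x y, S x -> S y -> P (x * y) -> P x \/ P y].

Definition nonunits S : set T :=
  [set x | S x /\ ~ exists2 y, S y & x * y = 1].

Definition local_ring S : Prop := subring S /\ ideal S (nonunits S).

Definition noetherian S : Prop :=
  forall J, ideal S J -> exists s : seq T, J = ideal_span S [set` s].

Definition prime_chain S (n : nat) (C : nat -> set T) : Prop :=
  (forall i, (i <= n)%N -> prime_ideal S (C i)) /\
  (forall i, (i < n)%N -> C i `<` C i.+1).

Definition krull_dim S (d : nat) : Prop :=
  (exists C, prime_chain S d C) /\
  (forall n C, prime_chain S n C -> (n <= d)%N).

Definition regular_local_ring S : Prop :=
  [/\ local_ring S, noetherian S
    & exists s : seq T, krull_dim S (size s) /\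
        nonunits S = ideal_span S [set` s]].

Definition integral_closure S J : set T :=
  [set x | S x /\ exists (n : nat) (c : nat -> T),
    [/\ (0 < n)%N, forall i, (1 <= i <= n)%N -> ideal_exp S J i (c i)
      & x ^+ n + \sum_(1 <= i < n.+1) c i * x ^+ (n - i) = 0]].

(** For [S] local (the only use below) this says that [J] is primary to the
    maximal ideal. *)
Definition max_primary S J : Prop :=
  ideal S J /\ [set x | S x /\ exists n : nat, J (x ^+ n)] = nonunits S.

End Rings.

(** * Excellent rings *)

Section Excellent.

Definition fg_algebra (A B : comNzRingType) (phi : {rmorphism A -> B}) : Prop :=
  exists s : seq B, adjoin (range phi) [set` s] = [set: B].

Definition prime_chain_between (B : comNzRingType) (P Q : set B)
    (n : nat) (C : nat -> set B) : Prop :=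
  [/\ prime_chain [set: B] n C, C 0%N = P & C n = Q].

Definition saturated (B : comNzRingType) (n : nat) (C : nat -> set B) : Prop :=
  forall i P, (i < n)%N -> prime_ideal [set: B] P ->
    C i `<=` P -> P `<=` C i.+1 -> P = C i \/ P = C i.+1.

Definition catenary (B : comNzRingType) : Prop :=
  forall P Q : set B, prime_ideal [set: B] P -> prime_ideal [set: B] Q ->
  P `<=` Q -> exists d : nat, forall n C, prime_chain_between P Q n C ->
    (n <= d)%N /\ (saturated n C -> n = d).

Definition universally_catenary (A : comNzRingType) : Prop :=
  forall (B : comNzRingType) (phi : {rmorphism A -> B}),
    fg_algebra phi -> catenary B.

Definition is_localization (B : comNzRingType) (P : set B)
    (L : comNzRingType) (phi : {rmorphism B -> L}) : Prop :=
  [/\ forall s, ~ P s -> exists y, phi s * y = 1,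
      forall x, exists a s, ~ P s /\ x * phi s = phi a
    & forall a, phi a = 0 -> exists2 s, ~ P s & s * a = 0].

Definition regular_at (B : comNzRingType) (P : set B) : Prop :=
  exists (L : comNzRingType) (phi : {rmorphism B -> L}),
    is_localization P phi /\ regular_local_ring [set: L].

Definition regular_ring (B : comNzRingType) : Prop :=
  noetherian [set: B] /\
  (forall P : set B, prime_ideal [set: B] P -> regular_at P).

(** J-2: the regular locus of every finitely generated algebra is open. *)
Definition J2_ring (A : comNzRingType) : Prop :=
  forall (B : comNzRingType) (phi : {rmorphism A -> B}), fg_algebra phi ->
  exists2 J : set B, ideal [set: B] J &
    forall P : set B, prime_ideal [set: B] P -> (regular_at P <-> ~ J `<=` P).

Definition ideal_ext (L L' : comNzRingType) (c : {rmorphism L -> L'})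
    (J : set L) : set L' := ideal_span [set: L'] (c @` J).

(** [c] is the completion of the Noetherian local ring [L] at its maximal
    ideal [n]: [L / n^r = L' / n^r L'] for all [r], and [L'] is separated and
    complete for the [n]-adic topology. *)
Definition is_completion (L L' : comNzRingType) (c : {rmorphism L -> L'}) : Prop :=
  let n r := ideal_exp [set: L] (nonunits [set: L]) r in
  [/\ forall r x, exists a, ideal_ext c (n r) (x - c a),
      forall r a, ideal_ext c (n r) (c a) -> n r a,
      forall x, (forall r, ideal_ext c (n r) x) -> x = 0
    & forall u : nat -> L', (forall r, ideal_ext c (n r) (u r.+1 - u r)) ->
        exists l, forall r, ideal_ext c (n r) (l - u r)].

(** [C] is the tensor product of [B1] and [B2] over [A]. *)
Definition is_pushout (A B1 B2 C : comNzRingType)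
    (f1 : {rmorphism A -> B1}) (f2 : {rmorphism A -> B2})
    (i1 : {rmorphism B1 -> C}) (i2 : {rmorphism B2 -> C}) : Prop :=
  i1 \o f1 =1 i2 \o f2 /\
  forall (D : comNzRingType) (g1 : {rmorphism B1 -> D}) (g2 : {rmorphism B2 -> D}),
    g1 \o f1 =1 g2 \o f2 ->
    (exists h : {rmorphism C -> D}, h \o i1 =1 g1 /\ h \o i2 =1 g2) /\
    (forall h h' : {rmorphism C -> D},
      h \o i1 =1 g1 -> h \o i2 =1 g2 ->
      h' \o i1 =1 g1 -> h' \o i2 =1 g2 -> h =1 h').

(** [F] is a finite extension of the residue field of [L] at [ker psi]. *)
Definition finite_residue_ext (L : comNzRingType) (F : fieldType)
    (psi : {rmorphism L -> F}) : Prop :=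
  exists s : seq F,
    ideal_span [set x | exists a b, x = psi a / psi b] [set` s] = [set: F].

(** The formal fibres of all localizations are geometrically regular: for
    every prime [Q] of [L = A_P] and every finite extension [F] of [kappa(Q)]
    the ring [L^ (x)_L F] is regular. *)
Definition G_ring (A : comNzRingType) : Prop :=
  forall (P : set A), prime_ideal [set: A] P ->
  forall (L : comNzRingType) (phi : {rmorphism A -> L}), is_localization P phi ->
  forall (L' : comNzRingType) (c : {rmorphism L -> L'}), is_completion c ->
  forall (F : fieldType) (psi : {rmorphism L -> F}), finite_residue_ext psi ->
  forall (C : comNzRingType) (i1 : {rmorphism L' -> C}) (i2 : {rmorphism F -> C}),
    is_pushout c psi i1 i2 -> regular_ring C.

Definition excellent (A : comNzRingType) : Prop :=
  [/\ noetherian [set: A], universally_catenary A, G_ring A & J2_ring A].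

End Excellent.

(** * Birational models

    An integral scheme [X], separated and of finite type over [Spec A] and with
    function field [K = Frac A], is given, following Zariski, by the set of its
    local rings [O_{X,x}], as subrings of [K]:
    - a point is identified with its local ring, and [x] specializes to [y]
      when [O_{X,y} `<=` O_{X,x}];
    - the affine scheme [Spec B] is the set of the localizations of [B];
    - [O_X(U)] is the intersection of the local rings at the points of [U]. *)

Section Models.
Variables (K : fieldType) (A : set K).
Implicit Types (B R V P E : set K) (X U : set (set K)).

Definition localization B P : set K :=
  [set x | exists a b, [/\ B a, B b, ~ P b & x = a / b]].

Definition spec B : set (set K) :=
  [set R | exists2 P, prime_ideal B P & R = localization B P].

Definition affine_cover X (r : nat) (B : 'I_r -> set K) : Prop :=
  (forall i, exists s : seq K, B i = adjoin A [set` s]) /\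
  X = \bigcup_(i in [set: 'I_r]) spec (B i).

Definition valuation_ring V : Prop := subring V /\ forall x, V x \/ V x^-1.

Definition dominates R' R : Prop :=
  R `<=` R' /\ nonunits R `<=` nonunits R'.

(** Separatedness and properness over [Spec A] are the valuative criterion. *)
Definition proper_model X : Prop :=
  (exists (r : nat) (B : 'I_r -> set K), affine_cover X B) /\
  (forall V, valuation_ring V -> A `<=` V ->
     exists! R, X R /\ dominates V R).

Definition resolution X : Prop :=
  proper_model X /\ (forall R, X R -> regular_local_ring R).

Definition structure_sections U : set K :=
  [set x | forall R, U R -> R x].

(** ** Cycles *)

Definition prime_divisor X E : Prop := X E /\ krull_dim E 1%N.

(** The prime divisors contained in the preimage of the maximal ideal. *)
Definition exceptional X : set (set K) :=
  [set E | prime_divisor X E /\ dominates E A].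

(** A divisor on [X] is a family of coefficients indexed by the prime divisors. *)
Definition cycle X (Z : set K -> int) : Prop :=
  forall E, Z E != 0 -> exceptional X E.

(** [v_E(x) >= n], for the valuation [v_E] of the discrete valuation ring [E]. *)
Definition val_ge E (n : int) (x : K) : Prop :=
  exists t y, [/\ nonunits E = [set t * z | z in E], E y & x = t ^ n * y].

(** The sections over [U] of [O_X(-Z)]. *)
Definition sections U (Z : set K -> int) : set K :=
  [set x | forall E, prime_divisor U E -> val_ge E (Z E) x].

(** The stalk of [O_X(-Z)] at [R]: the components of [Z] through the point [R]
    are the [E] containing [R]. *)
Definition stalk X (Z : set K -> int) R : set K :=
  sections [set E | X E /\ R `<=` E] Z.

(** [J O_X = O_X(-Z)]. *)
Definition generates X (J : set K) (Z : set K -> int) : Prop :=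
  forall R, X R -> ideal_span R J = stalk X Z R.

Definition invertible X (Z : set K -> int) : Prop :=
  forall R, X R -> exists2 t, t != 0 & stalk X Z R = [set t * y | y in R].

Definition represented X (I : set K) (Z : set K -> int) : Prop :=
  [/\ cycle X Z, generates X I Z, invertible X Z & I = sections X Z].

Definition max_ideal_cycle X (M : set K -> int) : Prop :=
  let adm M' := cycle X M' /\
    (forall R, X R -> ideal_span R (nonunits A) `<=` stalk X M' R) in
  adm M /\ (forall M', adm M' -> forall E, M' E <= M E).

(** ** Intersection numbers *)

(** The order at the closed point [R] of the curve [E] of the restriction to
    [E] of the Cartier divisor [Z - div h], where [v_E(h) = Z E]; [a / b] is a
    local equation of [Z - div h] at [R], which is a unit at [E], and the order
    of [a] on [E] is the length of [R / (p_E + a R)]. *)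
Definition local_degree X (Z : set K -> int) (h : K) E R : int :=
  let ord a := fine (@length K K^o A R
      [set x | exists p y, [/\ R p, nonunits E p, R y & x = p + a * y]]) in
  xget 0 [set n | exists a b,
    [/\ R a /\ ~ nonunits E a, R b /\ ~ nonunits E b,
        stalk X Z R = [set (h * a / b) * y | y in R]
      & n = ord a - ord b]].

(** [Z . E], the degree of [O_X(Z)] restricted to [E].  Lengths being taken over
    [A], closed points are weighted by the degree of their residue field. *)
Definition degree_on X (Z : set K -> int) E : int :=
  xget 0 [set n | exists h : K,
    [/\ h != 0, val_ge E (Z E) h, val_ge E (- Z E) h^-1
      & n = (\sum_(R \in [set R | X R /\ R `<` E]) local_degree X Z h E R)%R]].

Definition intersection X (Y Z : set K -> int) : int :=
  (\sum_(E \in exceptional X) (Y E * degree_on X Z E))%R.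

(** ** The invariants [mu], [p_g] and [epsilon] *)

Definition mu (I : set K) : \bar int :=
  @length K K^o A I (ideal_mul A (nonunits A) I).

Section Cech.
Variables (r : nat) (B : 'I_r -> set K).

(** Since all the [O_X(U)] lie in [K], a Cech 1-cochain with values in [O_X] is
    a matrix, and the cocycle condition can be read in [K]. *)
Definition cech_cocycles : set 'M[K]_r :=
  [set c | (forall i j, structure_sections (spec (B i) `&` spec (B j)) (c i j))
        /\ (forall i j l, c j l - c i l + c i j = 0)].

Definition cech_coboundaries : set 'M[K]_r :=
  [set c | exists b : 'I_r -> K,
     (forall i, structure_sections (spec (B i)) (b i)) /\
     (forall i j, c i j = b j - b i)].

End Cech.

(** [l_A(H^1(X, O_X))], computed on a finite affine open cover; it does not
    depend on the cover. *)
Definition geometric_genus X : \bar int :=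
  xget +oo%E [set l | exists (r : nat) (B : 'I_r -> set K),
    affine_cover X B /\
    l = @length K 'M[K]_r A (cech_cocycles B) (cech_coboundaries B)].

(** Exactness, at every point [R] of [X], of
    [0 -> O_X -> O_X(-Z1) (+) O_X(-Z2) -> O_X(-Z1-Z2) -> 0]. *)
Definition general X (Z1 Z2 : set K -> int) (f1 f2 : K) : Prop :=
  [/\ sections X Z1 f1, sections X Z2 f2
    & forall R, X R ->
      [/\ forall u, R u -> f1 * u = 0 -> f2 * u = 0 -> u = 0,
          forall a b, stalk X Z1 R a -> stalk X Z2 R b ->
            - f2 * a + f1 * b = 0 ->
            exists u, [/\ R u, a = f1 * u & b = f2 * u]
        & forall c, stalk X (Z1 \+ Z2) R c ->
            exists a b, [/\ stalk X Z1 R a, stalk X Z2 R b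
                          & c = - f2 * a + f1 * b]]].

(** [f1 J2 + f2 J1]. *)
Definition two_gen (f1 f2 : K) (J1 J2 : set K) : set K :=
  [set x | exists a b, [/\ J1 a, J2 b & x = f1 * b + f2 * a]].

(** [l_A(I_{Z1+Z2} / (f1 I_{Z2} + f2 I_{Z1}))] for general [f1] and [f2]; it does
    not depend on their choice. *)
Definition epsilon X (Z1 Z2 : set K -> int) : \bar int :=
  xget +oo%E [set l | exists f1 f2, general X Z1 Z2 f1 f2 /\
    l = @length K K^o A (sections X (Z1 \+ Z2))
          (two_gen f1 f2 (sections X Z1) (sections X Z2))].

End Models.

(** * The base ring, as a subring of its field of fractions *)

Definition base (A : idomainType) : set {fraction A} := range (@tofrac A).

Arguments base A : clear implicits.

Definition normal (A : idomainType) : Prop :=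
  forall x : {fraction A}, integralOver (@tofrac A) x -> base A x.

(* Main.v *)
(** A point of [X] is a local ring [R] with fraction field [K]; an exceptional
    curve [E] is studied through the rings [R + P_E] inside its discrete
    valuation ring, [P_E] being the maximal ideal of [E]. A nonconstant [u] on
    [E] is finite over [k(u)], and counting its zeros and poles by lengths of
    lattices shows that principal divisors on [E] have degree zero.

    Call [a] in [I] and [b] in [m] a general pair if at every point [a]
    generates [O_X(-Z)] or [b] generates [O_X(-M)]. The associativity formula,
    on [A] and at the closed points of [X], turns [l(A / (a, b))] into a sum
    over the nonexceptional components of [div a] of their intersections with
    [div b], that is with [-M]; if moreover [v_E(a) = Z_E] along [E], degree
    zero of [div a] gives [l(A / (a, b)) = - M Z]. By the associativity formula
    in the other order the length does not depend on [a] for a fixed [b], and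
    some [a] with [v_E(a) = Z_E] always exists. Since [a, b] is a regular
    sequence and [A / m = k], it follows that [l(I / (a m + b I)) = - M Z + 1].

    The integral closure of [I m] is [H^0(O_X(-Z-M))] by the valuative
    criterion, and this contains [I m], which contains [a m + b I]. Hence the
    upper bound and the formula with [epsilon]. Finally [H^0(O_X(-Z-M)) / (a m +
    b I)] embeds into [H^1(O_X)] by the Cech connecting map, so that [epsilon <=
    p_g]. *)
Require Import Defs.
From HB Require Import structures.
From mathcomp Require Import all_boot all_order all_algebra.
From mathcomp Require Import all_classical all_reals.
From mathcomp Require Import ring zify.

Import Order.TTheory GRing.Theory Num.Theory.

Local Open Scope classical_set_scope.
Local Open Scope ring_scope.

Set Implicit Arguments.
Unset Strict Implicit.
Unset Printing Implicit Defensive.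

(** The rings [R + P_E] stand for the local rings of [E] so that no quotient ring is formed:
    everything stays inside [K], and almost every isomorphism of subquotients is a multiplication.
    Nothing is lost, because [P_E] is an ideal of the whole valuation ring and so is contained in
    [a (R + P_E)] as soon as [a] is a unit at [E]. The main obstacle is that [E] may be singular: at
    a point of [E] neither [u] nor [1 / u] need be regular, and then zeros and poles cannot be
    counted separately. Degree zero is proved for functions with [u] or [1 / u] regular at each
    point; an arbitrary [u] is brought to the form [v / z ^ N] with [z] and [v] of this kind. That
    [E] is a curve over [k] at all is a dimension inequality, obtained by comparing cubic with
    quadratic growth of lengths over [A]. In a general pair, [a] may vanish along some [E] to an
    order greater than [Z_E], and then it says nothing about the degree of [Z] on [E]; hence the
    detour through a special first element. *)

Section Length.

(** * Lengths of subquotients of a module, through chains of submodules *)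

Variables (T : comNzRingType) (V : lmodType T) (S : set T).
Implicit Types (N P : set V).
Notation sm := (submodule S).
Hypothesis SN1 : S (-1).

Lemma sm_opp N x : sm N -> N x -> N (- x).
Proof. by move=> [_ _ NS] Nx; rewrite -scaleN1r; exact: NS. Qed.

Lemma sm_sub N x y : sm N -> N x -> N y -> N (x - y).
Proof. by move=> sN Nx Ny; have [_ ND _] := sN; apply: ND => //; exact: sm_opp. Qed.

Definition addset N P : set V := [set x | exists a b, [/\ N a, P b & x = a + b]].

Lemma sm_add N P : sm N -> sm P -> sm (addset N P).
Proof.
move=> [N0 ND NS] [P0 PD PS]; split.
- by exists 0, 0; rewrite addr0.
- move=> _ _ [a [b [Na Pb ->]]] [c [d [Nc Pd ->]]].
  by exists (a + c), (b + d); rewrite addrACA; split; auto.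
- move=> s _ Ss [a [b [Na Pb ->]]].
  by exists (s *: a), (s *: b); rewrite scalerDr; split; auto.
Qed.

Lemma sm_cap N P : sm N -> sm P -> sm (N `&` P).
Proof.
move=> [N0 ND NS] [P0 PD PS]; split => //.
- by move=> x y [? ?] [? ?]; split; auto.
- by move=> s x Ss [? ?]; split; auto.
Qed.

Lemma addset_subl N P : P 0 -> N `<=` addset N P.
Proof. by move=> P0 x Nx; exists x, 0; rewrite addr0. Qed.

Lemma addset_subr N P : N 0 -> P `<=` addset N P.
Proof. by move=> N0 x Px; exists 0, x; rewrite add0r. Qed.

Lemma addset_min N P Q : sm Q -> N `<=` Q -> P `<=` Q -> addset N P `<=` Q.
Proof. by move=> [_ QD _] NQ PQ _ [a [b [Na Pb ->]]]; apply: QD; auto. Qed.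

(** Chains that grow at the top, equivalent to [submodule_chain]; in this form they can be
    concatenated, cut and transported by induction. *)
Inductive lchain N' : set V -> nat -> Prop :=
| lchain0 : sm N' -> lchain N' N' 0
| lchainS N0 N n : lchain N' N0 n -> N0 `<` N -> sm N -> lchain N' N n.+1.

Lemma lchainP N' N n : submodule_chain S N' N n <-> lchain N' N n.
Proof.
split.
  move=> [C [<- <- smC ltC]].
  elim: n smC ltC => [|n IH] smC ltC; first by apply: lchain0; exact: smC.
  apply: (@lchainS _ (C n)); last 2 first.
  - exact: ltC.
  - exact: smC.
  by apply: IH => i lin; [apply: smC; exact: leqW|apply: ltC; exact: leqW].
elim=> [smN|N0 {}N {}n _ [C [C0 Cn smC ltC]] lt sN].
  by exists (fun=> N'); split.
exists (fun i => if (i <= n)%N then C i else N); split => //.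
- by rewrite ltnn.
- by move=> i _; case: ifP => // le; exact: smC.
- move=> i; rewrite ltnS => le; rewrite le; case: ltnP => lt'; first exact: ltC.
  have -> : i = n by apply/eqP; rewrite eqn_leq le.
  by rewrite Cn.
Qed.

Lemma lchain_sm N' N n : lchain N' N n -> [/\ sm N', sm N & N' `<=` N].
Proof.
elim=> [s|N0 {}N {}n _ [sN' _ sub] [lt _] sN]; first by split.
by split => //; exact: subset_trans lt.
Qed.

Lemma lchain_trans N P Q a b : lchain N P a -> lchain P Q b -> lchain N Q (a + b).
Proof.
move=> NP; elim=> [_|N0 {}Q {}b _ IH lt sQ]; first by rewrite addn0.
by rewrite addnS; apply: lchainS IH lt sQ.
Qed.

Lemma lchain1 N P : sm N -> sm P -> N `<` P -> lchain N P 1.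
Proof. by move=> sN sP lt; apply: lchainS lt sP; exact: lchain0. Qed.

Lemma lchain_ext N' N0 N a : lchain N' N0 a -> N0 `<=` N -> sm N ->
  exists2 b, lchain N' N b & (a + ~~ `[< N `<=` N0 >] <= b)%N.
Proof.
move=> c sub sN; case: asboolP => h /=.
  have -> : N = N0 by rewrite eqEsubset.
  by exists a; rewrite ?addn0.
by exists a.+1; [exact: lchainS c _ sN|rewrite addn1].
Qed.

(** Each strict step of the chain remains strict after intersecting with [P] or after adding [P]: by
    the modular law, a step trivial in both traces is trivial. Hence the two traces together lose no
    length. *)
Lemma lchain_split N' N P n : lchain N' N n -> sm P -> N' `<=` P ->
  exists a b, [/\ lchain N' (N `&` P) a, lchain P (addset N P) b & (n <= a + b)%N].
Proof.
move=> c sP; elim: c => [sN'|N0 {}N {}n c IH lt sN] sub.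
  have -> : N' `&` P = N' by rewrite setIidl.
  have -> : addset N' P = P.
    rewrite eqEsubset; split; first exact: addset_min.
    by apply: addset_subr; case: sN'.
  by exists 0, 0; split; [exact: lchain0|exact: lchain0|].
have [a [b [ca cb le]]] := IH sub.
have [_ sN0 _] := lchain_sm c.
have [P0 PD PS] := sP.
have [N00 N0D N0S] := sN0.
have [N_0 ND NS] := sN.
have [a' ca' lea] : exists2 a', lchain N' (N `&` P) a' &
    (a + ~~ `[< N `&` P `<=` N0 `&` P >] <= a')%N.
  apply: lchain_ext ca _ _; last exact: sm_cap.
  by apply: setSI; exact: properW.
have [b' cb' leb] : exists2 b', lchain P (addset N P) b' &
    (b + ~~ `[< addset N P `<=` addset N0 P >] <= b')%N.
  apply: lchain_ext cb _ _; last exact: sm_add.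
  apply: addset_min; first exact: sm_add.
    by apply: subset_trans (properW lt) _; exact: addset_subl.
  exact: addset_subr.
exists a', b'; split => //.
have : (~~ `[< N `&` P `<=` N0 `&` P >]) || (~~ `[< addset N P `<=` addset N0 P >]).
  rewrite -negb_and; apply/negP => /andP[/asboolP h1 /asboolP h2].
  have [ltl ltr] := lt; apply: ltr => x Nx.
  have [u [v [N0u Pv xE]]] : addset N0 P x by apply: h2; exact: addset_subl.
  have Nv : N v.
    have -> : v = x - u by rewrite xE addrAC subrr add0r.
    by apply: sm_sub => //; exact: ltl.
  by rewrite xE; apply: N0D => //; have [] := h1 v (conj Nv Pv).
move=> h; apply: leq_trans (leq_add lea leb).
rewrite addnACA -addn1 leq_add //.
by move: h; do 2 case: (~~ _).
Qed.

(** Finite length as a relation: equations between lengths become statements about natural numbers,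
    and every occurrence carries finiteness with it. *)
Definition len N N' n :=
  lchain N' N n /\ forall n', lchain N' N n' -> (n' <= n)%N.

Lemma len_sm N N' n : len N N' n -> [/\ sm N', sm N & N' `<=` N].
Proof. by case=> /lchain_sm. Qed.

Lemma len_uniq N N' n n' : len N N' n -> len N N' n' -> n = n'.
Proof. by move=> [c m] [c' m']; apply/eqP; rewrite eqn_leq m // m'. Qed.

Lemma len_bounded N N' C : sm N -> sm N' -> N' `<=` N ->
  (forall n, lchain N' N n -> (n <= C)%N) -> exists n, len N N' n.
Proof.
move=> sN sN' sub bd.
have ex : exists n, `[< lchain N' N n >].
  case: (pselect (N `<=` N')) => h.
    have -> : N = N' by rewrite eqEsubset.
    by exists 0; apply/asboolP; exact: lchain0.
  by exists 1; apply/asboolP; exact: lchain1.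
have bd' n : `[< lchain N' N n >] -> (n <= C)%N by move/asboolP; exact: bd.
exists (ex_maxn ex bd'); case: ex_maxnP => n /asboolP c m; split=> // n' c'.
by apply: m; apply/asboolP.
Qed.

Lemma len_length N N' n : len N N' n -> length S N N' = (n%:Z)%:E.
Proof.
move=> [c m]; rewrite /length; apply: xget_unique.
  exists n; split => //; first exact/lchainP.
  by move=> n' /lchainP; exact: m.
move=> _ [n' [-> /lchainP c' m']].
by congr EFin; congr Posz; apply/eqP; rewrite eqn_leq m // m' //; exact/lchainP.
Qed.

Lemma length_cases N N' : length S N N' = +oo%E \/ exists n, len N N' n.
Proof.
case: (pselect (exists n, len N N' n)) => h; [by right|left].
rewrite /length; apply: xgetPN => l [n [_ /lchainP c m]].
by apply: h; exists n; split=> // n' /lchainP; exact: m.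
Qed.

Lemma len0 N : sm N -> len N N 0.
Proof.
move=> sN; split; first exact: lchain0.
case=> // n c; inversion c; subst.
have [_ _ sub] := lchain_sm H0.
by case: H1 => _; elim.
Qed.

Lemma len0_eq N N' : len N N' 0 -> N = N'.
Proof.
move=> l; have [sN' sN sub] := len_sm l.
rewrite eqEsubset; split=> //; apply: contrapT => h.
by have := l.2 1 (lchain1 sN' sN (conj sub h)).
Qed.

(** Concatenation gives a chain of this length; [lchain_split] at [P] shows that none is longer. *)
Lemma len_add N P N' a b : len N P a -> len P N' b -> len N N' (a + b).
Proof.
move=> l1 l2; have [sN' sP sub2] := len_sm l2; have [_ sN sub1] := len_sm l1.
split; first by rewrite addnC; exact: lchain_trans l2.1 l1.1.
move=> n c; have [u [v [cu cv le]]] := lchain_split c sP sub2.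
apply: leq_trans le _; rewrite addnC leq_add //.
  apply: l1.2; have <- // : addset N P = N.
  rewrite eqEsubset; split; first exact: addset_min.
  by apply: addset_subl; case: sP.
by apply: l2.2; rewrite -[P](@setIidr _ N) //.
Qed.

Lemma len_split N P N' c : len N N' c -> sm P -> N' `<=` P -> P `<=` N ->
  exists a b, [/\ len N P a, len P N' b & c = (a + b)%N].
Proof.
move=> l sP sub1 sub2; have [sN' sN sub] := len_sm l.
have [a la] : exists a, len N P a.
  apply: (@len_bounded _ _ c) => // n cn.
  case: (pselect (P `<=` N')) => h.
    have E : P = N' by rewrite eqEsubset.
    by rewrite E in cn; apply: l.2.
  have c1 : lchain N' P 1 by exact: lchain1.
  by apply: leq_trans (l.2 _ (lchain_trans c1 cn)).
have [b lb] : exists b, len P N' b.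
  apply: (@len_bounded _ _ c) => // n cn.
  apply: leq_trans (l.2 _ (lchain_trans cn la.1)); exact: leq_addr.
by exists a, b; split => //; exact: len_uniq l (len_add la lb).
Qed.

Lemma len_sub N P N' c : len N N' c -> sm P -> N' `<=` P -> P `<=` N ->
  exists2 b, len P N' b & (b <= c)%N.
Proof.
by move=> l sP s1 s2; have [a [b [_ lb ->]]] := len_split l sP s1 s2; exists b; rewrite ?leq_addl.
Qed.

Lemma len_quo N P N' c : len N N' c -> sm P -> N' `<=` P -> P `<=` N ->
  exists2 a, len N P a & (a <= c)%N.
Proof.
by move=> l sP s1 s2; have [a [b [la _ ->]]] := len_split l sP s1 s2; exists a; rewrite ?leq_addr.
Qed.

Lemma lchain_len N N' n c : lchain N' N n -> len N N' c -> (n <= c)%N.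
Proof. by move=> h l; exact: l.2. Qed.

End Length.

(** * Invariance of length under isomorphisms of subquotients *)

Section LengthHom.
Variables (T : comNzRingType) (V W : lmodType T) (S : set T).
Hypothesis SN1 : S (-1).
Variables (N N' : set V) (M M' : set W) (f : V -> W).
Hypotheses (sN : submodule S N) (sN' : submodule S N') (sub : N' `<=` N).
Hypotheses (sM : submodule S M) (sM' : submodule S M') (subM : M' `<=` M).
Hypothesis fM : forall x, N x -> M (f x).
Hypothesis fD : forall x y, N x -> N y -> M' (f (x + y) - f x - f y).
Hypothesis fZ : forall a x, S a -> N x -> M' (f (a *: x) - a *: f x).
Hypothesis fsurj : forall y, M y -> exists2 x, N x & M' (y - f x).
Hypothesis fker : forall x, N x -> (M' (f x) <-> N' x).

Let pull (C : set W) : set V := [set x | N x /\ C (f x)].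
Let push (C : set V) : set W := [set y | exists2 x, C x & M' (y - f x)].

Let smB (C : set W) x y : submodule S C -> M' `<=` C -> C x -> M' (x - y) -> C y.
Proof.
move=> sC s Cx h; have -> : y = x - (x - y) by rewrite opprB addrC subrK.
by apply: (sm_sub SN1) => //; exact: s.
Qed.

Let sm_pull C : submodule S C -> M' `<=` C -> submodule S (pull C).
Proof.
move=> sC sMC; have [C0 CD CS] := sC; have [N0 ND NS] := sN.
split.
- split=> //; apply: sMC; apply/fker => //; by case: sN'.
- move=> x y [Nx Cx] [Ny Cy]; split; first exact: ND.
  have h := fD Nx Ny.
  rewrite -(subrK (f x) (f (x + y))) -(subrK (f y) (f (x + y) - f x)).
  by apply: (CD) => //; apply: (CD) => //; exact: sMC.
- move=> a x Sa [Nx Cx]; split; first exact: NS.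
  by rewrite -(subrK (a *: f x) (f _)); apply: CD; [exact/sMC/fZ|exact: CS].
Qed.

Let sm_push C : submodule S C -> N' `<=` C -> C `<=` N -> submodule S (push C).
Proof.
move=> [C0 CD CS] sNC sCN; have [M0 MD MS] := sM'.
split.
- exists 0 => //; rewrite sub0r; apply: (sm_opp SN1) => //.
  by apply/fker; [exact: sCN|case: sN'].
- move=> y z [x Cx h] [x' Cx' h']; exists (x + x'); first exact: CD.
  have h2 := fD (sCN _ Cx) (sCN _ Cx').
  have -> : y + z - f (x + x') = (y - f x) + (z - f x') - (f (x + x') - f x - f x').
    by rewrite addrACA -[f _ - _ - _]addrA -!opprD opprB addrA subrK.
  by apply: (sm_sub SN1) => //; exact: MD.
- move=> a y Sa [x Cx h]; exists (a *: x); first exact: CS.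
  have h2 := fZ Sa (sCN _ Cx).
  have -> : a *: y - f (a *: x) = a *: (y - f x) - (f (a *: x) - a *: f x).
    by rewrite scalerBr opprB addrA subrK.
  by apply: (sm_sub SN1) => //; exact: MS.
Qed.

Let pull_chain C n : lchain S M' C n -> C `<=` M -> lchain S N' (pull C) n.
Proof.
elim=> [_ _|C0 {}C {}n c IH lt sC sCM].
  have -> : pull M' = N'.
    rewrite eqEsubset; split => x; first by move=> [Nx /fker]; exact.
    by move=> N'x; split; [exact: sub|apply/fker => //; exact: sub].
  exact: lchain0.
have [_ sC0 sM0] := lchain_sm c.
apply: lchainS (IH (subset_trans (properW lt) sCM)) _ _.
  split; first by move=> x [Nx Cx]; split=> //; exact: (properW lt).
  move=> h; case: lt => l; apply => y Cy.
  have [x Nx hx] := fsurj (sCM _ Cy).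
  have Cx : C (f x) by apply: smB Cy hx => //; exact: subset_trans l.
  have [_ C0x] := h x (conj Nx Cx).
  rewrite -(subrK (f x) y); case: sC0 => _ D _; apply: D => //; exact: sM0.
apply: sm_pull => //; exact: subset_trans (properW lt).
Qed.

Let push_chain C n : lchain S N' C n -> C `<=` N -> lchain S M' (push C) n.
Proof.
elim=> [_ _|C0 {}C {}n c IH lt sC sCN].
  have -> : push N' = M'.
    rewrite eqEsubset; split => y.
      move=> [x N'x h]; rewrite -(subrK (f x) y); case: sM' => _ D _; apply: D => //.
      by apply/fker => //; exact: sub.
    move=> M'y; exists 0; first by case: sN'.
    apply: (sm_sub SN1) => //; apply/fker; by [case: sN|case: sN'].
  exact: lchain0.
have [_ sC0 sN0] := lchain_sm c.
apply: lchainS (IH (subset_trans (properW lt) sCN)) _ _.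
  split; first by move=> y [x Cx h]; exists x => //; exact: (properW lt).
  move=> h; case: lt => l; apply => x Cx.
  have [x' C0x' hx] : push C0 (f x).
    by apply: h; exists x => //; rewrite subrr; case: sM'.
  have Nx := sCN _ Cx; have Nx' := sCN _ (l _ C0x').
  have N'd : N' (x - x').
    apply/fker; first exact: (sm_sub SN1).
    have h1 := fD (sm_sub SN1 sN Nx Nx') Nx'.
    rewrite subrK in h1.
    have -> : f (x - x') = (f x - f x') - (f x - f (x - x') - f x').
      by rewrite [f x - f (x - x') - _]addrAC opprB [RHS]addrC subrK.
    exact: (sm_sub SN1).
  rewrite -(subrK x' x); case: sC0 => _ D _; apply: D => //; exact: sN0.
apply: sm_push => //; exact: subset_trans (properW lt).
Qed.

(** Pulling back and pushing forward match the submodules between [N'] and [N] with those between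
    [M'] and [M]. The map [f] is additive and linear only modulo [M'], because one of the maps used
    later is made by choosing local data for each element. *)
Lemma len_hom n : len S N N' n <-> len S M M' n.
Proof.
have E1 : pull M = N by rewrite eqEsubset; split=> x; [case|move=> Nx; split=> //; exact: fM].
have E2 : push N = M.
  rewrite eqEsubset; split=> y; last exact: fsurj.
  move=> [x Nx h]; rewrite -(subrK (f x) y); case: sM => _ D _; apply: D; first exact: subM.
  exact: fM.
split=> -[c m]; split.
- by rewrite -E2; exact: push_chain.
- by move=> n' c'; apply: m; rewrite -E1; exact: pull_chain.
- by rewrite -E1; exact: pull_chain.
- by move=> n' c'; apply: m; rewrite -E2; exact: push_chain.
Qed.

Lemma len_hom2 n : len S M M' n -> len S N N' n. Proof. by move/len_hom. Qed.

End LengthHom.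

Notation smod S N := (@submodule _ (GRing.regular _) S N).
Notation sadd N P := (@addset _ (GRing.regular _) N P).
Notation prin x S := [set x * y | y in S].

(** * Subrings of a field: modules, generated ideals, polynomials, units *)

Section Rings.
Variable K : fieldType.
Implicit Types (S R J N P : set K).

Lemma sr1 S : subring S -> S 1. Proof. by case. Qed.
Lemma srB S x y : subring S -> S x -> S y -> S (x - y). Proof. by case=> _ h _; exact: h. Qed.
Lemma srM S x y : subring S -> S x -> S y -> S (x * y). Proof. by case=> _ _; exact. Qed.
Lemma sr0 S : subring S -> S 0.
Proof. by move=> h; rewrite -(subrr 1); apply: srB => //; exact: sr1. Qed.
Lemma srN S x : subring S -> S x -> S (- x).
Proof. by move=> h Sx; rewrite -sub0r; apply: srB => //; exact: sr0. Qed.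
Lemma srD S x y : subring S -> S x -> S y -> S (x + y).
Proof. by move=> h Sx Sy; rewrite -[y]opprK; apply: srB => //; exact: srN. Qed.
Lemma srX S x n : subring S -> S x -> S (x ^+ n).
Proof.
move=> h Sx; elim: n => [|n IH]; first by rewrite expr0; exact: sr1.
by rewrite exprS; exact: srM.
Qed.
Lemma sr_sum S (I : Type) (r : seq I) (Q : pred I) (F : I -> K) :
  subring S -> (forall i, Q i -> S (F i)) -> S (\sum_(i <- r | Q i) F i).
Proof.
move=> h SF; elim/big_ind: _ => //; first exact: sr0.
by move=> x y; exact: srD.
Qed.
Lemma sr_prod S (I : Type) (r : seq I) (Q : pred I) (F : I -> K) :
  subring S -> (forall i, Q i -> S (F i)) -> S (\prod_(i <- r | Q i) F i).
Proof.
move=> h SF; elim/big_ind: _ => //; first exact: sr1.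
by move=> x y; exact: srM.
Qed.

Lemma srN1 S : subring S -> S (-1).
Proof. by move=> h; apply: srN => //; exact: sr1. Qed.

Lemma sm0 S N : smod S N -> N 0. Proof. by case. Qed.
Lemma smD S N x y : smod S N -> N x -> N y -> N (x + y). Proof. by case=> _ h _; exact: h. Qed.
Lemma smM S N a x : smod S N -> S a -> N x -> N (a * x). Proof. by case=> _ _; exact. Qed.
Lemma smMr S N a x : smod S N -> S a -> N x -> N (x * a).
Proof. by rewrite mulrC; exact: smM. Qed.
Lemma smN S N x : subring S -> smod S N -> N x -> N (- x).
Proof. by move=> /srN1 h sN Nx; exact: (sm_opp h sN Nx). Qed.
Lemma smB S N x y : subring S -> smod S N -> N x -> N y -> N (x - y).
Proof. by move=> /srN1 h sN Nx Ny; exact: (sm_sub h sN Nx Ny). Qed.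
Lemma sm_sum S N (I : Type) (r : seq I) (Q : pred I) (F : I -> K) :
  smod S N -> (forall i, Q i -> N (F i)) -> N (\sum_(i <- r | Q i) F i).
Proof.
move=> h SF; elim/big_ind: _ => //; first exact: sm0 h.
by move=> x y; exact: smD h.
Qed.

Lemma smod_mono S S' N : S `<=` S' -> smod S' N -> smod S N.
Proof. by move=> s [n0 nD nM]; split=> // a x Sa; apply: nM; exact: s. Qed.

Lemma sr_smod S : subring S -> smod S S.
Proof.
move=> h; split; [exact: sr0|by move=> x y; exact: srD|by move=> x y; exact: srM].
Qed.

Lemma prin_smod S x : subring S -> smod S (prin x S).
Proof.
move=> h; split.
- by exists 0; [exact: sr0|rewrite mulr0].
- by move=> _ _ [a Sa <-] [b Sb <-]; exists (a + b); [exact: srD|rewrite mulrDr].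
- by move=> a _ Sa [b Sb <-]; exists (a * b); [exact: srM|rewrite mulrCA].
Qed.

Lemma img_smod S N x : smod S N -> smod S (prin x N).
Proof.
move=> [n0 nD nM]; split.
- by exists 0; rewrite ?mulr0.
- by move=> _ _ [a Sa <-] [b Sb <-]; exists (a + b); [exact: nD|rewrite mulrDr].
- by move=> a _ Sa [b Sb <-]; exists (a * b); [exact: nM|rewrite /GRing.scale /= mulrCA].
Qed.

Lemma prin_sub S N x : smod S N -> N x -> prin x S `<=` N.
Proof. by move=> h Nx _ [y Sy <-]; exact: smMr h Sy Nx. Qed.

Lemma prin_self S x : subring S -> (prin x S) x.
Proof. by move=> h; exists 1; [exact: sr1|rewrite mulr1]. Qed.

Lemma prinP S x y : x != 0 -> (prin x S) y <-> S (y / x).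
Proof.
move=> x0; split; first by move=> [z Sz <-]; rewrite mulrC mulKf.
by move=> h; exists (y / x) => //; rewrite mulrC divfK.
Qed.

Lemma sadd_subl N P : P 0 -> N `<=` sadd N P.
Proof. by move=> P0 x Nx; exists x, 0; rewrite addr0. Qed.
Lemma sadd_subr N P : N 0 -> P `<=` sadd N P.
Proof. by move=> N0 x Px; exists 0, x; rewrite add0r. Qed.
Lemma sadd_min S N P N' : smod S N' -> N `<=` N' -> P `<=` N' -> sadd N P `<=` N'.
Proof. by move=> sN NN PN _ [a [b [Na Pb ->]]]; apply: (smD sN); [exact: NN|exact: PN]. Qed.
Lemma sadd_smod S N P : smod S N -> smod S P -> smod S (sadd N P).
Proof. by move=> sN sP; exact: (sm_add sN sP). Qed.

(** Between subquotients of [K] the maps needed below are multiplications; [p = 1] serves the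
    isomorphism theorems. *)
Lemma len_mulK S N N' M M' p n : subring S -> smod S N -> smod S N' -> N' `<=` N ->
  smod S M -> smod S M' -> M' `<=` M -> (forall x, N x -> M (p * x)) ->
  (forall y, M y -> exists2 x, N x & M' (y - p * x)) ->
  (forall x, N x -> (M' (p * x) <-> N' x)) ->
  len S (N : set K^o) N' n <-> len S (M : set K^o) M' n.
Proof.
move=> hS sN sN' s1 sM sM' s2 h1 h2 h3; have S1 := srN1 hS; have M0 := sm0 sM'.
have hD x y : N x -> N y -> M' (p * (x + y) - p * x - p * y).
  by move=> _ _; have -> : p * (x + y) - p * x - p * y = 0 by ring.
have hZ a x : S a -> N x -> M' (p * (a *: (x : K^o)) - a *: (p * x : K^o)).
  by move=> _ _; have -> : p * (a *: (x : K^o)) - a *: (p * x : K^o) = 0 by rewrite /GRing.scale /=; ring.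
exact: (@len_hom K K^o K^o S S1 N N' M M' (fun x => p * x) sN sN' s1 sM sM' s2 h1 hD hZ h2 h3 n).
Qed.

Lemma len_mul1 S N N' M M' p n : subring S -> smod S N -> smod S N' -> N' `<=` N ->
  smod S M -> smod S M' -> M' `<=` M -> (forall x, N x -> M (p * x)) ->
  (forall y, M y -> exists2 x, N x & M' (y - p * x)) ->
  (forall x, N x -> (M' (p * x) <-> N' x)) ->
  len S (N : set K^o) N' n -> len S (M : set K^o) M' n.
Proof. by move=> h1 h2 h3 h4 h5 h6 h7 h8 h9 h10; exact: (proj1 (len_mulK n h1 h2 h3 h4 h5 h6 h7 h8 h9 h10)). Qed.

Lemma len_mul2 S N N' M M' p n : subring S -> smod S N -> smod S N' -> N' `<=` N ->
  smod S M -> smod S M' -> M' `<=` M -> (forall x, N x -> M (p * x)) ->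
  (forall y, M y -> exists2 x, N x & M' (y - p * x)) ->
  (forall x, N x -> (M' (p * x) <-> N' x)) ->
  len S (M : set K^o) M' n -> len S (N : set K^o) N' n.
Proof. by move=> h1 h2 h3 h4 h5 h6 h7 h8 h9 h10; exact: (proj2 (len_mulK n h1 h2 h3 h4 h5 h6 h7 h8 h9 h10)). Qed.

Lemma len_iso2 S N P n : subring S -> smod S N -> smod S P ->
  len S (N : set K^o) (N `&` P) n <-> len S (sadd N P : set K^o) P n.
Proof.
move=> hS sN sP; have sNP : smod S (N `&` P) by exact: sm_cap.
apply: (@len_mulK S _ _ _ _ 1) => //.
- exact: sadd_smod.
- by apply: sadd_subr; exact: sm0 sN.
- by move=> x Nx; rewrite mul1r; apply: sadd_subl => //; exact: sm0 sP.
- move=> _ [a [b [Na Pb ->]]]; exists a => //.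
  by have -> : a + b - 1 * a = b by ring.
- by move=> x Nx; rewrite mul1r; split=> [|[]].
Qed.

Lemma ideal_spanS S G : G `<=` ideal_span S G.
Proof. by move=> x Gx N _; exact. Qed.

Lemma ideal_span_min S G N : smod S N -> G `<=` N -> ideal_span S G `<=` N.
Proof. by move=> sN sub x; apply. Qed.

Lemma ideal_span_smod S G : smod S (ideal_span S G).
Proof.
split.
- by move=> N [].
- by move=> x y hx hy N sN sG; apply: smD (sN) _ _; [exact: hx|exact: hy].
- by move=> a x Sa hx N sN sG; apply: smM (sN) _ _ => //; exact: hx.
Qed.

Lemma ideal_span_sub S G : subring S -> G `<=` S -> ideal_span S G `<=` S.
Proof. by move=> h; apply: ideal_span_min; exact: sr_smod. Qed.

Lemma ideal_span_mono S G G' : G `<=` G' -> ideal_span S G `<=` ideal_span S G'.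
Proof.
move=> s; apply: ideal_span_min; first exact: ideal_span_smod.
exact: subset_trans (@ideal_spanS _ _).
Qed.

Lemma ideal_span_prin S x : subring S -> ideal_span S [set x] = prin x S.
Proof.
move=> h; rewrite eqEsubset; split.
  by apply: ideal_span_min; [exact: prin_smod|move=> _ ->; exact: prin_self].
by apply: prin_sub; [exact: ideal_span_smod|exact: ideal_spanS].
Qed.

Lemma adjoin_subring S G : subring (adjoin S G).
Proof.
split.
- by move=> S' h *; exact: sr1.
- by move=> x y hx hy S' h s g; apply: srB => //; [exact: hx|exact: hy].
- by move=> x y hx hy S' h s g; apply: srM => //; [exact: hx|exact: hy].
Qed.
Lemma adjoinSl S G : S `<=` adjoin S G. Proof. by move=> x Sx S' _ s _; exact: s. Qed.
Lemma adjoinSr S G : G `<=` adjoin S G. Proof. by move=> x Gx S' _ _; exact. Qed.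
Lemma adjoin_min S G S' : subring S' -> S `<=` S' -> G `<=` S' -> adjoin S G `<=` S'.
Proof. by move=> h s g x; apply. Qed.
Lemma adjoin_cons S x (s : seq K) :
  adjoin S [set` x :: s] = adjoin (adjoin S [set` s]) [set x].
Proof.
rewrite eqEsubset; split; apply: adjoin_min; try exact: adjoin_subring.
- by apply: subset_trans (@adjoinSl _ _); exact: adjoinSl.
- move=> y /=; rewrite inE => /orP[/eqP ->|ys]; first exact: adjoinSr.
  by apply: adjoinSl; exact: adjoinSr.
- apply: adjoin_min; [exact: adjoin_subring|exact: adjoinSl|].
  by move=> y /= ys; apply: adjoinSr => /=; rewrite inE ys orbT.
- by move=> _ ->; apply: adjoinSr => /=; rewrite inE eqxx.
Qed.

Definition pin S (p : {poly K}) := forall i, S p`_i.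

Lemma pinC S c : subring S -> S c -> pin S c%:P.
Proof. by move=> h Sc i; rewrite coefC; case: ifP => // _; exact: sr0. Qed.
Lemma pinD S p q : subring S -> pin S p -> pin S q -> pin S (p + q).
Proof. by move=> h Sp Sq i; rewrite coefD; exact: srD. Qed.
Lemma pinB S p q : subring S -> pin S p -> pin S q -> pin S (p - q).
Proof. by move=> h Sp Sq i; rewrite coefB; exact: srB. Qed.
Lemma pinM S p q : subring S -> pin S p -> pin S q -> pin S (p * q).
Proof. by move=> h Sp Sq i; rewrite coefM; apply: sr_sum => // j _; exact: srM. Qed.
Lemma pinXn S n : subring S -> pin S 'X^n.
Proof. by move=> h i; rewrite coefXn; case: eqP => _; [exact: sr1|exact: sr0]. Qed.
Lemma pinX S : subring S -> pin S 'X.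
Proof. by move=> h i; rewrite coefX; case: eqP => _; [exact: sr1|exact: sr0]. Qed.
Lemma pinZ S c p : subring S -> S c -> pin S p -> pin S (c *: p).
Proof. by move=> h Sc Sp i; rewrite coefZ; exact: srM. Qed.
Lemma pin_sum S (I : Type) (r : seq I) (Q : pred I) (F : I -> {poly K}) :
  subring S -> (forall i, Q i -> pin S (F i)) -> pin S (\sum_(i <- r | Q i) F i).
Proof. by move=> h SF j; rewrite coef_sum; apply: sr_sum => // i Qi; exact: SF. Qed.
Lemma pin_exp S p n : subring S -> pin S p -> pin S (p ^+ n).
Proof.
move=> h Sp; elim: n => [|n IH]; first by rewrite expr0; apply: pinC; [|exact: sr1].
by rewrite exprS; exact: pinM.
Qed.
Lemma pin_sub S S' p : S `<=` S' -> pin S p -> pin S' p.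
Proof. by move=> s h i; exact/s/h. Qed.

Lemma pin_horner S N p x : smod S N -> pin S p -> (forall i, (i < size p)%N -> N (x ^+ i)) ->
  N p.[x].
Proof.
move=> sN Sp h; rewrite horner_coef; apply: (sm_sum _ sN) => i _.
by apply: (smM sN); [exact: Sp|exact: h].
Qed.

Lemma pin_sr S p x : subring S -> pin S p -> S x -> S p.[x].
Proof.
move=> h Sp Sx; apply: pin_horner (sr_smod h) Sp _ => i _; exact: srX.
Qed.

Lemma adjoin1P S x y : subring S -> adjoin S [set x] y <-> exists2 p, pin S p & y = p.[x].
Proof.
move=> h; split; last first.
  move=> [p Sp ->]; apply: (pin_sr (@adjoin_subring S [set x])).
    exact: (pin_sub (@adjoinSl S [set x]) Sp).
  exact: adjoinSr.
move: y; apply: adjoin_min.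
- split.
  + by exists 1; [apply: pinC => //; exact: sr1|rewrite hornerC].
  + by move=> _ _ [p Sp ->] [q Sq ->]; exists (p - q); [exact: pinB|rewrite !hornerE].
  + by move=> _ _ [p Sp ->] [q Sq ->]; exists (p * q); [exact: pinM|rewrite !hornerE].
- by move=> a Sa; exists a%:P; [exact: pinC|rewrite hornerC].
- by move=> _ ->; exists 'X; [exact: pinX|rewrite hornerX].
Qed.

Lemma unitP S x : (exists2 y, S y & x * y = 1) <-> x != 0 /\ S x^-1.
Proof.
split.
  move=> [y Sy xy]; have x0 : x != 0.
    by apply/eqP => x0; move/eqP: xy; rewrite x0 mul0r eq_sym oner_eq0.
  by split=> //; rewrite -[x^-1]mulr1 -xy mulKf.
by move=> [x0 h]; exists x^-1; rewrite ?divff.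
Qed.

Lemma nuP S x : nonunits S x <-> S x /\ (x = 0 \/ ~ S x^-1).
Proof.
split.
  move=> [Sx h]; split=> //; have [->|x0] := eqVneq x 0; [by left|right=> h'].
  by apply: h; apply/unitP.
move=> [Sx h]; split=> // /unitP [x0 h']; case: h => // E.
by rewrite E eqxx in x0.
Qed.

Lemma nu_inv S x : S x -> ~ nonunits S x -> x != 0 /\ S x^-1.
Proof. by move=> Sx h; apply/unitP; apply: contrapT => h'; exact: h. Qed.

Lemma nu_sub S : nonunits S `<=` S. Proof. by move=> x []. Qed.

Lemma nu1 S : subring S -> ~ nonunits S 1.
Proof. by move=> h [_]; apply; exists 1; [exact: sr1|rewrite mulr1]. Qed.

Lemma nu_not S x : nonunits S x -> x != 0 -> ~ S x^-1.
Proof. by move=> /nuP [_ [->|]] //; rewrite eqxx. Qed.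

Lemma nu_smod S : local_ring S -> smod S (nonunits S).
Proof. by case=> _ []. Qed.

Lemma nu_prime S : local_ring S -> prime_ideal S (nonunits S).
Proof.
move=> [h i]; split=> //; first exact: nu1.
move=> x y Sx Sy nxy; apply: contrapT => /not_orP [hx hy].
have [x0 Sx'] := nu_inv Sx hx; have [y0 Sy'] := nu_inv Sy hy.
by apply: (nu_not nxy); rewrite ?mulf_neq0 // invfM; exact: srM.
Qed.

Lemma nu_1B S x : local_ring S -> nonunits S x -> 1 - x != 0 /\ S (1 - x)^-1.
Proof.
move=> lS nx; have [h _] := lS; apply: nu_inv.
  by apply: srB => //; [exact: sr1|exact: nu_sub].
move=> h'; apply: (nu1 h); rewrite -(subrK x 1).
exact: smD (nu_smod lS) _ _.
Qed.

Lemma nu_unitD S u x : local_ring S -> S u -> ~ nonunits S u -> nonunits S x ->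
  ~ nonunits S (u + x).
Proof.
move=> lS Su nu nx h; apply: nu; rewrite -(addrK x u).
by apply: smB (proj1 lS) (nu_smod lS) _ _.
Qed.

Lemma ideal_proper S J : local_ring S -> ideal S J -> ~ J 1 -> J `<=` nonunits S.
Proof.
move=> lS [sub sJ] J1 x Jx; apply: contrapT => h.
have [x0 Sx] := nu_inv (sub _ Jx) h; apply: J1.
by rewrite -(mulVf x0); exact: smM sJ _ _.
Qed.

Lemma prime_prod S P n (x : nat -> K) : subring S -> prime_ideal S P ->
  (forall i, (i < n)%N -> S (x i)) -> P (\prod_(i < n) x i) ->
  exists2 i, (i < n)%N & P (x i).
Proof.
move=> h [iP P1 pr]; elim: n => [|n IH] Sx; first by rewrite big_ord0.
rewrite big_ord_recr /= => /pr [].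
- by apply: sr_prod => // i _; apply: Sx; rewrite ltnS ltnW.
- exact: Sx.
- move=> /IH [i lt|i lt Pi]; first by apply: Sx; exact: ltnW.
  by exists i => //; exact: ltnW.
- by exists n.
Qed.

Lemma prime_exp S P x n : subring S -> prime_ideal S P -> S x -> P (x ^+ n) -> P x.
Proof.
move=> h pP Sx; rewrite -[n]card_ord -prodr_const => /(prime_prod h pP) [] // i _; exact.
Qed.

End Rings.

(** * Noetherian rings: primes over an ideal, Nakayama's lemma, the principal ideal theorem *)

Section Noeth.
Variable K : fieldType.
Implicit Types (S R J N P : set K).

Lemma noeth_acc S (C : nat -> set K) : noetherian S -> (forall i, ideal S (C i)) ->
  (forall i, C i `<=` C i.+1) -> exists n, forall m, (n <= m)%N -> C m = C n.
Proof.
move=> nS iC sC.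
have mono i j : (i <= j)%N -> C i `<=` C j.
  elim: j => [|j IH]; first by rewrite leqn0 => /eqP ->.
  rewrite leq_eqVlt => /orP[/eqP -> //|]; rewrite ltnS => /IH h.
  exact: subset_trans (sC j).
have iU : ideal S (\bigcup_i C i).
  split; first by move=> x [i _ Cx]; exact: (proj1 (iC i)).
  split; first by exists 0 => //; exact: sm0 (proj2 (iC 0)).
    move=> x y [i _ Cx] [j _ Cy]; exists (maxn i j) => //.
    apply: (smD (proj2 (iC _))); [apply: mono Cx|apply: mono Cy].
      exact: leq_maxl. 
    exact: leq_maxr.
  by move=> a x Sa [i _ Cx]; exists i => //; exact: smM (proj2 (iC i)) _ _.
have [s sE] := nS _ iU.
have [n hn] : exists n, forall x, x \in s -> C n x.
  have : forall x, x \in s -> (\bigcup_i C i) x by move=> x xs; rewrite sE; exact: ideal_spanS.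
  elim: (s) => [|x s' IH] h; first by exists 0.
  have [n hn] : exists n, forall x, x \in s' -> C n x.
    by apply: IH => y ys; apply: h; rewrite inE ys orbT.
  have [i _ Cx] := h x (mem_head _ _).
  exists (maxn n i) => y; rewrite inE => /orP[/eqP ->|ys].
    by apply: mono Cx; exact: leq_maxr.
  by apply: mono (hn _ ys); exact: leq_maxl.
exists n => m nm; rewrite eqEsubset; split; last exact: mono.
apply: (@subset_trans _ (\bigcup_i C i)); first by move=> x Cx; exists m.
by rewrite sE; apply: ideal_span_min; [exact: proj2 (iC n)|exact: hn].
Qed.

Lemma noeth_ind S (Q : set K -> Prop) : noetherian S ->
  (forall J, ideal S J -> (forall J', ideal S J' -> J `<` J' -> Q J') -> Q J) ->
  forall J, ideal S J -> Q J.
Proof.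
move=> nS H J0 iJ0; apply: contrapT => nQ.
pose T := {J : set K | ideal S J /\ ~ Q J}.
have step (J : T) : {J' : T | proj1_sig J `<` proj1_sig J'}.
  apply: cid; case: J => J [iJ nQJ] /=; apply: contrapT => h; apply: nQJ; apply: H => // J' iJ' lt.
  apply: contrapT => nQ'; apply: h.
  by exists (exist _ J' (conj iJ' nQ')).
have [C [_ ltC]] := dependent_choice step (exist _ J0 (conj iJ0 nQ)).
have [n hn] := noeth_acc nS (fun i => proj1 (proj2_sig (C i))) (fun i => properW (ltC i)).
have [_] := ltC n; apply.
by rewrite (hn n.+1).
Qed.

(** A substitute for primary decomposition. If [x * y] is in [J] with neither factor in [J], the
    primes found for [J + x S] and [J + y S] are concatenated, since the product of these two ideals
    lies in [J]. *)
Lemma noeth_primes S J : subring S -> noetherian S -> ideal S J ->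
  exists r (p : nat -> set K),
    (forall i, (i < r)%N -> prime_ideal S (p i) /\ J `<=` p i) /\
    (forall x : nat -> K, (forall i, (i < r)%N -> p i (x i)) -> J (\prod_(i < r) x i)).
Proof.
move=> h nS; move: J; apply: (noeth_ind nS) => J iJ IH.
case: (pselect (J 1)) => J1.
  by exists 0, (fun=> J); split=> // x _; rewrite big_ord0.
case: (pselect (prime_ideal S J)) => pJ.
  exists 1, (fun=> J); split.
    by case=> // _; split.
  by move=> x hx; rewrite big_ord_recl big_ord0 mulr1; exact: hx.
have [x [y [Sx Sy Jxy [Jx Jy]]]] :
    exists x y, [/\ S x, S y, J (x * y) & ~ J x /\ ~ J y].
  apply: contrapT => h'; apply: pJ; split=> // x y Sx Sy Jxy.
  apply: contrapT => /not_orP [Jx Jy]; apply: h'.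
  by exists x, y.
have [sub sJ] := iJ.
have big z : S z -> ~ J z -> ideal S (sadd J (prin z S)) /\ J `<` sadd J (prin z S).
  move=> Sz Jz; have sp := prin_smod z h; split.
    split; last exact: sadd_smod.
    apply: sadd_min => //; first exact: sr_smod.
    by apply: prin_sub => //; exact: sr_smod.
  split; first by apply: sadd_subl; exact: sm0 sp.
  by move=> h'; apply: Jz; apply: h'; apply: sadd_subr; [exact: sm0 sJ|exact: prin_self].
have [i1 l1] := big x Sx Jx; have [i2 l2] := big y Sy Jy.
have [r1 [p1 [P1 Q1]]] := IH _ i1 l1.
have [r2 [p2 [P2 Q2]]] := IH _ i2 l2.
exists (r1 + r2)%N, (fun i => if (i < r1)%N then p1 i else p2 (i - r1)%N); split.
  move=> i lt; case: ifP => lt1.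
    by have [? s] := P1 i lt1; split=> //; exact: subset_trans (properW l1) s.
  have lt2 : (i - r1 < r2)%N by rewrite ltn_subLR // leqNgt lt1.
  by have [? s] := P2 _ lt2; split=> //; exact: subset_trans (properW l2) s.
move=> z hz; rewrite big_split_ord /=.
have [j1 [_ [J1' [a Sa <-] ->]]] : sadd J (prin x S) (\prod_(i < r1) z i).
  by apply: Q1 => i lt; have := hz i; rewrite ltn_addr // lt; apply.
have [j2 [_ [J2' [b Sb <-] ->]]] : sadd J (prin y S) (\prod_(i < r2) z (r1 + i)%N).
  apply: (Q2 (fun i => z (r1 + i)%N)) => i lt; have := hz (r1 + i)%N.
  by rewrite ltn_add2l lt ltnNge leq_addr /= addKn; apply.
have -> : (j1 + x * a) * (j2 + y * b) = (j2 + y * b) * j1 + (x * a) * j2 + (a * b) * (x * y).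
  by ring.
apply: (smD sJ); first apply: (smD sJ).
- by apply: (smM sJ) => //; apply: srD => //; [exact: sub|exact: srM].
- by apply: (smM sJ) => //; exact: srM.
- by apply: (smM sJ) => //; exact: srM.
Qed.

Lemma prime_over S J r (p : nat -> set K) Q : subring S -> prime_ideal S Q -> J `<=` Q ->
  (forall i, (i < r)%N -> prime_ideal S (p i)) ->
  (forall x : nat -> K, (forall i, (i < r)%N -> p i (x i)) -> J (\prod_(i < r) x i)) ->
  exists2 i, (i < r)%N & p i `<=` Q.
Proof.
move=> h pQ JQ pp prd; apply: contrapT => h'.
have [x hx] : exists x : nat -> K, forall i, (i < r)%N -> p i (x i) /\ ~ Q (x i).
  have : forall i, exists y, (i < r)%N -> p i y /\ ~ Q y.
    move=> i; case: (ltnP i r) => lt; last by exists 0.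
    apply: contrapT => h2; apply: h'; exists i => // y py.
    by apply: contrapT => Qy; apply: h2; exists y.
  by move=> /choice [f hf]; exists f.
have [i lt] : exists2 i, (i < r)%N & Q (x i).
  apply: (prime_prod h pQ).
    by move=> i lt; have [[[s _] _ _] [px _]] := (pp i lt, hx i lt); exact: s.
  by apply/JQ/prd => i /hx [].
by case: (hx i lt).
Qed.

(** The coefficients range over a set [C] smaller than the ring if need be: with [C = nonunits S]
    this is the maximal ideal times the module spanned by [s], as in Nakayama's lemma. *)
Fixpoint lin (C : set K) (s : seq K) : set K :=
  if s is x :: s' then [set z | exists a y, [/\ C a, lin C s' y & z = a * x + y]]
  else [set 0].

Lemma lin_smod S C s : smod S C -> smod S (lin C s).
Proof.
move=> sC; elim: s => [|x s IH] /=.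
  split=> //; first by move=> x y /= -> ->; rewrite addr0.
  by move=> a x _ /= ->; rewrite scaler0.
split.
- by exists 0, 0; split; [exact: sm0 sC|exact: sm0 IH|rewrite mul0r addr0].
- move=> _ _ [a [y [Ca hy ->]]] [b [z [Cb hz ->]]].
  exists (a + b), (y + z); split; [exact: smD sC _ _|exact: smD IH _ _|by ring].
- move=> c _ Sc [a [y [Ca hy ->]]]; exists (c * a), (c * y).
  split; [exact: smM sC _ _|exact: smM IH _ _|].
  by rewrite /GRing.scale /=; ring.
Qed.

Lemma lin_sub S C N s : smod S N -> C `<=` S -> (forall x, x \in s -> N x) -> lin C s `<=` N.
Proof.
move=> sN CS; elim: s => [|x s IH] hs /=; first by move=> _ ->; exact: sm0 sN.
move=> _ [a [y [Ca hy ->]]]; apply: (smD sN).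
  by apply: (smM sN); [exact: CS|apply: hs; rewrite mem_head].
by apply: IH => // z zs; apply: hs; rewrite inE zs orbT.
Qed.

Lemma lin_mem S s x : subring S -> x \in s -> lin S s x.
Proof.
move=> h; elim: s => //= y s IH; rewrite inE => /orP[/eqP ->|/IH hx].
  exists 1, 0; split; [exact: sr1| |by rewrite mul1r addr0].
  by apply: sm0; apply: lin_smod; exact: (sr_smod h).
by exists 0, x; split=> //; [exact: sr0|rewrite mul0r add0r].
Qed.

Lemma ideal_span_lin S s : subring S -> ideal_span S [set` s] = lin S s.
Proof.
move=> h; rewrite eqEsubset; split.
  apply: ideal_span_min; first by apply: lin_smod; exact: sr_smod.
  by move=> x; exact: lin_mem.
apply: (@lin_sub S) => //; first exact: ideal_span_smod.
by move=> x xs; exact: ideal_spanS.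
Qed.

(** The first generator is solved for, [1 - v] being a unit for a nonunit [v], and substituted in
    the relations of the others. *)
Lemma nakayama S J (s : seq K) : local_ring S -> smod S J ->
  (forall x, x \in s -> sadd J (lin (nonunits S) s) x) -> forall x, x \in s -> J x.
Proof.
move=> lS sJ; have [h _] := lS; have sn := nu_smod lS.
elim: s => //= x s IH hs.
have [j [_ [Jj [v [y [nv hy ->]] xE]]]] := hs x (mem_head _ _).
have [v0 Sv] := nu_1B lS nv.
have sL : smod S (lin (nonunits S) s) by apply: lin_smod.
pose j1 := (1 - v)^-1 * j; pose y1 := (1 - v)^-1 * y.
have xE1 : x = j1 + y1.
  by apply: (mulfI v0); rewrite /j1 /y1 -mulrDr mulVKf // {1}mulrBl mul1r {1}xE; ring.
have Jj1 : J j1 by exact: smM sJ _ _.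
have hy1 : lin (nonunits S) s y1 by exact: smM sL _ _.
have J1 z : z \in s -> J z.
  apply: IH => {}z zs; have := hs z; rewrite inE zs orbT => /(_ isT).
  move=> [j' [_ [Jj' [v' [y' [nv' hy' ->]] ->]]]].
  exists (j' + v' * j1), (v' * y1 + y'); split; last by rewrite xE1; ring.
    by apply: (smD sJ) => //; apply: (smM sJ) => //; exact: nu_sub.
  by apply: (smD sL) => //; apply: (smM sL) => //; exact: nu_sub.
move=> z; rewrite inE => /orP[/eqP ->|]; last exact: J1.
rewrite xE1; apply: (smD sJ) => //.
exact: (lin_sub sJ (@nu_sub _ S) J1).
Qed.

Lemma nakayama_prin S J J' p : local_ring S -> noetherian S -> ideal S J ->
  smod S J' -> nonunits S p -> J `<=` sadd J' (prin p J) -> J `<=` J'.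
Proof.
move=> lS nS iJ sJ' np sub; have [h _] := lS.
have [s sE] := nS _ iJ; rewrite sE.
apply: ideal_span_min => //; apply: (nakayama lS sJ') => x xs.
have [j [_ [Jj [y Jy <-] ->]]] := sub x ltac:(by rewrite sE; exact: ideal_spanS).
exists j, (p * y); split=> //.
move: Jy; rewrite sE ideal_span_lin //.
elim: (s) y {xs} => [|z s' IH] y /=; first by move=> ->; rewrite mulr0.
move=> [a [w [Sa hw ->]]]; exists (p * a), (p * w); split; last by ring.
  exact: smMr (nu_smod lS) _ _.
exact: IH.
Qed.

(** ** Ideals of finite colength *)

(** [N ^ r] is contained in [J], tested on products only. *)
Definition powin N J r := forall x : nat -> K, (forall i, (i < r)%N -> N (x i)) ->
  J (\prod_(i < r) x i).

(** [R] dominates [S] without extending the residue field. A simple [R]-module then has length one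
    over [S], so lengths at all points can be measured over the one ring [A]. *)
Definition residual S R := [/\ local_ring S, local_ring R, S `<=` R,
  nonunits S `<=` nonunits R
  & forall x, R x -> exists2 s, S s & nonunits R (x - s)].

Lemma residual_refl S : local_ring S -> residual S S.
Proof.
move=> lS; split=> // x Sx; exists x => //; rewrite subrr; exact: sm0 (nu_smod lS).
Qed.

Lemma len_simple S R J x : residual S R -> smod R J -> R x -> ~ J x ->
  (forall v, nonunits R v -> J (v * x)) -> len S (sadd J (prin x R) : set K^o) J 1.
Proof.
move=> [lS lR SR nSR res] sJ Rx Jx nJ.
have [hS _] := lS; have [hR _] := lR.
have sJ1 : smod S J by exact: smod_mono sJ.
have sp : smod S (prin x R) by exact: smod_mono (prin_smod x hR).
have sA : smod S (sadd J (prin x R)) by exact: sadd_smod.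
have JA : J `<=` sadd J (prin x R) by apply: sadd_subl; exact: sm0 sp.
have lt : J `<` sadd J (prin x R).
  split=> // h; apply: Jx; apply: h; apply: sadd_subr; first exact: sm0 sJ.
  exact: prin_self.
have key (C : set K) : smod S C -> J `<` C -> sadd J (prin x R) `<=` C \/ ~ C `<=` sadd J (prin x R).
  move=> sC [JC nCJ]; case: (pselect (C `<=` sadd J (prin x R))) => CA; [left|by right].
  have [c Cc Jc] : exists2 c, C c & ~ J c.
    apply: contrapT => h; apply: nCJ => c Cc; apply: contrapT => Jc; apply: h.
    by exists c.
  have [j [_ [Jj [r Rr <-] cE]]] := CA _ Cc.
  have Jrx : ~ J (x * r).
    by move=> h; apply: Jc; rewrite cE; exact: smD sJ _ _.
  have [s Ss nrs] := res r Rr.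
  have Csx : C (s * x).
    have -> : s * x = c - j - (r - s) * x by rewrite cE; ring.
    apply: (smB hS sC); first by apply: (smB hS sC) => //; exact: JC.
    by apply/JC/nJ.
  have ns : ~ nonunits S s.
    move=> h; apply: Jrx; have -> : x * r = (r - s) * x + s * x by ring.
    by apply: (smD sJ); apply: nJ => //; exact: nSR.
  have [s0 Ss'] := nu_inv Ss ns.
  have Cx : C x by rewrite -(mulKf s0 x); exact: smM sC _ _.
  move=> _ [j' [_ [Jj' [r' Rr' <-] ->]]]; apply: (smD sC); first exact: JC.
  have [s' Ss1 n'] := res r' Rr'.
  have -> : x * r' = (r' - s') * x + s' * x by ring.
  by apply: (smD sC); [apply/JC/nJ|exact: smM sC _ _].
split; first by apply: lchain1.
case=> // -[|n] // c; exfalso.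
inversion c as [|C0 C1 n' c1 lt1 sC1]; subst.
inversion c1 as [|C2 C3 n2 c2 lt2 sC2]; subst.
have [_ _ s2] := lchain_sm c2.
have ltJ : J `<` C0.
  split; first exact: subset_trans (properW lt2).
  by move=> h; case: lt2 => _; apply; exact: subset_trans s2.
case: (key C0 sC2 ltJ) => [h|]; first by case: lt1.
by case; exact: properW lt1.
Qed.

(** For the least [r] with [N ^ r] in [J], some product of [r - 1] elements of [N] is outside [J],
    and [N] kills it modulo [J]. *)
Lemma socle R N J r : subring R -> N `<=` R -> powin N J r -> ~ J 1 ->
  exists x, [/\ R x, ~ J x & forall v, N v -> J (v * x)].
Proof.
move=> hR NR pw J1.
elim: r pw => [|r IHr] pw; first by case: J1; have := pw (fun=> 0); rewrite big_ord0; apply.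
case: (pselect (powin N J r)) => h; first exact: IHr.
have [y [hy Jy]] : exists y : nat -> K, (forall i, (i < r)%N -> N (y i)) /\
    ~ J (\prod_(i < r) y i).
  apply: contrapT => h'; apply: h => y hy; apply: contrapT => Jy; apply: h'.
  by exists y.
exists (\prod_(i < r) y i); split=> //.
  by apply: sr_prod => // i _; apply: NR; exact: hy.
move=> v nv; have := pw (fun i => if i == 0 then v else y i.-1).
by rewrite big_ord_recl /=; apply=> -[|i] //=; exact: hy.
Qed.

(** Noetherian induction: adding a socle element to [J] costs length one. *)
Lemma finlen S R J r : residual S R -> noetherian R -> ideal R J ->
  powin (nonunits R) J r -> exists l, len S (R : set K^o) J l.
Proof.
move=> rSR nR iJ; move: (rSR) => [lS lR SR nSR res].
have [hS _] := lS; have [hR _] := lR.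
move: J iJ; apply: (noeth_ind (Q := fun J => powin (nonunits R) J r -> _) nR) => J iJ IH pw.
have [sub sJ] := iJ.
case: (pselect (J 1)) => J1.
  have -> : J = R.
    rewrite eqEsubset; split=> // x Rx; rewrite -[x]mulr1.
    exact: smM sJ _ _.
  by exists 0; apply: len0; exact: smod_mono (sr_smod hR).
have [x [Rx Jx nJ]] := socle hR (@nu_sub _ R) pw J1.
have iA : ideal R (sadd J (prin x R)).
  split; last by apply: sadd_smod => //; exact: prin_smod.
  apply: sadd_min; [exact: sr_smod|exact: sub|].
  by apply: prin_sub => //; exact: sr_smod.
have JA : J `<=` sadd J (prin x R) by apply: sadd_subl; exact: sm0 (prin_smod x hR).
have lt : J `<` sadd J (prin x R).
  split=> // h; apply: Jx; apply: h; apply: sadd_subr; first exact: sm0 sJ.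
  exact: prin_self.
have [l hl] : exists l, len S (R : set K^o) (sadd J (prin x R)) l.
  by apply: IH => // y hy; apply: JA; exact: pw.
by exists (l + 1)%N; apply: len_add hl _; [exact: srN1|exact: len_simple].
Qed.

Lemma len_stab S (N N' : set K^o) l (C : nat -> set K^o) : S (-1) -> len S N N' l ->
  (forall i, submodule S (C i)) -> (forall i, N' `<=` C i) -> (forall i, C i `<=` N) ->
  (forall i, C i.+1 `<=` C i) -> exists i, C i.+1 = C i.
Proof.
move=> S1 hl sC s1 s2 dec; apply: contrapT => h.
have lt i : C i.+1 `<` C i.
  split=> // h'; apply: h; exists i; rewrite eqEsubset; split=> //; exact: dec.
have ch n : lchain S (C n) (C 0) n.
  elim: n => [|n IH]; first exact: lchain0.
  rewrite -add1n; apply: lchain_trans IH.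
  exact: lchain1.
have sub0 i : C i `<=` C 0 by elim: i => // i IH; exact: subset_trans (dec i) IH.
have [b hb le] := len_quo S1 hl (sC l.+1) (s1 _) (s2 _).
have [b' hb' le'] := len_sub S1 hb (sC 0) (sub0 _) (s2 0).
have := lchain_len (ch l.+1) hb'.
by rewrite leqNgt ltnS (leq_trans le' le).
Qed.

(** Krull's principal ideal theorem. In place of symbolic powers of [Q], the ideals [J i] are the
    contractions of [y ^ i S_Q] for one nonzero [y] in [Q]. They become constant modulo [p], hence
    constant at some step by Nakayama, and then [y] is invertible in [S_Q]. *)
Lemma pit S p r Q : local_ring S -> noetherian S -> nonunits S p ->
  powin (nonunits S) (prin p S) r -> prime_ideal S Q ->
  nonunits S `<=` Q \/ Q `<=` [set 0].
Proof.
move=> lS nS np pw pQ; have [h _] := lS; have Sp : S p by exact: nu_sub.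
case: (pselect (Q p)) => Qp.
  left=> x nx; apply: (prime_exp (n := r) h pQ (nu_sub nx)).
  have [[_ sQ] _ _] := pQ.
  apply: (prin_sub sQ Qp); rewrite -[r]card_ord -prodr_const.
  by apply: (pw (fun=> x)).
right=> y Qy /=; have [//|y0] := eqVneq y 0; exfalso.
have [[QS sQ] Q1 prQ] := pQ; have Sy := QS _ Qy.
pose J i : set K := [set z | S z /\ exists s, [/\ S s, ~ Q s & (prin (y ^+ i) S) (s * z)]].
have iJ i : ideal S (J i).
  split; first by move=> z [].
  split.
  - split; first exact: sr0.
    by exists 1; rewrite mulr0; split=> //; [exact: sr1|exact: sm0 (prin_smod _ h)].
  - move=> z w [Sz [s [Ss Qs hs]]] [Sw [t [St Qt ht]]]; split; first exact: srD.
    exists (s * t); split; [exact: srM|by move=> /prQ [] //|].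
    have -> : s * t * (z + w) = t * (s * z) + s * (t * w) by ring.
    by apply: (smD (prin_smod _ h)); apply: (smM (prin_smod _ h)).
  - move=> a z Sa [Sz [s [Ss Qs hs]]]; split; first exact: srM.
    exists s; split=> //; rewrite /GRing.scale /= mulrCA.
    exact: smM (prin_smod _ h) _ _.
have dec i : J i.+1 `<=` J i.
  move=> z [Sz [s [Ss Qs [w Sw wE]]]]; split=> //; exists s; split=> //.
  by exists (y * w); [exact: srM|rewrite -wE exprSr mulrA].
have spp := prin_smod p h.
have ipp : ideal S (prin p S) by split=> //; apply: prin_sub => //; exact: sr_smod.
have [l hl] := finlen (residual_refl lS) nS ipp pw.
have [i Ei] : exists i, sadd (J i.+1) (prin p S) = sadd (J i) (prin p S).
  apply: (@len_stab S S (prin p S) l (fun i => sadd (J i) (prin p S))) => //.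
  - exact: srN1.
  - by move=> i; apply: sadd_smod => //; exact: (proj2 (iJ i)).
  - by move=> i; apply: sadd_subr; exact: sm0 (proj2 (iJ i)).
  - by move=> i; apply: sadd_min; [exact: sr_smod|exact: proj1 (iJ i)|exact: proj1 ipp].
  - move=> i; apply: (sadd_min (S := S)); first by apply: sadd_smod => //; exact: (proj2 (iJ i)).
      by apply: subset_trans (dec i) _; apply: sadd_subl; exact: sm0 spp.
    by apply: sadd_subr; exact: sm0 (proj2 (iJ i)).
have JJ : J i `<=` J i.+1.
  apply: (nakayama_prin lS nS (iJ i) (proj2 (iJ i.+1)) np) => z Jz.
  have : sadd (J i.+1) (prin p S) z.
    by rewrite Ei; apply: sadd_subl => //; exact: sm0 spp.
  move=> [j [_ [Jj [w Sw <-] zE]]]; exists j, (p * w); split=> //.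
  exists w => //; split=> //.
  (* Since [p] is not in [Q], it is absorbed into the denominator [s], so that [p * w] in [J i]
     gives [w] in [J i]. *)
  have [_ [s [Ss Qs hs]]] : J i (p * w).
    have -> : p * w = z - j by rewrite zE; ring.
    by apply: (smB h (proj2 (iJ i))) => //; exact: dec.
  by exists (s * p); rewrite -mulrA; split=> //; [exact: srM|move=> /prQ []].
have [_ [s [Ss Qs [a Sa aE]]]] : J i.+1 (y ^+ i).
  apply: JJ; split; first exact: srX.
  by exists 1; rewrite mul1r; split=> //; [exact: sr1|exact: prin_self].
apply: Qs; have -> : s = a * y.
  by apply: (mulIf (expf_neq0 i y0)); rewrite -aE exprS; ring.
exact: smM sQ _ _.
Qed.

End Noeth.

(** * Hilbert's basis theorem *)

Section Hilbert.
Variable K : fieldType.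
Implicit Types (S R J N P : set K).

Lemma noeth_mod S N s : subring S -> noetherian S -> smod S N -> N `<=` lin S s ->
  exists t : seq K, N = ideal_span S [set` t].
Proof.
move=> h nS; elim: s N => [|x s IH] N sN sub.
  exists [::]; rewrite ideal_span_lin // eqEsubset; split; first exact: sub.
  by move=> _ ->; exact: sm0 sN.
have sL : smod S (lin S s) by apply: lin_smod; exact: sr_smod.
have sN' : smod S (N `&` lin S s) by exact: sm_cap.
have [t tE] := IH _ sN' (@subIsetr _ _ _).
pose L : set K := [set a | S a /\ exists2 y, lin S s y & N (a * x + y)].
have iL : ideal S L.
  split; first by move=> a [].
  split.
  - by split; [exact: sr0|exists 0; [exact: sm0 sL|rewrite mul0r addr0; exact: sm0 sN]].
  - move=> a b [Sa [y hy Ny]] [Sb [z hz Nz]]; split; first exact: srD.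
    exists (y + z); first exact: smD sL _ _.
    have -> : (a + b) * x + (y + z) = (a * x + y) + (b * x + z) by ring.
    exact: smD sN _ _.
  - move=> c a Sc [Sa [y hy Ny]]; split; first exact: srM.
    exists (c * y); first exact: smM sL _ _.
    have -> : (c *: (a : K^o)) * x + c * y = c * (a * x + y) by rewrite /GRing.scale /=; ring.
    exact: smM sN _ _.
have [u uE] := nS _ iL.
have [f hf] : exists f : K -> K, forall a, L a -> lin S s (f a - a * x) /\ N (f a).
  have : forall a, exists w, L a -> lin S s (w - a * x) /\ N w.
    move=> a; case: (pselect (L a)) => [[Sa [y hy Ny]]|nL]; last by exists 0.
    by exists (a * x + y) => _; split=> //; rewrite addrAC subrr add0r.
  by move=> /choice [f hf]; exists f.
have Lu a : a \in u -> L a by move=> au; rewrite uE; exact: ideal_spanS.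
exists (map f u ++ t).
rewrite eqEsubset; split; last first.
  apply: ideal_span_min => // y /=; rewrite mem_cat => /orP[/mapP[a au ->]|yt].
    by have [] := hf _ (Lu _ au).
  have : (N `&` lin S s) y by rewrite tE; exact: ideal_spanS.
  by case.
set B := ideal_span S _.
have sB : smod S B by exact: ideal_span_smod.
have NB : N `&` lin S s `<=` B.
  by rewrite tE; apply: ideal_span_mono => y /= yt; rewrite mem_cat yt orbT.
have LB : L `<=` [set a | exists2 w, B w & lin S s (w - a * x)].
  rewrite uE; apply: ideal_span_min.
    split.
    - by exists 0; [exact: sm0 sB|rewrite mul0r subr0; exact: sm0 sL].
    - move=> a b [w Bw hw] [v Bv hv]; exists (w + v); first exact: smD sB _ _.
      have -> : w + v - (a + b) * x = (w - a * x) + (v - b * x) by ring.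
      exact: smD sL _ _.
    - move=> c a Sc [w Bw hw]; exists (c * w); first exact: smM sB _ _.
      have -> : c * w - (c *: (a : K^o)) * x = c * (w - a * x) by rewrite /GRing.scale /=; ring.
      exact: smM sL _ _.
  move=> a /= au; have [h1 h2] := hf _ (Lu _ au).
  exists (f a) => //; apply: ideal_spanS => /=; rewrite mem_cat map_f //.
have BN : B `<=` N.
  apply: ideal_span_min => // y /=; rewrite mem_cat => /orP[/mapP[a au ->]|yt].
    by have [] := hf _ (Lu _ au).
  have : (N `&` lin S s) y by rewrite tE; exact: ideal_spanS.
  by case.
move=> z Nz; have := sub _ Nz => /= -[a [y [Sa hy zE]]].
have La : L a by split=> //; exists y => //; rewrite -zE.
have [w Bw hw] := LB _ La.
rewrite -(subrK w z); apply: (smD sB) => //; apply: NB; split.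
  by apply: (smB h sN) => //; exact: BN.
have -> : z - w = y - (w - a * x) by rewrite zE; ring.
exact: smB h sL _ _.
Qed.

Lemma size_mulXn_le (p : {poly K}) a b :
  (size p <= a.+1)%N -> (size (p * 'X^b)%R <= (a + b).+1)%N.
Proof.
move=> sp; apply: leq_trans (size_polyMleq _ _) _.
by rewrite size_polyXn addnS /= -addSn leq_add2r.
Qed.

(** The classical argument, applied to the polynomials whose value at [x] lies in [J]; as [x] may be
    algebraic over [S], leading coefficients belong to polynomials and not to elements of [J]. *)
Lemma hilbert S x : subring S -> noetherian S -> noetherian (adjoin S [set x]).
Proof.
move=> h nS J [JT sJ]; set T := adjoin S [set x].
have hT : subring T by exact: adjoin_subring.
have ST : S `<=` T by exact: adjoinSl.
have Tx : T x by exact: adjoinSr.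
have sJS : smod S J by exact: smod_mono sJ.
(* The degree [n] is only a bound, so that sums with cancelling leading terms stay in [L]. *)
pose L : set K := [set c | exists n p, [/\ pin S p, (size p <= n.+1)%N, p`_n = c & J p.[x]]].
have iL : ideal S L.
  split; first by move=> c [n [p [Sp _ <- _]]].
  split.
  - exists 0, 0; split; rewrite ?size_poly0 ?coef0 ?horner0 //; last exact: sm0 sJ.
    by move=> i; rewrite coef0; exact: sr0.
  - move=> _ _ [n [p [Sp sp <- Jp]]] [m [q [Sq sq <- Jq]]].
    exists (n + m)%N, (p * 'X^m + q * 'X^n); split.
    + by apply: pinD => //; apply: pinM => //; exact: pinXn.
    + apply: leq_trans (size_polyD _ _) _; rewrite geq_max.
      by rewrite size_mulXn_le // addnC size_mulXn_le.
    + rewrite coefD !coefMXn; do 2 (case: ltnP => [|_]; first by rewrite ltnNge ?leq_addl ?leq_addr).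
      by rewrite addnK addKn.
    + by rewrite !hornerE ?hornerXn; apply: (smD sJ); apply: (smMr sJ) => //; exact: (srX _ hT Tx).
  - move=> a _ Sa [n [p [Sp sp <- Jp]]]; exists n, (a *: p); split.
    + exact: pinZ.
    + by apply: leq_trans (size_scale_leq _ _) _.
    + by rewrite coefZ.
    + by rewrite hornerZ; exact: smM sJS _ _.
have [u uE] := nS _ iL.
have [d [g [gJ gL]]] : exists d (g : seq K), (forall y, y \in g -> J y) /\
    forall c, c \in u -> exists p, [/\ pin S p, (size p <= d.+1)%N, p`_d = c & p.[x] \in g].
  have : forall c, c \in u -> L c by move=> c cu; rewrite uE; exact: ideal_spanS.
  elim: (u) => [|c u' IH] hu; first by exists 0, [::].
  have [d [g [gJ gL]]] : exists d (g : seq K), (forall y, y \in g -> J y) /\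
    forall c, c \in u' -> exists p, [/\ pin S p, (size p <= d.+1)%N, p`_d = c & p.[x] \in g].
    by apply: IH => c' c'u; apply: hu; rewrite inE c'u orbT.
  have [n [p [Sp sp pc Jp]]] := hu c (mem_head _ _).
  exists (n + d)%N, (p.[x] * x ^+ d :: [seq y * x ^+ n | y <- g]); split.
    move=> y; rewrite inE => /orP[/eqP ->|/mapP[z zg ->]].
      by apply: (smMr sJ) => //; exact: (srX _ hT Tx).
    by apply: (smMr sJ); [exact: (srX _ hT Tx)|exact: gJ].
  move=> c'; rewrite inE => /orP[/eqP ->|/gL [q [Sq sq qc qg]]].
    exists (p * 'X^d); split; [by apply: pinM => //; exact: pinXn|exact: size_mulXn_le| |].
      by rewrite coefMXn ltnNge leq_addl /= addnK.
    by rewrite !hornerE ?hornerXn mem_head.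
  exists (q * 'X^n); split; [by apply: pinM => //; exact: pinXn|by rewrite addnC size_mulXn_le| |].
    by rewrite coefMXn ltnNge leq_addr /= addKn.
  by rewrite !hornerE ?hornerXn inE; apply/orP; right; apply/mapP; exists q.[x].
(* Low degrees, which the leading coefficients of degree [d] do not reach, lie in a finite
   [S]-module, where [noeth_mod] provides generators. *)
pose M : set K := [set y | exists p, [/\ pin S p, (size p <= d)%N, y = p.[x] & J y]].
have sM : smod S M.
  split.
  - exists 0; split; rewrite ?size_poly0 ?horner0 //; last exact: sm0 sJ.
    by move=> i; rewrite coef0; exact: sr0.
  - move=> _ _ [p [Sp sp -> Jp]] [q [Sq sq -> Jq]]; exists (p + q); split.
    + exact: pinD.
    + by apply: leq_trans (size_polyD _ _) _; rewrite geq_max sp.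
    + by rewrite hornerD.
    + exact: smD sJ _ _.
  - move=> a _ Sa [p [Sp sp -> Jp]]; exists (a *: p); split.
    + exact: pinZ.
    + by apply: leq_trans (size_scale_leq _ _) _.
    + by rewrite hornerZ.
    + exact: smM sJS _ _.
have [t tE] : exists t : seq K, M = ideal_span S [set` t].
  apply: (@noeth_mod S M [seq x ^+ i | i <- iota 0 d]) => // _ [p [Sp sp -> _]].
  have sL : smod S (lin S [seq x ^+ i | i <- iota 0 d]) by apply: lin_smod; exact: sr_smod.
  apply: (pin_horner sL Sp) => i lt; apply: lin_mem => //; apply: map_f.
  by rewrite mem_iota /= add0n (leq_trans lt).
exists (g ++ t); set B := ideal_span T _.
have sB : smod T B by exact: ideal_span_smod.
have sBS : smod S B by exact: smod_mono sB.
have gB y : y \in g -> B y by move=> yg; apply: ideal_spanS => /=; rewrite mem_cat yg.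
have MB : M `<=` B.
  by rewrite tE; apply: ideal_span_min => // y /= yt; apply: ideal_spanS => /=; rewrite mem_cat yt orbT.
have BJ : B `<=` J.
  apply: ideal_span_min => // y /=; rewrite mem_cat => /orP[/gJ //|yt].
  have : M y by rewrite tE; exact: ideal_spanS.
  by case=> p [].
have LB : L `<=` [set c | exists p, [/\ pin S p, (size p <= d.+1)%N, p`_d = c & B p.[x]]].
  rewrite uE; apply: ideal_span_min.
    split.
    - exists 0; split; rewrite ?size_poly0 ?coef0 ?horner0 //; last exact: sm0 sB.
      by move=> i; rewrite coef0; exact: sr0.
    - move=> _ _ [p [Sp sp <- Bp]] [q [Sq sq <- Bq]]; exists (p + q); split.
      + exact: pinD.
      + by apply: leq_trans (size_polyD _ _) _; rewrite geq_max sp.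
      + by rewrite coefD.
      + by rewrite hornerD; exact: smD sB _ _.
    - move=> a _ Sa [p [Sp sp <- Bp]]; exists (a *: p); split.
      + exact: pinZ.
      + by apply: leq_trans (size_scale_leq _ _) _.
      + by rewrite coefZ.
      + by rewrite hornerZ; exact: smM sBS _ _.
  by move=> c /= /gL [p [Sp sp pc pg]]; exists p; split=> //; exact: gB.
rewrite eqEsubset; split=> // y Jy.
have [p Sp yE] := (adjoin1P x y h).1 (JT _ Jy).
rewrite yE in Jy *.
elim: {p}(size p) {-2}p (leqnn (size p)) Sp Jy {yE} => [|n IH] p sp Sp Jp.
  by move: sp; rewrite leqn0 size_poly_eq0 => /eqP ->; rewrite horner0; exact: sm0 sB.
case: (leqP (size p) d) => spd; first by apply: MB; exists p.
have Lc : L p`_(size p).-1.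
  exists (size p).-1, p; split=> //.
  by rewrite prednK // (leq_ltn_trans _ spd).
have [q [Sq sq qc Bq]] := LB _ Lc.
have sp0 : (0 < size p)%N by exact: leq_ltn_trans spd.
set e := ((size p).-1 - d)%N.
have eE : (d + e = (size p).-1)%N by rewrite subnKC // -ltnS prednK.
have Bq' : B (q * 'X^e).[x].
  by rewrite hornerM hornerXn; apply: (smMr sB) => //; exact: (srX _ hT Tx).
have -> : p.[x] = (p - q * 'X^e).[x] + (q * 'X^e).[x] by rewrite -hornerD subrK.
apply: (smD sB) => //; apply: IH.
- have s1 : (size (p - q * 'X^e)%R <= size p)%N.
    apply: leq_trans (size_polyD _ _) _; rewrite size_polyN geq_max leqnn /=.
    apply: leq_trans (size_polyMleq _ _) _; rewrite size_polyXn addnS /=.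
    by apply: leq_trans (leq_add sq (leqnn e)) _; rewrite addSn eE prednK.
  rewrite -ltnS; apply: leq_trans sp; rewrite ltn_neqAle s1 andbT.
  apply/eqP => E.
  have : (p - q * 'X^e)`_(size p).-1 = 0.
    by rewrite coefB coefMXn -eE ltnNge leq_addl /= addnK qc eE subrr.
  move/eqP; rewrite -E -lead_coefE lead_coef_eq0 => /eqP E0.
  by rewrite E0 size_poly0 in E; rewrite -E in sp0.
- by apply: pinB => //; apply: pinM => //; exact: pinXn.
- rewrite hornerD hornerN; apply: (smB hT sJ) => //; exact: BJ.
Qed.

Lemma hilbert_seq S (s : seq K) : subring S -> noetherian S -> noetherian (adjoin S [set` s]).
Proof.
move=> h nS; elim: s => [|x s IH].
  suff -> : adjoin S [set` [::]] = S by [].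
  rewrite eqEsubset; split; last exact: adjoinSl.
  by apply: adjoin_min => // x; rewrite /= in_nil.
by rewrite adjoin_cons; apply: hilbert => //; exact: adjoin_subring.
Qed.

(** ** Domination by valuation rings *)

(** Chevalley's theorem. [V] is a maximal subring over which [G] does not generate the unit ideal.
    If neither [x] nor [1 / x] were in [V], then [1] would be a polynomial in each of them with
    coefficients in the ideal [N] generated by [G], and the shorter relation would shorten the
    longer one again and again. *)
Lemma valuation_over S0 (G : set K) : subring S0 -> ~ ideal_span S0 G 1 -> G `<=` S0 ->
  exists V, [/\ valuation_ring V, S0 `<=` V & G `<=` nonunits V].
Proof.
move=> h0 G1 GS.
pose Q : set (set K) := [set S | [/\ subring S, S0 `<=` S & ~ ideal_span S G 1]].
have [V [[hV SV V1] maxV]] : exists V, Q V /\ forall B, V `<` B -> ~ Q B.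
  pose Q' : set (set K) := [set S | S = set0 \/ Q S].
  have [F FQ tot|V [QV maxV]] := @Zorn_bigcup K Q'.
    case: (pselect (exists2 S, F S & S != set0)) => [[S1 F1 n1]|h]; last first.
      left; rewrite -subset0 => x [S FS Sx]; apply: h; exists S => //.
      by apply/eqP => E; rewrite E in Sx.
    have FQ' S : F S -> S !=set0 -> Q S.
      by move=> /FQ [->|//] [].
    have Q1 : Q S1 by apply: FQ' => //; exact/set0P.
    right; split.
    - split.
      + by exists S1 => //; case: Q1 => h _ _; exact: sr1.
      + move=> x y [S FS Sx] [S' FS' Sy].
        case: (tot _ _ FS FS') => s.
          exists S' => //; have [h _ _] := FQ' _ FS' (ex_intro _ y Sy).
          by apply: srB => //; exact: s.
        exists S => //; have [h _ _] := FQ' _ FS (ex_intro _ x Sx).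
        by apply: srB => //; exact: s.
      + move=> x y [S FS Sx] [S' FS' Sy].
        case: (tot _ _ FS FS') => s.
          exists S' => //; have [h _ _] := FQ' _ FS' (ex_intro _ y Sy).
          by apply: srM => //; exact: s.
        exists S => //; have [h _ _] := FQ' _ FS (ex_intro _ x Sx).
        by apply: srM => //; exact: s.
    - by move=> x Sx; exists S1 => //; case: Q1 => _ s _; exact: s.
    - move=> h1.
      have [S [FS ne h]] : exists S, [/\ F S, S !=set0 & ideal_span S G 1].
        apply: (h1 [set y | exists S, [/\ F S, S !=set0 & ideal_span S G y]]); last first.
          move=> y Gy; exists S1; split=> //; [exact/set0P|exact: ideal_spanS].
        have up S S' y : S `<=` S' -> ideal_span S G y -> ideal_span S' G y.
          move=> s; apply: ideal_span_min; last exact: ideal_spanS.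
          by apply: smod_mono s _; exact: ideal_span_smod.
        split.
        + exists S1; split=> //; [exact/set0P|exact: sm0 (@ideal_span_smod _ _ _)].
        + move=> x y [S [FS neS hS]] [S' [FS' neS' hS']].
          case: (tot _ _ FS FS') => s.
            exists S'; split=> //; apply: (smD (@ideal_span_smod _ _ _)) => //; exact: up hS.
          exists S; split=> //; apply: (smD (@ideal_span_smod _ _ _)) => //; exact: up hS'.
        + move=> a x [S FS Sa] [S' [FS' neS' hS']].
          have neS : S !=set0 by exists a.
          case: (tot _ _ FS FS') => s.
            exists S'; split=> //; apply: (smM (@ideal_span_smod _ _ _)) => //; exact: s.
          exists S; split=> //; apply: (smM (@ideal_span_smod _ _ _)) => //; exact: up hS'.
      by have [_ _] := FQ' _ FS ne; apply.
  exists V; split.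
    case: QV => // E; exfalso; apply: (maxV S0); last by right; split.
    rewrite E; split=> // h; have := h 1 (sr1 h0); exact.
  by move=> B lt QB; apply: (maxV B) => //; right.
have GV : G `<=` V by exact: subset_trans SV.
have big x : ~ V x -> ideal_span (adjoin V [set x]) G 1.
  move=> Vx; apply: contrapT => h; apply: (maxV (adjoin V [set x])).
    split; first exact: adjoinSl.
    by move=> s; apply: Vx; apply: s; exact: adjoinSr.
  by split=> //; [exact: adjoin_subring|exact: subset_trans (@adjoinSl _ _ _)].
pose N := ideal_span V G.
have sN : smod V N by exact: ideal_span_smod.
have NV : N `<=` V by exact: ideal_span_sub.
have expand x : ~ V x -> exists2 p, pin N p & p.[x] = 1.
  move=> /big; apply: (@ideal_span_min _ _ _ [set y | exists2 p, pin N p & p.[x] = y]).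
    split.
    - by exists 0; rewrite ?horner0 // => i; rewrite coef0; exact: sm0 sN.
    - move=> _ _ [p Np <-] [q Nq <-]; exists (p + q); rewrite ?hornerD //.
      by move=> i; rewrite coefD; exact: smD sN _ _.
    - move=> a _ /(adjoin1P _ _ hV) [q Vq ->] [p Np <-]; exists (q * p); rewrite ?hornerM //.
      by move=> i; rewrite coefM; apply: (sm_sum _ sN) => j _; exact: smM sN _ _.
  move=> y Gy; exists y%:P; rewrite ?hornerC // => i; rewrite coefC.
  by case: ifP => _; [exact: ideal_spanS|exact: sm0 sN].
(* If [1 / (1 - s)] were outside [V], its relation [p] multiplied by [(1 - s) ^ size p] would put a
   power of [1 - s], and so [1], in [N]. *)
have unit1 s : N s -> 1 - s != 0 /\ V (1 - s)^-1.
  move=> Ns; have s0 : 1 - s != 0.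
    by rewrite subr_eq0; apply/eqP => E; apply: V1; rewrite [X in ideal_span _ _ X]E.
  split=> //; apply: contrapT => /expand [p Np p1].
  suff : N ((1 - s) ^+ (size p)).
    have : forall n, N ((1 - s) ^+ n - 1).
      elim=> [|n IH]; first by rewrite expr0 subrr; exact: sm0 sN.
      have -> : (1 - s) ^+ n.+1 - 1 = (1 - s) * ((1 - s) ^+ n - 1) + (- s) by rewrite exprS; ring.
      apply: (smD sN); last exact: smN hV sN _.
      by apply: (smM sN) => //; apply: srB => //; [exact: sr1|exact: NV].
    move=> /(_ (size p)) h1 h2; apply: V1.
    have -> : 1 = (1 - s) ^+ size p - ((1 - s) ^+ size p - 1) by ring.
    exact: smB hV sN _ _.
  rewrite -[X in N X]mulr1 -[X in _ * X]p1 horner_coef mulr_sumr; apply: (sm_sum _ sN) => i _.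
  have -> : (1 - s) ^+ size p * (p`_i * (1 - s)^-1 ^+ i) = p`_i * (1 - s) ^+ (size p - i).
    case: i => i lt /=; rewrite mulrCA -{1}(subnK (ltnW lt)) exprD exprVn mulfK //.
    exact: expf_neq0.
  apply: (smMr sN) => //.
  by apply: srX => //; apply: srB => //; [exact: sr1|exact: NV].
exists V; split=> //; last first.
  move=> y Gy; split; first exact: GV.
  move=> /unitP [y0 Vy]; apply: V1; rewrite -(mulVf y0).
  by apply: (smM sN) => //; exact: ideal_spanS.
split=> // x; apply: contrapT => /not_orP [Vx Vx'].
have x0 : x != 0 by apply/eqP => E; apply: Vx; rewrite E; exact: sr0.
(* The relation for [z = 1 / y], solved for [1] and multiplied by [y ^ n], expresses [y ^ n] by
   lower powers; this replaces the top term of [p]. *)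
have key (y z : K) : y * z = 1 -> forall n m (p q : {poly K}), (size p <= n.+1)%N -> (size q <= m.+1)%N ->
    (m <= n)%N -> pin N p -> pin N q -> p.[y] = 1 -> q.[z] = 1 ->
    exists p', [/\ pin N p', (size p' <= n)%N & p'.[y] = 1].
  move=> yz n m p q sp sq mn Np Nq p1 q1.
  have [u0 Vu] := unit1 _ (Nq 0).
  pose b i := q`_i.+1 / (1 - q`_0).
  have Nb i : N (b i) by exact: smMr sN _ _.
  have bE : \sum_(i < m) b i * z ^+ i.+1 = 1.
    move: q1; rewrite (horner_coef_wide _ sq) big_ord_recl expr0 mulr1 => E.
    apply: (mulfI u0); rewrite mulr1 mulr_sumr -[in RHS]E addrAC subrr add0r.
    by apply: eq_bigr => i _; rewrite mulrA /b mulrCA divff // mulr1.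
  pose w : {poly K} := \sum_(i < m) b i *: 'X^(n - i.+1).
  have wE : w.[y] = y ^+ n.
    rewrite -[RHS]mulr1 -bE /w horner_sum mulr_sumr; apply: eq_bigr => i _.
    have le : (i.+1 <= n)%N by exact: leq_trans mn.
    rewrite hornerZ hornerXn -{2}(subnK le) exprD -mulrA [_ * (b i * _)]mulrCA.
    by rewrite -exprMn yz expr1n mulr1 mulrC.
  have Nw i : N w`_i.
    rewrite /w coef_sum; apply: (sm_sum _ sN) => j _; rewrite coefZ coefXn.
    by case: eqP => _; rewrite ?mulr1 ?mulr0 //; exact: sm0 sN.
  have w0 j : (n <= j)%N -> w`_j = 0.
    move=> nj; rewrite /w coef_sum big1 // => i _; rewrite coefZ coefXn.
    case: eqP => [E|]; last by rewrite mulr0.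
    have le : (i.+1 <= n)%N by exact: leq_trans mn.
    move: nj; rewrite E -{1}(subnK le) addnS ltnNge; by rewrite leq_addr.
  exists (p - p`_n *: ('X^n - w)); split.
  - move=> i; rewrite coefB coefZ coefB; apply: (smB hV sN) => //.
    apply: (smMr sN) => //; apply: srB => //; last exact: NV.
    by rewrite coefXn; case: eqP => _; [exact: sr1|exact: sr0].
  - apply/leq_sizeP => j nj; rewrite coefB coefZ coefB w0 // subr0 coefXn.
    case: eqP => [->|/eqP ne]; first by rewrite mulr1 subrr.
    rewrite mulr0 subr0 nth_default //; apply: leq_trans sp _.
    by rewrite ltn_neqAle eq_sym ne.
  - by rewrite !hornerE ?hornerXn wE subrr mulr0 subr0.
have fin (y z : K) : y * z = 1 -> forall s n m (p q : {poly K}), (n + m <= s)%N -> (size p <= n)%N -> (size q <= m)%N ->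
    pin N p -> pin N q -> p.[y] = 1 -> q.[z] = 1 -> False.
  move=> yz; elim=> [|s IH] n m p q; last first.
    case: n => [|n] les sp sq Np Nq p1 q1.
      move: sp p1; rewrite leqn0 size_poly_eq0 => /eqP ->.
      by rewrite horner0 => /eqP; rewrite eq_sym oner_eq0.
    case: m sq les => [|m] sq les.
      move: sq q1; rewrite leqn0 size_poly_eq0 => /eqP ->.
      by rewrite horner0 => /eqP; rewrite eq_sym oner_eq0.
    case: (leqP m n) => mn.
      have [p' [Np' sp' p'1]] := key _ _ yz n m p q sp sq mn Np Nq p1 q1.
      by apply: (IH n m.+1 p' q).
    have zy : z * y = 1 by rewrite mulrC.
    have [q' [Nq' sq' q'1]] := key _ _ zy m n q p sq sp (ltnW mn) Nq Np q1 p1.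
    by apply: (IH n.+1 m p q') => //; rewrite addSnnS.
  rewrite leqn0 addn_eq0 => /andP[/eqP -> _] sp _ _ _ p1 _.
  move: sp p1; rewrite leqn0 size_poly_eq0 => /eqP ->.
  by rewrite horner0 => /eqP; rewrite eq_sym oner_eq0.
have [p Np p1] := expand _ Vx; have [q Nq q1] := expand _ Vx'.
by apply: (fin x x^-1 _ _ _ _ p q (leqnn _) (leqnn _) (leqnn _)) => //; rewrite divff.
Qed.
End Hilbert.

(** * Localization at a prime, inside the field [K] *)

Section Localization.
Variables (K : fieldType) (B P : set K).
Hypotheses (hB : subring B) (pP : prime_ideal B P).
Let Loc := localization B P.

Lemma prime_sub S Q : @prime_ideal K S Q -> Q `<=` S. Proof. by case=> -[]. Qed.
Lemma prime_smod S Q : @prime_ideal K S Q -> smod S Q. Proof. by case=> -[]. Qed.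
Lemma prime_nmul S Q x y : @prime_ideal K S Q -> S x -> S y -> ~ Q x -> ~ Q y -> ~ Q (x * y).
Proof. by case=> _ _ h Sx Sy nx ny /h []. Qed.
Lemma prime_n0 S Q x : @prime_ideal K S Q -> ~ Q x -> x != 0.
Proof. by move=> /prime_smod sQ Qx; apply/eqP => E; apply: Qx; rewrite E; exact: sm0 sQ. Qed.
Lemma prime_n1 S Q : @prime_ideal K S Q -> ~ Q 1. Proof. by case. Qed.

Lemma prime_contr S R Q : subring S -> S `<=` R -> @prime_ideal K R Q -> prime_ideal S (Q `&` S).
Proof.
move=> hS SR [[QR sQ] Q1 pr]; split.
- split; first exact: subIsetr.
  by apply: sm_cap; [exact: smod_mono sQ|exact: sr_smod].
- by case.
- by move=> x y Sx Sy [/pr h _]; case: h => [||h|h]; [exact: SR|exact: SR|left|right].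
Qed.

Lemma loc_subring : subring Loc.
Proof.
split.
- by exists 1, 1; rewrite divff ?oner_neq0 //; split=> //; [exact: sr1|exact: sr1|exact: prime_n1 pP].
- move=> _ _ [a [b [Ba Bb Pb ->]]] [c [d [Bc Bd Pd ->]]].
  exists (a * d - c * b), (b * d); split.
  + by apply: srB => //; exact: srM.
  + exact: srM.
  + exact: prime_nmul pP _ _ _ _.
  + by field; rewrite (prime_n0 pP Pb) (prime_n0 pP Pd).
- move=> _ _ [a [b [Ba Bb Pb ->]]] [c [d [Bc Bd Pd ->]]].
  exists (a * c), (b * d); split; [exact: srM|exact: srM|exact: prime_nmul pP _ _ _ _|].
  by field; rewrite (prime_n0 pP Pb) (prime_n0 pP Pd).
Qed.

Lemma loc_sub : B `<=` Loc.
Proof. by move=> x Bx; exists x, 1; rewrite divr1; split=> //; [exact: sr1|exact: prime_n1 pP]. Qed.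

Lemma loc_inv s : B s -> ~ P s -> Loc s^-1.
Proof. by move=> Bs Ps; exists 1, s; rewrite div1r; split=> //; exact: sr1. Qed.

Lemma loc_nuP x : nonunits Loc x <-> exists a b, [/\ P a, B b, ~ P b & x = a / b].
Proof.
split.
  move=> [[a [b [Ba Bb Pb xE]]] h]; exists a, b; split=> //; apply: contrapT => Pa.
  apply: h; apply/unitP; rewrite xE; split.
    by rewrite mulf_neq0 ?invr_neq0 ?(prime_n0 pP Pa) ?(prime_n0 pP Pb).
  by rewrite invf_div; exists b, a.
move=> [a [b [Pa Bb Pb ->]]]; have Ba := prime_sub pP Pa; split; first by exists a, b.
move=> /unitP [x0 [c [d [Bc Bd Pd E]]]].
have a0 : a != 0 by apply: contraNneq x0 => ->; rewrite mul0r.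
apply: (prime_nmul pP Bb Bd Pb Pd).
have -> : b * d = c * a.
  have b0 := prime_n0 pP Pb; have d0 := prime_n0 pP Pd.
  move: E; rewrite invf_div => E; apply: (mulIf (invr_neq0 (mulf_neq0 a0 d0))).
  have -> : b * d / (a * d) = b / a by field; rewrite a0 d0.
  by rewrite E; field; rewrite a0 d0.
exact: smM (prime_smod pP) _ _.
Qed.

Lemma loc_local : local_ring Loc.
Proof.
split; first exact: loc_subring.
split; first exact: nu_sub.
have sP := prime_smod pP.
split.
- by apply/loc_nuP; exists 0, 1; rewrite mul0r; split=> //; [exact: sm0 sP|exact: sr1|exact: prime_n1 pP].
- move=> x y /loc_nuP [a [b [Pa Bb Pb ->]]] /loc_nuP [c [d [Pc Bd Pd ->]]].
  apply/loc_nuP; exists (a * d + c * b), (b * d); split.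
  + by apply: (smD sP); apply: (smMr sP).
  + exact: srM.
  + exact: prime_nmul pP _ _ _ _.
  + by field; rewrite (prime_n0 pP Pb) (prime_n0 pP Pd).
- move=> _ y [a [b [Ba Bb Pb ->]]] /loc_nuP [c [d [Pc Bd Pd ->]]].
  apply/loc_nuP; exists (a * c), (b * d); split.
  + exact: smM sP _ _.
  + exact: srM.
  + exact: prime_nmul pP _ _ _ _.
  + by rewrite /GRing.scale /=; field; rewrite (prime_n0 pP Pb) (prime_n0 pP Pd).
Qed.

Lemma loc_contr : nonunits Loc `&` B = P.
Proof.
rewrite eqEsubset; split.
  move=> x [/loc_nuP [a [b [Pa Bb Pb xE]]] Bx]; apply: contrapT => Px.
  apply: (prime_nmul pP Bx Bb Px Pb); rewrite xE divfK //; exact: prime_n0 pP Pb.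
move=> x Px; split; last exact: prime_sub pP _ Px.
by apply/loc_nuP; exists x, 1; rewrite divr1; split=> //; [exact: sr1|exact: prime_n1 pP].
Qed.

Lemma loc_loc Q : prime_ideal Loc Q -> localization Loc Q = localization B (Q `&` B).
Proof.
move=> pQ; have pQB := prime_contr hB loc_sub pQ.
rewrite eqEsubset; split.
  move=> _ [_ [_ [[a [b [Ba Bb Pb ->]]] [c [d [Bc Bd Pd ->]]] Qcd ->]]].
  have b0 := prime_n0 pP Pb; have d0 := prime_n0 pP Pd.
  have c0 : c != 0.
    by apply: contra_notN Qcd => /eqP ->; rewrite mul0r; exact: sm0 (prime_smod pQ).
  exists (a * d), (c * b); split; [exact: srM|exact: srM| |by field; rewrite b0 c0 d0].
  move=> [Qcb _]; apply: Qcd; have -> : c / d = (c * b) * (b^-1 * d^-1) by field; rewrite b0 d0.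
  apply: (smMr (prime_smod pQ)) => //.
  by apply: (srM loc_subring); exact: loc_inv.
move=> _ [a [b [Ba Bb Qb ->]]]; exists a, b; split=> //; try exact: loc_sub.
by move=> h; exact: Qb.
Qed.

Lemma loc_denom G x : ideal_span Loc G x -> exists s, [/\ B s, ~ P s & ideal_span B G (s * x)].
Proof.
have sG := @ideal_span_smod _ B G.
apply: (@ideal_span_min _ _ _ [set x | exists s, [/\ B s, ~ P s & ideal_span B G (s * x)]]).
  split.
  - by exists 1; rewrite mulr0; split; [exact: sr1|exact: prime_n1 pP|exact: sm0 sG].
  - move=> {}x y [s [Bs Ps hs]] [t [Bt Pt ht]]; exists (s * t); split; [exact: srM|exact: prime_nmul pP _ _ _ _|].
    have -> : s * t * (x + y) = t * (s * x) + s * (t * y) by ring.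
    by apply: (smD sG); apply: (smM sG).
  - move=> _ {}x [a [b [Ba Bb Pb ->]]] [s [Bs Ps hs]].
    exists (b * s); split; [exact: srM|exact: prime_nmul pP _ _ _ _|].
    have -> : b * s * ((a / b) *: (x : K^o)) = a * (s * x).
      by rewrite /GRing.scale /=; field; exact: prime_n0 pP Pb.
    exact: smM sG _ _.
move=> y Gy; exists 1; rewrite mul1r; split; [exact: sr1|exact: prime_n1 pP|exact: ideal_spanS].
Qed.

Lemma loc_noeth : noetherian B -> noetherian Loc.
Proof.
move=> nB J [JL sJ].
have sJB : smod B J by apply: smod_mono sJ; exact: loc_sub.
have iJ : ideal B (J `&` B).
  by split; [exact: subIsetr|apply: sm_cap => //; exact: sr_smod].
have [s sE] := nB _ iJ; exists s; rewrite eqEsubset; split; last first.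
  by apply: ideal_span_min => // x xs; have [] : (J `&` B) x by rewrite sE; exact: ideal_spanS.
move=> x Jx; have [a [b [Ba Bb Pb xE]]] := JL _ Jx.
have b0 := prime_n0 pP Pb.
have Ja : (J `&` B) a.
  split=> //; have -> : a = b * x by rewrite xE mulrC divfK.
  by apply: (smM sJ) => //; exact: loc_sub.
have : ideal_span Loc [set` s] a.
  move: Ja; rewrite sE; apply: ideal_span_min; last exact: ideal_spanS.
  by apply: smod_mono loc_sub _; exact: ideal_span_smod.
rewrite xE mulrC; apply: (smM (@ideal_span_smod _ _ _)); exact: loc_inv.
Qed.

End Localization.

Section LocalMisc.
Variable K : fieldType.
Implicit Types (A S R V E : set K).

Lemma nu_contr S R : local_ring R -> subring S -> S `<=` R -> prime_ideal S (nonunits R `&` S).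
Proof. by move=> lR hS SR; apply: prime_contr SR _ => //; exact: nu_prime. Qed.

Lemma loc_nu R : local_ring R -> localization R (nonunits R) = R.
Proof.
move=> lR; have [h _] := lR; rewrite eqEsubset; split; last first.
  by apply: loc_sub => //; exact: nu_prime.
move=> _ [a [b [Ra Rb nb ->]]]; apply: srM => //.
by have [] := nu_inv Rb nb.
Qed.

Lemma val_local V : valuation_ring V -> local_ring V.
Proof.
move=> [h tot]; split=> //; split; first exact: nu_sub.
split.
- by apply/nuP; split; [exact: sr0|left].
- have key x y : nonunits V x -> nonunits V y -> V (y / x) -> x != 0 -> nonunits V (x + y).
    move=> nx ny Vyx x0; have [Vx Vy] := (nu_sub nx, nu_sub ny).
    split; first exact: srD.
    move=> /unitP [xy0 Vxy]; apply: (nu_not nx x0).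
    have -> : x^-1 = (1 + y / x) * (x + y)^-1 by field; rewrite x0 xy0.
    by apply: srM => //; apply: srD => //; exact: sr1.
  move=> x y nx ny.
  have [->|x0] := eqVneq x 0; first by rewrite add0r.
  have [->|y0] := eqVneq y 0; first by rewrite addr0.
  case: (tot (y / x)) => Vq; first exact: key.
  by rewrite addrC; apply: key => //; rewrite -invf_div.
- move=> a x Va nx; split; first by apply: srM => //; exact: nu_sub.
  move=> /unitP [ax0 Vax]; move: ax0; rewrite mulf_eq0 negb_or => /andP[a0 x0].
  apply: (nu_not nx x0); have -> : x^-1 = a * (a *: (x : K^o))^-1 by rewrite /GRing.scale /=; field; rewrite a0 x0.
  exact: srM.
Qed.

Lemma krull_uniq S d d' : @krull_dim K S d -> krull_dim S d' -> d = d'.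
Proof.
move=> [[C hC] m] [[C' hC'] m']; apply/eqP; rewrite eqn_leq.
by apply/andP; split; [exact: m' hC|exact: m hC'].
Qed.

(** ** Discrete valuation rings *)

Definition dvr E t := [/\ local_ring E, t != 0, nonunits E = prin t E &
  forall x, x != 0 -> exists (n : int) u, [/\ u != 0, E u, E u^-1 & x = t ^ n * u]].

Lemma noeth_dvr E t : local_ring E -> noetherian E -> t != 0 -> nonunits E = prin t E ->
  (forall x, exists a b, [/\ E a, E b, b != 0 & x = a / b]) -> dvr E t.
Proof.
move=> lE nE t0 tE fr; split=> //; have [h _] := lE.
have key x : E x -> x != 0 -> exists (n : nat) u, [/\ u != 0, E u, E u^-1 & x = t ^ n * u].
  have idx y : E y -> ideal E (prin y E).
    by move=> Ey; split; [apply: prin_sub => //; exact: sr_smod|exact: prin_smod].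
  move=> Ex x0; move: (idx _ Ex) (erefl (prin x E)).
  move: {-2}(prin x E) => J iJ; move: J iJ x Ex x0.
  apply: (noeth_ind nE) => J iJ IH x Ex x0 xJ.
  case: (pselect (nonunits E x)) => nx; last first.
    by have [_ ?] := nu_inv Ex nx; exists 0, x; rewrite expr0z mul1r.
  move: (nx); rewrite tE => -[y Ey yE].
  have y0 : y != 0 by apply: contraNneq x0 => y0; rewrite -yE y0 mulr0.
  have [n [u [u0 Eu Eu' yE']]] : exists (n : nat) u, [/\ u != 0, E u, E u^-1 & y = t ^ n * u].
    apply: (IH (prin y E)) => //; first exact: idx.
    rewrite -xJ; split.
      by apply: prin_sub; [exact: prin_smod|exists t; [apply: nu_sub; rewrite tE; exact: prin_self|rewrite mulrC]].
    move=> /(_ y (prin_self y h)) [z Ez yz].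
    have : nonunits E t by rewrite tE; exact: prin_self.
    move=> [_]; apply; exists z => //; apply: (mulIf y0).
    by rewrite mul1r -[in RHS]yz -yE; ring.
  exists n.+1, u; split=> //; rewrite -yE yE' mulrA; congr (_ * _).
  by rewrite -!exprnP exprS.
move=> x x0; have [a [b [Ea Eb b0 xE]]] := fr x.
have a0 : a != 0 by apply: contraNneq x0 => a0; rewrite xE a0 mul0r.
have [n [u [u0 Eu Eu' aE]]] := key a Ea a0.
have [m [v [v0 Ev Ev' bE]]] := key b Eb b0.
exists (n%:Z - m%:Z), (u / v); split.
- by rewrite mulf_neq0 ?invr_neq0.
- exact: srM.
- by rewrite invf_div; exact: srM.
- rewrite xE aE bE expfzDr // -invr_expz; field.
  by rewrite v0 expfz_neq0.
Qed.

End LocalMisc.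

Section DVR.
Variable K : fieldType.
Implicit Types (A S R V E : set K).

Lemma dvr_subring E t : dvr E t -> subring E. Proof. by case=> -[]. Qed.
Lemma dvr_loc E t : dvr E t -> local_ring E. Proof. by case. Qed.
Lemma dvr_n0 E t : dvr E t -> t != 0. Proof. by case. Qed.
Lemma dvr_t E t : dvr E t -> E t.
Proof. by case=> -[h _] t0 tE _; apply: nu_sub; rewrite tE; exact: prin_self. Qed.
Lemma dvr_tinv E t : dvr E t -> ~ E t^-1.
Proof. by case=> -[h _] t0 tE _; apply: nu_not => //; rewrite tE; exact: prin_self. Qed.

Lemma dvr_expz E t (n : int) : dvr E t -> E (t ^ n) <-> (0 <= n)%R.
Proof.
move=> d; have h := dvr_subring d; split; last first.
  by case: n => // n _; rewrite -exprnP; apply: srX => //; exact: dvr_t d.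
case: n => // n; rewrite NegzE -invr_expz -exprnP => h'; exfalso; apply: (dvr_tinv d).
have -> : t^-1 = t ^+ n * (t ^+ n.+1)^-1.
  by rewrite exprS; field; rewrite expf_neq0 (dvr_n0 d).
by apply: srM => //; apply: srX => //; exact: dvr_t d.
Qed.

Lemma dvr_valuation E t : dvr E t -> valuation_ring E.
Proof.
move=> d; have h := dvr_subring d; split=> // x.
have [->|x0] := eqVneq x 0; first by left; exact: sr0.
have [_ _ _ /(_ x x0) [n [u [u0 Eu Eu' ->]]]] := d.
case: (lerP 0 n) => hn; [left|right].
  by apply: srM => //; apply/(dvr_expz _ d).
rewrite invfM; apply: srM => //; rewrite invr_expz; apply/(dvr_expz _ d).
by rewrite oppr_ge0 ltW.
Qed.

Lemma dvr_max E t R : dvr E t -> subring R -> E `<=` R -> R = E \/ R = setT.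
Proof.
move=> d hR ER; have h := dvr_subring d.
case: (pselect (R `<=` E)) => RE; [by left; rewrite eqEsubset|right].
rewrite eqEsubset; split=> // y _.
have [x Rx Ex] : exists2 x, R x & ~ E x.
  by apply: contrapT => h'; apply: RE => x Rx; apply: contrapT => Ex; apply: h'; exists x.
have Rt : R t^-1.
  have x0 : x != 0 by apply: contra_notN Ex => /eqP ->; exact: sr0.
  have [_ _ _ /(_ x x0) [n [u [u0 Eu Eu' xE]]]] := d.
  case: n xE => [n xE|n]; first by case: Ex; rewrite xE; apply: srM => //; exact/(dvr_expz _ d).
  rewrite NegzE -invr_expz -exprnP => xE.
  have -> : t^-1 = t ^+ n * x * u^-1.
    by rewrite xE exprS; field; rewrite u0 expf_neq0 (dvr_n0 d).
  apply: srM => //; last exact: ER.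
  by apply: srM => //; apply: ER; apply: srX => //; exact: dvr_t d.
have [->|y0] := eqVneq y 0; first exact: sr0.
have [_ _ _ /(_ y y0) [n [u [u0 Eu Eu' ->]]]] := d.
apply: srM => //; last exact: ER.
case: n => n; first by apply: ER; apply/(dvr_expz _ d).
by rewrite NegzE -exprz_inv -exprnP; exact: srX.
Qed.

Lemma dvr_primes E t Q : dvr E t -> prime_ideal E Q -> Q = [set 0] \/ Q = nonunits E.
Proof.
move=> d pQ; have h := dvr_subring d; have [lE t0 tE vE] := d.
case: (pselect (exists2 x, Q x & x != 0)) => [[x Qx x0]|h0]; last first.
  left; rewrite eqEsubset; split=> x.
    by move=> Qx; apply/eqP; apply: contrapT => /negP x0; apply: h0; exists x.
  by move=> ->; exact: sm0 (prime_smod pQ).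
right; rewrite eqEsubset; split.
  by apply: ideal_proper => //; [case: pQ|exact: prime_n1 pQ].
have [n [u [u0 Eu Eu' xE]]] := vE x x0.
have Ex := prime_sub pQ Qx.
have Qt : Q (t ^ n).
  have -> : t ^ n = x * u^-1 by rewrite xE mulfK.
  exact: smMr (prime_smod pQ) _ _.
have : (0 <= n)%R.
  apply/(dvr_expz _ d); exact: prime_sub pQ _ Qt.
case: n Qt {xE} => // n; rewrite -exprnP => /(prime_exp h pQ (dvr_t d)) Qt _.
by rewrite tE; apply: prin_sub => //; exact: prime_smod pQ.
Qed.

Lemma prime0 S : subring S -> prime_ideal S ([set 0] : set K).
Proof.
move=> h; split.
- split; first by move=> _ ->; exact: sr0.
  split=> //; first by move=> x y /= -> ->; rewrite addr0.
  by move=> a x _ /= ->; rewrite scaler0.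
- by move=> /= /eqP; rewrite oner_eq0.
- by move=> x y _ _ /= /eqP; rewrite mulf_eq0 => /orP[] /eqP; [left|right].
Qed.

Lemma dvr_krull E t : dvr E t -> krull_dim E 1.
Proof.
move=> d; have h := dvr_subring d; have [lE t0 tE vE] := d.
have nt : nonunits E t by rewrite tE; exact: prin_self.
split.
  exists (fun i => if i is 0 then [set 0] else nonunits E); split.
    by case=> [|i] _; [exact: prime0|exact: nu_prime].
  case=> // _; split; first by move=> _ ->; exact: sm0 (nu_smod lE).
  by move=> /(_ t nt) /= /eqP; rewrite (negPf t0).
move=> n C [pC ltC]; rewrite leqNgt; apply/negP => n1.
have [l0 l1] := (ltC 0 (ltnW n1), ltC 1 n1).
have p1 := pC 1 (ltnW n1); have p2 := pC 2 n1.
case: (dvr_primes d p1) => E1.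
  case: l0 => _; apply; rewrite E1 => _ ->; exact: sm0 (prime_smod (pC 0 _)).
case: (dvr_primes d p2) => E2.
  case: l1 => _; apply; rewrite E2 => _ ->; exact: sm0 (prime_smod p1).
by case: l1 => _; apply; rewrite E1 E2.
Qed.

Lemma dvr_set0 E t : dvr E t -> E <> setT.
Proof. by move=> d E1; apply: (dvr_tinv d); rewrite E1. Qed.

Lemma lin_sum (C : set K) (s : seq K) y : lin C s y ->
  exists c : nat -> K, (forall i, (i < size s)%N -> C (c i)) /\ y = \sum_(i < size s) c i * s`_i.
Proof.
elim: s y => [|x s IH] y /=; first by move=> ->; exists (fun=> 0); rewrite big_ord0.
move=> [a [z [Ca /IH [c [Cc ->]] ->]]].
exists (fun i => if i is i'.+1 then c i' else a); split; first by case=> //= i; exact: Cc.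
by rewrite big_ord_recl.
Qed.

End DVR.

(** * The points of the resolution and their specializations *)

Section Model.
Variables (K : fieldType) (A : set K) (X : set (set K)).
Hypotheses (lA : local_ring A) (nA : noetherian A).
Hypothesis frA : forall x, exists a b, [/\ A a, A b, b != 0 & x = a / b].
Hypothesis rX : resolution A X.
Hypothesis dA : krull_dim A 2.
(** Normality of [A] as the determinant trick uses it: an eigenvalue in [K] of a matrix over [A]
    lies in [A]. *)
Hypothesis clA : forall x n (a : 'I_n -> K) (b : 'I_n -> 'I_n -> K),
  (exists i, a i != 0) -> (forall i j, A (b i j)) ->
  (forall i, x * a i = \sum_j b i j * a j) -> A x.

Lemma A_subring : subring A. Proof. by case: lA. Qed.
Let hA := A_subring.

Lemma X_cover : exists r (B : 'I_r -> set K), affine_cover A X B.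
Proof. by case: rX => -[]. Qed.

Lemma cover_B r (B : 'I_r -> set K) i : affine_cover A X B ->
  [/\ subring (B i), A `<=` B i, noetherian (B i) & spec (B i) `<=` X].
Proof.
move=> [Bs XE].
have sX : spec (B i) `<=` X by rewrite XE => R hR; exists i.
split=> //; have [s ->] := Bs i.
- exact: adjoin_subring.
- exact: adjoinSl.
- exact: hilbert_seq.
Qed.

Lemma cover_X r (B : 'I_r -> set K) R : affine_cover A X B -> X R ->
  exists i P, prime_ideal (B i) P /\ R = localization (B i) P.
Proof. by move=> [_ ->] [i _ [P pP ->]]; exists i, P. Qed.

Lemma X_regular R : X R -> regular_local_ring R.
Proof. by case: rX => _; exact. Qed.
Lemma X_local R : X R -> local_ring R. Proof. by move=> /X_regular []. Qed.
Lemma X_noeth R : X R -> noetherian R. Proof. by move=> /X_regular []. Qed.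
Lemma X_subring R : X R -> subring R. Proof. by move=> /X_local []. Qed.

Lemma X_A R : X R -> A `<=` R.
Proof.
move=> XR; have [r [B cB]] := X_cover.
have [i [P [pP ->]]] := cover_X cB XR; have [hB AB _ _] := cover_B i cB.
by apply: subset_trans AB _; exact: loc_sub.
Qed.

Lemma X_loc R Q : X R -> prime_ideal R Q -> X (localization R Q).
Proof.
move=> XR; have [r [B cB]] := X_cover.
have [i [P [pP ->]]] := cover_X cB XR; have [hB AB _ sX] := cover_B i cB.
move=> pQ; rewrite loc_loc //; apply: sX; exists (Q `&` B i) => //.
by apply: (prime_contr hB _ pQ); exact: loc_sub.
Qed.

Lemma X_val V : valuation_ring V -> A `<=` V -> exists2 R, X R & dominates V R.
Proof.
move=> vV AV; case: rX => -[_ /(_ V vV AV) [R [[XR d] _]] _].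
by exists R.
Qed.

Lemma X_val_uniq (V R R' : set K) : valuation_ring V -> A `<=` V -> X R -> X R' ->
  dominates V R -> dominates V R' -> R = R'.
Proof.
move=> vV AV XR XR' d d'; case: rX => -[_ /(_ V vV AV) [R0 [_ u]] _].
by rewrite -(u R) // -(u R').
Qed.

Lemma local_val (R : set K) : local_ring R -> exists V, valuation_ring V /\ dominates V R.
Proof.
move=> lR; have [h _] := lR.
have [||V [vV RV nV]] := @valuation_over _ R (nonunits R) h; last by exists V.
- move=> /(ideal_span_min (nu_smod lR) (fun x => id)); exact: nu1.
- exact: nu_sub.
Qed.

Lemma dominates_trans R1 R2 R3 : @dominates K R1 R2 -> dominates R2 R3 -> dominates R1 R3.
Proof. by move=> [a b] [c d]; split; [exact: subset_trans a|exact: subset_trans b]. Qed.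

Lemma X_dom R R' : X R -> X R' -> dominates R R' -> R = R'.
Proof.
move=> XR XR' d; have [V [vV dV]] := local_val (X_local XR).
have AV : A `<=` V by apply: subset_trans (proj1 dV); exact: X_A.
by apply: (X_val_uniq vV AV) => //; exact: dominates_trans d.
Qed.

(** The localization is also a point of [X], and [R] dominates it; by separatedness two points, one
    dominating the other, coincide. *)
Lemma X_gen R R' : X R -> X R' -> R' `<=` R -> R = localization R' (nonunits R `&` R').
Proof.
move=> XR XR' s; have hR' := X_subring XR'.
have pP := nu_contr (X_local XR) hR' s.
apply: X_dom => //; first exact: X_loc.
split.
  move=> _ [a [b [Ra Rb nb ->]]]; apply: (srM (X_subring XR)); first exact: s.
  have [|_ //] := nu_inv (s _ Rb).
  by move=> n; apply: nb.
move=> _ /(loc_nuP pP) [a [b [[na _] Rb nb ->]]].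
apply: (smMr (nu_smod (X_local XR))) => //.
have [|_ //] := nu_inv (s _ Rb).
by move=> n; apply: nb.
Qed.

Lemma loc_sub_nu R P : local_ring R -> A `<=` R -> nonunits R `&` A = P -> localization A P `<=` R.
Proof.
move=> lR AR E _ [a [b [Aa Ab Pb ->]]]; apply: (srM (proj1 lR)); first exact: AR.
have [|_ //] := nu_inv (AR _ Ab).
by move=> n; apply: Pb; rewrite -E.
Qed.

(** ** Primes of [A] *)

Lemma A_chain P P' : prime_ideal A P -> prime_ideal A P' -> P `<=` P' ->
  P <> [set 0] -> P' <> nonunits A -> P = P'.
Proof.
move=> pP pP' s P0 Pm; apply: contrapT => ne.
have [_ /(_ 3 (fun i => if i is 0 then [set 0] else if i is 1 then P else if i is 2 then P' else nonunits A))] := dA.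
suff h : prime_chain A 3 (fun i => if i is 0 then [set 0] else if i is 1 then P else if i is 2 then P' else nonunits A).
  by move/(_ h).
split; first by case=> [|[|[|i]]] _ //; [exact: prime0|exact: nu_prime].
case=> [|[|[|i]]] // _; split=> //.
- by move=> _ ->; exact: sm0 (prime_smod pP).
- move=> h; apply: P0; rewrite eqEsubset; split=> //.
  by move=> _ ->; exact: sm0 (prime_smod pP).
- by move=> h; apply: ne; rewrite eqEsubset.
- by apply: ideal_proper => //; [case: pP'|exact: prime_n1 pP'].
- move=> h; apply: Pm; rewrite eqEsubset; split=> //.
  by apply: ideal_proper => //; [case: pP'|exact: prime_n1 pP'].
Qed.

Lemma A_prime1 : exists P, [/\ prime_ideal A P, P <> [set 0] & P <> nonunits A].
Proof.
have [[C [pC ltC]] _] := dA; exists (C 1); split.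
- exact: pC.
- move=> E; have [_] := ltC 0 isT; apply; rewrite E => _ ->.
  exact: sm0 (prime_smod (pC 0 isT)).
- move=> E; have [_] := ltC 1 isT; apply; rewrite E.
  by apply: ideal_proper => //; [case: (pC 2 isT)|exact: prime_n1 (pC 2 isT)].
Qed.

Lemma prime_neq0 S P : @prime_ideal K S P -> P <> [set 0] -> exists2 x, P x & x != 0.
Proof.
move=> pP P0; apply: contrapT => h; apply: P0; rewrite eqEsubset; split=> x.
  by move=> Px; have [//|x0] := eqVneq x 0; exfalso; apply: h; exists x.
by move=> ->; exact: sm0 (prime_smod pP).
Qed.

Lemma A_nprin p r : nonunits A p -> ~ powin (nonunits A) (prin p A) r.
Proof.
move=> np pw; have [P [pP P0 Pm]] := A_prime1.
case: (pit lA nA np pw pP) => h.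
  apply: Pm; rewrite eqEsubset; split=> //.
  by apply: ideal_proper => //; [case: pP|exact: prime_n1 pP].
apply: P0; rewrite eqEsubset; split=> //.
by move=> _ ->; exact: sm0 (prime_smod pP).
Qed.

Lemma denom_seq B P (s : seq K) : subring B -> prime_ideal B P ->
  (forall y, y \in s -> localization B P y) ->
  exists d, [/\ B d, ~ P d & forall y, y \in s -> B (d * y)].
Proof.
move=> hB pP; elim: s => [|x s IH] h.
  by exists 1; split=> //; [exact: sr1|exact: prime_n1 pP].
have [d [Bd Pd hd]] : exists d, [/\ B d, ~ P d & forall y, y \in s -> B (d * y)].
  by apply: IH => y ys; apply: h; rewrite inE ys orbT.
have [a [b [Ba Bb Pb xE]]] := h x (mem_head _ _).
exists (d * b); split; [exact: srM|exact: prime_nmul pP _ _ _ _|].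
move=> y; rewrite inE => /orP[/eqP ->|ys].
  rewrite xE; have -> : d * b * (a / b) = d * a by field; exact: prime_n0 pP Pb.
  exact: srM.
by rewrite mulrAC; apply: srM => //; exact: hd.
Qed.

(** The determinant trick over a localization: for a common denominator [d] of the matrix of [x] on
    [N], normality of [A] applies to [d * x]. *)
Lemma normal_fix P N (s : seq K) x : prime_ideal A P -> let S := localization A P in
  N = ideal_span S [set` s] -> (exists2 y, N y & y != 0) ->
  (forall y, N y -> N (x * y)) -> S x.
Proof.
move=> pP S NE [y Ny y0] xN; have hS : subring S by exact: loc_subring.
have sN : smod S N by rewrite NE; exact: ideal_span_smod.
have Ns z : z \in s -> N z by move=> zs; rewrite NE; exact: ideal_spanS.
have [b hb] : exists b : nat -> nat -> K, forall i, (i < size s)%N ->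
    (forall j, (j < size s)%N -> S (b i j)) /\ x * s`_i = \sum_(j < size s) b i j * s`_j.
  have : forall i, exists c : nat -> K, (i < size s)%N ->
    (forall j, (j < size s)%N -> S (c j)) /\ x * s`_i = \sum_(j < size s) c j * s`_j.
    move=> i; case: (ltnP i (size s)) => lt; last by exists (fun=> 0).
    have : N (x * s`_i) by apply: xN; apply: Ns; exact: mem_nth.
    rewrite NE ideal_span_lin // => /lin_sum [c [Sc E]].
    by exists c.
  by move=> /choice [b hb]; exists b.
have [|d [Ad Pd hd]] := @denom_seq A P [seq b i j | i <- iota 0 (size s), j <- iota 0 (size s)] hA pP.
  move=> w /allpairsP [[i j] /= [li lj ->]]; move: li lj; rewrite !mem_iota /= !add0n => li lj.
  by have [h _] := hb i li; exact: h.
have d0 : d != 0 by exact: prime_n0 pP Pd.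
have Adx : A (d * x).
  apply: (@clA _ (size s) (fun i => s`_i) (fun i j => d * b i j)).
  - have [i lt h] : exists2 i, (i < size s)%N & s`_i != 0.
      apply: contrapT => h; move/eqP: y0; apply.
      move: Ny; rewrite NE ideal_span_lin // => /lin_sum [c [_ ->]].
      rewrite big1 // => i _; have [->|ne] := eqVneq s`_i 0; first by rewrite mulr0.
      by exfalso; apply: h; exists i.
    by exists (Ordinal lt).
  - move=> i j; apply: hd; apply: allpairs_f; by rewrite mem_iota /= add0n.
  - move=> i; have [_ E] := hb i (ltn_ord i); rewrite -mulrA E mulr_sumr.
    by apply: eq_bigr => j _; rewrite mulrA.
exists (d * x), d; split=> //; by rewrite mulrC mulKf.
Qed.

Lemma A_loc : localization A (nonunits A) = A. Proof. exact: loc_nu. Qed.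

Lemma nu_ideal S : @local_ring K S -> ideal S (nonunits S).
Proof. by case. Qed.

(** Depth two of [A]. If [x m] lies in [m], then [x] is integral over [A]; otherwise some [v * x] is
    a unit and [m] is principal, against dimension two. *)
Lemma A_depth x : (forall v, nonunits A v -> A (v * x)) -> A x.
Proof.
move=> h; have sm := nu_smod lA.
case: (pselect (forall v, nonunits A v -> nonunits A (v * x))) => hx.
  have [s sE] := nA (nu_ideal lA).
  rewrite -A_loc; apply: (@normal_fix _ (nonunits A) s) => //.
  - exact: nu_prime.
  - by rewrite A_loc.
  - have [P [pP P0 Pm]] := A_prime1; have [y Py y0] := prime_neq0 pP P0.
    by exists y => //; apply: ideal_proper Py => //; [case: pP|exact: prime_n1 pP].
  - by move=> y ny; rewrite mulrC; exact: hx.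
have [v nv nvx] : exists2 v, nonunits A v & ~ nonunits A (v * x).
  by apply: contrapT => h'; apply: hx => v nv; apply: contrapT => n; apply: h'; exists v.
have [vx0 Avx] := nu_inv (h _ nv) nvx.
have x0 : x != 0 by apply: contraNneq vx0 => ->; rewrite mulr0.
have v0 : v != 0 by apply: contraNneq vx0 => ->; rewrite mul0r.
exfalso; apply: (@A_nprin (v * (v * x)^-1) 1); first exact: smMr sm _ _.
move=> y hy; rewrite big_ord_recl big_ord0 mulr1.
exists (y 0 * x); first by apply: h; exact: hy.
by field; rewrite x0 v0.
Qed.

(** The alternative of [A_depth] for [z / y], with [z] a socle element modulo [y]: as [z / y] is not
    in [S], it is now the maximal ideal that must be principal. *)
Lemma loc_dvr P : prime_ideal A P -> P <> [set 0] -> P <> nonunits A ->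
  exists t, dvr (localization A P) t.
Proof.
move=> pP P0 Pm; set S := localization A P.
have lS : local_ring S by exact: loc_local.
have hS := proj1 lS; have nS : noetherian S by exact: loc_noeth.
have AS : A `<=` S by exact: loc_sub.
have nuA : nonunits S `&` A = P by exact: loc_contr.
have [y Py y0] := prime_neq0 pP P0.
have ny : nonunits S y by move: Py; rewrite -nuA => -[].
have frS x : exists a b, [/\ S a, S b, b != 0 & x = a / b].
  by have [a [b [Aa Ab b0 ->]]] := frA x; exists a, b; split=> //; exact: AS.
have iy : ideal S (prin y S).
  by split; [apply: prin_sub; [exact: sr_smod|exact: nu_sub]|exact: prin_smod].
have prS Q : prime_ideal S Q -> Q y -> Q = nonunits S.
  move=> pQ Qy; have QS := prime_sub pQ.
  have nQ : Q `<=` nonunits S by apply: ideal_proper => //; [case: pQ|exact: prime_n1 pQ].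
  rewrite eqEsubset; split=> // z /(loc_nuP pP) [a [b [Pa Ab Pb ->]]].
  have pQA := prime_contr hA AS pQ.
  have E : Q `&` A = P.
    apply: A_chain => //.
    - by rewrite -nuA => w [Qw Aw]; split=> //; exact: nQ.
    - move=> E; have : (Q `&` A) y by split=> //; exact: prime_sub pP _ Py.
      by rewrite E => /= E0; move/eqP: y0.
  apply: (smMr (prime_smod pQ)); first by apply: loc_inv.
  by move: Pa; rewrite -E => -[].
have [r [p [pp prd]]] := noeth_primes hS nS iy.
have pw : powin (nonunits S) (prin y S) r.
  move=> x hx; apply: prd => i lt; have [ppi s] := pp i lt.
  by rewrite (prS _ ppi (s _ (prin_self y hS))); exact: hx.
have [|z [Sz nz hz]] := socle hS (@nu_sub _ S) pw.
  by move=> [w Sw yw]; move: ny => [_]; apply; exists w.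
have nz' : ~ S (z / y) by move=> h; apply: nz; exact/(prinP _ _ y0).
have hx v : nonunits S v -> S (v * (z / y)).
  by move=> nv; rewrite mulrA; apply/(prinP _ _ y0); exact: hz.
case: (pselect (forall v, nonunits S v -> nonunits S (v * (z / y)))) => hx'.
  exfalso; apply: nz'; have [s sE] := nS _ (nu_ideal lS).
  apply: (@normal_fix P _ s _ pP sE).
  - by exists y.
  - by move=> w nw; rewrite mulrC; exact: hx'.
have [v nv nvx] : exists2 v, nonunits S v & ~ nonunits S (v * (z / y)).
  by apply: contrapT => h'; apply: hx' => v nv; apply: contrapT => n; apply: h'; exists v.
have [vx0 Avx] := nu_inv (hx _ nv) nvx.
have z0 : z != 0 by apply: contraNneq vx0 => ->; rewrite mul0r mulr0.
have v0 : v != 0 by apply: contraNneq vx0 => ->; rewrite mul0r.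
set t := v * (v * (z / y))^-1.
have nt : nonunits S t by exact: smMr (nu_smod lS) _ _.
exists t; apply: noeth_dvr => //.
  by rewrite mulf_neq0 // invr_neq0.
rewrite eqEsubset; split; last by apply: prin_sub => //; exact: nu_smod.
move=> w nw; exists (w * (z / y)); first exact: hx.
by rewrite /t; field; rewrite v0 z0 y0.
Qed.

(** The center of [E] on [X] contains the localization of [A] under it, which is already [E]. *)
Lemma dvr_X E t : dvr E t -> A `<=` E -> localization A (nonunits E `&` A) = E -> X E.
Proof.
move=> d AE EE; have lE := dvr_loc d.
have [R XR [RE nRE]] := X_val (dvr_valuation d) AE.
suff <- : R = E by [].
rewrite eqEsubset; split=> //; rewrite -{1}EE.
apply: loc_sub_nu; [exact: X_local|exact: X_A|].
rewrite eqEsubset; split=> x [n Ax]; split=> //; first exact: nRE.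
apply: contrapT => n'; have [x0 Rx] := nu_inv (X_A XR Ax) n'.
by apply: (nu_not n x0); exact: RE.
Qed.

Lemma pdiv_dvr E : prime_divisor X E -> exists t, dvr E t.
Proof.
move=> [XE k1]; have [lE nE [s [ks sE]]] := X_regular XE.
have s1 : size s = 1 by exact: krull_uniq ks k1.
case: s s1 sE {ks} => // t [|//] _ sE; exists t.
have hE := proj1 lE.
have tE : nonunits E = prin t E.
  rewrite sE -ideal_span_prin //; congr ideal_span.
  by rewrite eqEsubset; split=> x /=; rewrite inE => /eqP.
apply: noeth_dvr => //.
  apply/eqP => t0; have [[C [pC ltC]] _] := k1.
  have nC i : (i <= 1)%N -> C i `<=` [set 0].
    move=> le x Cx; have : nonunits E x.
      by apply: ideal_proper Cx => //; [case: (pC i le)|exact: prime_n1 (pC i le)].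
    by rewrite tE t0 => -[y _ <-]; rewrite mul0r.
  have [_] := ltC 0 isT; apply=> x /(nC 1 isT) ->.
  exact: sm0 (prime_smod (pC 0 isT)).
by move=> x; have [a [b [Aa Ab b0 ->]]] := frA x; exists a, b; split=> //; exact: X_A.
Qed.

Lemma dvr_pdiv E t : X E -> dvr E t -> prime_divisor X E.
Proof. by move=> XE d; split=> //; exact: dvr_krull d. Qed.

Lemma loc_pdiv P : prime_ideal A P -> P <> [set 0] -> P <> nonunits A ->
  prime_divisor X (localization A P).
Proof.
move=> pP P0 Pm; have [t d] := loc_dvr pP P0 Pm.
apply: (dvr_pdiv _ d); apply: (dvr_X d); first exact: loc_sub.
by rewrite loc_contr.
Qed.

(** If the trace of the maximal ideal of [R] on [A] is neither [0] nor [m], then [R] contains a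
    discrete valuation ring of [K], and such a ring is maximal among the proper subrings. *)
Lemma X_cases R : X R -> [\/ R = setT, prime_divisor X R | dominates R A].
Proof.
move=> XR; have lR := X_local XR; have AR := X_A XR.
have pP := nu_contr lR hA AR; set P := nonunits R `&` A in pP.
case: (pselect (P = nonunits A)) => Pm.
  by apply: Or33; split=> //; rewrite -Pm => x [].
case: (pselect (P = [set 0])) => P0.
  apply: Or31; rewrite eqEsubset; split=> // x _.
  have [a [b [Aa Ab b0 ->]]] := frA x.
  apply: (loc_sub_nu lR AR P0); exists a, b; split=> //.
  by move=> /= /eqP; rewrite (negPf b0).
apply: Or32; have [t d] := loc_dvr pP P0 Pm; have pd := loc_pdiv pP P0 Pm.
have [E|E] := dvr_max d (X_subring XR) (loc_sub_nu lR AR erefl); first by rewrite E.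
exfalso; apply: P0; rewrite eqEsubset; split.
  move=> x [n _]; have [//|x0] := eqVneq x 0; by case: (nu_not n x0); rewrite E.
by move=> _ ->; exact: sm0 (prime_smod pP).
Qed.

Lemma pdiv_eq E F : prime_divisor X E -> prime_divisor X F -> E `<=` F -> E = F.
Proof.
move=> pE pF s; have [t d] := pdiv_dvr pE; have [t' d'] := pdiv_dvr pF.
have [-> //|E1] := dvr_max d (dvr_subring d') s.
by case: (dvr_set0 d').
Qed.

(** ** The residue field and the dimension inequality *)

Variables (k : closedFieldType) (j : {rmorphism k -> K}).
Hypothesis jA : forall c, A (j c).
Hypothesis resA : forall a, A a -> exists c, nonunits A (a - j c).

Lemma j_eq0 c : (j c == 0) = (c == 0). Proof. exact: fmorph_eq0. Qed.

Lemma j_unit R c : @local_ring K R -> A `<=` R -> nonunits R (j c) -> c = 0.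
Proof.
move=> lR AR n; have [//|c0] := eqVneq c 0.
case: (nu_not n); first by rewrite j_eq0.
by rewrite -fmorphV; apply: AR; exact: jA.
Qed.

(** An algebraically closed field is infinite: the polynomial [p] takes the value [1] on all of [s],
    so its root is new. *)
Lemma k_fresh (s : seq k) : exists c, c \notin s.
Proof.
pose p := \prod_(z <- s) ('X - z%:P) * 'X + 1.
have sp : size p != 1.
  rewrite /p size_polyDl size_mulX ?monic_neq0 ?monic_prod_XsubC //.
    by rewrite size_prod_XsubC.
  by rewrite size_poly1 size_prod_XsubC.
have /closed_rootP [c rc] := sp; exists c; apply/negP => cs.
move: rc; rewrite /root /p hornerD hornerM hornerC.
have /eqP -> : (\prod_(z <- s) ('X - z%:P)).[c] == 0 by rewrite -/(root _ c) root_prod_XsubC.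
by rewrite mul0r add0r oner_eq0.
Qed.

Definition ksub (N : set K) := [/\ N 0, forall x y, N x -> N y -> N (x + y)
  & forall c x, N x -> N (j c * x)].

Lemma smod_ksub S N : A `<=` S -> smod S N -> ksub N.
Proof.
move=> AS [n0 nD nM]; split=> // c x Nx; apply: nM => //; apply: AS; exact: jA.
Qed.

(** A vector space over an infinite field is not a finite union of proper subspaces: each of the
    earlier spaces excludes at most one [c] on the line [y + c x]. This plays the part of prime
    avoidance and applies to submodules that are not prime as well. *)
Lemma avoid N (I : eqType) (Ws : seq I) (W : I -> set K) : ksub N ->
  (forall i, i \in Ws -> ksub (W i)) -> (forall i, i \in Ws -> ~ N `<=` W i) ->
  exists2 x, N x & forall i, i \in Ws -> ~ W i x.
Proof.
move=> [n0 nD nM]; elim: Ws => [|i Ws IH] kW nW; first by exists 0.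
have [x Nx hx] : exists2 x, N x & forall i, i \in Ws -> ~ W i x.
  by apply: IH => i' h; [apply: kW|apply: nW]; rewrite inE h orbT.
case: (pselect (W i x)) => Wix; last first.
  by exists x => // i'; rewrite inE => /orP[/eqP ->|/hx].
have [y Ny Wy] : exists2 y, N y & ~ W i y.
  apply: contrapT => h; apply: (nW i (mem_head _ _)) => y Ny; apply: contrapT => Wy.
  by apply: h; exists y.
have [w0 wD wM] := kW i (mem_head _ _).
have [bad hbad] : exists bad : seq k, forall c i', c \notin bad -> i' \in Ws -> ~ W i' (y + j c * x).
  have kW' i' : i' \in Ws -> ksub (W i') by move=> h; apply: kW; rewrite inE h orbT.
  elim: (Ws) kW' hx => [|i' Ws' IH'] kW' hx; first by exists [::].
  have [bad hbad] : exists bad : seq k, forall c i', c \notin bad -> i' \in Ws' -> ~ W i' (y + j c * x).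
    by apply: IH' => i2 h; [apply: kW'|apply: hx]; rewrite inE h orbT.
  have [v0 vD vM] := kW' i' (mem_head _ _).
  have hx' := hx i' (mem_head _ _).
  case: (pselect (exists c, W i' (y + j c * x))) => [[c hc]|h]; last first.
    exists bad => c i2 cb; rewrite inE => /orP[/eqP ->|]; last exact: hbad.
    by move=> h2; apply: h; exists c.
  exists (c :: bad) => c' i2; rewrite inE negb_or => /andP[cc cb].
  case/orP=> [/eqP ->|]; last exact: hbad.
  move=> hc'; apply: hx'.
  have -> : x = j (c - c')^-1 * ((y + j c * x) + j (-1) * (y + j c' * x)).
    rewrite rmorphN1 fmorphV rmorphB; field.
    by rewrite -rmorphB j_eq0 subr_eq0 eq_sym.
  by apply: (vM); apply: vD => //; exact: vM.
have [c cb] := k_fresh bad.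
exists (y + j c * x); first by apply: nD => //; exact: nM.
move=> i'; rewrite inE => /orP[/eqP ->|]; last exact: hbad.
move=> h; apply: Wy; have -> : y = (y + j c * x) + j (- c) * x by rewrite rmorphN; ring.
by apply: wD => //; exact: wM.
Qed.

Lemma prim_powin S J : @local_ring K S -> noetherian S -> ideal S J ->
  (forall Q, prime_ideal S Q -> J `<=` Q -> Q = nonunits S) -> exists r, powin (nonunits S) J r.
Proof.
move=> lS nS iJ h; have [r [p [pp prd]]] := noeth_primes (proj1 lS) nS iJ.
by exists r => x hx; apply: prd => i lt; have [pi s] := pp i lt; rewrite (h _ pi s); exact: hx.
Qed.

Lemma residual_A S : @local_ring K S -> A `<=` S -> nonunits A `<=` nonunits S ->
  (forall x, S x -> exists c, nonunits S (x - j c)) -> residual A S.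
Proof.
by move=> lS AS nAS res; split=> // x /res [c hc]; exists (j c).
Qed.

Lemma residual_AA : residual A A. Proof. exact: residual_refl. Qed.

Lemma sadd_ideal S N P : subring S -> ideal S N -> @ideal K S P -> ideal S (sadd N P).
Proof.
move=> hS [NS sN] [PS sP]; split; last exact: sadd_smod.
by apply: sadd_min => //; exact: sr_smod.
Qed.

Lemma prin_ideal S x : subring S -> S x -> @ideal K S (prin x S).
Proof.
by move=> hS Sx; split; [apply: prin_sub => //; exact: sr_smod|exact: prin_smod].
Qed.

(** A system of parameters: [q] avoids the primes over [p] other than the maximal ideal. *)
Lemma A_params : exists p q C, [/\ nonunits A p, nonunits A q
  & len A (A : set K^o) (sadd (prin p A) (prin q A)) C].
Proof.
have [P [pP P0 Pm]] := A_prime1; have [p Pp p0] := prime_neq0 pP P0.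
have np : nonunits A p by apply: ideal_proper Pp => //; [case: pP|exact: prime_n1 pP].
have Ap := nu_sub np; have sm := nu_smod lA.
have ip := prin_ideal hA Ap.
have [r [Q [pQ prd]]] := noeth_primes hA nA ip.
have [|||q nq hq] := @avoid (nonunits A) _ [seq i <- iota 0 r | `[< Q i <> nonunits A >] ] Q.
- exact: smod_ksub sm.
- move=> i; rewrite mem_filter mem_iota /= => /andP[_ lt].
  by have [pi _] := pQ i lt; exact: smod_ksub (prime_smod pi).
- move=> i; rewrite mem_filter mem_iota /= => /andP[/asboolP ne lt] s.
  have [pi _] := pQ i lt; apply: ne; rewrite eqEsubset; split=> //.
  by apply: ideal_proper => //; [case: pi|exact: prime_n1 pi].
have iJ : ideal A (sadd (prin p A) (prin q A)).
  by apply: sadd_ideal => //; apply: prin_ideal => //; exact: nu_sub.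
have [|r' pw] := prim_powin lA nA iJ.
  move=> Q' pQ' JQ'; apply: contrapT => Qm.
  have Qp : Q' p by apply/JQ'/sadd_subl; [exact: sm0 (prin_smod _ hA)|exact: prin_self].
  have Qq : Q' q by apply/JQ'/sadd_subr; [exact: sm0 (prin_smod _ hA)|exact: prin_self].
  have [i lt s] : exists2 i, (i < r)%N & Q i `<=` Q'.
    apply: (prime_over hA pQ' _ _ prd); last by move=> i /pQ [].
    by apply: prin_sub => //; exact: prime_smod pQ'.
  have [pi si] := pQ i lt.
  have Qi0 : Q i <> [set 0].
    move=> E; move/eqP: p0; apply; have : Q i p by apply/si/prin_self.
    by rewrite E.
  have E := A_chain pi pQ' s Qi0 Qm.
  apply: (hq i); last by rewrite E.
  rewrite mem_filter mem_iota /= lt andbT; apply/asboolP; by rewrite E.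
have [C hC] := finlen residual_AA nA iJ pw.
by exists p, q, C.
Qed.

Lemma AN1 : A (-1). Proof. exact: srN1. Qed.

Lemma len_mulbound N N' p l : @ideal K A N -> ideal A N' -> A p -> len A (A : set K^o) N' l ->
  (forall x, N' x -> N (p * x)) ->
  exists2 l', len A (sadd N (prin p A) : set K^o) N l' & (l' <= l)%N.
Proof.
move=> [NA sN] [NA' sN'] Ap hl h.
have sA := sr_smod hA; have sp := prin_smod p hA.
pose N2 := [set x | A x /\ N (p * x)].
have sN2 : smod A N2.
  split.
  - by split; [exact: sr0|rewrite mulr0; exact: sm0 sN].
  - by move=> x y [Ax Nx] [Ay Ny]; split; [exact: srD|rewrite mulrDr; exact: smD sN _ _].
  - move=> a x Aa [Ax Nx]; split; first exact: srM.
    by rewrite /GRing.scale /= mulrCA; exact: smM sN _ _.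
have s1 : N' `<=` N2 by move=> x Nx; split; [exact: NA'|exact: h].
have s2 : N2 `<=` A by move=> x [].
have [l' hl' le] := len_quo AN1 hl sN2 s1 s2.
exists l' => //.
apply: (@len_mul1 _ A A N2 _ _ p _ _ _ _ _ _ _ _ _ _ _ hl') => //.
- exact: sadd_smod.
- by apply: sadd_subl; exact: sm0 sp.
- by move=> x Ax; apply: sadd_subr; [exact: sm0 sN|exists x].
- move=> _ [a [_ [Na [x Ax <-] ->]]]; exists x => //.
  by rewrite addrK.
- by move=> x Ax; split=> // -[].
Qed.

(** Multiplication by [x] maps the quotient for [x ^ e] onto the kernel of the passage from
    [x ^ e.+1] to [x], so the length grows at most linearly in each exponent. *)
Lemma len_powers p q C : nonunits A p -> nonunits A q ->
  len A (A : set K^o) (sadd (prin p A) (prin q A)) C ->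
  forall a b, exists2 l, len A (A : set K^o) (sadd (prin (p ^+ a) A) (prin (q ^+ b) A)) l & (l <= a * b * C)%N.
Proof.
move=> np nq hC; have [Ap Aq] := (nu_sub np, nu_sub nq).
have iI a b : ideal A (sadd (prin (p ^+ a) A) (prin (q ^+ b) A)).
  by apply: sadd_ideal => //; apply: prin_ideal => //; exact: srX.
have sA := sr_smod hA.
have sp x := prin_smod x hA.
have top a b : (a == 0) || (b == 0) -> sadd (prin (p ^+ a) A) (prin (q ^+ b) A) = A.
  move=> h; have [sub sI] := iI a b; rewrite eqEsubset; split=> // x Ax.
  rewrite -[x]mulr1; apply: (smM sI) => //.
  case/orP: h => /eqP ->; rewrite expr0.
    by apply: sadd_subl; [exact: sm0 (sp _)|exact: prin_self].
  by apply: sadd_subr; [exact: sm0 (sp _)|exact: prin_self].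
have step x y e f : nonunits A x -> A y -> forall l l',
    len A (A : set K^o) (sadd (prin (x ^+ e) A) (prin (y ^+ f) A)) l ->
    len A (A : set K^o) (sadd (prin x A) (prin (y ^+ f) A)) l' ->
    exists2 l2, len A (A : set K^o) (sadd (prin (x ^+ e.+1) A) (prin (y ^+ f) A)) l2 & (l2 <= l + l')%N.
  move=> nx Ay l l' hl hl'; have Ax := nu_sub nx.
  have iN e' : ideal A (sadd (prin (x ^+ e') A) (prin (y ^+ f) A)).
    by apply: sadd_ideal => //; apply: prin_ideal => //; exact: srX.
  have [|l2 h2 le] := len_mulbound (iN e.+1) (iN e) Ax hl.
    move=> _ [_ [_ [[a Aa <-] [b Ab <-] ->]]]; exists (x ^+ e.+1 * a), (y ^+ f * (x * b)).
    by split; [exists a|exists (x * b) => //; exact: srM|rewrite exprS; ring].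
  have E : sadd (sadd (prin (x ^+ e.+1) A) (prin (y ^+ f) A)) (prin x A) = sadd (prin x A) (prin (y ^+ f) A).
    have s3 := sadd_smod (sp x) (sp (y ^+ f)).
    rewrite eqEsubset; split.
      apply: (sadd_min s3); last by apply: sadd_subl; exact: sm0 (sp _).
      apply: (sadd_min s3); last by apply: sadd_subr; exact: sm0 (sp _).
      move=> _ [a Aa <-]; apply: sadd_subl; first exact: sm0 (sp _).
      by exists (x ^+ e * a); [apply: srM => //; exact: srX|rewrite exprS; ring].
    have s4 := sadd_smod (proj2 (iN e.+1)) (sp x).
    apply: (sadd_min s4); first by apply: sadd_subr; exact: sm0 (proj2 (iN _)).
    move=> z hz; apply: sadd_subl; first exact: sm0 (sp _).
    by apply: sadd_subr => //; exact: sm0 (sp _).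
  rewrite E in h2; exists (l' + l2)%N; last by rewrite addnC leq_add2r.
  exact: (len_add AN1 hl' h2).
have swap x y : sadd (prin x A) (prin y A) = sadd (prin y A) (prin x A).
  by rewrite eqEsubset; split=> _ [a [b [ha hb ->]]]; exists b, a; rewrite addrC.
have one b : exists2 l, len A (A : set K^o) (sadd (prin p A) (prin (q ^+ b) A)) l & (l <= b * C)%N.
  elim: b => [|b [l hl le]].
    by exists 0 => //; have -> := top 1 0 isT; exact: len0.
  have hC' : len A (A : set K^o) (sadd (prin q A) (prin (p ^+ 1) A)) C by rewrite swap.
  rewrite swap in hl; have [l2 h2 le2] := step q p b 1 nq Ap _ _ hl hC'.
  exists l2; first by rewrite swap.
  by apply: leq_trans le2 _; rewrite mulSn addnC leq_add2l.
move=> a b; elim: a => [|a [l hl le]].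
  by exists 0 => //; rewrite top //; exact: len0.
have [l' hl' le'] := one b.
have [l2 h2 le2] := step p q a b np Aq _ _ hl hl'.
exists l2 => //; apply: leq_trans le2 _; rewrite -mulnA mulSn addnC leq_add //.
by rewrite mulnA.
Qed.

(** The maximal ideal kills [N / N'], so [A] acts there through [k], and the [k]-spans of initial
    segments of the family form a strict chain of submodules. *)
Lemma len_indep N N' (I : finType) (e : I -> K) n : smod A N -> smod A N' -> N' `<=` N ->
  (forall v x, nonunits A v -> N x -> N' (v * x)) -> (forall i, N (e i)) ->
  (forall c : I -> k, N' (\sum_i j (c i) * e i) -> forall i, c i = 0) ->
  len A (N : set K^o) N' n -> (#|I| <= n)%N.
Proof.
move=> sN sN' sub nN Ne ind hl.
pose f (i : nat) : K := if (insub i : option 'I_#|I|) is Some i' then e (enum_val i') else 0.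
have fE (i : 'I_#|I|) : f i = e (enum_val i) by rewrite /f valK.
have Nf i : N (f i) by rewrite /f; case: insubP => [u _ _|_]; [exact: Ne|exact: sm0 sN].
have indf (c : nat -> k) : N' (\sum_(i < #|I|) j (c i) * f i) -> forall i, (i < #|I|)%N -> c i = 0.
  move=> h i lt; have := ind (fun x => c (enum_rank x)) _ (enum_val (Ordinal lt)).
  rewrite enum_valK; apply; rewrite (@reindex _ _ _ I 'I_#|I| (fun x => enum_val x) predT) /=; last first.
    by exists enum_rank => x _; rewrite ?enum_valK ?enum_rankK.
  by under eq_bigr => l _ do rewrite enum_valK -fE.
pose C i : set K := [set x | exists c : nat -> k, N' (x - \sum_(l < i) j (c l) * f l)].
have sC i : smod A (C i).
  split.
  - exists (fun=> 0); rewrite big1 ?subr0; first exact: sm0 sN'.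
    by move=> l _; rewrite rmorph0 mul0r.
  - move=> x y [c hc] [d hd]; exists (fun l => c l + d l).
    have -> : x + y - \sum_(l < i) j (c l + d l) * f l =
        (x - \sum_(l < i) j (c l) * f l) + (y - \sum_(l < i) j (d l) * f l).
      under eq_bigr => l _ do rewrite rmorphD mulrDl.
      by rewrite big_split /=; ring.
    exact: smD sN' _ _.
  - move=> a x Aa [c hc]; have [b hb] := resA Aa; exists (fun l => b * c l).
    set s := \sum_(l < i) j (c l) * f l in hc.
    have -> : \sum_(l < i) j (b * c l) * f l = j b * s.
      by rewrite mulr_sumr; apply: eq_bigr => l _; rewrite rmorphM mulrA.
    have -> : (a *: (x : K^o)) - j b * s = a * (x - s) + (a - j b) * s.
      by rewrite /GRing.scale /=; ring.
    apply: (smD sN'); first exact: smM sN' _ _.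
    apply: nN => //; apply: (sm_sum _ sN) => l _; exact: smM sN _ _.
have CN i : C i `<=` N.
  move=> x [c hc]; rewrite -(subrK (\sum_(l < i) j (c l) * f l) x).
  apply: (smD sN); first exact: sub.
  apply: (sm_sum _ sN) => l _; exact: smM sN _ _.
have ch i : (i <= #|I|)%N -> lchain A (N' : set K^o) (C i) i.
  elim: i => [|i IH] lt.
    have -> : C 0 = N'.
      rewrite eqEsubset; split=> x; first by move=> [c]; rewrite big_ord0 subr0.
      by move=> hx; exists (fun=> 0); rewrite big_ord0 subr0.
    exact: lchain0.
  apply: lchainS (IH (ltnW lt)) _ (sC _); split.
    move=> x [c hc]; exists (fun l => if (l < i)%N then c l else 0).
    rewrite big_ord_recr /= ltnn rmorph0 mul0r addr0.
    by under eq_bigr => l _ do rewrite ltn_ord.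
  move=> h; have [c hc] : C i (f i).
    apply: h; exists (fun l => (l == i)%:R); rewrite big_ord_recr /= eqxx rmorph1 mul1r big1 ?add0r ?subrr.
      exact: sm0 sN'.
    by move=> l _; rewrite ltn_eqF // rmorph0 mul0r.
  pose d (l : nat) : k := if (l < i)%N then - c l else (l == i)%:R.
  suff h' : N' (\sum_(l < #|I|) j (d l) * f l).
    by have /eqP := indf d h' i lt; rewrite /d ltnn eqxx oner_eq0.
  have -> : \sum_(l < #|I|) j (d l) * f l = f i - \sum_(l < i) j (c l) * f l; last by [].
  rewrite /d.
  rewrite -(subnKC lt) big_split_ord /= [X in _ + X]big1 ?addr0; last first.
    move=> l _; rewrite ltnNge (leq_trans (leqnSn i) (leq_addr _ _)) /=.
    by rewrite gtn_eqF ?rmorph0 ?mul0r // ltn_addr.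
  rewrite big_ord_recr /= ltnn eqxx rmorph1 mul1r addrC; congr (_ + _).
  rewrite -sumrN; apply: eq_bigr => l _; by rewrite ltn_ord rmorphN mulNr.
have [_ _ sNC] := lchain_sm (ch _ (leqnn _)).
have [b hb le] := len_sub AN1 hl (sC #|I|) sNC (CN _).
exact: leq_trans (lchain_len (ch _ (leqnn _)) hb) le.
Qed.

Lemma exc_pdiv E : exceptional A X E -> prime_divisor X E. Proof. by case. Qed.
Lemma exc_X E : exceptional A X E -> X E. Proof. by case=> -[]. Qed.
Lemma exc_dom E : exceptional A X E -> dominates E A. Proof. by case. Qed.
Lemma exc_dvr E : exceptional A X E -> exists t, dvr E t.
Proof. by move=> /exc_pdiv /pdiv_dvr. Qed.

Lemma len_A_down N' N n (C : nat -> set K) (q : nat -> nat) : (forall i, smod A (C i)) ->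
  (forall i, C i.+1 `<=` C i) -> N' = C n -> N = C 0 ->
  (forall i l, (i < n)%N -> len A (C i : set K^o) (C i.+1) l -> (q i <= l)%N) ->
  forall l, len A (N : set K^o) N' l -> (\sum_(i < n) q i <= l)%N.
Proof.
move=> sC dec -> ->; elim: n => [|n IH] h l hl; first by rewrite big_ord0.
have sub m : C m `<=` C 0 by elim: m => // m IHm; exact: subset_trans (dec m) IHm.
have [a [b [ha hb ->]]] := len_split AN1 hl (sC n) (dec n) (sub n).
rewrite big_ord_recr /= leq_add //; last exact: h hb.
by apply: IH ha => i l' lt; apply: h; exact: ltnW.
Qed.

Lemma sum_sq N : (N ^ 3 <= 3 * \sum_(i < N) i.+1 ^ 2)%N.
Proof.
elim: N => // N IH; rewrite big_ord_recr /= mulnDr.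
apply: leq_trans (leq_add IH (leqnn _)).
rewrite -!mulnn !expnS expn0 !muln1; nia.
Qed.

Definition ev1 (q : {poly k}) (x : K) : K := (map_poly j q).[x].

Lemma ev1X q x : ev1 ('X * q) x = x * ev1 q x.
Proof. by rewrite /ev1 rmorphM /= map_polyX hornerM hornerX. Qed.

(** If [x] and [y] were independent over [k], then for a common denominator [e]
    of [x] and [y] the [(n + 1)^2] elements [e^(2n) x^i y^j] with [i, j <= n] would
    be independent in one graded piece of the filtration [J] of [A] by the valuation
    of [E].  Summing over [n], the lengths of [A / J s] would grow like [s^3];
    but [J s] contains [p^s] and [q^s] for parameters [p, q], so they are [O(s^2)]. *)
Lemma exc_dep E x y : exceptional A X E -> E x -> E y -> exists n (c : nat -> {poly k}),
  (exists2 i, (i < n)%N & c i != 0) /\ nonunits E (\sum_(i < n) ev1 (c i) x * y ^+ i).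
Proof.
move=> eE Ex Ey; apply: contrapT => nodep.
have [t d] := exc_dvr eE; have [AE mE] := exc_dom eE; have [lE t0 tE vE] := d.
have hE := proj1 lE; have Et := dvr_t d.
have [a1 [b1 [Aa1 Ab1 b10 xE]]] := frA x.
have [a2 [b2 [Aa2 Ab2 b20 yE]]] := frA y.
have [P [pP P0 Pm]] := A_prime1; have [w Pw w0] := prime_neq0 pP P0.
have nw : nonunits A w by apply: ideal_proper Pw => //; [case: pP|exact: prime_n1 pP].
(* The factor [w] makes [e] a nonunit even when both denominators are units, so that its value
   [v.+1] at [E] is positive. *)
pose e := w * (b1 * b2).
have e0 : e != 0 by rewrite !mulf_neq0.
have ne : nonunits A e by apply: (smMr (nu_smod lA)) => //; exact: srM.
have Aex : A (e * x).
  have -> : e * x = w * b2 * a1 by rewrite xE /e; field.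
  by apply: srM => //; apply: srM => //; exact: nu_sub.
have Aey : A (e * y).
  have -> : e * y = w * b1 * a2 by rewrite yE /e; field.
  by apply: srM => //; apply: srM => //; exact: nu_sub.
have [v [u [u0 Eu Eu' eE']]] : exists v u, [/\ u != 0, E u, E u^-1 & e = t ^+ v.+1 * u].
  have [n [u [u0 Eu Eu' eE']]] := vE e e0.
  have : nonunits E e by exact: mE.
  case: n eE' => [[|v]|v] eE' ne'.
  - by case: (nu_not ne' e0); rewrite eE' expr0z mul1r.
  - by exists v, u.
  - exfalso; apply: (nu_not ne' e0); rewrite eE' invfM NegzE -invr_expz invrK -exprnP.
    by apply: srM => //; exact: srX.
pose J s : set K := [set z | A z /\ E (z / t ^+ s)].
have ts0 s : t ^+ s != 0 by exact: expf_neq0.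
have sJ s : smod A (J s).
  split.
  - by split; [exact: sr0|rewrite mul0r; exact: sr0].
  - by move=> z z' [? ?] [? ?]; split; [exact: srD|rewrite mulrDl; exact: srD].
  - move=> z z' Az [Az' Ez]; split; first exact: srM.
    by rewrite /GRing.scale /= -mulrA; apply: srM => //; exact: AE.
have JS s : J s.+1 `<=` J s.
  move=> z [Az h]; split=> //; have -> : z / t ^+ s = t * (z / t ^+ s.+1).
    by rewrite exprS; field; rewrite ts0 t0.
  exact: srM.
have Jle s s' : (s <= s')%N -> J s' `<=` J s.
  move=> /subnK <-; elim: (s' - s)%N => // m IH; apply: subset_trans IH.
  by rewrite addSn; exact: JS.
have mJ s z z' : nonunits A z -> J s z' -> J s.+1 (z * z').
  move=> nz [Az' h]; split; first by apply: srM => //; exact: nu_sub.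
  have : nonunits E z by exact: mE.
  rewrite tE => -[z2 Ez2 <-]; have -> : t * z2 * z' / t ^+ s.+1 = z2 * (z' / t ^+ s).
    by rewrite exprS; field; rewrite ts0 t0.
  exact: srM.
have [p [q [C [np nq hC]]]] := A_params.
have Jp s z : nonunits A z -> J s (z ^+ s).
  move=> nz; elim: s => [|s IH].
    by rewrite expr0; split; [exact: sr1|rewrite expr0 divr1; exact: sr1].
  by rewrite exprS; exact: mJ.
have bound s : exists2 l, len A (A : set K^o) (J s) l & (l <= s * s * C)%N.
  have [l hl le] := len_powers np nq hC s s.
  have [||l' hl' le'] := len_quo AN1 hl (sJ s).
  - by apply: (sadd_min (sJ s)); apply: prin_sub => //; exact: Jp.
  - by move=> z [].
  by exists l' => //; exact: leq_trans le' le.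
pose V := v.+1.
(* All [f i] have value at least [2 n V]. A relation among them in the graded piece, divided by
   [e ^ (2 n)], would be an algebraic relation of [x] and [y] modulo the maximal ideal of [E]. *)
have lower (n l : nat) : len A (J (2 * n * V)%N : set K^o) (J (2 * n * V).+1%N) l -> (n.+1 ^ 2 <= l)%N.
  move=> hl.
  pose f (i : 'I_n.+1 * 'I_n.+1) := e ^+ (2 * n) * (x ^+ i.1 * y ^+ i.2).
  have eVE : e ^+ (2 * n) = t ^+ (2 * n * V) * u ^+ (2 * n).
    by rewrite eE' exprMn -exprM mulnC.
  have Jf i : J (2 * n * V)%N (f i).
    split.
      have le : (i.1 + i.2 <= 2 * n)%N by rewrite mul2n -addnn leq_add // -ltnS.
      have -> : f i = (e * x) ^+ i.1 * (e * y) ^+ i.2 * e ^+ (2 * n - (i.1 + i.2)).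
        rewrite /f -{1}(subnK le) !exprD !exprMn; ring.
      apply: (srM hA); first by apply: (srM hA); exact: (srX _ hA).
      by apply: (srX _ hA); exact: nu_sub.
    rewrite /f eVE; have -> : t ^+ (2 * n * V) * u ^+ (2 * n) * (x ^+ i.1 * y ^+ i.2) / t ^+ (2 * n * V) =
      u ^+ (2 * n) * (x ^+ i.1 * y ^+ i.2) by field.
    by apply: (srM hE); [exact: (srX _ hE Eu)|apply: (srM hE); exact: (srX _ hE)].
  have := @len_indep _ _ _ f l (sJ _) (sJ _) (JS _) (mJ _) Jf _ hl.
  rewrite card_prod card_ord -mulnn; apply.
  move=> c [_ hc] i; apply: contrapT => /eqP ci; apply: nodep.
  exists n.+1, (fun b => \poly_(a < n.+1) c (inord a, inord b)); split.
    exists i.2; first exact: ltn_ord.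
    apply/eqP => E0; have := congr1 (fun q : {poly k} => q`_i.1) E0.
    rewrite coef0 coef_poly ltn_ord !inord_val -surjective_pairing => /eqP.
    by rewrite (negPf ci).
  set Sm := \sum_(b < n.+1) _.
  suff hS : \sum_i j (c i) * f i = e ^+ (2 * n) * Sm.
    rewrite tE; apply/(prinP _ _ t0).
    have -> : Sm / t = (u ^+ (2 * n))^-1 * ((\sum_i j (c i) * f i) / t ^+ (2 * n * V).+1).
      by rewrite hS eVE exprS; field; rewrite t0 ts0 expf_neq0.
    by apply: (srM hE) => //; rewrite -exprVn; exact: (srX _ hE).
  rewrite /Sm mulr_sumr.
  rewrite (eq_bigr (fun i => j (c (i.1, i.2)) * f (i.1, i.2))); last by case.
  rewrite -(pair_bigA _ (fun a b => j (c (a, b)) * f (a, b))) /= exchange_big /=.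
  apply: eq_bigr => b _; rewrite /ev1 (@horner_coef_wide _ n.+1); last first.
    by rewrite size_map_poly size_poly.
  rewrite mulr_suml mulr_sumr; apply: eq_bigr => a _.
  rewrite coef_map coef_poly ltn_ord !inord_val /f /=; ring.
(* By [sum_sq], [N ^ 3] is at most three times the length, hence at most [3 (2 N V) ^ 2 C], which is
   [12 V ^ 2 C] times [N ^ 2]; this [N] is too large for that. *)
pose N := (12 * V * V * C).+1.
have [l hl le] := bound (2 * N * V)%N.
have : (\sum_(i < N) i.+1 ^ 2 <= l)%N.
  apply: (@len_A_down (J (2 * N * V)%N) A N (fun i => J (2 * i * V)%N) (fun i => i.+1 ^ 2)%N) hl => //.
  - move=> i; apply: Jle; by rewrite leq_mul2r leq_mul2l leqnSn orbT.
  - rewrite muln0 mul0n eqEsubset; split; last by move=> z [].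
    by move=> z Az; split=> //; rewrite expr0 divr1; exact: AE.
  - move=> i l' lt hl'.
    have [||b hb leb] := len_quo AN1 hl' (sJ (2 * i * V).+1%N).
    + by apply: Jle; rewrite mulnS mulnDl /V; lia.
    + exact: JS.
    + exact: leq_trans (lower _ _ hb) leb.
move=> h; have := sum_sq N; rewrite leqNgt => /negP; apply.
apply: (@leq_ltn_trans (3 * (2 * N * V * (2 * N * V) * C))).
  by rewrite leq_mul2l /= (leq_trans h le).
have -> : (3 * (2 * N * V * (2 * N * V) * C) = N * N * (12 * V * V * C))%N by ring.
have -> : (N ^ 3 = N * N * N)%N by rewrite !expnS expn0 muln1 mulnA.
by rewrite ltn_pmul2l // muln_gt0.
Qed.

(** * Closed points of [X]: residue fields, primes, finiteness statements *)

Variable M : set K -> int.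
Hypotheses (cM : Defs.cycle A X M) (gM : generates X (nonunits A) M).

(** The closed points: by [X_class] all points other than the generic point and the prime
    divisors. *)
Definition cpt R := X R /\ exists2 E, exceptional A X E & R `<` E.

Lemma val_ge0 E x : prime_divisor X E -> E x -> val_ge E 0 x.
Proof.
move=> /pdiv_dvr [t [lE t0 tE _]] Ex; exists t, x; split=> //.
by rewrite expr0z mul1r.
Qed.

(** If no exceptional curve passed through [R], the cycle [M] would vanish near [R] and the stalk of
    [O_X(-M)] would contain [1]; but this stalk is [m R], a proper ideal. *)
Lemma dom_exc R : X R -> dominates R A -> exists2 E, exceptional A X E & R `<=` E.
Proof.
move=> XR [AR mR]; apply: contrapT => h.
have lR := X_local XR.
have : stalk X M R 1.
  move=> E [[XE RE] kE]; have pE : prime_divisor X E by split.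
  have [->|ME] := eqVneq (M E) 0; first by apply: val_ge0 => //; exact: sr1 (X_subring XE).
  by exfalso; apply: h; exists E => //; exact: cM.
rewrite -(gM XR) => /(ideal_span_min (nu_smod lR) mR).
exact: nu1 (proj1 lR).
Qed.

Lemma X_class R : X R -> [\/ R = setT, prime_divisor X R | cpt R].
Proof.
move=> XR; case: (X_cases XR) => h; [by apply: Or31|by apply: Or32|].
have [E eE RE] := dom_exc XR h.
case: (pselect (E `<=` R)) => ER; last by apply: Or33; split=> //; exists E.
have -> : R = E by rewrite eqEsubset.
by apply: Or32; exact: exc_pdiv.
Qed.

Lemma cpt_X R : cpt R -> X R. Proof. by case. Qed.

Lemma cpt_dom R : cpt R -> dominates R A.
Proof.
move=> [XR [E eE [RE _]]]; split; first exact: X_A.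
move=> a na; have Aa := nu_sub na; split; first exact: X_A XR _ Aa.
move=> /unitP [a0 Ra]; have [_ mE] := exc_dom eE.
by apply: (nu_not (mE _ na) a0); exact: RE.
Qed.

Lemma X_notsub F R : X F -> X R -> R `<` F -> exists2 y, nonunits R y & ~ nonunits F y.
Proof.
move=> XF XR [RF FR]; apply: contrapT => h; apply: FR.
have lR := X_local XR.
have E : nonunits F `&` R = nonunits R.
  rewrite eqEsubset; split=> y.
    move=> [n Ry]; split=> // /unitP [y0 Ry'].
    by apply: (nu_not n y0); exact: RF.
  move=> n; split; last exact: nu_sub.
  by apply: contrapT => n'; apply: h; exists y.
by rewrite {1}(X_gen XF XR RF) E loc_nu.
Qed.

(** Powers of the unit [y] are divided out until the constant coefficient is nonzero. *)
Lemma exc_dep0 E x y : exceptional A X E -> E x -> E y -> ~ nonunits E y ->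
  exists n (c : nat -> {poly k}), c 0 != 0 /\ nonunits E (\sum_(i < n.+1) ev1 (c i) x * y ^+ i).
Proof.
move=> eE Ex Ey ny; have lE := X_local (exc_X eE); have pE := nu_prime lE.
have [n [c [[i lt ci] hc]]] := exc_dep eE Ex Ey.
elim: i n c lt ci hc => [|i IH] n c lt ci hc.
  by case: n lt hc => // n _ hc; exists n, c.
have [c0|c0] := eqVneq (c 0) 0; last by case: n lt hc => // n _ hc; exists n, c.
case: n lt hc => // n lt; rewrite big_ord_recl c0 /ev1 rmorph0 horner0 mul0r add0r.
move=> hc; apply: (IH n (fun l => c l.+1)) => //.
have -> : \sum_(i0 < n) ev1 (c i0.+1) x * y ^+ i0 = y^-1 * (\sum_(i0 < n) (map_poly j (c (bump 0 i0))).[x] * y ^+ bump 0 i0).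
  rewrite mulr_sumr; apply: eq_bigr => l _; rewrite /bump add1n exprS /ev1; field.
  by have [] := nu_inv Ey ny.
by apply: (smM (nu_smod lE)) => //; have [] := nu_inv Ey ny.
Qed.

Lemma root_prime S Q x q : @prime_ideal K S Q -> A `<=` S -> S x -> subring S -> q != 0 ->
  Q (ev1 q x) -> exists c, Q (x - j c).
Proof.
move=> pQ AS Sx hS q0; have [r ->] := closed_field_poly_normal q.
rewrite /ev1 map_polyZ hornerZ rmorph_prod horner_prod.
have [_ Q1 pr] := pQ; move=> /pr [].
- by apply: AS; exact: jA.
- apply: sr_prod => // i _; rewrite /= map_polyXsubC hornerXsubC; apply: srB => //; apply: AS; exact: jA.
- move=> h; exfalso; apply: Q1; have -> : 1 = (j (lead_coef q)^-1) * j (lead_coef q).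
    by rewrite -rmorphM mulVf ?rmorph1 // lead_coef_eq0.
  by apply: (smM (prime_smod pQ)) => //; apply: AS; exact: jA.
elim: r => [|c r IH]; first by rewrite big_nil.
rewrite big_cons => /pr []; rewrite /= ?map_polyXsubC ?hornerXsubC.
- by apply: srB => //; apply: AS; exact: jA.
- apply: sr_prod => // i _; rewrite /= map_polyXsubC hornerXsubC; apply: srB => //; apply: AS; exact: jA.
- by exists c.
- exact: IH.
Qed.

Lemma cpt_dep R E x y : X R -> exceptional A X E -> R `<=` E -> R x -> R y -> ~ nonunits E y ->
  exists2 q, q != 0 & exists2 w, R w & nonunits E (ev1 q x + y * w) /\ R (ev1 q x).
Proof.
move=> XR eE RE Rx Ry ny; have hR := X_subring XR; have AR := X_A XR.
have Rev q : R (ev1 q x).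
  apply: (pin_sr hR) => // i; rewrite coef_map; apply: AR; exact: jA.
have [n [c [c0 hc]]] := exc_dep0 eE (RE _ Rx) (RE _ Ry) ny.
exists (c 0) => //; exists (\sum_(i < n) ev1 (c i.+1) x * y ^+ i).
  by apply: sr_sum => // i _; apply: (srM hR) => //; exact: (srX _ hR).
split=> //; move: hc; rewrite big_ord_recl expr0 mulr1 mulr_sumr.
move=> h; have -> : \sum_(i < n) y * (ev1 (c i.+1) x * y ^+ i) = \sum_(i < n) ev1 (c (lift ord0 i)) x * y ^+ lift ord0 i.
  by apply: eq_bigr => i _; rewrite lift0 exprS mulrCA.
exact: h.
Qed.

(** For [y] in the maximal ideal of [R] but a unit at [E], the relation of [cpt_dep] puts some
    [q(x)] with [q] nonzero over [k] in that ideal; as [k] is algebraically closed, a linear factor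
    lies there. *)
Lemma cpt_res R : cpt R -> forall x, R x -> exists c, nonunits R (x - j c).
Proof.
move=> cR x Rx; have [XR [E eE lt]] := cR; have RE := properW lt.
have lR := X_local XR; have hR := proj1 lR.
have [y ny nEy] := X_notsub (exc_X eE) XR lt.
have [q q0 [w Rw [h Rev]]] := cpt_dep XR eE RE Rx (nu_sub ny) nEy.
have sn := nu_smod lR.
apply: (root_prime (nu_prime lR) (X_A XR) Rx hR q0).
have -> : ev1 q x = (ev1 q x + y * w) - y * w by rewrite addrK.
apply: (smB hR sn); last exact: smMr sn _ _.
split; first by apply: (srD hR) => //; apply: (srM hR) => //; exact: nu_sub.
by move=> /unitP [z0 Rz]; apply: (nu_not h z0); exact: RE.
Qed.

(** The relation is now read modulo [Q]: some [x - c] lies in [Q], and [c = 0] when [x] is a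
    nonunit. *)
Lemma cpt_1dim R E Q y : X R -> exceptional A X E -> R `<` E -> prime_ideal R Q ->
  nonunits E `&` R `<=` Q -> Q y -> ~ nonunits E y -> Q = nonunits R.
Proof.
move=> XR eE lt pQ EQ Qy ny; have RE := properW lt; have lR := X_local XR; have hR := proj1 lR.
have sQ := prime_smod pQ; have Qn : Q `<=` nonunits R.
  by apply: ideal_proper => //; [case: pQ|exact: prime_n1 pQ].
rewrite eqEsubset; split=> // x nx; have Rx := nu_sub nx; have Ry := prime_sub pQ Qy.
have [q q0 [w Rw [h Rev]]] := cpt_dep XR eE RE Rx Ry ny.
have [c hc] : exists c, Q (x - j c).
  apply: (root_prime pQ (X_A XR) Rx hR q0).
  have -> : ev1 q x = (ev1 q x + y * w) - y * w by rewrite addrK.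
  apply: (smB hR sQ); last exact: smMr sQ _ _.
  by apply: EQ; split=> //; apply: (srD hR) => //; exact: srM.
have c0 : c = 0.
  apply: (j_unit lR (X_A XR)); have -> : j c = x - (x - j c) by ring.
  by apply: (smB hR (nu_smod lR)) => //; exact: Qn.
by move: hc; rewrite c0 rmorph0 subr0.
Qed.

Lemma X_locT R Q : X R -> prime_ideal R Q -> localization R Q = setT -> Q = [set 0].
Proof.
move=> XR pQ E; rewrite -(loc_contr (X_subring XR) pQ) E eqEsubset; split=> [x [n _]|_ ->].
  have [//|x0] := eqVneq x 0; by case: (nu_not n x0).
split; last exact: sr0 (X_subring XR).
by apply/nuP; split=> //; left.
Qed.

Lemma cpt_primes R Q : cpt R -> prime_ideal R Q ->
  [\/ Q = [set 0], Q = nonunits R | prime_divisor X (localization R Q)].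
Proof.
move=> cR pQ; have XR := cpt_X cR; have hR := X_subring XR.
have XL := X_loc XR pQ; have RL := loc_sub hR pQ.
case: (X_class XL) => [E|pd|[_ [E eE lt]]].
- by apply: Or31; exact: X_locT E.
- exact: Or33.
apply: Or32; have [y ny nEy] := X_notsub (exc_X eE) XL lt.
move/(loc_nuP pQ): (ny) => [a [b [Qa Rb Qb yE]]].
have lt' : R `<` E.
  split; first exact: subset_trans (properW lt).
  by move=> ER; case: lt => _; apply; exact: subset_trans RL.
apply: (cpt_1dim XR eE lt' pQ _ Qa).
  move=> z [n Rz]; rewrite -(loc_contr hR pQ); split=> //; split; first exact: RL.
  by move=> /unitP [z0 Lz]; apply: (nu_not n z0); exact: (properW lt).
move=> na; apply: nEy; rewrite yE.
apply: (smMr (nu_smod (X_local (exc_X eE)))) => //; apply: (properW lt); exact: loc_inv.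
Qed.

Lemma pt_cpt F R : prime_divisor X F -> X R -> R `<` F -> cpt R.
Proof.
move=> pF XR [RF FR]; case: (X_class XR) => // [E|pR].
  by exfalso; apply: FR; rewrite E.
by exfalso; apply: FR; rewrite (pdiv_eq pR pF RF).
Qed.

Lemma pt_1dim F R Q y : prime_divisor X F -> X R -> R `<` F -> prime_ideal R Q ->
  nonunits F `&` R `<=` Q -> Q y -> ~ nonunits F y -> Q = nonunits R.
Proof.
move=> pF XR lt pQ FQ Qy ny; have cR := pt_cpt pF XR lt; have lF := X_local (proj1 pF).
have hR := X_subring XR.
case: (cpt_primes cR pQ) => [E|//|pd].
  by exfalso; apply: ny; move: Qy; rewrite E => ->; exact: sm0 (nu_smod lF).
exfalso; apply: ny.
have LF : localization R Q `<=` F.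
  move=> _ [a [b [Ra Rb Qb ->]]]; apply: (srM (proj1 lF)); first exact: (properW lt).
  have [|_ //] := nu_inv (properW lt Rb).
  by move=> n; apply: Qb; exact: FQ.
by move: Qy; rewrite -(loc_contr hR pQ) (pdiv_eq pd pF LF) => -[].
Qed.

(** On each chart the points in question are minimal over one ideal [J], hence among the primes that
    [noeth_primes] attaches to [J]. *)
Lemma finite_pts (Phi : set (set K)) :
  (forall r (B : 'I_r -> set K) i, affine_cover A X B -> exists J, ideal (B i) J /\
    forall P, prime_ideal (B i) P -> Phi (localization (B i) P) -> J `<=` P /\
      forall p, prime_ideal (B i) p -> J `<=` p -> p `<=` P ->
        localization (B i) p = localization (B i) P) ->
  exists s : seq (set K), forall R, X R -> Phi R -> R \in s.
Proof.
move=> H; have [r [B cB]] := X_cover.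
have : forall i : 'I_r, exists s : seq (set K), forall P, prime_ideal (B i) P ->
    Phi (localization (B i) P) -> localization (B i) P \in s.
  move=> i; have [J [iJ hJ]] := H r B i cB; have [hB AB nB sX] := cover_B i cB.
  have [n [p [pp prd]]] := noeth_primes hB nB iJ.
  exists [seq localization (B i) (p l) | l <- iota 0 n] => P pP PhiP.
  have [JP hp] := hJ P pP PhiP.
  have [l lt s] : exists2 l, (l < n)%N & p l `<=` P.
    by apply: (prime_over hB pP JP _ prd) => l /pp [].
  have [pl sl] := pp l lt; rewrite -(hp _ pl sl s).
  by apply/mapP; exists l => //; rewrite mem_iota.
move=> /choice [s hs]; exists (flatten [seq s i | i <- enum 'I_r]) => R XR PhiR.
have [i [P [pP RE]]] := cover_X cB XR.
apply/flattenP; exists (s i); first by apply: map_f; rewrite mem_enum.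
by rewrite RE; apply: hs => //; rewrite -RE.
Qed.

Lemma loc_antimono B p P : p `<=` P -> @localization K B P `<=` localization B p.
Proof. by move=> s _ [a [b [Ba Bb Pb ->]]]; exists a, b; split=> // /s. Qed.

Lemma fin_pdiv f : f != 0 -> exists s : seq (set K),
  forall F, prime_divisor X F -> nonunits F f -> F \in s.
Proof.
move=> f0; have [a [b [Aa Ab b0 fE]]] := frA f.
have a0 : a != 0 by apply: contraNneq f0 => a0; rewrite fE a0 mul0r.
have [|s hs] := @finite_pts [set F | prime_divisor X F /\ nonunits F a]; last first.
  exists s => F pF nf; apply: hs; first by case: pF.
  split=> //; have -> : a = b * f by rewrite fE; field.
  by apply: (smM (nu_smod (X_local (proj1 pF)))) => //; exact: X_A (proj1 pF) _ Ab.
move=> r B i cB; have [hB AB nB sX] := cover_B i cB.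
exists (prin a (B i)); split; first by apply: prin_ideal => //; exact: AB.
move=> P pP [pF na]; split.
  apply: prin_sub; first exact: prime_smod pP.
  by rewrite -(loc_contr hB pP); split=> //; exact: AB.
move=> p pp Jp pP'; have [t d] := pdiv_dvr pF.
have [//|E] := dvr_max d (loc_subring hB pp) (loc_antimono pP').
exfalso; have : (nonunits (localization (B i) p) `&` B i) a.
  by rewrite loc_contr //; apply: Jp; exact: prin_self.
by move=> [n _]; apply: (nu_not n a0); rewrite E.
Qed.

Lemma fin_exc : exists s : seq (set K), uniq s /\ forall E, E \in s <-> exceptional A X E.
Proof.
have [P [pP P0 Pm]] := A_prime1; have [w Pw w0] := prime_neq0 pP P0.
have nw : nonunits A w by apply: ideal_proper Pw => //; [case: pP|exact: prime_n1 pP].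
have [s hs] := fin_pdiv w0.
exists (undup [seq E <- s | `[< exceptional A X E >]]); split; first exact: undup_uniq.
move=> E; rewrite mem_undup mem_filter; split; first by case/andP => /asboolP.
move=> eE; apply/andP; split; first exact/asboolP.
apply: hs; first exact: exc_pdiv.
by have [_ mE] := exc_dom eE; exact: mE.
Qed.

Lemma X_gen_nu R F : X R -> X F -> R `<=` F -> nonunits F `&` R `<=` nonunits R.
Proof.
move=> XR XF RF x [n Rx]; split=> // /unitP [x0 Rx'].
by apply: (nu_not n x0); exact: RF.
Qed.

(** On a chart meeting the curve, [u = a / b], and a point where [u] is not a unit contains [a * b].
    Over the ideal of the curve together with [a * b] such points are minimal, the curve having
    dimension one. *)
Lemma fin_pts F u : prime_divisor X F -> u != 0 -> F u -> F u^-1 ->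
  exists s : seq (set K), forall R, X R -> R `<` F -> ~ (R u /\ R u^-1) -> R \in s.
Proof.
move=> pF u0 Fu Fu'.
have [|s hs] := @finite_pts [set R | R `<` F /\ ~ (R u /\ R u^-1)]; last first.
  by exists s => R XR lt h; apply: hs.
move=> r B i cB; have [hB AB nB sX] := cover_B i cB.
case: (pselect (B i `<=` F)) => BF; last first.
  exists (B i); split; first by split=> //; exact: sr_smod.
  move=> P pP [[s _] _]; exfalso; apply: BF; apply: subset_trans s; exact: loc_sub.
have XF := proj1 pF; have lF := X_local XF; have hF := proj1 lF.
set q := nonunits F `&` B i.
have pq : prime_ideal (B i) q by exact: nu_contr.
have FE : localization (B i) q = F.
  apply/esym/X_dom => //; first by apply: sX; exists q.
  have s : localization (B i) q `<=` F.
    move=> _ [a [b [Ba Bb qb ->]]]; apply: srM => //; first exact: BF.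
    have [|_ //] := nu_inv (BF _ Bb).
    by move=> n; apply: qb.
  split=> // x n; split; first by apply: s; exact: nu_sub.
  move/(loc_nuP pq): n => [a [b [[na _] Bb qb ->]]] /unitP [ab0 Fab].
  apply: (nu_not na); first by apply: contraNneq ab0 => ->; rewrite mul0r.
  have b0 := prime_n0 pq qb.
  have -> : a^-1 = b^-1 * (a / b)^-1.
    by rewrite invf_div mulKf.
  apply: srM => //; have [|_ //] := nu_inv (BF _ Bb).
  by move=> n; apply: qb.
have [a [b [Ba Bb qb uE]]] : localization (B i) q u by rewrite FE.
have b0 := prime_n0 pq qb.
have a0 : a != 0 by apply: contraNneq u0 => a0; rewrite uE a0 mul0r.
have qa : ~ q a.
  move=> [na _]; apply: (nu_not na a0).
  have -> : a^-1 = u^-1 * b^-1 by rewrite uE; field; rewrite a0 b0.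
  apply: srM => //; have [|_ //] := nu_inv (BF _ Bb).
  by move=> n; apply: qb.
have Bab : B i (a * b) by exact: srM.
have nab : ~ nonunits F (a * b).
  by move=> n; apply: (prime_nmul pq Ba Bb qa qb).
exists (sadd q (prin (a * b) (B i))); split.
  by apply: sadd_ideal => //; [case: pq|exact: prin_ideal].
move=> P pP [lt nu]; have XP : X (localization (B i) P) by apply: sX; exists P.
have BP := loc_sub hB pP.
have qP : q `<=` P.
  move=> x [n Bx]; rewrite -(loc_contr hB pP); split=> //.
  by apply: (X_gen_nu XP XF (properW lt)); split=> //; exact: BP.
have sP := prime_smod pP.
split.
  apply: (sadd_min sP) => //; apply: (prin_sub sP); apply: contrapT => Pab; apply: nu.
  have Pa : ~ P a by move=> h; apply: Pab; exact: smMr sP _ _.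
  have Pb : ~ P b by move=> h; apply: Pab; exact: smM sP _ _.
  split; first by exists a, b.
  by exists b, a; split=> //; rewrite uE invf_div.
move=> p pp Jp pP'; have Xp : X (localization (B i) p) by apply: sX; exists p.
have sub := loc_antimono (B := B i) pP'.
have qp : q `<=` p by apply: subset_trans Jp; apply: sadd_subl; exact: sm0 (prin_smod _ hB).
have pab : p (a * b).
  by apply: Jp; apply: sadd_subr; [exact: sm0 (prime_smod pq)|exact: prin_self].
have hL := X_subring XP.
set Q := nonunits (localization (B i) p) `&` localization (B i) P.
have pQ : prime_ideal (localization (B i) P) Q by apply: nu_contr => //; exact: X_local.
have nLab : nonunits (localization (B i) p) (a * b).
  by have [] : (nonunits (localization (B i) p) `&` B i) (a * b) by rewrite loc_contr.
have pLF : localization (B i) p `<=` F by rewrite -FE; exact: loc_antimono.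
have QE : Q = nonunits (localization (B i) P).
  apply: (pt_1dim (y := a * b) pF XP lt pQ) => //.
    move=> x [n Lx]; split=> //.
    by apply: (X_gen_nu Xp XF pLF); split=> //; exact: sub.
  by split=> //; exact: BP.
by rewrite (X_gen Xp XP sub) -/Q QE loc_nu //; exact: X_local.
Qed.

(** ** Local rings of a curve on [X], seen modulo the ideal of the curve *)

Section Curve.
Variable F : set K.
Hypothesis pF : prime_divisor X F.
Let P := nonunits F.
Let XF : X F. Proof. by case: pF. Qed.
Let lF : local_ring F. Proof. exact: X_local. Qed.
Let hF : subring F. Proof. by case: lF. Qed.
Let sP : smod F P. Proof. exact: nu_smod. Qed.
Let pP : prime_ideal F P. Proof. exact: nu_prime. Qed.

(** [Q] lies between [P] and [F]: it is the preimage of a local ring of the curve in its function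
    field [F / P]. The record collects what is used of one-dimensional local rings, so that the
    points of [X] and the ring [A] are treated alike. *)
Record cring (Q : set K) : Prop := CRing {
  cr_sub : subring Q;
  cr_A : A `<=` Q;
  cr_m : nonunits A `<=` nonunits Q;
  cr_P : P `<=` Q;
  cr_F : Q `<=` F;
  cr_loc : local_ring Q;
  cr_res : forall x, Q x -> exists c, nonunits Q (x - j c);
  cr_pow : forall a, Q a -> ~ P a -> exists N, powin (nonunits Q) (prin a Q) N;
  cr_len : forall a, Q a -> ~ P a -> exists l, len A (Q : set K^o) (prin a Q) l;
  cr_frac : forall z, F z -> exists b, [/\ Q b, ~ P b & Q (b * z)]
}.

(** [hat R / P] is the local ring at [R] of the curve with generic point [F]. *)
Definition hat (R : set K) : set K := sadd R P.

Lemma nP_inv a : F a -> ~ P a -> a != 0 /\ F a^-1. Proof. exact: nu_inv. Qed.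

(** [P] is a module over [F], where [a] is invertible, so it is divisible by [a]; therefore lengths
    modulo [a Q] are lengths on the curve. *)
Lemma P_prin Q a : Q `<=` F -> P `<=` Q -> Q a -> ~ P a -> P `<=` prin a Q.
Proof.
move=> QF PQ Qa Pa x Px; have [a0 Fa] := nP_inv (QF _ Qa) Pa.
by apply/(prinP _ _ a0); apply: PQ; exact: smMr sP _ _.
Qed.

(** The local rings whose image modulo [P] is a one-dimensional local ring with
    function field [F / P] and residue field [k]. *)
Record oncurve (R : set K) : Prop := OnCurve {
  oc_loc : local_ring R;
  oc_noeth : noetherian R;
  oc_A : A `<=` R;
  oc_m : nonunits A `<=` nonunits R;
  oc_F : R `<=` F;
  oc_nu : P `&` R `<=` nonunits R;
  oc_res : forall x, R x -> exists c, nonunits R (x - j c);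
  oc_dim : forall Q y, prime_ideal R Q -> P `&` R `<=` Q -> Q y -> ~ P y -> Q = nonunits R;
  oc_frac : F = localization R (P `&` R)
}.

Lemma pt_oncurve R : X R -> R `<` F -> oncurve R.
Proof.
move=> XR lt; have cR := pt_cpt pF XR lt; have RF := properW lt; split=> //.
- exact: X_local.
- exact: X_noeth.
- exact: X_A.
- by have [_] := cpt_dom cR.
- exact: X_gen_nu.
- exact: cpt_res.
- by move=> Q y pQ h1 Qy; apply: (pt_1dim pF XR lt pQ h1 Qy).
- exact: X_gen.
Qed.

Section Hat.
Variable R : set K.
Hypothesis oR : oncurve R.
Let lR : local_ring R. Proof. exact: oc_loc. Qed.
Let hR : subring R. Proof. by case: lR. Qed.
Let RF : R `<=` F. Proof. exact: oc_F. Qed.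

Lemma hat_sub : R `<=` hat R. Proof. by apply: sadd_subl; exact: sm0 sP. Qed.
Lemma hat_P : P `<=` hat R. Proof. by apply: sadd_subr; exact: sr0. Qed.
Lemma hat_F : hat R `<=` F.
Proof. by apply: (sadd_min (sr_smod hF)) => //; exact: nu_sub. Qed.

Lemma hat_subring : subring (hat R).
Proof.
split.
- by apply: hat_sub; exact: sr1.
- move=> _ _ [a [p [Ra Pp ->]]] [b [q [Rb Pq ->]]]; exists (a - b), (p - q).
  by split; [exact: srB|exact: smB hF sP _ _|ring].
- move=> _ _ [a [p [Ra Pp ->]]] [b [q [Rb Pq ->]]].
  exists (a * b), (a * q + (b + q) * p); split; [exact: srM| |ring].
  apply: (smD sP); apply: (smM sP) => //; first exact: RF.
  by apply: srD => //; [exact: RF|exact: nu_sub].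
Qed.

Lemma nuR_P : P `&` R `<=` nonunits R. Proof. exact: oc_nu. Qed.

Lemma hat_nu : nonunits (hat R) = sadd (nonunits R) P.
Proof.
rewrite eqEsubset; split.
  move=> x [[r [p [Rr Pp xE]]] h]; exists r, p; split=> //; apply: contrapT => nr.
  have [r0 Rr'] := nu_inv Rr nr.
  have Pr : ~ P r by move=> Pr; apply: nr; exact: nuR_P.
  have Px : ~ P x.
    move=> Px; apply: Pr; have -> : r = x - p by rewrite xE addrK.
    exact: smB hF sP _ _.
  have Fx : F x by rewrite xE; apply: srD => //; [exact: RF|exact: nu_sub].
  have [x0 Fx'] := nP_inv Fx Px.
  apply: h; apply/unitP; split=> //.
  exists r^-1, (- (r^-1 * x^-1 * p)); split=> //.
    apply: smN hF sP _; apply: (smM sP) => //; apply: srM => //; exact: RF.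
  by rewrite xE; field; rewrite r0 -xE x0.
move=> _ [n [p [nn Pp ->]]].
split; first by exists n, p; split=> //; exact: nu_sub.
move=> [_ [r [q [Rr Pq ->]]] E].
have h : (P `&` R) (1 - n * r).
  have -> : 1 - n * r = n * q + (r + q) * p by rewrite -E; ring.
  split.
    apply: (smD sP); apply: (smM sP) => //; first by apply: RF; exact: nu_sub.
    by apply: srD => //; [exact: RF|exact: nu_sub].
  have -> : n * q + (r + q) * p = 1 - n * r by rewrite -E; ring.
  by apply: srB => //; [exact: sr1|apply: srM => //; exact: nu_sub].
apply: (nu1 hR); rewrite -(subrK (n * r) 1); apply: (smD (nu_smod lR)).
  exact: nuR_P.
exact: smMr (nu_smod lR) _ _.
Qed.

Lemma hat_local : local_ring (hat R).
Proof.
split; first exact: hat_subring.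
split; first exact: nu_sub.
rewrite hat_nu; have sn := nu_smod lR; split.
- by exists 0, 0; rewrite addr0; split=> //; [exact: sm0 sn|exact: sm0 sP].
- move=> _ _ [a [p [Ra Pp ->]]] [b [q [Rb Pq ->]]]; exists (a + b), (p + q).
  by split; [exact: smD sn _ _|exact: smD sP _ _|ring].
- move=> _ _ [a [p [Ra Pp ->]]] [b [q [Rb Pq ->]]].
  exists (a * b), (a * q + (b + q) * p); split; [exact: smM sn _ _| |by rewrite /GRing.scale /=; ring].
  apply: (smD sP); apply: (smM sP) => //; first exact: RF.
  by apply: srD => //; [apply: RF; exact: nu_sub|exact: nu_sub].
Qed.

Lemma hat_res x : hat R x -> exists c, nonunits (hat R) (x - j c).
Proof.
move=> [r [p [Rr Pp ->]]]; have [c hc] := oc_res oR Rr.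
exists c; rewrite hat_nu; exists (r - j c), p; split=> //; ring.
Qed.

(** The part of [a] in [P] is divisible by the part in [R], so the latter generates the same
    ideal. *)
Lemma hat_prin a : hat R a -> ~ P a -> exists r, [/\ R r, ~ P r & prin a (hat R) = prin r (hat R)].
Proof.
move=> [r [p [Rr Pp aE]]] Pa; exists r.
have Pr : ~ P r by move=> Pr; apply: Pa; rewrite aE; exact: smD sP _ _.
have key x y q : R x -> ~ P x -> P q -> y = x + q -> prin y (hat R) `<=` prin x (hat R).
  move=> Rx Px Pq yE; have [x0 Fx] := nP_inv (RF Rx) Px.
  apply: prin_sub; first exact: prin_smod hat_subring.
  apply/(prinP _ _ x0); rewrite yE; exists 1, (q / x); split; [exact: sr1|exact: smMr sP _ _|].
  by field.
split=> //; rewrite eqEsubset; split; first exact: key aE.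
have [a0 Fa] : a != 0 /\ F a^-1.
  by apply: nP_inv => //; rewrite aE; apply: srD => //; [exact: RF|exact: nu_sub].
apply: prin_sub; first exact: prin_smod hat_subring.
apply/(prinP _ _ a0); exists 1, (- (p / a)); split; [exact: sr1| |].
  by apply: smN hF sP _; exact: smMr sP _ _.
by rewrite aE; field; rewrite -aE.
Qed.

Lemma pt_powin r : R r -> ~ P r ->
  exists N, powin (nonunits R) (sadd (P `&` R) (prin r R)) N.
Proof.
move=> Rr Pr; have pPR : prime_ideal R (P `&` R) by exact: nu_contr.
have iJ : ideal R (sadd (P `&` R) (prin r R)).
  by apply: sadd_ideal => //; [case: pPR|exact: prin_ideal].
apply: prim_powin => //; first exact: oc_noeth.
move=> Q pQ JQ; apply: (oc_dim (y := r) oR pQ) => //.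
  by apply: subset_trans JQ; apply: sadd_subl; exact: sm0 (prin_smod _ hR).
by apply: JQ; apply: sadd_subr; [exact: sm0 (prime_smod pPR)|exact: prin_self].
Qed.

Lemma oncurve_residual : residual A R.
Proof. by apply: residual_A => //; [exact: oc_A|exact: oc_m|exact: oc_res]. Qed.

(** Second isomorphism theorem: [R / (P ∩ R + rR) = (R + P) / r(R + P)]. *)
Lemma len_hat r l : R r -> ~ P r ->
  len A (R : set K^o) (sadd (P `&` R) (prin r R)) l <-> len A (hat R : set K^o) (prin r (hat R)) l.
Proof.
move=> Rr Pr; have [r0 Fr] := nP_inv (RF Rr) Pr; have AR := oc_A oR.
have sp := prin_smod r hat_subring.
have -> : sadd (P `&` R) (prin r R) = R `&` prin r (hat R).
  rewrite eqEsubset; split.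
    apply: (@sadd_min _ R).
    - apply: sm_cap; first exact: sr_smod.
      by apply: smod_mono sp; exact: hat_sub.
    - move=> p [Pp Rp]; split=> //; apply: (P_prin hat_F hat_P _ Pr Pp); exact: hat_sub.
    - move=> _ [x Rx <-]; split; first exact: srM.
      by exists x => //; exact: hat_sub.
  move=> y [Ry [z [x [p [Rx' Pp zE]]] yE]]; subst z y; exists (r * p), (r * x); split; last by ring.
    split; first by apply: (smM sP) => //; exact: RF.
    have -> : r * p = r * (x + p) - r * x by ring.
    by apply: srB => //; exact: srM.
  by exists x.
rewrite len_iso2 //; last 2 first.
- by apply: smod_mono AR _; exact: sr_smod.
- by apply: smod_mono sp; exact: subset_trans hat_sub.
suff -> : sadd R (prin r (hat R)) = hat R by [].
rewrite eqEsubset; split.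
  apply: (sadd_min (sr_smod hat_subring)); first exact: hat_sub.
  apply: (prin_sub (sr_smod hat_subring)); exact: hat_sub.
move=> _ [x [p [Rx Pp ->]]]; exists x, p; split=> //.
by apply: (P_prin hat_F hat_P _ Pr Pp); exact: hat_sub.
Qed.

Lemma pt_len r : R r -> ~ P r -> exists l, len A (R : set K^o) (sadd (P `&` R) (prin r R)) l.
Proof.
move=> Rr Pr; have [N hN] := pt_powin Rr Pr.
have pPR : prime_ideal R (P `&` R) by exact: nu_contr.
apply: finlen hN; [exact: oncurve_residual|exact: oc_noeth|].
by apply: sadd_ideal => //; [case: pPR|exact: prin_ideal].
Qed.

Lemma hat_cring : cring (hat R).
Proof.
have AR := oc_A oR; split.
- exact: hat_subring.
- exact: subset_trans hat_sub.
- have mR := oc_m oR; rewrite hat_nu.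
  by apply: subset_trans mR _; apply: sadd_subl; exact: sm0 sP.
- exact: hat_P.
- exact: hat_F.
- exact: hat_local.
- exact: hat_res.
- move=> a ha Pa; have [r [Rr Pr ->]] := hat_prin ha Pa.
  have [N hN] := pt_powin Rr Pr; exists N => x.
  rewrite hat_nu => hx.
  have [n hn] : exists n : nat -> K, forall i, (i < N)%N -> nonunits R (n i) /\ P (x i - n i).
    have : forall i, exists n, (i < N)%N -> nonunits R n /\ P (x i - n).
      move=> i; case: (ltnP i N) => lti; last by exists 0.
      by have [n [p [nn Pp ->]]] := hx i lti; exists n => _; rewrite addrAC subrr add0r.
    by move=> /choice [n hn]; exists n.
  have Fn i : (i < N)%N -> F (n i).
    by move=> lti; have [nn _] := hn i lti; apply: RF; exact: nu_sub.
  have h : P (\prod_(i < N) x i - \prod_(i < N) n i).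
    elim: (N) hn Fn => [|N' IH] hn Fn; first by rewrite !big_ord0 subrr; exact: sm0 sP.
    rewrite !big_ord_recr /=.
    set a1 := \prod_(i < N') x i; set b1 := \prod_(i < N') n i.
    have Fb : F b1 by apply: sr_prod => // i _; apply: Fn; rewrite ltnS ltnW.
    have h1 : P (a1 - b1).
      by apply: IH => i lti; [apply: hn|apply: Fn]; exact: ltnW.
    have [_ h2] := hn N' (ltnSn _); have Fn' := Fn N' (ltnSn _).
    have -> : a1 * x N' - b1 * n N' = (x N' - n N') * (a1 - b1) + n N' * (a1 - b1) + b1 * (x N' - n N') by ring.
    apply: (smD sP); first apply: (smD sP); apply: (smM sP) => //.
    exact: nu_sub.
  rewrite -(subrK (\prod_(i < N) n i) (\prod_(i < N) x i)).
  have spr := prin_smod r hat_subring.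
  have Pp : P `<=` prin r (hat R) by apply: (P_prin hat_F hat_P _ Pr); exact: hat_sub.
  apply: (smD spr); first exact: Pp.
  have : sadd (P `&` R) (prin r R) (\prod_(i < N) n i) by apply: hN => i /hn [].
  apply: (sadd_min spr); first by move=> y [Py _]; exact: Pp.
  by move=> _ [y Ry <-]; exists y => //; exact: hat_sub.
- move=> a ha Pa; have [r [Rr Pr ->]] := hat_prin ha Pa.
  by have [l hl] := pt_len Rr Pr; exists l; apply/len_hat.
- move=> z; rewrite (oc_frac oR) => -[a [b [Ra Rb nb ->]]].
  exists b; split; [exact: hat_sub|by move=> Pb; apply: nb|].
  rewrite mulrC divfK; first exact: hat_sub.
  by apply/eqP => b0; apply: nb; rewrite b0; split; [exact: sm0 sP|exact: sr0].
Qed.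

End Hat.

(** * Integral elements and finite modules over the local rings of a curve *)

Definition intg (D : set K) z := exists s (p : {poly K}), [/\ pin D p, (size p <= s)%N & z ^+ s = p.[z]].
(** [T] is merely contained in a finite [D]-module, which is what a common denominator ([fin_bd])
    requires. *)
Definition fin (D T : set K) := exists zs : seq K, (forall z, z \in zs -> F z) /\ T `<=` lin D zs.

Lemma intg_mono D D' z : D `<=` D' -> intg D z -> intg D' z.
Proof. by move=> s [n [p [Dp sp E]]]; exists n, p; split=> //; exact: pin_sub Dp. Qed.

Lemma intg_red T z s (p : {poly K}) : subring T -> pin T p -> (size p <= s)%N -> z ^+ s = p.[z] ->
  forall q, pin T q -> exists r : {poly K}, [/\ pin T r, (size r <= s)%N & q.[z] = r.[z]].
Proof.
move=> hT Tp sp E; have s0 : (0 < s)%N.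
  case: s sp E => // sp; rewrite expr0; move: sp; rewrite leqn0 size_poly_eq0 => /eqP ->.
  by rewrite horner0 => /eqP; rewrite oner_eq0.
elim/poly_ind => [|q c IH] Tq.
  exists 0; rewrite size_poly0 horner0; split=> // i; rewrite coef0; exact: sr0.
have Tq' : pin T q.
  by move=> i; have := Tq i.+1; rewrite coefD coefMX coefC /= addr0.
have Tc : T c by have := Tq 0; rewrite coefD coefMX coefC /= add0r.
have [r [Tr sr rE]] := IH Tq'.
exists (r * 'X + c%:P - r`_s.-1 *: ('X^s - p)); split.
- apply: pinB => //; first by apply: pinD => //; [apply: pinM => //; exact: pinX|exact: pinC].
  by apply: pinZ => //; apply: pinB => //; exact: pinXn.
- apply/leq_sizeP => i le; have i0 : (0 < i)%N by exact: leq_trans le.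
  rewrite coefB coefD coefMX coefC coefZ coefB coefXn (gtn_eqF i0) addr0.
  have -> : p`_i = 0 by rewrite nth_default // (leq_trans sp).
  rewrite subr0; case: eqP => [->|/eqP ne]; first by rewrite mulr1 subrr.
  rewrite mulr0 subr0 nth_default //; apply: leq_trans sr _.
  by rewrite -ltnS prednK // ltn_neqAle eq_sym ne.
- by rewrite !hornerE ?hornerXn E rE subrr mulr0 subr0.
Qed.

Lemma lin_img (D : set K) zs zs' w y : subring D -> (forall z, z \in zs -> lin D zs' (z * w)) ->
  lin D zs y -> lin D zs' (y * w).
Proof.
move=> hD h; have sL : smod D (lin D zs') by apply: lin_smod; exact: sr_smod.
apply: (@lin_sub _ D D [set y | lin D zs' (y * w)]) => //.
split.
- by rewrite /= mul0r; exact: sm0 sL.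
- by move=> a b /= ha hb; rewrite mulrDl; exact: smD sL _ _.
- by move=> a b Da /= hb; rewrite /GRing.scale /= -mulrA; exact: smM sL _ _.
Qed.

Lemma fin_adjoin D T z : subring D -> subring T -> fin D T -> intg T z -> F z ->
  fin D (adjoin T [set z]).
Proof.
move=> hD hT [zs [Fz Tz]] [s [p [Tp sp E]]] Fz0.
exists [seq y * z ^+ i | y <- zs, i <- iota 0 s]; split.
  move=> _ /allpairsP [[y i] /= [ys _ ->]]; apply: srM => //; first exact: Fz.
  exact: srX.
move=> _ /(adjoin1P _ _ hT) [q Tq ->].
have [r [Tr sr ->]] := intg_red hT Tp sp E Tq.
set zs' := [seq _ | _ <- _, _ <- _].
have sL : smod D (lin D zs') by apply: lin_smod; exact: sr_smod.
rewrite (horner_coef_wide _ sr); apply: (sm_sum _ sL) => i _.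
apply: (@lin_img _ zs) => //; last exact: Tz.
move=> y ys; apply: lin_mem => //; apply: allpairs_f => //.
by rewrite mem_iota /= add0n.
Qed.

Lemma fin_self D : subring D -> fin D D.
Proof.
move=> hD; exists [:: 1]; split; first by move=> z; rewrite inE => /eqP ->; exact: sr1 hF.
move=> x Dx /=; exists x, 0; split=> //; by rewrite mulr1 addr0.
Qed.

Lemma fin_adjoins D (zs : seq K) : subring D ->
  (forall z, z \in zs -> F z /\ intg D z) -> fin D (adjoin D [set` zs]).
Proof.
move=> hD; elim: zs => [|z zs IH] h.
  have [ys [Fy Dy]] := fin_self hD; exists ys; split=> //.
  apply: subset_trans Dy; apply: adjoin_min => // x; by rewrite /= in_nil.
rewrite adjoin_cons; have [Fz iz] := h z (mem_head _ _).
apply: fin_adjoin => //; first exact: adjoin_subring.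
  by apply: IH => y ys; apply: h; rewrite inE ys orbT.
by apply: intg_mono iz; exact: adjoinSl.
Qed.

Lemma fin_bd Q T : cring Q -> fin Q T -> exists b, [/\ Q b, ~ P b & forall x, T x -> Q (b * x)].
Proof.
move=> cQ [zs [Fz Tz]]; have hQ := cr_sub cQ.
suff [b [Qb Pb hb]] : exists b, [/\ Q b, ~ P b & forall z, z \in zs -> Q (b * z)].
  exists b; split=> // x /Tz; apply: (@lin_sub _ Q Q [set x | Q (b * x)]) => //.
  split.
  - by rewrite /= mulr0; exact: sr0.
  - by move=> y z /= hy hz; rewrite mulrDr; exact: srD.
  - by move=> a z Qa /= hz; rewrite /GRing.scale /= mulrCA; exact: srM.
elim: zs Fz {Tz} => [|z zs IH] Fz.
  by exists 1; split=> //; [exact: sr1|exact: prime_n1 pP].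
have [b [Qb Pb hb]] : exists b, [/\ Q b, ~ P b & forall z, z \in zs -> Q (b * z)].
  by apply: IH => y ys; apply: Fz; rewrite inE ys orbT.
have [c [Qc Pc hc]] := cr_frac cQ (Fz z (mem_head _ _)).
exists (b * c); split; first exact: srM.
  by apply: (prime_nmul pP) => //; exact: cr_F cQ _ _.
move=> y; rewrite inE => /orP[/eqP ->|ys]; first by rewrite -mulrA; exact: srM.
by rewrite mulrAC; apply: srM => //; exact: hb.
Qed.

(** [J / g N] is measured through [N] and through [g J]; since [J / N] and [g J / g N] have the same
    length, so do the other two quotients. Multiplicities can thus be read off any lattice of finite
    colength. *)
Lemma len_index N J g l c : smod A N -> smod A J -> N `<=` J -> (forall x, N x -> N (g * x)) ->
  (forall x, J x -> J (g * x)) -> g != 0 -> len A (J : set K^o) N l ->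
  (len A (N : set K^o) (prin g N) c -> len A (J : set K^o) (prin g J) c) /\
  (len A (J : set K^o) (prin g J) c -> len A (N : set K^o) (prin g N) c).
Proof.
move=> sN sJ NJ gN gJ g0 hl.
have sgN := img_smod g sN; have sgJ := img_smod g sJ.
have sgNN : prin g N `<=` N by move=> _ [x Nx <-]; exact: gN.
have sgJJ : prin g J `<=` J by move=> _ [x Nx <-]; exact: gJ.
have sgNJ : prin g N `<=` prin g J by move=> _ [x Nx <-]; exists x => //; exact: NJ.
have hl' : len A (prin g J : set K^o) (prin g N) l.
  apply: (@len_mul1 _ A J N _ _ g _ hA sJ sN NJ sgJ sgN sgNJ) => //.
  - by move=> x Jx; exists x.
  - move=> _ [x Jx <-]; exists x => //; rewrite subrr; exact: sm0 sgN.
  - move=> x Jx; split; last by move=> Nx; exists x.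
    by move=> [y Ny /(mulfI g0) <-].
split=> hc.
  have h := len_add AN1 hl hc.
  have [a [b [ha hb E]]] := len_split AN1 h sgJ sgNJ sgJJ.
  have bl := len_uniq hb hl'; subst b.
  by have -> : c = a by move/eqP: E; rewrite addnC eqn_add2r => /eqP.
have h := len_add AN1 hc hl'.
have [a [b [ha hb E]]] := len_split AN1 h sN sgNN NJ.
have bl := len_uniq ha hl; subst a.
by have -> : c = b by move/eqP: E; rewrite addnC eqn_add2l => /eqP.
Qed.

Lemma cr_smod Q N : cring Q -> smod Q N -> smod A N.
Proof. by move=> cQ; apply: smod_mono; exact: cr_A. Qed.

Lemma fin_colen Q N b : cring Q -> smod Q N -> Q `<=` N -> Q b -> ~ P b ->
  (forall x, N x -> Q (b * x)) -> exists l, len A (N : set K^o) Q l.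
Proof.
move=> cQ sN QN Qb Pb h; have hQ := cr_sub cQ; have [l hl] := cr_len cQ Qb Pb.
have b0 : b != 0 by exact: prime_n0 pP Pb.
have sNA := cr_smod cQ sN; have sQA := cr_smod cQ (sr_smod hQ).
have [||l' hl' _] := len_sub AN1 hl (img_smod b sNA).
- by move=> _ [x Qx <-]; exists x => //; exact: QN.
- by move=> _ [x Nx <-]; exact: h.
exists l'; apply: (@len_mul2 _ A N Q (prin b N) (prin b Q) b _ _ _ _ _ _ _ _ _ _ _ hl') => //.
- exact: img_smod.
- exact: img_smod.
- by move=> _ [x Qx <-]; exists x => //; exact: QN.
- by move=> x Nx; exists x.
- by move=> _ [x Nx <-]; exists x => //; rewrite subrr; exists 0; rewrite ?mulr0 //; exact: sr0.
- move=> x Nx; split; last by move=> Qx; exists x.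
  by move=> [y Qy /(mulfI b0) <-].
Qed.

(** With [s] the length of [Q / b Q], the module [N] of polynomials in [u] of degree at most [s]
    also has [N / b N] of length [s]. So the [s + 1] powers of [u] are dependent over [k] modulo
    polynomials over the maximal ideal, and the relation [a] has a nonzero reduction [q]. *)
Lemma gen_rel Q u : cring Q -> F u -> exists s (q : {poly k}) (a : {poly K}),
  [/\ q != 0, (size a <= s.+1)%N, pin Q a, pin (nonunits Q) (a - map_poly j q) & a.[u] = 0].
Proof.
move=> cQ Fu; have hQ := cr_sub cQ; have lQ := cr_loc cQ; have sn := nu_smod lQ.
have [b [Qb Pb Qbu]] := cr_frac cQ Fu; have b0 : b != 0 by exact: prime_n0 pP Pb.
(* For a unit [b], [u] is in [Q] and a linear relation will do. Otherwise [b] in the maximal ideal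
   is what puts [b N] inside [N']. *)
case: (pselect (nonunits Q b)) => nb; last first.
  have [_ Qb'] := nu_inv Qb nb.
  have Qu : Q u by rewrite -(mulKf b0 u); exact: srM.
  have [c hc] := cr_res cQ Qu.
  exists 1, ('X - c%:P), ('X - u%:P); split.
  - by rewrite polyXsubC_eq0.
  - by rewrite size_XsubC.
  - by apply: pinB => //; [exact: pinX|exact: pinC].
  - rewrite map_polyXsubC opprB addrC addrA subrK => i; rewrite coefB !coefC.
    case: eqP => _; last by rewrite subrr; exact: sm0 sn.
    by rewrite -opprB; exact: smN hQ sn _.
  - by rewrite hornerXsubC subrr.
have [s hs] := cr_len cQ Qb Pb.
pose N := [set y | exists p : {poly K}, [/\ pin Q p, (size p <= s.+1)%N & y = p.[u]]].
pose N' := [set y | exists p : {poly K}, [/\ pin (nonunits Q) p, (size p <= s.+1)%N & y = p.[u]]].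
have mk C : smod Q C -> smod Q [set y | exists p : {poly K}, [/\ pin C p, (size p <= s.+1)%N & y = p.[u]]].
  move=> sC; split.
  - exists 0; rewrite size_poly0 horner0; split=> // i; rewrite coef0; exact: sm0 sC.
  - move=> _ _ [p [Cp sp ->]] [q [Cq sq ->]]; exists (p + q); rewrite hornerD; split=> //.
      by move=> i; rewrite coefD; exact: smD sC _ _.
    by apply: leq_trans (size_polyD _ _) _; rewrite geq_max sp.
  - move=> x _ Qx [p [Cp sp ->]]; exists (x *: p); rewrite hornerZ; split=> //.
      by move=> i; rewrite coefZ; exact: smM sC _ _.
    exact: leq_trans (size_scale_leq _ _) _.
have sN : smod Q N by apply: mk; exact: sr_smod.
have sN' : smod Q N' by exact: mk.
have N'N : N' `<=` N by move=> _ [p [np sp ->]]; exists p; split=> //; apply: pin_sub np; exact: nu_sub.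
have QN : Q `<=` N.
  by move=> x Qx; exists x%:P; rewrite hornerC size_polyC; split=> //; [exact: pinC|case: (x != 0)].
have bs0 : ~ P (b ^+ s) by move/(prime_exp hF pP (cr_F cQ Qb)).
have bN x : N x -> Q (b ^+ s * x).
  move=> [p [Qp sp ->]]; rewrite (horner_coef_wide _ sp) mulr_sumr; apply: sr_sum => // i _.
  have le : (i <= s)%N by rewrite -ltnS.
  have -> : b ^+ s * (p`_i * u ^+ i) = b ^+ (s - i) * (p`_i * (b * u) ^+ i).
    rewrite -{1}(subnK le) exprD exprMn; ring.
  by apply: srM => //; [exact: srX|apply: srM => //; exact: srX].
have [l hl] := fin_colen cQ sN QN (srX s hQ Qb) bs0 bN.
have sNA := cr_smod cQ sN; have sQA := cr_smod cQ (sr_smod hQ).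
have hN : len A (N : set K^o) (prin b N) s.
  have bQ x : Q x -> Q (b * x) by exact: srM.
  have bN' x : N x -> N (b * x) by move=> Nx; exact: smM sN _ _.
  exact: (len_index s sQA sNA QN bQ bN' b0 hl).1 hs.
have sN'A := cr_smod cQ sN'.
have [|m hm lem] := len_quo AN1 hN sN'A _ N'N.
  move=> _ [_ [p [Qp sp ->]] <-]; exists (b *: p); rewrite hornerZ; split=> //.
    by move=> i; rewrite coefZ; exact: smMr sn _ _.
  exact: leq_trans (size_scale_leq _ _) _.
have [c hc] : exists c : 'I_s.+1 -> k, N' (\sum_i j (c i) * u ^+ i) /\ exists i, c i != 0.
  apply: contrapT => h.
  suff : (#|{: 'I_s.+1}| <= m)%N by rewrite card_ord ltnNge lem.
  apply: (@len_indep N N' _ (fun i : 'I_s.+1 => u ^+ i) m sNA sN'A N'N _ _ _ hm).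
  - move=> v _ nv [p [Qp sp ->]]; exists (v *: p); rewrite hornerZ; split=> //.
      by move=> i; rewrite coefZ; apply: (smMr sn) => //; exact: cr_m cQ _ nv.
    exact: leq_trans (size_scale_leq _ _) _.
  - move=> i; exists 'X^i; rewrite hornerXn size_polyXn; split=> //; exact: pinXn.
  - move=> c hc i; apply: contrapT => /eqP ci; apply: h; exists c; split=> //.
    by exists i.
have [[p [np sp E]] [i0 ci0]] := hc.
pose q := \poly_(i < s.+1) c (inord i).
have qE : (map_poly j q).[u] = \sum_i j (c i) * u ^+ i.
  rewrite (@horner_coef_wide _ s.+1) ?size_map_poly ?size_poly //.
  by apply: eq_bigr => i _; rewrite coef_map coef_poly ltn_ord inord_val.
exists s, q, (map_poly j q - p); split.
- apply/eqP => q0; have := congr1 (fun r : {poly k} => r`_i0) q0.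
  by rewrite coef_poly ltn_ord inord_val coef0 => /eqP; rewrite (negPf ci0).
- apply: leq_trans (size_polyD _ _) _; rewrite size_polyN geq_max sp andbT.
  by rewrite size_map_poly size_poly.
- move=> i; rewrite coefB; apply: srB => //; last exact: nu_sub.
  by rewrite coef_map; apply: (cr_A cQ); exact: jA.
- move=> i; rewrite addrAC subrr add0r coefN; exact: smN hQ sn _.
- by rewrite hornerD hornerN qE E subrr.
Qed.

Lemma coef_top (c : K) i : ((1 - c *: 'X) ^+ i)`_i = (- c) ^+ i /\ (size ((1 - c *: 'X) ^+ i)%R <= i.+1)%N.
Proof.
elim: i => [|i [IH sz]]; first by rewrite !expr0 coef1 size_poly1.
have E : (1 - c *: 'X) ^+ i.+1 = (1 - c *: 'X) ^+ i - c *: ((1 - c *: 'X) ^+ i * 'X).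
  by rewrite exprS mulrBl mul1r -scalerAl [in X in _ - X]mulrC.
split; last first.
  rewrite E; apply: leq_trans (size_polyD _ _) _; rewrite size_polyN geq_max leqW //=.
  apply: leq_trans (size_scale_leq _ _) _; apply: leq_trans (size_polyMleq _ _) _.
  by rewrite size_polyX addn2 /=.
by rewrite E coefB coefZ coefMX /= IH nth_default // sub0r exprS mulNr.
Qed.

(** Substituting [u = 1 / t - c] in the relation [a] and multiplying by [t ^ s] gives a relation [G]
    for [t] with top coefficient [a(- c)], a unit of [Q] unless [- c] is a root of the reduction
    [q]. *)
Lemma gen_intg Q u : cring Q -> F u -> exists bad : seq k, forall c, c \notin bad ->
  u + j c != 0 /\ intg Q (u + j c)^-1.
Proof.
move=> cQ Fu; have hQ := cr_sub cQ; have lQ := cr_loc cQ; have sn := nu_smod lQ.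
have [s [q [a [q0 sa Qa na au]]]] := gen_rel cQ Fu.
have [r qE] := closed_field_poly_normal q.
exists [seq - z | z <- r] => c cbad; pose d := - j c.
have qc : q.[- c] != 0.
  rewrite qE hornerZ mulf_neq0 ?lead_coef_eq0 // -/(root _ _) root_prod_XsubC.
  by apply: contra cbad => h; rewrite -[c]opprK; exact: map_f.
have nd : nonunits Q (a.[d] - j q.[- c]).
  have -> : a.[d] - j q.[- c] = (a - map_poly j q).[d].
    by rewrite hornerD hornerN /d -rmorphN horner_map.
  rewrite horner_coef; apply: (sm_sum _ sn) => i _; apply: (smMr sn) => //.
  by apply: (srX _ hQ); rewrite /d -rmorphN; apply: (cr_A cQ); exact: jA.
have Qd : Q d by rewrite /d -rmorphN; apply: (cr_A cQ); exact: jA.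
have Qk : Q a.[d] by exact: pin_sr.
have nk : ~ nonunits Q a.[d].
  move=> h; case/eqP: qc; apply: (j_unit lQ (cr_A cQ)).
  have -> : j q.[- c] = a.[d] - (a.[d] - j q.[- c]) by ring.
  exact: smB hQ sn _ _.
have [k0 Qk'] := nu_inv Qk nk.
have uc : u + j c != 0.
  apply: contraTneq isT => E; case/eqP: k0; rewrite -au; congr (_.[_]).
  by rewrite /d -[RHS](addrK (j c)) E sub0r.
split=> //; set t := (u + j c)^-1.
pose w : {poly K} := 1 - j c *: 'X.
pose G : {poly K} := \sum_(i < s.+1) a`_i *: (w ^+ i * 'X^(s - i)).
have Qw : pin Q w.
  apply: pinB => //; first by apply: pinC => //; exact: sr1.
  by apply: pinZ => //; [apply: (cr_A cQ); exact: jA|exact: pinX].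
have QG : pin Q G.
  apply: pin_sum => // i _; apply: pinZ => //; apply: pinM => //; [exact: pin_exp|exact: pinXn].
have sG : (size G <= s.+1)%N.
  rewrite /G; elim/big_ind: _ => [|x y hx hy|i _]; first by rewrite size_poly0.
    by apply: leq_trans (size_polyD _ _) _; rewrite geq_max hx.
  apply: leq_trans (size_scale_leq _ _) _.
  have le : (i <= s)%N by rewrite -ltnS.
  have [_ sz] := coef_top (j c) i.
  by have := size_mulXn_le (s - i) sz; rewrite subnKC.
have G_top : G`_s = a.[d].
  rewrite (horner_coef_wide _ sa) /G coef_sum; apply: eq_bigr => i _.
  have le : (i <= s)%N by rewrite -ltnS.
  rewrite coefZ coefMXn ltnNge leq_subr /= subKn //.
  by have [-> _] := coef_top (j c) i.
have Gt : G.[t] = 0.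
  have wt : w.[t] = u * t by rewrite /w /t !hornerE; field.
  have -> : G.[t] = t ^+ s * a.[u].
    rewrite (horner_coef_wide _ sa) /G horner_sum mulr_sumr; apply: eq_bigr => i _.
    have le : (i <= s)%N by rewrite -ltnS.
    rewrite hornerZ hornerM horner_exp wt hornerXn exprMn.
    have -> : t ^+ s = t ^+ (s - i) * t ^+ i by rewrite -exprD subnK.
    ring.
  by rewrite au mulr0.
exists s, ('X^s - a.[d]^-1 *: G); split.
- by apply: pinB => //; [exact: pinXn|exact: pinZ].
- apply/leq_sizeP => i le; rewrite coefB coefXn coefZ.
  case: eqP => [->|/eqP ne]; first by rewrite G_top mulVf // subrr.
  rewrite nth_default ?mulr0 ?subr0 //; apply: leq_trans sG _.
  by rewrite ltn_neqAle eq_sym ne.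
- by rewrite hornerD hornerN hornerXn hornerZ Gt mulr0 subr0.
Qed.

(** * Finitely many points of a curve: separation and Chinese remainders *)

Section Points.
Variables (g : K) (Qs : seq (set K)).
Hypotheses (Fg : F g) (Pg : ~ P g) (uQs : uniq Qs).
Hypothesis cQs : forall Q, Q \in Qs -> cring Q /\ nonunits Q g.
Hypothesis sepQs : forall Q Q', Q \in Qs -> Q' \in Qs -> Q <> Q' -> adjoin Q Q' g^-1.

Let g0 : g != 0. Proof. exact: prime_n0 pP Pg. Qed.

Definition goodz (Q : set K) z := [/\ F z, z != 0, Q z, Q z^-1 & forall Q', Q' \in Qs -> intg Q' z].
(** A unit at [Q] built from finitely many [zs] that are integral over every point of the list:
    adjoining the [zs] to another point gives a finite module, hence bounded denominators. *)
Definition sepx (Q : set K) (zs : seq K) x := [/\ x != 0, Q x, Q x^-1,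
  (forall z, z \in zs -> goodz Q z) & forall T, subring T -> (forall z, z \in zs -> T z) -> T x].

Lemma gen_all (L : seq (set K)) u : {subset L <= Qs} -> F u -> exists bad : seq k, forall c, c \notin bad ->
  u + j c != 0 /\ forall Q, Q \in L -> intg Q (u + j c)^-1.
Proof.
move=> sL Fu; elim: L sL => [|Q L IH] sL.
  case: (pselect (exists c, u + j c = 0)) => [[c Ec]|h].
    exists [:: c] => c'; rewrite inE => ne; split=> //.
    apply: contraNneq ne => E; apply/eqP; apply: (fmorph_inj j).
    by apply: (addrI u); rewrite E Ec.
  by exists [::] => c _; split=> //; apply/eqP => E; apply: h; exists c.
have [b1 h1] : exists bad : seq k, forall c, c \notin bad ->
    u + j c != 0 /\ forall Q, Q \in L -> intg Q (u + j c)^-1.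
  by apply: IH => Q' h; apply: sL; rewrite inE h orbT.
have [b2 h2] := gen_intg (proj1 (cQs (sL _ (mem_head _ _)))) Fu.
exists (b1 ++ b2) => c; rewrite mem_cat negb_or => /andP[c1 c2].
have [u0 h] := h1 c c1; split=> // Q'; rewrite inE => /orP[/eqP ->|]; last exact: h.
by have [] := h2 c c2.
Qed.

Lemma sepx_nil Q : Q \in Qs -> sepx Q [::] 1.
Proof.
move=> /cQs [cQ _]; have hQ := cr_sub cQ.
split; rewrite ?invr1 ?oner_neq0 //; try exact: sr1.
by move=> T hT _; exact: sr1.
Qed.

Lemma sepx_cat Q zs x zs' x' : Q \in Qs -> sepx Q zs x -> sepx Q zs' x' -> sepx Q (zs ++ zs') (x * x').
Proof.
move=> /cQs [cQ _] [x0 Qx Qx' gz gx] [y0 Qy Qy' gz' gy]; have hQ := cr_sub cQ; split.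
- exact: mulf_neq0.
- exact: srM.
- by rewrite invfM; exact: srM.
- by move=> z; rewrite mem_cat => /orP[/gz|/gz'].
- move=> T hT hz; apply: srM => //; [apply: gx|apply: gy] => // z h; apply: hz; by rewrite mem_cat h ?orbT.
Qed.

(** An element [x], a unit at [Q'], which lies in [g * T] for the ring [T] generated over
    [Q] by finitely many elements integral over every point: [1 / g] is in the compositum
    of [Q] and [Q'], and each [b] of [Q'] is a polynomial in [1 / z], [z = 1 / (b + c)]. *)
Lemma sep_pair Q Q' : Q \in Qs -> Q' \in Qs -> Q <> Q' -> exists zs x, sepx Q' zs x /\
  forall T, subring T -> Q `<=` T -> (forall z, z \in zs -> T z) -> T (x / g).
Proof.
move=> Qin Q'in ne; have [cQ ng] := cQs Qin; have [cQ' ng'] := cQs Q'in.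
have hQ' := cr_sub cQ'; have lQ' := cr_loc cQ'; have sn' := nu_smod lQ'.
apply: (@adjoin_min _ Q Q' [set y | exists zs x, sepx Q' zs x /\
  forall T, subring T -> Q `<=` T -> (forall z, z \in zs -> T z) -> T (x * y)] _ _ _ g^-1 (sepQs Qin Q'in ne)).
- split.
  + exists [::], 1; split; first exact: sepx_nil.
    by move=> T hT _ _; rewrite mulr1; exact: sr1.
  + move=> y y' [zs [x [hx hy]]] [zs' [x' [hx' hy']]].
    exists (zs ++ zs'), (x * x'); split; first exact: sepx_cat.
    move=> T hT QT hz.
    have hz1 z : z \in zs -> T z by move=> h; apply: hz; rewrite mem_cat h.
    have hz2 z : z \in zs' -> T z by move=> h; apply: hz; rewrite mem_cat h orbT.
    have Tx : T x by case: hx => _ _ _ _; exact.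
    have Tx' : T x' by case: hx' => _ _ _ _; exact.
    have -> : x * x' * (y - y') = x' * (x * y) - x * (x' * y') by ring.
    by apply: srB => //; apply: srM => //; [exact: hy|exact: hy'].
  + move=> y y' [zs [x [hx hy]]] [zs' [x' [hx' hy']]].
    exists (zs ++ zs'), (x * x'); split; first exact: sepx_cat.
    move=> T hT QT hz.
    have hz1 z : z \in zs -> T z by move=> h; apply: hz; rewrite mem_cat h.
    have hz2 z : z \in zs' -> T z by move=> h; apply: hz; rewrite mem_cat h orbT.
    have -> : x * x' * (y * y') = (x * y) * (x' * y') by ring.
    by apply: srM => //; [exact: hy|exact: hy'].
- move=> y Qy; exists [::], 1; split; first exact: sepx_nil.
  by move=> T hT QT _; rewrite mul1r; exact: QT.
- move=> b Q'b; have Fb := cr_F cQ' Q'b.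
  have [bad hbad] := @gen_all Qs b (fun _ h => h) Fb.
  have [c0 hc0] := cr_res cQ' Q'b.
  have [c] := k_fresh (- c0 :: bad); rewrite inE negb_or => /andP[cc0 cb].
  have [u0 iu] := hbad c cb; set z := (b + j c)^-1.
  have Qj c' : Q' (j c') by apply: (cr_A cQ'); exact: jA.
  have Qu : Q' (b + j c) by exact: srD.
  have [_ Qz] : b + j c != 0 /\ Q' (b + j c)^-1.
    apply: nu_inv => // h; case/eqP: cc0.
    apply/eqP; rewrite -addr_eq0; apply/eqP; apply: (j_unit lQ' (cr_A cQ')).
    have -> : j (c + c0) = (b + j c) - (b - j c0) by rewrite rmorphD; ring.
    exact: smB hQ' sn' _ _.
  have z0 : z != 0 by rewrite invr_neq0.
  exists [:: z], z; split.
    split=> //; first by rewrite /z invrK.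
      move=> z'; rewrite inE => /eqP ->; split=> //; rewrite ?invrK //; exact: cr_F cQ' _ _.
    by move=> T hT hz; apply: hz; rewrite mem_head.
  move=> T hT QT hz; have Tz : T z by apply: hz; rewrite mem_head.
  have -> : z * b = 1 - j c * z by rewrite /z; field.
  apply: srB => //; first exact: sr1.
  by apply: srM => //; apply/QT/(cr_A cQ); exact: jA.
Qed.

Lemma sep_all Q' (L : seq (set K)) : {subset L <= Qs} -> Q' \in Qs -> Q' \notin L ->
  exists zs x, sepx Q' zs x /\ forall Q, Q \in L -> forall T, subring T -> Q `<=` T ->
    (forall z, z \in zs -> T z) -> T (x / g).
Proof.
move=> sL Q'in; elim: L sL => [|Q L IH] sL.
  by move=> _; exists [::], 1; split=> //; exact: sepx_nil.
rewrite inE negb_or => /andP[/eqP ne nL].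
have [zs [x [hx hg]]] : exists zs x, sepx Q' zs x /\ forall Q, Q \in L -> forall T, subring T -> Q `<=` T ->
    (forall z, z \in zs -> T z) -> T (x / g).
  by apply: IH => // Q2 h; apply: sL; rewrite inE h orbT.
have [zs' [x' [hx' hg']]] := sep_pair (sL _ (mem_head _ _)) Q'in (fun e => ne (esym e)).
exists (zs ++ zs'), (x * x'); split; first exact: sepx_cat.
move=> Q2 Q2in T hT QT hz.
have hz1 z : z \in zs -> T z by move=> h; apply: hz; rewrite mem_cat h.
have hz2 z : z \in zs' -> T z by move=> h; apply: hz; rewrite mem_cat h orbT.
have Tx : T x by case: hx => _ _ _ _; exact.
have Tx' : T x' by case: hx' => _ _ _ _; exact.
move: Q2in; rewrite inE => /orP[/eqP E|Q2in].
  by rewrite -mulrA; apply: srM => //; apply: hg' => //; rewrite -E.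
by rewrite mulrAC; apply: srM => //; exact: (hg Q2).
Qed.

Lemma prin_pow Q y N : cring Q -> nonunits Q g -> Q y -> ~ P y -> exists N', forall M', (N' <= M')%N ->
  prin (g ^+ N * y) Q (g ^+ M').
Proof.
move=> cQ ng Qy Py; have hQ := cr_sub cQ; have Qg := nu_sub ng.
have [N1 hN1] := cr_pow cQ Qy Py.
have [w Qw wE] : prin y Q (g ^+ N1).
  by rewrite -[N1]card_ord -prodr_const; exact: (hN1 (fun=> g)).
exists (N + N1)%N => M' le; exists (w * g ^+ (M' - (N + N1))).
  by apply: srM => //; exact: srX.
have -> : g ^+ N * y * (w * g ^+ (M' - (N + N1))) = g ^+ N * (y * w) * g ^+ (M' - (N + N1)) by ring.
by rewrite wE -!exprD subnKC.
Qed.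

(** Powers of [x / g] have bounded denominators at the other points, so a high power of [x] is
    divisible by [g] there. Scaled to residue [1] at [Q'] it becomes [v], and [1 - (1 - v) ^ N1] is
    congruent to [1] modulo [g] at [Q']. *)
Lemma crt_elt Q' : Q' \in Qs -> exists e, prin g Q' (e - 1) /\
  forall Q, Q \in Qs -> Q <> Q' -> prin g Q e.
Proof.
move=> Q'in; have [cQ' ng'] := cQs Q'in.
have hQ' := cr_sub cQ'; have lQ' := cr_loc cQ'; have sn' := nu_smod lQ'; have Qg' := nu_sub ng'.
pose L := [seq Q <- Qs | Q != Q'].
have [||zs [x [[x0 Qx Qx' gz gx] hg]]] := @sep_all Q' L _ Q'in.
- by move=> Q; rewrite mem_filter => /andP[].
- by rewrite mem_filter eqxx.
have [N0 hN0] : exists N0, forall Q, Q \in L -> forall M', (N0 <= M')%N -> prin g Q (x ^+ M').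
  have sL : {subset L <= Qs} by move=> Q; rewrite mem_filter => /andP[].
  elim: (L) sL hg => [|Q L' IH] sL hg; first by exists 0.
  have [N0 hN0] : exists N0, forall Q, Q \in L' -> forall M', (N0 <= M')%N -> prin g Q (x ^+ M').
    by apply: IH => [Q2 h|Q2 h]; [apply: sL|apply: hg]; rewrite inE h orbT.
  have [cQ ng] := cQs (sL _ (mem_head _ _)); have hQ := cr_sub cQ; have Qg := nu_sub ng.
  have [b [Qb Pb hb]] : exists b, [/\ Q b, ~ P b & forall y, adjoin Q [set` zs] y -> Q (b * y)].
    apply: fin_bd => //; apply: fin_adjoins => // z /gz [Fz _ _ _ iz]; split=> //.
    by apply: iz; apply: sL; exact: mem_head.
  have Txg : adjoin Q [set` zs] (x / g).
    apply: (hg Q (mem_head _ _) _ (adjoin_subring _ _) (@adjoinSl _ _ _)) => z zin.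
    exact: (@adjoinSr _ Q [set` zs]).
  have [N1 hN1] := prin_pow 1 cQ ng Qb Pb.
  exists (maxn N0 N1) => Q2; rewrite inE => /orP[/eqP ->|h] M'; rewrite geq_max => /andP[l0 l1]; last exact: hN0.
  have [w Qw wE] := hN1 M' l1.
  exists (w * (b * (x / g) ^+ M')).
    by apply: srM => //; apply: hb; exact: (srX _ (adjoin_subring _ _) Txg).
  have -> : g * (w * (b * (x / g) ^+ M')) = (g ^+ 1 * b * w) * (x / g) ^+ M' by rewrite expr1; ring.
  by rewrite wE -exprMn mulrC divfK.
pose y := x ^+ N0.
have [c hc] := cr_res cQ' (srX N0 hQ' Qx).
have c0 : j c != 0.
  apply/eqP => E; move: hc; rewrite E subr0 => h.
  by apply: (nu_not h); rewrite ?expf_neq0 // -exprVn; exact: srX.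
pose v := y / j c.
have Qc : Q' (j c)^-1 by rewrite -fmorphV; apply: (cr_A cQ'); exact: jA.
have nv : nonunits Q' (1 - v).
  have -> : 1 - v = - (j c)^-1 * (y - j c) by rewrite /v; field.
  by apply: (smM sn') => //; exact: srN.
have [N1 hN1] := cr_pow cQ' Qg' Pg.
exists (1 - (1 - v) ^+ N1); split.
  have -> : 1 - (1 - v) ^+ N1 - 1 = - (1 - v) ^+ N1 by ring.
  apply: (smN hQ' (prin_smod g hQ')); rewrite -[N1]card_ord -prodr_const.
  exact: (hN1 (fun=> 1 - v)).
move=> Q Qin ne; have [cQ ng] := cQs Qin; have hQ := cr_sub cQ; have sg := prin_smod g hQ.
have gv : prin g Q v.
  apply: (smMr sg); first by rewrite -fmorphV; apply: (cr_A cQ); exact: jA.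
  by apply: hN0 => //; rewrite mem_filter Qin andbT; apply/eqP.
have Qv : Q v by apply: (prin_sub (sr_smod hQ) (nu_sub ng)).
elim: (N1) => [|n IH]; first by rewrite expr0 subrr; exact: sm0 sg.
have -> : 1 - (1 - v) ^+ n.+1 = (1 - v) * (1 - (1 - v) ^+ n) + v by rewrite exprS; ring.
by apply: (smD sg) => //; apply: (smM sg) => //; apply: srB => //; exact: sr1.
Qed.

Lemma absorb Q e y : Q \in Qs -> prin g Q e -> F y -> exists N, forall M', (N <= M')%N -> prin g Q (e ^+ M' * y).
Proof.
move=> /cQs [cQ ng] [e' Qe' eE] Fy; have hQ := cr_sub cQ.
have [b [Qb Pb hb]] := cr_frac cQ Fy.
have [N1 hN1] := prin_pow 1 cQ ng Qb Pb.
exists N1 => M' le; have [w Qw wE] := hN1 _ le.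
exists (w * e' ^+ M' * (b * y)).
  by apply: srM => //; apply: srM => //; exact: srX.
by rewrite -eE exprMn -wE; ring.
Qed.

(** The semilocal ring of the curve at the points [Qs]. *)
Definition D1 : set K := [set x | F x /\ forall Q, Q \in Qs -> Q x].

Lemma D1_subring : subring D1.
Proof.
split.
- by split; [exact: sr1|move=> Q /cQs [/cr_sub hQ _]; exact: sr1].
- move=> x y [Fx Qx] [Fy Qy]; split; first exact: srB.
  by move=> Q Qin; have [/cr_sub hQ _] := cQs Qin; apply: srB => //; [exact: Qx|exact: Qy].
- move=> x y [Fx Qx] [Fy Qy]; split; first exact: srM.
  by move=> Q Qin; have [/cr_sub hQ _] := cQs Qin; apply: srM => //; [exact: Qx|exact: Qy].
Qed.

Lemma D1_A : A `<=` D1.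
Proof.
move=> a Aa; split; first exact: (X_A XF).
by move=> Q /cQs [/cr_A AQ _]; exact: AQ.
Qed.

Lemma eM1 Q e y N : Q \in Qs -> prin g Q (e - 1) -> Q y -> prin g Q (e ^+ N * y - y).
Proof.
move=> /cQs [cQ ng] he Qy; have hQ := cr_sub cQ; have sg := prin_smod g hQ.
have Qe : Q e.
  rewrite -(subrK 1 e); apply: srD => //; last exact: sr1.
  exact: (prin_sub (sr_smod hQ) (nu_sub ng)).
elim: N => [|N IH]; first by rewrite expr0 mul1r subrr; exact: sm0 sg.
have -> : e ^+ N.+1 * y - y = e * (e ^+ N * y - y) + (e - 1) * y by rewrite exprS; ring.
by apply: (smD sg); [exact: smM sg _ _|exact: smMr sg _ _].
Qed.

(** Chinese remainder: an element of [D1] close to [y] at [Q] and to [0] elsewhere. *)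
Lemma crt Q y : Q \in Qs -> Q y -> exists x, [/\ D1 x, prin g Q (y - x)
  & forall Q', Q' \in Qs -> Q' <> Q -> prin g Q' x].
Proof.
move=> Qin Qy; have [cQ ng] := cQs Qin; have hQ := cr_sub cQ.
have Fy := cr_F cQ Qy.
have [e [he he']] := crt_elt Qin.
have [N hN] : exists N, forall Q', Q' \in Qs -> Q' <> Q -> prin g Q' (e ^+ N * y).
  have [N hN] : exists N, forall M', (N <= M')%N -> forall Q', Q' \in Qs -> Q' <> Q -> prin g Q' (e ^+ M' * y).
    suff : forall L : seq (set K), {subset L <= Qs} -> exists N, forall M', (N <= M')%N ->
      forall Q', Q' \in L -> Q' <> Q -> prin g Q' (e ^+ M' * y) by apply.
    elim=> [|Q2 L IH] sL; first by exists 0.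
    have [N hN] : exists N, forall M', (N <= M')%N -> forall Q', Q' \in L -> Q' <> Q -> prin g Q' (e ^+ M' * y).
      by apply: IH => Q' h; apply: sL; rewrite inE h orbT.
    case: (pselect (Q2 = Q)) => E.
      exists N => M' le Q'; rewrite inE => /orP[/eqP -> //|]; exact: hN.
    have [N1 hN1] := absorb (sL _ (mem_head _ _)) (he' _ (sL _ (mem_head _ _)) E) Fy.
    exists (maxn N N1) => M'; rewrite geq_max => /andP[l1 l2] Q'.
    by rewrite inE => /orP[/eqP -> _|]; [exact: hN1|exact: hN].
  by exists N; exact: hN.
exists (e ^+ N * y); split=> //.
  have hd := eM1 N Qin he Qy.
  have Qx : Q (e ^+ N * y).
    rewrite -(subrK y (_ * _)); apply: srD => //.
    exact: (prin_sub (sr_smod hQ) (nu_sub ng)).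
  split; first exact: cr_F cQ _ Qx.
  move=> Q' Q'in; case: (pselect (Q' = Q)) => [-> //|ne].
  have [cQ' ng'] := cQs Q'in.
  exact: (prin_sub (sr_smod (cr_sub cQ')) (nu_sub ng') (hN _ Q'in ne)).
rewrite -opprB; apply: (smN hQ (prin_smod g hQ)); exact: eM1.
Qed.

(** The elements divisible by [g] at the points of [L] form a submodule [J L]; enlarging [L] by one
    point [Q] gives a step that [crt] identifies with [Q / g Q]. *)
Lemma D1_len (l : set K -> nat) : (forall Q, Q \in Qs -> len A (Q : set K^o) (prin g Q) (l Q)) ->
  len A (D1 : set K^o) (prin g D1) (\sum_(Q <- Qs) l Q)%N.
Proof.
move=> hl; have sD : smod A D1 by apply: smod_mono D1_A _; exact: sr_smod D1_subring.
pose J (L : seq (set K)) : set K := [set x | D1 x /\ forall Q, Q \in L -> prin g Q x].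
have sg Q : Q \in Qs -> smod A (prin g Q).
  by move=> /cQs [cQ _]; apply: cr_smod (cQ) _; exact: prin_smod (cr_sub cQ).
have sJ L : {subset L <= Qs} -> smod A (J L).
  move=> sL; split.
  - by split; [exact: sm0 sD|move=> Q /sL /sg; exact: sm0].
  - move=> x y [Dx hx] [Dy hy]; split; first exact: smD sD _ _.
    by move=> Q Qin; apply: (smD (sg _ (sL _ Qin))); [exact: hx|exact: hy].
  - move=> a x Aa [Dx hx]; split; first exact: smM sD _ _.
    by move=> Q Qin; apply: (smM (sg _ (sL _ Qin))) => //; exact: hx.
have JE : J Qs = prin g D1.
  rewrite eqEsubset; split.
    move=> x [[Fx Qx] hx]; apply/(prinP _ _ g0); split.
      by apply: srM => //; have [] := nP_inv Fg Pg.
    by move=> Q Qin; apply/(prinP _ _ g0); exact: hx.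
  move=> _ [x Dx <-]; have [Fx Qx] := Dx; split.
    split; first exact: srM.
    by move=> Q Qin; have [cQ ng] := cQs Qin; apply: (srM (cr_sub cQ)); [exact: nu_sub|exact: Qx].
  by move=> Q Qin; exists x => //; exact: Qx.
rewrite -JE; suff : forall L : seq (set K), uniq L -> {subset L <= Qs} ->
  len A (D1 : set K^o) (J L) (\sum_(Q <- L) l Q)%N by apply.
elim=> [|Q L IH] /=.
  move=> _ _; rewrite big_nil; have -> : J [::] = D1.
    by rewrite eqEsubset; split=> x; [case|move=> Dx; split].
  exact: len0.
move=> /andP[QL uL] sQL.
have sL : {subset L <= Qs} by move=> Q' h; apply: sQL; rewrite inE h orbT.
have Qin : Q \in Qs by apply: sQL; exact: mem_head.
have [cQ ng] := cQs Qin; have hQ := cr_sub cQ.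
rewrite big_cons addnC; apply: (len_add AN1 (IH uL sL)).
have JL : J (Q :: L) `<=` J L by move=> x [Dx hx]; split=> // Q' h; apply: hx; rewrite inE h orbT.
apply: (@len_mul2 _ A _ _ Q (prin g Q) 1 _ _ _ _ _ _ _ _ _ _ _ (hl _ Qin)) => //.
- exact: sJ.
- exact: sJ.
- by apply: cr_smod (cQ) _; exact: sr_smod.
- exact: sg.
- by apply: (prin_sub (sr_smod hQ)); exact: nu_sub.
- by move=> x [[Fx Qx] _]; rewrite mul1r; exact: Qx.
- move=> y Qy; have [x [Dx h h']] := crt Qin Qy; exists x; last by rewrite mul1r.
  split=> // Q' Q'in; apply: h'; first exact: sL.
  by move=> E; move: QL; rewrite -E Q'in.
- move=> x [Dx hx]; rewrite mul1r; split; last by move=> [_]; apply; exact: mem_head.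
  by move=> h; split=> // Q'; rewrite inE => /orP[/eqP -> //|]; exact: hx.
Qed.

(** ** Finiteness of the normalization of a curve *)

Section Base.
Variable D : set K.
Hypothesis hD : subring D.
Hypotheses (Dg : D g) (nDg : ~ D g^-1).
(** That [x] lies in [D[1 / x]] is integrality over [D], in the form in which valuation rings
    deliver it. *)
Hypothesis intD : forall x, x != 0 -> D1 x -> adjoin D [set x^-1] x.
Hypothesis genD : forall Q, Q \in Qs -> exists G : seq K, (forall y, y \in G -> Q y) /\
  forall x, Q x -> exists s, [/\ Q s, ~ nonunits Q s, adjoin D [set` G] s & adjoin D [set` G] (s * x)].

Lemma intg_D1 w : D1 w -> intg D w.
Proof.
move=> D1w; case: (eqVneq w 0) => [->|w0].
  exists 1, 0; rewrite size_poly0 horner0 expr1; split=> // i; rewrite coef0; exact: sr0.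
have [p Dp E] := (adjoin1P _ _ hD).1 (intD w0 D1w); set n := size p.
exists n.+1, (\sum_(i < n) p`_i *: 'X^(n - i)); split.
- by apply: pin_sum => // i _; apply: pinZ => //; exact: pinXn.
- elim/big_ind: _ => [|x y hx hy|i _]; first by rewrite size_poly0.
    by apply: leq_trans (size_polyD _ _) _; rewrite geq_max hx.
  by apply: leq_trans (size_scale_leq _ _) _; rewrite size_polyXn ltnS leq_subr.
- rewrite exprSr {2}E horner_coef mulr_sumr horner_sum; apply: eq_bigr => i _.
  rewrite hornerZ hornerXn mulrCA; case: i => i lt /=; congr (_ * _).
  rewrite -[n in w ^+ n](subnK (ltnW lt)) exprD exprVn mulfK //.
  by rewrite expf_neq0.
Qed.

Lemma Qs_n0 : exists Q, Q \in Qs.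
Proof.
case E : Qs => [|Q L]; last by exists Q; rewrite mem_head.
case: nDg; have [g0' Fg'] := nP_inv Fg Pg.
have : adjoin D [set g^-1^-1] g^-1.
  by apply: intD; [rewrite invr_neq0|split=> // Q; rewrite E].
by rewrite invrK; apply: adjoin_min => // x ->.
Qed.

(** The list [ws] consists of [e], congruent to [1] modulo [g] at [Q] and to [0] elsewhere, and of
    the generators of [Q] over [D] multiplied by a power of [e] that clears their poles. A
    denominator [s] of [x] at [Q] times a power of [e] is the element [S]. *)
Lemma base_pt Q : Q \in Qs -> exists ws : seq K, (forall w, w \in ws -> D1 w) /\
  forall D2, subring D2 -> D `<=` D2 -> (forall w, w \in ws -> D2 w) -> forall x, D1 x ->
  exists S, [/\ D2 S, D2 (S * x), Q S, ~ nonunits Q S & forall Q', Q' \in Qs -> Q' <> Q -> nonunits Q' S].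
Proof.
move=> Qin; have [cQ ng] := cQs Qin; have hQ := cr_sub cQ; have lQ := cr_loc cQ.
have [e [he he']] := crt_elt Qin; have [G [GQ hG]] := genD Qin.
have Qe : Q e.
  rewrite -(subrK 1 e); apply: srD => //; last exact: sr1.
  exact: (prin_sub (sr_smod hQ) (nu_sub ng)).
have Fe := cr_F cQ Qe.
have abs y (Qy : Q y) : exists N, forall M', (N <= M')%N ->
    forall Q', Q' \in Qs -> Q' <> Q -> prin g Q' (e ^+ M' * y).
  suff : forall L : seq (set K), {subset L <= Qs} -> exists N, forall M', (N <= M')%N ->
    forall Q', Q' \in L -> Q' <> Q -> prin g Q' (e ^+ M' * y) by apply.
  elim=> [|Q2 L IH] sL; first by exists 0.
  have [N hN] : exists N, forall M', (N <= M')%N -> forall Q', Q' \in L -> Q' <> Q -> prin g Q' (e ^+ M' * y).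
    by apply: IH => Q' h; apply: sL; rewrite inE h orbT.
  case: (pselect (Q2 = Q)) => E.
    exists N => M' le Q'; rewrite inE => /orP[/eqP -> //|]; exact: hN.
  have [N1 hN1] := absorb (sL _ (mem_head _ _)) (he' _ (sL _ (mem_head _ _)) E) (cr_F cQ Qy).
  exists (maxn N N1) => M'; rewrite geq_max => /andP[l1 l2] Q'.
  by rewrite inE => /orP[/eqP -> _|]; [exact: hN1|exact: hN].
have gsub Q' y : Q' \in Qs -> prin g Q' y -> nonunits Q' y.
  by move=> /cQs [cQ' ng']; apply: (prin_sub (nu_smod (cr_loc cQ'))).
have mkD1 M' y : Q y -> (forall Q', Q' \in Qs -> Q' <> Q -> prin g Q' (e ^+ M' * y)) -> D1 (e ^+ M' * y).
  move=> Qy h; have Qx : Q (e ^+ M' * y) by apply: srM => //; exact: srX.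
  split; first exact: cr_F cQ _ Qx.
  move=> Q' Q'in; case: (pselect (Q' = Q)) => [-> //|ne].
  exact: nu_sub (gsub _ _ Q'in (h Q' Q'in ne)).
have [N hN] : exists N, (0 < N)%N /\ forall y, y \in G -> D1 (e ^+ N * y).
  suff [N hN] : exists N, forall M', (N <= M')%N -> forall y, y \in G -> D1 (e ^+ M' * y).
    by exists N.+1; split=> //; exact: hN.
  elim: (G) GQ => [|y G' IH] GQ; first by exists 0.
  have [N hN] : exists N, forall M', (N <= M')%N -> forall y, y \in G' -> D1 (e ^+ M' * y).
    by apply: IH => z h; apply: GQ; rewrite inE h orbT.
  have Qy := GQ y (mem_head _ _); have [N1 hN1] := abs y Qy.
  exists (maxn N N1) => M'; rewrite geq_max => /andP[l1 l2] z.
  rewrite inE => /orP[/eqP ->|]; last exact: hN.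
  by apply: mkD1 => //; exact: hN1.
case: hN => N0 hN.
have D1e : D1 e.
  have h := mkD1 1%N 1 (sr1 hQ); rewrite mulr1 expr1 in h.
  by apply: h => Q' Q'in ne; exact: he'.
exists (e :: [seq e ^+ N * y | y <- G]); split.
  move=> w; rewrite inE => /orP[/eqP -> //|/mapP [y yG ->]]; exact: hN.
move=> D2 hD2 DD2 hw x [Fx Qx].
have D2e : D2 e by apply: hw; exact: mem_head.
have up y : (exists n, D2 (e ^+ n * y)) -> exists n, forall n', (n <= n')%N -> D2 (e ^+ n' * y).
  move=> [n h]; exists n => n' le; rewrite -(subnK le) exprD -mulrA; apply: srM => //; exact: srX.
have pole y : adjoin D [set` G] y -> exists n, D2 (e ^+ n * y).
  apply: (@adjoin_min _ D [set` G] [set y | exists n, D2 (e ^+ n * y)]).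
  - split.
    + by exists 0; rewrite mulr1; exact: sr1.
    + move=> y1 y2 /up [n1 h1] /up [n2 h2]; exists (maxn n1 n2); rewrite mulrBr.
      by apply: srB => //; [apply: h1; exact: leq_maxl|apply: h2; exact: leq_maxr].
    + move=> y1 y2 [n1 h1] [n2 h2]; exists (n1 + n2)%N; rewrite exprD mulrACA; exact: srM.
  - by move=> y1 Dy; exists 0; rewrite mul1r; exact: DD2.
  - move=> y1 yG; exists N; apply: hw; rewrite inE; apply/orP; right.
    by apply/mapP; exists y1.
have [s [Qs' ns Gs Gsx]] := hG x (Qx _ Qin).
have [n1 h1] := up _ (pole _ Gs); have [n2 h2] := up _ (pole _ Gsx).
have [n3 h3] := abs s Qs'.
pose n := maxn n1 (maxn n2 n3).
have l1 : (n1 <= n)%N by exact: leq_maxl.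
have l2 : (n2 <= n)%N by rewrite /n maxnCA leq_maxl.
have l3 : (n3 <= n)%N by rewrite /n maxnA leq_maxr.
exists (e ^+ n * s); split.
- exact: h1.
- by rewrite -mulrA; exact: h2.
- by apply: srM => //; exact: srX.
- move=> h; have := nu_unitD lQ Qs' ns (gsub _ _ Qin (eM1 n Qin he Qs')).
  by rewrite addrC subrK.
- by move=> Q' Q'in ne; apply: gsub => //; exact: h3.
Qed.

(** The elements [S] of [base_pt], added over all points, give a denominator of [x] that is a unit
    at every point. Its inverse lies in [D1], so it is integral and lies in [D2] again; hence [D1]
    is contained in the finite algebra [D2]. *)
Lemma fin_D1 : fin D D1.
Proof.
have [ws [wD1 hws]] : exists ws : seq K, (forall w, w \in ws -> D1 w) /\
  forall Q, Q \in Qs -> forall D2, subring D2 -> D `<=` D2 -> (forall w, w \in ws -> D2 w) -> forall x, D1 x ->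
  exists S, [/\ D2 S, D2 (S * x), Q S, ~ nonunits Q S & forall Q', Q' \in Qs -> Q' <> Q -> nonunits Q' S].
  suff : forall L : seq (set K), {subset L <= Qs} -> exists ws : seq K, (forall w, w \in ws -> D1 w) /\
    forall Q, Q \in L -> forall D2, subring D2 -> D `<=` D2 -> (forall w, w \in ws -> D2 w) -> forall x, D1 x ->
    exists S, [/\ D2 S, D2 (S * x), Q S, ~ nonunits Q S & forall Q', Q' \in Qs -> Q' <> Q -> nonunits Q' S].
    by apply.
  elim=> [|Q L IH] sL; first by exists [::].
  have [|ws [h1 h2]] := IH; first by move=> Q' h; apply: sL; rewrite inE h orbT.
  have [ws' [h1' h2']] := base_pt (sL _ (mem_head _ _)).
  exists (ws ++ ws'); split; first by move=> w; rewrite mem_cat => /orP[/h1|/h1'].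
  move=> Q' Q'in D2 hD2 DD2 hw.
  move: Q'in; rewrite inE => /orP[/eqP ->|Q'in].
    by apply: h2' => // w h; apply: hw; rewrite mem_cat h orbT.
  by apply: h2 => // w h; apply: hw; rewrite mem_cat h.
have [zs [Fz hz]] : fin D (adjoin D [set` ws]).
  apply: fin_adjoins => // w /wD1 D1w; split; [by case: D1w|exact: intg_D1].
exists zs; split=> //; apply: subset_trans hz => x D1x.
set D2 := adjoin D [set` ws]; have hD2 : subring D2 by exact: adjoin_subring.
have DD2 : D `<=` D2 by exact: adjoinSl.
have wD2 w : w \in ws -> D2 w by move=> h; exact: (@adjoinSr _ D [set` ws]).
have [S [D2S D2Sx hS]] : exists S, [/\ D2 S, D2 (S * x) & forall Q, Q \in Qs -> Q S /\ ~ nonunits Q S].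
  suff : forall L : seq (set K), uniq L -> {subset L <= Qs} -> exists S, [/\ D2 S, D2 (S * x),
      forall Q, Q \in L -> Q S /\ ~ nonunits Q S & forall Q, Q \in Qs -> Q \notin L -> nonunits Q S].
    by move=> /(_ Qs uQs) [//|S [? ? ? _]]; exists S.
  elim=> [|Q L IH] /=.
    move=> _ _; exists 0; rewrite mul0r; split=> //; try exact: sr0.
    by move=> Q /cQs [/cr_loc /nu_smod sQ _] _; exact: sm0 sQ.
  move=> /andP[nQ uL] sL; have sL' : {subset L <= Qs} by move=> Q' h; apply: sL; rewrite inE h orbT.
  have [S [s1 s2 s3 s4]] := IH uL sL'.
  have Qin : Q \in Qs by apply: sL; exact: mem_head.
  have [S' [t1 t2 t3 t4 t5]] := hws Q Qin D2 hD2 DD2 wD2 x D1x.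
  exists (S + S'); split.
  - exact: (srD hD2 s1 t1).
  - by rewrite mulrDl; exact: (srD hD2 s2 t2).
  - move=> Q'; rewrite inE => /orP[/eqP ->|Q'L].
      have [cQ _] := cQs Qin; have nS := s4 Q Qin nQ.
      split; first by apply: (srD (cr_sub cQ)) => //; exact: nu_sub.
      by rewrite addrC; apply: (nu_unitD (cr_loc cQ)).
    have Q'in := sL' _ Q'L; have [cQ _] := cQs Q'in; have [q1 q2] := s3 _ Q'L.
    have nS : nonunits Q' S' by apply: t5 => // E; move: nQ; rewrite -E Q'L.
    split; first by apply: (srD (cr_sub cQ)) => //; exact: nu_sub.
    by apply: (nu_unitD (cr_loc cQ)).
  - move=> Q' Q'in; rewrite inE negb_or => /andP[/eqP ne nL]; have [cQ _] := cQs Q'in.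
    by apply: (smD (nu_smod (cr_loc cQ))); [exact: s4|exact: t5].
have [Q Qin] := Qs_n0; have [QS nS] := hS Q Qin; have [S0 _] := nu_inv QS nS.
have D1S : D1 S^-1.
  split; first by have [cQ _] := cQs Qin; apply: (cr_F cQ); have [] := nu_inv QS nS.
  by move=> Q' Q'in; have [q1 q2] := hS _ Q'in; have [] := nu_inv q1 q2.
have : D2 S^-1.
  have := intD (invr_neq0 S0) D1S; rewrite invrK; apply: adjoin_min => // _ -> //.
by move=> h; rewrite -(mulKf S0 x); exact: (srM hD2 h D2Sx).
Qed.

End Base.

End Points.

(** * The semilocal ring of a curve on [X] at finitely many of its points *)

Lemma X_algebra R : X R -> exists B p (G : seq K), [/\ subring B, B = adjoin A [set` G], prime_ideal B p
  & R = localization B p].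
Proof.
move=> XR; have [r [B cB]] := X_cover; have [i [p [pB RE]]] := cover_X cB XR.
have [hB _ _ _] := cover_B i cB; have [G BE] := cB.1 i.
by exists (B i), p, G.
Qed.

(** A valuation ring dominating [hat R] is centered at both points. *)
Lemma hat_inj (V : set K) R R' : X R -> X R' -> R `<` F -> R' `<` F -> hat R = hat R' -> R = R'.
Proof.
move=> XR XR' lt lt' E; have [V' [vV [hV dV]]] := local_val (hat_local (pt_oncurve XR lt)).
have cen R0 : X R0 -> R0 `<` F -> hat R0 = hat R -> dominates V' R0.
  move=> XR0 lt0 E0; split; first by apply: subset_trans hV; rewrite -E0; exact: hat_sub.
  apply: subset_trans dV; rewrite -E0 (hat_nu (pt_oncurve XR0 lt0)); apply: sadd_subl; exact: sm0 sP.
apply: (X_val_uniq vV) => //; try exact: cen.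
exact: (subset_trans (X_A XR) (subset_trans (@hat_sub R) hV)).
Qed.

Section CurveRing.
Variables (g : K) (Rs : seq (set K)).
Hypotheses (Fg : F g) (Pg : ~ P g) (uRs : uniq Rs).
Hypothesis RsP : forall R, R \in Rs -> [/\ X R, R `<` F & nonunits (hat R) g].
Let g0 : g != 0. Proof. exact: prime_n0 pP Pg. Qed.

Definition curve_norm : set K := [set x | F x /\ forall R, R \in Rs -> hat R x].

Let Qs : seq (set K) := [seq hat R | R <- Rs].
Let uQs : uniq Qs.
Proof.
rewrite map_inj_in_uniq // => R R' /RsP [XR lt _] /RsP [XR' lt' _]; exact: hat_inj.
Qed.
Let cQs : forall Q, Q \in Qs -> cring Q /\ nonunits Q g.
Proof. by move=> _ /mapP [R /RsP [XR lt ngR] ->]; split=> //; exact/hat_cring/pt_oncurve. Qed.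
Let D1E : curve_norm = D1 Qs.
Proof.
rewrite eqEsubset; split=> x [Fx hx]; split=> //.
  by move=> _ /mapP [R Rin ->]; exact: hx.
by move=> R Rin; apply: hx; exact: map_f.
Qed.

Let center V R : valuation_ring V -> X R -> R `<` F -> nonunits (hat R) g ->
  hat R `<=` V -> nonunits V g -> dominates V R.
Proof.
move=> vV XR lt ngR RV nV; have lV := val_local vV; have hV : subring V by case: lV.
split; first by apply: subset_trans RV; exact: hat_sub.
have cR := hat_cring (pt_oncurve XR lt); have hR := cr_sub cR.
have [N hN] := cr_pow cR (nu_sub ngR) Pg => x nx.
have nx' : nonunits (hat R) x by rewrite (hat_nu (pt_oncurve XR lt)); apply: sadd_subl nx; exact: sm0 sP.
have [w Rw wE] : prin g (hat R) (x ^+ N).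
  by rewrite -[N]card_ord -prodr_const; exact: (hN (fun=> x)).
apply: (prime_exp (n := N) hV (nu_prime lV)); first by apply: RV; exact: nu_sub.
rewrite -wE; apply: (smMr (nu_smod lV)) => //; exact: RV.
Qed.

(** If [1 / g] were not in the compositum, a valuation ring containing both points would have [g] in
    its maximal ideal and would be centered at both, against separatedness. *)
Let sep Q Q' : Q \in Qs -> Q' \in Qs -> Q <> Q' -> adjoin Q Q' g^-1.
Proof.
move=> /mapP [R Rin ->] /mapP [R' Rin' ->] ne; apply: contrapT => h; apply: ne.
have [XR lt ngR] := RsP Rin; have [XR' lt' ngR'] := RsP Rin'.
set T := adjoin _ _ in h; have hT : subring T by exact: adjoin_subring.
have RT : hat R `<=` T by exact: adjoinSl.
have RT' : hat R' `<=` T by exact: adjoinSr.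
have Tg : T g by apply: RT; exact: nu_sub.
have [||V [vV TV gV]] := @valuation_over _ T [set g] hT.
- by rewrite ideal_span_prin // => /(prinP _ _ g0); rewrite div1r.
- by move=> _ ->.
have nVg : nonunits V g by exact: gV.
have -> // : R = R'.
apply: (X_val_uniq vV) => //.
- exact: (subset_trans (X_A XR) (subset_trans (@hat_sub R) (subset_trans RT TV))).
- by apply: center => //; exact: subset_trans RT TV.
- by apply: center => //; exact: subset_trans RT' TV.
Qed.

Lemma len_curve l : (forall R, R \in Rs -> len A (hat R : set K^o) (prin g (hat R)) (l R)) ->
  len A (curve_norm : set K^o) (prin g curve_norm) (\sum_(R <- Rs) l R)%N.
Proof.
move=> hl.
have [l' hl'] : exists l' : set K -> nat, forall R, R \in Rs -> l' (hat R) = l R.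
  have : forall Q, exists n, forall R, R \in Rs -> hat R = Q -> n = l R.
    move=> Q; case: (pselect (exists2 R, R \in Rs & hat R = Q)) => [[R Rin RQ]|h].
      exists (l R) => R' Rin' RQ'; congr l.
      have [XR lt _] := RsP Rin; have [XR' lt' _] := RsP Rin'.
      by apply: hat_inj => //; rewrite RQ.
    by exists 0%N => R Rin RQ; case: h; exists R.
  by move=> /choice [l' h]; exists l' => R Rin; exact: h.
have -> : (\sum_(R <- Rs) l R = \sum_(Q <- Qs) l' Q)%N.
  by rewrite big_map big_seq [RHS]big_seq; apply: eq_bigr => R Rin; rewrite hl'.
rewrite D1E; apply: (@D1_len g Qs) => // Q; move=> /mapP [R Rin ->].
by rewrite hl'; [exact: hl|].
Qed.

Lemma curve_norm_subring : subring curve_norm.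
Proof. by rewrite D1E; exact: (@D1_subring g Qs). Qed.

Lemma curve_norm_A : A `<=` curve_norm.
Proof. by rewrite D1E; exact: (@D1_A g Qs). Qed.

Variable D : set K.
Hypotheses (lD : local_ring D) (AD : A `<=` D) (PD : P `<=` D) (ng : nonunits D g).
(** The list contains every point where a valuation ring over [D] with [g] in its maximal ideal can
    be centered; with properness this makes [curve_norm] integral over [D]. *)
Hypothesis RsV : forall V R, valuation_ring V -> D `<=` V -> nonunits V g -> X R -> dominates V R -> R \in Rs.
Let hD : subring D. Proof. by case: lD. Qed.

(** Otherwise [1 / x] and [g] generate a proper ideal of [D[1 / x]], [D] being local, and some
    valuation ring has both in its maximal ideal; its center is in the list, so it contains [x]
    too. *)
Let intD x : x != 0 -> D1 Qs x -> adjoin D [set x^-1] x.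
Proof.
move=> x0 [Fx Qx]; apply: contrapT => h.
set T := adjoin _ _ in h; have hT : subring T by exact: adjoin_subring.
have DT : D `<=` T by exact: adjoinSl.
have Tx : T x^-1 by exact: (@adjoinSr _ D [set x^-1]).
have Dg : D g by exact: nu_sub.
have [||V [vV TV gV]] := @valuation_over _ T [set z | z = x^-1 \/ z = g] hT.
- move=> h1.
  have : sadd (prin x^-1 T) (prin g D) 1.
    have : sadd (prin x^-1 T) (prin g T) 1.
      move: h1; apply: ideal_span_min.
        apply: sadd_smod; exact: prin_smod.
      move=> z [->|->].
        by apply: sadd_subl; [exact: sm0 (prin_smod _ hT)|exact: prin_self].
      by apply: sadd_subr; [exact: sm0 (prin_smod _ hT)|exact: prin_self].
    move=> [_ [_ [[a Ta <-] [b Tb <-] E]]].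
    have [p Dp bE] := (adjoin1P _ _ hD).1 Tb.
    have [b' Tb' bE'] : exists2 b', T b' & b = x^-1 * b' + p`_0.
      elim/poly_ind: (p) Dp bE => [|q c _] Dq bE.
        by exists 0; [exact: sr0|rewrite bE horner0 coef0 mulr0 addr0].
      exists q.[x^-1].
        apply: (pin_sr hT _ Tx) => i; apply: DT; have := Dq i.+1.
        by rewrite coefD coefMX coefC addr0.
      by rewrite bE hornerMXaddC coefD coefMX coefC /= add0r mulrC.
    exists (x^-1 * (a + g * b')), (g * p`_0); split.
    - by exists (a + g * b') => //; exact: (srD hT Ta (srM hT (DT _ Dg) Tb')).
    - by exists p`_0 => //; exact: Dp.
    - by rewrite E bE'; ring.
  move=> [_ [_ [[a Ta <-] [d Dd <-] E]]].
  have [u0 Du] := nu_1B lD (smMr (nu_smod lD) Dd ng).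
  apply: h; have -> : x = a / (1 - g * d).
    have -> : 1 - g * d = x^-1 * a by rewrite {1}E addrK.
    rewrite invfM invrK; field.
    by apply: contraNneq u0 => a0; rewrite {1}E a0 mulr0 add0r subrr.
  exact: (srM hT Ta (DT _ Du)).
- by move=> z [->|->] //; exact: DT.
have lV := val_local vV; have hV : subring V by case: lV.
have nVg : nonunits V g by apply: gV; right.
have nVx : nonunits V x^-1 by apply: gV; left.
have DV : D `<=` V by exact: subset_trans TV.
have [R XR dR] := X_val vV (subset_trans AD DV).
have Rin := RsV vV DV nVg XR dR; have [_ lt _] := RsP Rin.
have : hat R x by apply: Qx; exact: map_f.
move=> Rx; have Vx : V x.
  move: Rx; apply: (sadd_min (sr_smod hV)); first by case: dR.
  exact: subset_trans DV.
by apply: (nu_not nVx); rewrite ?invr_neq0 // invrK.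
Qed.

Let genD Q : Q \in Qs -> exists G : seq K, (forall y, y \in G -> Q y) /\
  forall x, Q x -> exists s, [/\ Q s, ~ nonunits Q s, adjoin D [set` G] s & adjoin D [set` G] (s * x)].
Proof.
move=> /mapP [R Rin ->]; have [XR lt _] := RsP Rin.
have [B [p [G [hB BE pB RE]]]] := X_algebra XR; exists G.
have BR : B `<=` R by rewrite RE; exact: loc_sub.
have BD : B `<=` adjoin D [set` G].
  rewrite BE; apply: adjoin_min; first exact: adjoin_subring.
    exact: subset_trans (@adjoinSl _ _ _).
  exact: adjoinSr.
split; first by move=> y yG; apply/hat_sub/BR; rewrite BE; exact: (@adjoinSr _ A [set` G]).
move=> _ [r [q [Rr Pq ->]]].
have [a [b [Ba Bb nb rE]]] : localization B p r by rewrite -RE.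
have hTT : subring (adjoin D [set` G]) by exact: adjoin_subring.
have b0 : b != 0 by exact: prime_n0 pB nb.
have Rb : R b by exact: BR.
have Rb' : R b^-1 by rewrite RE; exact: loc_inv.
exists b; split.
- exact: hat_sub.
- by move=> h; apply: (nu_not h b0); exact: hat_sub.
- exact: BD.
- rewrite mulrDr rE [b * (a / b)]mulrC divfK //.
  apply: (srD hTT (BD _ Ba)); apply: (@adjoinSl _ D [set` G]); apply: PD.
  by apply: (smM sP) => //; exact: (properW lt).
Qed.

Lemma fin_curve : fin D curve_norm.
Proof.
rewrite D1E; apply: (@fin_D1 g Qs) => //.
- exact: nu_sub ng.
- exact: nu_not ng g0.
Qed.

End CurveRing.

(** For [x] in [V] outside [F], the inverse of [x] lies in [P], hence in [g P] and in the maximal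
    ideal of [V]. *)
Lemma val_below V g : valuation_ring V -> P `<=` V -> F g -> ~ P g -> nonunits V g -> V `<=` F.
Proof.
move=> vV PV Fg Pg nV x Vx; apply: contrapT => Fx.
have [t dt] := pdiv_dvr pF; have [_ /(_ x)[//|Fx']] := dvr_valuation dt.
have x0 : x != 0 by apply: contra_notN Fx => /eqP ->; exact: sr0.
have Px' : P x^-1 by apply/nuP; split=> //; right; rewrite invrK.
have lV := val_local vV; have [hVV _] := lV; have [g0 Fg'] := nP_inv Fg Pg.
have V' : V (x^-1 / g) by apply: PV; exact: smMr sP _ _.
apply: (nu1 hVV); rewrite -(mulfV x0); apply: (smM (nu_smod lV)) => //.
by rewrite -(divfK g0 x^-1); apply: (smM (nu_smod lV)).
Qed.

(** * Nonexceptional curves: comparison of [A] with the points of [X] *)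

Section Transversal.
Hypothesis nE : ~ exceptional A X F.

Lemma nexc_m : ~ nonunits A `<=` P.
Proof. by move=> h; apply: nE; split=> //; split=> //; exact: X_A. Qed.

Lemma nexc_loc : F = localization A (P `&` A).
Proof.
have pPA : prime_ideal A (P `&` A) by apply: nu_contr => //; exact: X_A.
have sub : localization A (P `&` A) `<=` F by apply: loc_sub_nu => //; exact: X_A.
have nm : P `&` A <> nonunits A by move=> E; apply: nexc_m; rewrite -E; exact: subIsetl.
have n0 : P `&` A <> [set 0].
  move=> E; have [t dt] := pdiv_dvr pF; apply: (dvr_set0 dt).
  rewrite eqEsubset; split=> // x _; have [a [b [Aa Ab b0 xE]]] := frA x.
  apply: sub; exists a, b; split=> //; rewrite E; exact/eqP.
by have -> // := pdiv_eq (loc_pdiv pPA n0 nm) pF sub.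
Qed.

Lemma A_oncurve : oncurve A.
Proof.
have AF := X_A XF.
have pPA : prime_ideal A (P `&` A) by apply: nu_contr.
split=> //; last exact: nexc_loc.
  by apply: ideal_proper => //; [case: pPA|exact: prime_n1 pPA].
move=> Q y pQ hQ Qy Py; apply: contrapT => nQ.
have Ay := prime_sub pQ Qy.
have : P `&` A = Q.
  apply: A_chain => //.
  move=> E; have [t dt] := pdiv_dvr pF; apply: (dvr_set0 dt).
  rewrite eqEsubset; split=> // x _; have [a [b [Aa Ab b0 xE]]] := frA x.
  rewrite nexc_loc; exists a, b; split=> //; rewrite E; exact/eqP.
by move=> E; move: Qy; rewrite -E => -[].
Qed.

(** The projection formula: [curve_norm] is finite over [hat A] and contains it with finite
    colength, so by [len_index] the left side can be computed upstairs, where it is a sum over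
    points. *)
Lemma len_transversal g Rs l : nonunits A g -> ~ P g -> uniq Rs ->
  (forall R, R \in Rs <-> X R /\ R `<` F) ->
  (forall R, R \in Rs -> len A (R : set K^o) (sadd (P `&` R) (prin g R)) (l R)) ->
  len A (A : set K^o) (sadd (P `&` A) (prin g A)) (\sum_(R <- Rs) l R)%N.
Proof.
move=> mg Pg uRs RsP hl; have oA := A_oncurve; have cD := hat_cring oA.
have Ag := nu_sub mg; have Fg := X_A XF Ag; have hD := cr_sub cD; have lD := cr_loc cD.
have AD := cr_A cD; have PD := cr_P cD.
have ngD : nonunits (hat A) g by exact: cr_m cD _ mg.
have ngR R : R \in Rs -> nonunits (hat R) g.
  by move=> /RsP [XR lt]; exact: cr_m (hat_cring (pt_oncurve XR lt)) _ mg.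
have hRs R : R \in Rs -> [/\ X R, R `<` F & nonunits (hat R) g].
  by move=> Rin; have [XR lt] := (RsP R).1 Rin; split=> //; exact: ngR.
have hV V R : valuation_ring V -> hat A `<=` V -> nonunits V g -> X R -> dominates V R -> R \in Rs.
  move=> vV DV nV XR [RV nR]; apply/RsP; split=> //; split.
    exact: subset_trans RV (val_below vV (subset_trans PD DV) Fg Pg nV).
  move=> FR; have [_ Fg'] := nP_inv Fg Pg; have Vg' := RV _ (FR _ Fg').
  by apply: (nu_not nV) => //; exact: prime_n0 pP Pg.
have h1 := len_curve Fg Pg uRs hRs (l := l).
have {}h1 := h1 _; have hn := fin_curve Fg Pg uRs hRs lD AD PD ngD hV.
have [b [Db Pb hb]] := fin_bd cD hn.
apply/len_hat => //; set N := curve_norm Rs in h1 hn hb.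
have sNN : subring N by exact: (curve_norm_subring hRs).
have DN : hat A `<=` N.
  move=> x Dx; split; first exact: cr_F cD _ Dx.
  move=> R /hRs [XR lt _]; move: Dx; have cR := hat_cring (pt_oncurve XR lt).
  apply: (sadd_min (sr_smod (cr_sub cR))); [exact: cr_A cR|exact: cr_P cR].
have sN : smod (hat A) N by apply: smod_mono DN _; exact: sr_smod.
have [l0 hl0] := fin_colen cD sN DN Db Pb hb.
have AN := subset_trans AD DN.
have sNA : smod A N by apply: smod_mono AN _; exact: sr_smod.
have sDA : smod A (hat A) by apply: smod_mono AD _; exact: sr_smod.
have Dg : hat A g by exact: AD.
have g0 := prime_n0 pP Pg.
have gD x : hat A x -> hat A (g * x) by exact: srM.
have gN x : N x -> N (g * x) by move=> Nx; apply: (srM sNN) => //; exact: DN.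
apply: ((len_index _ sDA sNA DN gD gN g0 hl0).2); apply: h1 => R Rin; have [XR lt _] := hRs R Rin.
apply/(len_hat (pt_oncurve XR lt)) => //; last exact: hl.
exact: (X_A XR).
Qed.

End Transversal.

(** * Orders of functions at a point of a curve *)

Section Order.
Variable Q : set K.
Hypothesis cQ : cring Q.
Let hQ : subring Q. Proof. exact: cr_sub cQ. Qed.

Lemma ord_mul a b la lb : Q a -> ~ P a -> Q b -> ~ P b -> len A (Q : set K^o) (prin a Q) la ->
  len A (Q : set K^o) (prin b Q) lb -> len A (Q : set K^o) (prin (a * b) Q) (la + lb).
Proof.
move=> Qa Pa Qb Pb ha hb; have a0 := prime_n0 pP Pa.
apply: (len_add AN1 ha).
have sQ := cr_smod cQ (sr_smod hQ); have sb := cr_smod cQ (prin_smod b hQ).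
have sa := cr_smod cQ (prin_smod a hQ); have sab := cr_smod cQ (prin_smod (a * b) hQ).
apply: (@len_mul1 _ A Q (prin b Q) (prin a Q) (prin (a * b) Q) a _ hA sQ sb _ sa sab _ _ _ _ hb).
- by apply: prin_sub => //; exact: sr_smod.
- by move=> _ [y Qy <-]; exists (b * y); rewrite ?mulrA //; exact: srM.
- by move=> x Qx; exists x.
- move=> _ [x Qx <-]; exists x => //; rewrite subrr; exact: sm0 sab.
- move=> x Qx; split; last by move=> [y Qy <-]; exists y; rewrite ?mulrA.
  by move=> [y Qy /esym]; rewrite -mulrA => /(mulfI a0) ->; exists y.
Qed.

Lemma ord_unit a l : Q a -> Q a^-1 -> a != 0 -> len A (Q : set K^o) (prin a Q) l -> l = 0%N.
Proof.
move=> Qa Qa' a0; have -> : prin a Q = Q.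
  rewrite eqEsubset; split; first by apply: prin_sub => //; exact: sr_smod.
  by move=> x Qx; exists (a^-1 * x); rewrite ?mulVKf //; exact: srM.
by move=> h; apply: (len_uniq h); apply: len0; exact: cr_smod cQ (sr_smod hQ).
Qed.

(** The order of the rational function [u] on the curve at the point [Q]. *)
Definition cdeg (u : K) : int := xget 0 [set n | exists a b la lb,
  [/\ Q a /\ ~ P a, Q b /\ ~ P b, u * b = a, len A (Q : set K^o) (prin a Q) la /\
   len A (Q : set K^o) (prin b Q) lb & n = la%:Z - lb%:Z]].

Lemma cdegE a b la lb u : Q a -> ~ P a -> Q b -> ~ P b -> u * b = a ->
  len A (Q : set K^o) (prin a Q) la -> len A (Q : set K^o) (prin b Q) lb -> cdeg u = la%:Z - lb%:Z.
Proof.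
move=> Qa Pa Qb Pb E ha hb; rewrite /cdeg; case: xgetP => [n -> |/(_ (la%:Z - lb%:Z))].
  move=> [a' [b' [la' [lb' [[Qa' Pa'] [Qb' Pb'] E' [ha' hb'] ->]]]]].
  have h1 := ord_mul Qa Pa Qb' Pb' ha hb'; have h2 := ord_mul Qa' Pa' Qb Pb ha' hb.
  have e : a * b' = a' * b by rewrite -E -E'; ring.
  by rewrite e in h1; have := len_uniq h1 h2; lia.
by case; exists a, b, la, lb.
Qed.

Lemma cdeg_ex u : F u -> ~ P u -> exists a b la lb, [/\ Q a /\ ~ P a, Q b /\ ~ P b, u * b = a,
  len A (Q : set K^o) (prin a Q) la /\ len A (Q : set K^o) (prin b Q) lb & cdeg u = la%:Z - lb%:Z].
Proof.
move=> Fu Pu; have [b [Qb Pb Qbu]] := cr_frac cQ Fu.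
have Pbu : ~ P (u * b) by apply: (prime_nmul pP) => //; exact: cr_F cQ _ Qb.
rewrite mulrC in Qbu; have [la ha] := cr_len cQ Qbu Pbu; have [lb hb] := cr_len cQ Qb Pb.
exists (u * b), b, la, lb; split=> //; exact: (cdegE Qbu Pbu Qb Pb).
Qed.

Lemma cdegM u v : F u -> ~ P u -> F v -> ~ P v -> cdeg (u * v) = cdeg u + cdeg v.
Proof.
move=> Fu Pu Fv Pv.
have [a [b [la [lb [[Qa Pa] [Qb Pb] E [ha hb] ->]]]]] := cdeg_ex Fu Pu.
have [c [d [lc [ld [[Qc Pc] [Qd Pd] E' [hc hd] ->]]]]] := cdeg_ex Fv Pv.
have QF := cr_F cQ.
rewrite (cdegE (a := a * c) (b := b * d) (la := la + lc) (lb := lb + ld)); first by lia.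
- exact: srM.
- by apply: (prime_nmul pP) => //; exact: QF.
- exact: srM.
- by apply: (prime_nmul pP) => //; exact: QF.
- by rewrite mulrACA E E'.
- exact: ord_mul.
- exact: ord_mul.
Qed.

Lemma cdegX u n : F u -> ~ P u -> cdeg (u ^+ n) = cdeg u *+ n.
Proof.
move=> Fu Pu; elim: n => [|n IH].
  have P1 := prime_n1 pP; have [l hl] := cr_len cQ (sr1 hQ) P1.
  by rewrite (cdegE (sr1 hQ) P1 (sr1 hQ) P1 _ hl hl) ?mulr1 // subrr.
rewrite exprS cdegM // ?IH ?mulrS //; first exact: srX.
by move/(prime_exp hF pP Fu).
Qed.

Lemma cdeg_unit u : Q u -> Q u^-1 -> u != 0 -> cdeg u = 0.
Proof.
move=> Qu Qu' u0; have P1 := prime_n1 pP; have QF := cr_F cQ.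
have Pu : ~ P u by move=> h; apply: (nu_not h u0); exact: QF.
have [l hl] := cr_len cQ Qu Pu; have [l1 hl1] := cr_len cQ (sr1 hQ) P1.
rewrite (cdegE Qu Pu (sr1 hQ) P1 _ hl hl1) ?mulr1 //.
rewrite (ord_unit _ _ _ hl) // (ord_unit _ _ _ hl1) ?invr1 ?oner_neq0 //; exact: sr1.
Qed.

Lemma cdeg_int u l : Q u -> ~ P u -> len A (Q : set K^o) (prin u Q) l -> cdeg u = l%:Z.
Proof.
move=> Qu Pu hl; have P1 := prime_n1 pP; have [l1 hl1] := cr_len cQ (sr1 hQ) P1.
rewrite (cdegE Qu Pu (sr1 hQ) P1 _ hl hl1) ?mulr1 //.
by rewrite (ord_unit _ _ _ hl1) ?invr1 ?oner_neq0 ?subr0 //; exact: sr1.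
Qed.

Lemma cdegV u : F u -> ~ P u -> cdeg u^-1 = - cdeg u.
Proof.
move=> Fu Pu; have [u0 Fu'] := nP_inv Fu Pu.
have Pu' : ~ P u^-1 by move=> h; apply: (nu_not h); rewrite ?invr_neq0 // invrK.
apply/eqP; rewrite -addr_eq0 -cdegM // mulVf //; apply/eqP.
by apply: cdeg_unit; rewrite ?invr1 ?oner_neq0 //; exact: sr1.
Qed.

Lemma pole_clear z t : F z -> nonunits Q t -> exists N, forall n, (N <= n)%N -> Q (t ^+ n * z).
Proof.
move=> Fz nt; have [b [Qb Pb Qbz]] := cr_frac cQ Fz; have [N hN] := cr_pow cQ Qb Pb.
have [w Qw E] : prin b Q (t ^+ N) by rewrite -[N]card_ord -prodr_const; exact: (hN (fun=> t)).
exists N => n le; rewrite -(subnK le) exprD -E.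
have -> : t ^+ (n - N) * (b * w) * z = t ^+ (n - N) * w * (b * z) by ring.
by apply: srM => //; apply: srM => //; apply: srX => //; exact: nu_sub.
Qed.

End Order.

(** * Functions on an exceptional curve and the subfield [k(t)] *)

Section Exceptional.
Hypothesis eF : exceptional A X F.
Let mP : nonunits A `<=` P. Proof. by case: eF => _ []. Qed.
Let AF : A `<=` F. Proof. by case: eF => _ []. Qed.
Let Fj c : F (j c). Proof. by apply/AF/jA. Qed.
Lemma ev1_sr S q t : subring S -> (forall c, S (j c)) -> S t -> S (ev1 q t).
Proof. by move=> hS Sj St; rewrite /ev1; apply: (pin_sr hS _ St) => i; rewrite coef_map; exact: Sj. Qed.

Lemma ev1B q r t : ev1 (q - r) t = ev1 q t - ev1 r t.
Proof. by rewrite /ev1 rmorphB /= hornerD hornerN. Qed.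
Lemma ev1M q r t : ev1 (q * r) t = ev1 q t * ev1 r t.
Proof. by rewrite /ev1 rmorphM hornerM. Qed.
Lemma ev1C c t : ev1 c%:P t = j c.
Proof. by rewrite /ev1 map_polyC hornerC. Qed.
Lemma ev1_X t : ev1 'X t = t.
Proof. by rewrite /ev1 map_polyX hornerX. Qed.
Lemma ev1E n q t : ev1 (q ^+ n) t = ev1 q t ^+ n.
Proof. by rewrite /ev1 rmorphXn /= horner_exp. Qed.

(** The class of [t] in [F / P] is outside [k], hence transcendental over [k] ([transcP]). *)
Definition transc t := forall c, ~ P (t - j c).

Lemma transcP t q : F t -> transc t -> P (ev1 q t) -> q = 0.
Proof.
move=> Ft tr h; apply: contrapT => /eqP q0.
by have [c] := root_prime pP AF Ft hF q0 h; exact: tr.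
Qed.

Lemma transcV t : F t -> transc t -> transc t^-1.
Proof.
move=> Ft tr c h.
have Pt : ~ P t by have := tr 0; rewrite rmorph0 subr0.
have [t0 Ft'] := nP_inv Ft Pt; case: (eqVneq c 0) => c0.
  by move: h; rewrite c0 rmorph0 subr0 => h; apply: (nu_not h); rewrite ?invr_neq0 // invrK.
apply: (tr c^-1); have -> : t - j c^-1 = (- t / j c) * (t^-1 - j c).
  by rewrite fmorphV; field; rewrite t0 j_eq0.
by apply: (smM sP) => //; apply: (srM hF); [exact: srN|rewrite -fmorphV].
Qed.

(** [k[t]_(t) + P] *)
Definition tloc t : set K := [set x | F x /\ exists q s, s.[0] != 0 /\ P (x * ev1 s t - ev1 q t)].
(** The inverse image in [F] of the subfield [k(t)] of [F / P]. *)
Definition tfield t : set K := [set x | forall S, subring S -> P `<=` S -> (forall c, S (j c)) -> S t ->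
  (forall y, S y -> ~ P y -> S y^-1) -> S x].

Section Tloc.
Variable t : K.
Hypotheses (Ft : F t) (tr : transc t).
Let Pt : ~ P t. Proof. by have := @tr 0; rewrite rmorph0 subr0. Qed.
Let t0 : t != 0. Proof. by have [] := nP_inv Ft Pt. Qed.
Let Ft' : F t^-1. Proof. by have [] := nP_inv Ft Pt. Qed.
Let Fev q : F (ev1 q t). Proof. exact: ev1_sr. Qed.

Lemma tloc_P : P `<=` tloc t.
Proof.
move=> p Pp; split; first exact: nu_sub.
exists 0, 1; rewrite hornerC oner_neq0; split=> //.
by rewrite -[0]/(0%:P) -[1]/(1%:P) !ev1C rmorph0 rmorph1 mulr1 subr0.
Qed.

Lemma tloc_ev q : tloc t (ev1 q t).
Proof.
split=> //; exists q, 1; rewrite hornerC oner_neq0; split=> //.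
by rewrite -[1]/(1%:P) ev1C rmorph1 mulr1 subrr; exact: sm0 sP.
Qed.

Lemma tloc_sub : subring (tloc t).
Proof.
split.
- by have := tloc_ev 1; rewrite -[1]/(1%:P) ev1C rmorph1.
- move=> x y [Fx [q [s [s0 h]]]] [Fy [q' [s' [s0' h']]]]; split; first exact: srB.
  exists (q * s' - q' * s), (s * s'); rewrite hornerM mulf_neq0 //; split=> //.
  rewrite ev1B !ev1M.
  have -> : (x - y) * (ev1 s t * ev1 s' t) - (ev1 q t * ev1 s' t - ev1 q' t * ev1 s t) =
    ev1 s' t * (x * ev1 s t - ev1 q t) - ev1 s t * (y * ev1 s' t - ev1 q' t) by ring.
  by apply: (smB hF sP); apply: (smM sP).
- move=> x y [Fx [q [s [s0 h]]]] [Fy [q' [s' [s0' h']]]]; split; first exact: srM.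
  exists (q * q'), (s * s'); rewrite hornerM mulf_neq0 //; split=> //.
  rewrite !ev1M.
  have -> : x * y * (ev1 s t * ev1 s' t) - ev1 q t * ev1 q' t =
    (y * ev1 s' t) * (x * ev1 s t - ev1 q t) + ev1 q t * (y * ev1 s' t - ev1 q' t) by ring.
  by apply: (smD sP); apply: (smM sP) => //; exact: srM.
Qed.
Let hD := tloc_sub.

Lemma tloc_t : tloc t t. Proof. by have := tloc_ev 'X; rewrite ev1_X. Qed.
Lemma tloc_j c : tloc t (j c). Proof. by have := tloc_ev c%:P; rewrite ev1C. Qed.

Lemma tloc_Pt : P `<=` prin t (tloc t).
Proof.
move=> p Pp; apply/(prinP _ _ t0); apply: tloc_P; exact: smMr sP _ _.
Qed.

Lemma tloc_prin x : tloc t x -> prin t (tloc t) x \/ x != 0 /\ tloc t x^-1.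
Proof.
move=> [Fx [q [s [s0 h]]]]; case: (eqVneq q.[0] 0) => q0.
  left; have /factor_theorem [r qE] : root q 0 by apply/eqP.
  rewrite subr0 in qE.
  have Ps : ~ P (ev1 s t).
    by move=> /(transcP Ft tr) E; move: s0; rewrite E horner0 eqxx.
  have [sn0 Fs] := nP_inv (Fev s) Ps.
  apply/(prinP _ _ t0); split; first exact: srM.
  exists r, s; split=> //.
  have -> : x / t * ev1 s t - ev1 r t = t^-1 * (x * ev1 s t - ev1 q t).
    by rewrite qE ev1M ev1_X; field.
  exact: smM sP _ _.
right; have Pq : ~ P (ev1 q t).
  by move=> /(transcP Ft tr) E; move: q0; rewrite E horner0 eqxx.
have Px : ~ P x.
  move=> Px; apply: Pq; have -> : ev1 q t = x * ev1 s t - (x * ev1 s t - ev1 q t) by ring.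
  by apply: (smB hF sP) => //; exact: smMr sP _ _.
have [x0 Fx'] := nP_inv Fx Px; split=> //; split=> //.
exists s, q; split=> //.
have -> : x^-1 * ev1 q t - ev1 s t = - x^-1 * (x * ev1 s t - ev1 q t) by field.
by apply: (smM sP) => //; exact: srN.
Qed.

Lemma tloc_nt : ~ tloc t t^-1.
Proof.
move=> [_ [q [s [s0 h]]]].
have : P (ev1 (s - 'X * q) t).
  rewrite ev1B ev1X; have -> : ev1 s t - t * ev1 q t = t * (t^-1 * ev1 s t - ev1 q t) by field.
  exact: smM sP _ _.
move=> /(transcP Ft tr) /(congr1 (horner^~ 0)).
by rewrite !hornerE subr0 => E; rewrite E eqxx in s0.
Qed.

Lemma tloc_nu : nonunits (tloc t) = prin t (tloc t).
Proof.
rewrite eqEsubset; split.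
  move=> x nx; have [//|[x0 Dx']] := tloc_prin (nu_sub nx).
  by case: (nu_not nx x0).
move=> x [y Dy <-]; split; first by apply: (srM hD) => //; exact: tloc_t.
move=> [z Dz E]; apply: tloc_nt; have -> : t^-1 = y * z.
  by apply: (mulfI t0); rewrite mulfV // mulrA.
exact: (srM hD).
Qed.

Lemma tloc_local : local_ring (tloc t).
Proof.
split; first exact: hD.
split; first exact: nu_sub.
rewrite tloc_nu; exact: prin_smod.
Qed.

Lemma tloc_res x : tloc t x -> exists c, prin t (tloc t) (x - j c).
Proof.
move=> Dx; have [Fx [q [s [s0 h]]]] := Dx.
exists (q.[0] / s.[0]); set c := _ / _.
have [//|[x0 Dx']] : prin t (tloc t) (x - j c) \/ x - j c != 0 /\ tloc t (x - j c)^-1.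
  apply: tloc_prin; apply: (srB hD) => //; exact: tloc_j.
set y := x - j c in x0 Dx' *.
have hy : P (y * ev1 s t - ev1 (q - c%:P * s) t).
  rewrite ev1B ev1M ev1C /y; have -> : (x - j c) * ev1 s t - (ev1 q t - j c * ev1 s t) =
    x * ev1 s t - ev1 q t by ring.
  done.
have /factor_theorem [r qE] : root (q - c%:P * s) 0.
  by apply/eqP; rewrite !hornerE /c divfK // subrr.
rewrite subr0 in qE; apply/(prinP _ _ t0); split.
  by apply: (srM hF) => //; apply: (srB hF).
exists r, s; split=> //; rewrite qE ev1M ev1_X in hy.
have -> : y / t * ev1 s t - ev1 r t = t^-1 * (y * ev1 s t - ev1 r t * t) by field.
exact: smM sP _ _.
Qed.

Lemma tfield_sub : subring (tfield t).
Proof.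
split.
- by move=> S hS *; exact: sr1.
- by move=> x y hx hy S h1 h2 h3 h4 h5; apply: srB => //; [exact: hx|exact: hy].
- by move=> x y hx hy S h1 h2 h3 h4 h5; apply: srM => //; [exact: hx|exact: hy].
Qed.

Lemma tfield_inv x : tfield t x -> ~ P x -> tfield t x^-1.
Proof. by move=> hx Px S h1 h2 h3 h4 h5; apply: (h5 x) => //; exact: (hx S). Qed.

Lemma tfield_P : P `<=` tfield t. Proof. by move=> p Pp S h1 h2 *; exact: h2. Qed.
Lemma tfield_j c : tfield t (j c). Proof. by move=> S h1 h2 h3 *; exact: h3. Qed.
Lemma tfield_t : tfield t t. Proof. by []. Qed.
Lemma tfield_F : tfield t `<=` F.
Proof. move=> x hx; apply: (hx F) => //; [exact: nu_sub|by move=> y Fy /(nP_inv Fy) []]. Qed.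

Lemma tloc_field : tloc t `<=` tfield t.
Proof.
move=> x [Fx [q [s [s0 h]]]]; have hL := tfield_sub.
have Lev r : tfield t (ev1 r t) by apply: (ev1_sr _ hL); [exact: tfield_j|exact: tfield_t].
have Ps : ~ P (ev1 s t) by move=> /(transcP Ft tr) E; move: s0; rewrite E horner0 eqxx.
have [sn0 Fs] := nP_inv (Fev s) Ps.
have -> : x = (ev1 q t + (x * ev1 s t - ev1 q t)) * (ev1 s t)^-1 by field.
apply: (srM hL); last exact: tfield_inv.
by apply: (srD hL) => //; exact: tfield_P.
Qed.

(** As [tfield] is a smallest ring, it suffices that the elements with this property form a ring of
    the required kind; for inverses, [t] is factored out of the numerator. *)
Lemma tfield_pole x : tfield t x -> exists N, tloc t (t ^+ N * x).
Proof.
have Dt : tloc t t by exact: tloc_t.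
move=> hx; have [_] : F x /\ exists N, tloc t (t ^+ N * x); last by [].
apply: (hx [set x | F x /\ exists N, tloc t (t ^+ N * x)]).
- split.
  + by split; [exact: sr1|exists 0; rewrite mulr1; exact: sr1].
  + move=> y z [Fy [n hy]] [Fz [m hz]]; split; first exact: srB.
    exists (n + m)%N; have -> : t ^+ (n + m) * (y - z) = t ^+ m * (t ^+ n * y) - t ^+ n * (t ^+ m * z).
      by rewrite exprD; ring.
    by apply: (srB hD); apply: (srM hD) => //; exact: (srX _ hD).
  + move=> y z [Fy [n hy]] [Fz [m hz]]; split; first exact: srM.
    by exists (n + m)%N; rewrite exprD mulrACA; exact: (srM hD).
- by move=> p Pp; split; [exact: nu_sub|exists 0; rewrite mul1r; exact: tloc_P].
- by move=> c; split=> //; exists 0; rewrite mul1r; exact: tloc_j.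
- by split=> //; exists 0; rewrite mul1r.
- move=> y [Fy [n hy]] Py; have [y0 Fy'] := nP_inv Fy Py; split=> //.
  have [_ [q [s [s0 h]]]] := hy.
  have Ps : ~ P (ev1 s t) by move=> /(transcP Ft tr) E; move: s0; rewrite E horner0 eqxx.
  have q0 : q != 0.
    apply/eqP => q0; move: h; rewrite q0 -[0]/(0%:P) ev1C rmorph0 subr0.
    apply: (prime_nmul pP) => //; first by apply: srM => //; exact: srX.
    by apply: (prime_nmul pP) => //; [exact: srX|move/(prime_exp hF pP Ft)].
  have [m [q' ]] := multiplicity_XsubC q 0; rewrite q0 subr0 /= => q0' qE.
  have ty0 : t ^+ n * y != 0 by rewrite mulf_neq0 ?expf_neq0.
  have Fty : F (t ^+ n * y)^-1 by rewrite invfM -exprVn; apply: srM => //; exact: srX.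
  exists m; have -> : t ^+ m * y^-1 = t ^+ n * (t ^+ m * (t ^+ n * y)^-1).
    by field; rewrite y0 expf_neq0.
  apply: (srM hD (srX n hD Dt)); split; first by apply: srM => //; exact: srX.
  exists s, q'; split; first by [].
  have -> : t ^+ m / (t ^+ n * y) * ev1 q' t - ev1 s t = - (t ^+ n * y)^-1 * (t ^+ n * y * ev1 s t - ev1 q t).
    by rewrite qE ev1M ev1E ev1_X mulNr mulrBr opprB mulKf //; ring.
  by apply: (smM sP) => //; exact: srN.
Qed.

End Tloc.

(** One field for [t] and [1 / t]: the degree of [F / P] over it counts the zeros of [t] and also
    its poles. *)
Lemma tfieldV t : F t -> ~ P t -> tfield t^-1 = tfield t.
Proof.
have sub u : F u -> ~ P u -> tfield u^-1 `<=` tfield u.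
  move=> Fu Pu x hx S h1 h2 h3 h4 h5; apply: (hx S) => //; exact: h5.
move=> Ft Pt; have [t0 Ft'] := nP_inv Ft Pt; rewrite eqEsubset; split; first exact: sub.
have := sub t^-1 Ft' _; rewrite invrK; apply=> h.
by apply: (nu_not h); rewrite ?invr_neq0 // invrK.
Qed.

(** * Bases over [k(t)] and lengths of lattices *)

Section Span.
Variable L : set K.
Hypotheses (hL : subring L) (PL : P `<=` L) (LF : L `<=` F).
Hypothesis LV : forall x, L x -> ~ P x -> L x^-1.

Definition spans (zs : seq K) := F `<=` sadd (lin L zs) P.
(** Linear independence over the field [L / P] in triangular form: no entry depends on the later
    ones modulo [P]. *)
Fixpoint indep (zs : seq K) : Prop :=
  if zs is z :: zs' then (forall a y, L a -> lin L zs' y -> P (a * z + y) -> P a) /\ indep zs' else True.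

Lemma span_smod (C : set K) zs : smod L C -> smod L (sadd (lin C zs) P).
Proof. by move=> sC; apply: sadd_smod; [exact: lin_smod|exact: smod_mono LF sP]. Qed.

Lemma span_min zs : (forall z, z \in zs -> F z) -> spans zs ->
  exists ws : seq K, [/\ forall z, z \in ws -> F z, spans ws & indep ws].
Proof.
elim: (size zs) {-2}zs (leqnn (size zs)) => [|n IH] {}zs sz Fz szs.
  by exists zs; split=> //; move: sz; rewrite leqn0 size_eq0 => /eqP ->.
case: (pselect (indep zs)) => [h|h]; first by exists zs.
have [pre [z [zs' [E [a [y [La ly h1 Pa]]]]]]] : exists pre z zs', zs = pre ++ z :: zs' /\
    exists a y, [/\ L a, lin L zs' y, P (a * z + y) & ~ P a].
  elim: (zs) h => [|z zs' IHz] h; first by case: h.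
  case: (pselect (indep zs')) => hz.
    apply: contrapT => h'; apply: h; split=> // a y La ly h1; apply: contrapT => Pa; apply: h'.
    by exists [::], z, zs'; split=> //; exists a, y.
  by have [pre [z1 [zs1 [-> h1]]]] := IHz hz; exists (z :: pre), z1, zs1.
apply: (IH (pre ++ zs')).
- by move: sz; rewrite E !size_cat /= addnS.
- by move=> x; rewrite mem_cat => hx; apply: Fz; rewrite E mem_cat inE; case/orP: hx => ->; rewrite ?orbT.
apply: (subset_trans szs); have sS : smod L (sadd (lin L (pre ++ zs')) P).
  by apply: span_smod; exact: sr_smod.
have sL : smod L (lin L (pre ++ zs')) by apply: lin_smod; exact: sr_smod.
apply: (sadd_min sS); last by apply: sadd_subr; exact: sm0 sL.
have memS x : x \in pre ++ zs' -> sadd (lin L (pre ++ zs')) P x.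
  by move=> hx; apply: (@sadd_subl _ _ P); [exact: sm0 sP|exact: lin_mem].
apply: (@lin_sub _ L) => // x; rewrite E mem_cat inE => /or3P [hx|/eqP ->|hx].
- by apply: memS; rewrite mem_cat hx.
- have [a0 Fa'] := nP_inv (LF La) Pa; have La' := LV La Pa.
  have -> : z = - a^-1 * y + a^-1 * (a * z + y) by field.
  apply: (smD sS).
    apply: (smM sS); first exact: srN.
    apply: (@sadd_subl _ _ P); first exact: sm0 sP.
    by move: ly; apply: (@lin_sub _ L) => // w hw; apply: lin_mem => //; rewrite mem_cat hw orbT.
  by apply: (smM sS) => //; apply: sadd_subr => //; exact: sm0 sL.
- by apply: memS; rewrite mem_cat hx orbT.
Qed.

Lemma indep_P zs y : indep zs -> (forall z, z \in zs -> F z) -> lin L zs y -> P y -> lin P zs y.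
Proof.
elim: zs y => [|z zs IH] y //= [h hz] Fz [a [w [La lw ->]]] Pa.
have Pa' : P a by exact: h lw Pa.
exists a, w; split=> //; apply: IH => //; first by move=> x hx; apply: Fz; rewrite inE hx orbT.
have -> : w = a * z + w - a * z by ring.
apply: (smB hF sP) => //; apply: (smMr sP) => //; apply: Fz; exact: mem_head.
Qed.

Lemma lin_mono (C C' : set K) zs : C `<=` C' -> lin C zs `<=` lin C' zs.
Proof.
move=> CC; elim: zs => [|z zs IH] //= x [a [y [Ca ly ->]]].
by exists a, y; split=> //; [exact: CC|exact: IH].
Qed.

Lemma lin_scale (C : set K) t zs : prin t (lin C zs) = lin (prin t C) zs.
Proof.
elim: zs => [|z zs IH] /=.
  by rewrite eqEsubset; split=> [x [y -> <-]|x ->]; [rewrite mulr0|exists 0; rewrite ?mulr0].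
rewrite eqEsubset; split=> x.
  move=> [_ [a [y [Ca ly ->]]] <-]; exists (t * a), (t * y).
  by split; [exists a|rewrite -IH; exists y|ring].
move=> [_ [w [[a Ca <-] + ->]]]; rewrite -IH => -[y ly <-].
by exists (a * z + y); [exists a, y|ring].
Qed.

Variables (D : set K) (t : K).
Hypotheses (hD : subring D) (AD : A `<=` D) (DL : D `<=` L) (Dt : D t) (PD : P `<=` prin t D).
Hypotheses (resD : forall x, D x -> exists c, prin t D (x - j c)) (Pt : ~ P t) (nt : ~ prin t D 1).
Let DF : D `<=` F. Proof. exact: subset_trans LF. Qed.
Let Ft : F t. Proof. exact: DF. Qed.
Let sD : smod A D. Proof. by apply: smod_mono AD _; exact: sr_smod. Qed.
Let stD : smod D (prin t D). Proof. exact: prin_smod. Qed.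
Let stA : smod A (prin t D). Proof. exact: smod_mono AD _. Qed.
Let sPA : smod A P. Proof. by apply: smod_mono sP; exact: subset_trans AD DF. Qed.
Let tDD : prin t D `<=` D. Proof. by apply: prin_sub => //; exact: sr_smod. Qed.

Definition lat (C : set K) zs := sadd (lin C zs) P.

Let len_k : len A (D : set K^o) (prin t D) 1.
Proof.
have [_ mD] : subring D /\ nonunits A `<=` prin t D.
  by split=> //; exact: subset_trans mP PD.
have E : D = sadd (prin t D) (prin 1 A).
  rewrite eqEsubset; split; last first.
    by apply: (sadd_min sD) => // _ [a Aa <-]; rewrite mul1r; exact: AD.
  move=> x /resD [c hc]; exists (x - j c), (j c); split=> //; last by rewrite subrK.
  by exists (j c); rewrite ?mul1r.
rewrite [X in len A X _ _]E; apply: (len_simple residual_AA) => //; first exact: sr1.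
by move=> v /mD; rewrite mulr1.
Qed.

Let lat_smod C zs : smod A C -> smod A (lat C zs).
Proof. by move=> sC; apply: sadd_smod => //; exact: lin_smod. Qed.

(** Each basis element contributes [D / t D], which has length one because the residue field is
    [k]. *)
Lemma lat_len zs : indep zs -> (forall z, z \in zs -> F z) ->
  len A (lat D zs : set K^o) (lat (prin t D) zs) (size zs).
Proof.
elim: zs => [|z zs IH] /=.
  by move=> _ _; apply: len0; exact: lat_smod.
move=> [h hz] Fz; have Fz1 := Fz z (mem_head _ _).
have Fzs x : x \in zs -> F x by move=> hx; apply: Fz; rewrite inE hx orbT.
pose W : set K := [set x | exists a y, [/\ prin t D a, lat D zs y & x = a * z + y]].
have sl := lat_smod zs sD; have slt := lat_smod zs stA.
have sW : smod A W.
  split.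
  - by exists 0, 0; split; [exact: sm0 stA|exact: sm0 sl|rewrite mul0r addr0].
  - move=> _ _ [a [y [ha hy ->]]] [a' [y' [ha' hy' ->]]]; exists (a + a'), (y + y').
    by split; [exact: smD stA _ _|exact: smD sl _ _|ring].
  - move=> c _ Ac [a [y [ha hy ->]]]; exists (c * a), (c * y).
    by split; [exact: smM stA _ _|exact: smM sl _ _|rewrite /GRing.scale /=; ring].
have latE C x : lat C (z :: zs) x <-> exists a y, [/\ C a, lat C zs y & x = a * z + y].
  split.
    move=> [_ [p [[a [y [Ca ly ->]]] Pp ->]]]; exists a, (y + p); split=> //; last by ring.
    by exists y, p.
  move=> [a [_ [Ca [y [p [ly Pp ->]]] ->]]]; exists (a * z + y), p; split=> //; last by ring.
  by exists a, y.
have tsub : lat (prin t D) zs `<=` lat D zs.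
  move=> _ [y [p [ly Pp ->]]]; exists y, p; split=> //; exact: lin_mono ly.
have W1 : W `<=` lat D (z :: zs).
  by move=> x [a [y [ha hy E]]]; apply/latE; exists a, y; split=> //; exact: tDD.
have W2 : lat (prin t D) (z :: zs) `<=` W.
  by move=> x /latE [a [y [ha hy E]]]; exists a, y; split=> //; exact: tsub.
have lL y : lin D zs y -> lin L zs y by exact: lin_mono.
have h1 : len A (lat D (z :: zs) : set K^o) W 1.
  apply: (@len_mul1 _ A D (prin t D) _ W z _ hA sD stA tDD (lat_smod _ sD) sW W1 _ _ _ len_k).
  + move=> x Dx; apply/latE; exists x, 0; split=> //; [exact: sm0 sl|ring].
  + move=> x /latE [a [y [Da hy ->]]]; exists a => //; exists 0, y.
    by split=> //; [exact: sm0 stA|ring].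
  + move=> x Dx; split.
      move=> [a [_ [ha [y [p [ly Pp ->]]] E]]].
      have : P (x - a).
        apply: (h _ (- y)).
        * by apply: DL; apply: srB => //; exact: tDD.
        * by apply: (smN hL (lin_smod _ (sr_smod hL))); exact: lL.
        * have -> : (x - a) * z - y = p by rewrite mulrBl [x * z]mulrC E; ring.
          done.
      by move=> /PD hx; rewrite -(subrK a x); exact: smD stD _ _.
    by move=> hx; exists x, 0; split=> //; [exact: sm0 sl|ring].
have h2 : len A (W : set K^o) (lat (prin t D) (z :: zs)) (size zs).
  apply: (@len_mul1 _ A (lat D zs) (lat (prin t D) zs) W _ 1 _ hA sl slt tsub sW (lat_smod _ stA) W2 _ _ _ (IH hz Fzs)).
  + by move=> x hx; exists 0, x; split=> //; [exact: sm0 stA|ring].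
  + move=> _ [a [y [ha hy ->]]]; exists y => //; apply/latE; exists a, 0.
    by split=> //; [exact: sm0 slt|ring].
  + move=> x hx; rewrite mul1r; split; last first.
      by move=> hx'; apply/latE; exists 0, x; split=> //; [exact: sm0 stA|ring].
    move=> /latE [a [_ [ha [y [p [ly Pp ->]]] E]]].
    have [y' [p' [ly' Pp' E']]] := hx.
    have sLz : smod L (lin L zs) by apply: lin_smod; exact: sr_smod.
    have lyL : lin L zs y by apply: lL; exact: lin_mono ly.
    have Pa : P a.
      apply: (h a (y - y')); [by apply/DL/tDD|apply: (smB hL sLz) => //; exact: lL|].
      have -> : a * z + (y - y') = p' - p by rewrite -[p'](addrK y') [p' + y']addrC -E' E; ring.
      exact: smB hF sP _ _.
    have : lin P zs (y' - y).
      apply: indep_P => //; first by apply: (smB hL sLz) => //; exact: lL.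
      have -> : y' - y = a * z + (p - p') by rewrite -[y'](addrK p') -E' E; ring.
      by apply: (smD sP); [apply: (smMr sP)|exact: smB hF sP _ _].
    move=> /(lin_mono PD) h2; exists y', p'; split=> //.
    rewrite -(subrK y y'); apply: (smD (lin_smod zs stD)) => //.
exact: (len_add AN1 h1 h2).
Qed.

Lemma lat_prin zs : lat (prin t D) zs = prin t (lat D zs).
Proof.
have [t0 Ft'] := nP_inv Ft Pt.
rewrite eqEsubset; split=> x.
  move=> [y [p [+ Pp ->]]]; rewrite -lin_scale => -[w lw <-].
  exists (w + t^-1 * p); last by rewrite mulrDr mulVKf.
  exists w, (t^-1 * p); split=> //; exact: smM sP _ _.
move=> [_ [w [p [lw Pp ->]]] <-]; exists (t * w), (t * p); split; [|exact: smM sP _ _|ring].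
by rewrite -lin_scale; exists w.
Qed.

(** Any lattice in [F] has the colength of its [t]-multiple given by the basis. *)
Lemma lat_index zs J a b : indep zs -> (forall z, z \in zs -> F z) -> smod A J ->
  (forall x, J x -> J (t * x)) -> (forall x, lat D zs x -> J (t ^+ b * x)) ->
  (forall x, J x -> lat D zs (t ^+ a * x)) -> len A (J : set K^o) (prin t J) (size zs).
Proof.
move=> iz Fz sJ tJ hb ha; have [t0 _] := nP_inv Ft Pt.
set N := lat D zs; have sN : smod A N by exact: lat_smod.
have sND : smod D N by apply: sadd_smod; [apply: lin_smod; exact: sr_smod|exact: smod_mono DF sP].
have tN x : N x -> N (t * x) by move=> Nx; exact: smM sND _ _.
have hN : len A (N : set K^o) (prin t N) (size zs) by rewrite -lat_prin; exact: lat_len.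
have pw n : exists l, len A (N : set K^o) (prin (t ^+ n) N) l.
  elim: n => [|n [l IH]].
    exists 0%N; have -> : prin (t ^+ 0) N = N.
      by rewrite eqEsubset expr0; split=> [_ [x Nx <-]|x Nx]; [rewrite mul1r|exists x; rewrite ?mul1r].
    exact: len0.
  exists (l + size zs)%N; apply: (len_add AN1 IH).
  have tn0 : t ^+ n != 0 by rewrite expf_neq0.
  have stn m : smod A (prin (t ^+ m) N) by exact: img_smod.
  apply: (@len_mul1 _ A N (prin t N) _ _ (t ^+ n) _ hA sN (img_smod t sN) _ (stn n) (stn n.+1) _ _ _ _ hN).
  - by move=> _ [x Nx <-]; exact: tN.
  - by move=> _ [x Nx <-]; exists (t * x); [exact: tN|rewrite exprS; ring].
  - by move=> x Nx; exists x.
  - move=> _ [x Nx <-]; exists x => //; rewrite subrr; exact: sm0 (stn n.+1).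
  - move=> x Nx; split; last by move=> [y Ny <-]; exists y => //; rewrite exprS; ring.
    by move=> [y Ny E]; exists y => //; apply: (mulfI tn0); rewrite -E exprS; ring.
have [l hl] := pw (a + b)%N.
set N0 := prin (t ^+ b) N; have sN0 : smod A N0 by exact: img_smod.
have N0J : N0 `<=` J by move=> _ [x Nx <-]; exact: hb.
have [l0 hl0] : exists l0, len A (J : set K^o) N0 l0.
  have sta : smod A (prin (t ^+ a) J) by exact: img_smod.
  have [||l' hl' _] := len_sub AN1 hl sta.
  - by move=> _ [x Nx <-]; exists (t ^+ b * x); [exact: hb|rewrite exprD mulrA].
  - by move=> _ [x Jx <-]; exact: ha.
  exists l'.
  have ta0 : t ^+ a != 0 by rewrite expf_neq0.
  apply: (@len_mul2 _ A J N0 _ _ (t ^+ a) _ hA sJ sN0 N0J sta (img_smod _ sN) _ _ _ _ hl').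
  - by move=> _ [x Nx <-]; exists (t ^+ b * x); [exact: hb|rewrite exprD mulrA].
  - by move=> x Jx; exists x.
  - move=> _ [x Jx <-]; exists x => //; rewrite subrr; exact: sm0 (img_smod _ sN).
  - move=> x Jx; split; last by move=> [y Ny <-]; exists y => //; rewrite exprD mulrA.
    by move=> [y Ny E]; exists y => //; apply: (mulfI ta0); rewrite -E exprD mulrA.
have tN0 x : N0 x -> N0 (t * x).
  by move=> [y Ny <-]; exists (t * y); [exact: tN|ring].
apply: (len_index _ sN0 sJ N0J tN0 tJ t0 hl0).1.
have tb0 : t ^+ b != 0 by rewrite expf_neq0.
apply: (@len_mul1 _ A N (prin t N) _ _ (t ^+ b) _ hA sN (img_smod t sN) _ sN0 (img_smod t sN0) _ _ _ _ hN).
- by move=> _ [x Nx <-]; exact: tN.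
- by move=> _ [x Nx <-]; exact: tN0.
- by move=> x Nx; exists x.
- move=> _ [x Nx <-]; exists x => //; rewrite subrr; exact: sm0 (img_smod t sN0).
- move=> x Nx; split; last by move=> [y Ny <-]; exists (t ^+ b * y); [exists y|ring].
  by move=> [_ [y Ny <-] E]; exists y => //; apply: (mulfI tb0); rewrite -E; ring.
Qed.

End Span.

(** * Zeros and poles counted by the degree over [k(t)] *)

Lemma ev1_unit Q w s : local_ring Q -> A `<=` Q -> nonunits Q w -> s.[0] != 0 ->
  ev1 s w != 0 /\ Q (ev1 s w)^-1.
Proof.
move=> lQ AQ nw s0; have hQ : subring Q by case: lQ.
have Qj c : Q (j c) by exact/AQ/jA.
have Qev r : Q (ev1 r w) by apply: (ev1_sr _ hQ) => //; exact: nu_sub.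
apply: nu_inv => // ns; have : nonunits Q (j s.[0]).
  have -> : j s.[0] = ev1 s w - (ev1 (s - s.[0]%:P) w) by rewrite ev1B ev1C; ring.
  have sn := nu_smod lQ; apply: (smB hQ sn) => //.
  have /factor_theorem [r ->] : root (s - s.[0]%:P) 0 by apply/eqP; rewrite !hornerE subrr.
  rewrite subr0 ev1M ev1_X; exact: (smM sn).
by move/(j_unit lQ AQ) => E; rewrite E eqxx in s0.
Qed.

(** That [t] is a morphism to the projective line, a real restriction at singular points of the
    curve. *)
Definition good t := forall R, X R -> R `<` F -> hat R t \/ hat R t^-1.
Definition covers (Rs : seq (set K)) u := (forall R, R \in Rs -> X R /\ R `<` F) /\
  forall R, X R -> R `<` F -> ~ (hat R u /\ hat R u^-1) -> R \in Rs.
Let hc R : X R -> R `<` F -> cring (hat R). Proof. by move=> XR lt; exact/hat_cring/pt_oncurve. Qed.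

(** The semilocal ring at the zeros of [t] is a lattice, so the length of its quotient by [t], which
    counts the zeros, is the size of any basis of [F / P] over [k(t)]. All bases are quantified over
    so that one basis can serve [t] and its inverse. *)
Lemma good_sum t Rs : F t -> transc t -> good t -> uniq Rs -> covers Rs t ->
  exists2 n, forall zs, (forall z, z \in zs -> F z) -> spans (tfield t) zs -> indep (tfield t) zs -> size zs = n
  & (exists zs : seq K, (forall z, z \in zs -> F z) /\ spans (tfield t) zs) /\
   (\sum_(R <- Rs | `[< nonunits (hat R) t >]) cdeg (hat R) t = n%:Z).
Proof.
move=> Ft tr gt uRs [XRs cRs].
have Pt : ~ P t by have := tr 0; rewrite rmorph0 subr0.
have [t0 Ft'] := nP_inv Ft Pt.
set D := tloc t; set L := tfield t.
have hD : subring D by exact: tloc_sub.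
have lD : local_ring D by exact: tloc_local.
have PD : P `<=` D by exact: tloc_P.
have AD : A `<=` D.
  move=> a Aa; have [c hc'] := resA Aa; rewrite -(subrK (j c) a); apply: srD => //.
    by apply: PD; exact: mP.
  exact: tloc_j.
have nD := tloc_nu Ft tr.
have ng : nonunits D t by rewrite nD; exact: prin_self.
pose Rp := [seq R <- Rs | `[< nonunits (hat R) t >]].
have uRp : uniq Rp by exact: filter_uniq.
have RpP R : R \in Rp -> [/\ X R, R `<` F & nonunits (hat R) t].
  by rewrite mem_filter => /andP[/asboolP nR /XRs [XR lt]].
have RpV V R : valuation_ring V -> D `<=` V -> nonunits V t -> X R -> dominates V R -> R \in Rp.
  move=> vV DV nV XR [RV nR]; have PV := subset_trans PD DV.
  have VF := val_below vV PV Ft Pt nV.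
  have lt : R `<` F.
    split; first exact: subset_trans RV VF.
    by move=> FR; apply: (nu_not nV t0); apply: RV; exact: FR.
  have lV := val_local vV; have hV : subring V by case: lV.
  have hRV : hat R `<=` V by exact: (sadd_min (sr_smod hV)).
  have nR' : ~ hat R t^-1 by move=> h; apply: (nu_not nV t0); exact: hRV.
  have Rt : hat R t by case: (gt R XR lt).
  rewrite mem_filter; apply/andP; split; last by apply: cRs => // -[].
  by apply/asboolP/nuP; split=> //; right.
have cord R : R \in Rp -> exists l, len A (hat R : set K^o) (prin t (hat R)) l.
  by move=> /RpP [XR lt nR]; apply: (cr_len (hc XR lt)) => //; exact: nu_sub.
have [l hl] : exists l : set K -> nat, forall R, R \in Rp -> len A (hat R : set K^o) (prin t (hat R)) (l R).
  have : forall R, exists l, R \in Rp -> len A (hat R : set K^o) (prin t (hat R)) l.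
    by move=> R; case: (boolP (R \in Rp)) => [/cord [l h]|_]; [exists l|exists 0%N].
  by move=> /choice [l h]; exists l.
have h1 := len_curve Ft Pt uRp RpP hl.
have [ws [Fws hws]] := fin_curve Ft Pt uRp RpP lD AD PD ng RpV.
set J := curve_norm Rp in h1 hws.
have hJ : subring J by exact: (curve_norm_subring RpP).
have AJ : A `<=` J by exact: (curve_norm_A RpP).
have PJ : P `<=` J.
  move=> p Pp; split; [exact: nu_sub|move=> R /RpP [XR lt _]; exact: cr_P (hc XR lt) _ Pp].
have clear z : F z -> exists N, J (t ^+ N * z).
  move=> Fz; have [N hN] : exists N, forall R, R \in Rp -> forall n, (N <= n)%N -> hat R (t ^+ n * z).
    elim: (Rp) RpP => [|R Rp' IH] hRp; first by exists 0%N.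
    have [|N hN] := IH; first by move=> R' hR'; apply: hRp; rewrite inE hR' orbT.
    have [XR lt nR] := hRp R (mem_head _ _); have [N' hN'] := pole_clear (hc XR lt) Fz nR.
    exists (maxn N N') => R'; rewrite inE => /orP[/eqP ->|hR'] n; rewrite geq_max => /andP[l1 l2].
      exact: hN'.
    exact: hN.
  exists N; split; first by apply: srM => //; exact: srX.
  by move=> R Rin; exact: hN.
have Jt : J t.
  by split=> // R /RpP [_ _]; exact: nu_sub.
have hL : subring L by exact: tfield_sub.
have LF : L `<=` F by exact: tfield_F.
have LV x : L x -> ~ P x -> L x^-1 by exact: tfield_inv.
have PL : P `<=` L by exact: tfield_P.
have DL : D `<=` L by exact: tloc_field.
have Dt : D t by exact: tloc_t.
have PtD : P `<=` prin t D by exact: tloc_Pt.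
have Lt' : L t^-1 by apply: LV => //; exact: tfield_t.
have szs : spans L ws.
  move=> x Fx; have [N hN] := clear x Fx.
  have h : lin L ws (t ^+ N * x) := lin_mono DL (hws _ hN).
  have sL : smod L (lin L ws) by apply: lin_smod; exact: sr_smod.
  exists x, 0; split; [|exact: sm0 sP|by rewrite addr0].
  have -> : x = t^-1 ^+ N * (t ^+ N * x) by rewrite mulrA -exprMn mulVf // expr1n mul1r.
  exact: (smM sL (srX N hL Lt') h).
have resD x : D x -> exists c, prin t D (x - j c) by exact: tloc_res.
exists (\sum_(R <- Rp) l R)%N; last first.
  split; first by exists ws.
  rewrite (big_morph Posz PoszD (erefl _)) -[LHS]big_filter -/Rp.
  rewrite [LHS]big_seq [RHS]big_seq; apply: eq_bigr => R Rin; have [XR lt nR] := RpP _ Rin.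
  by apply: (cdeg_int (hc XR lt)) => //; [exact: nu_sub|exact: hl].
move=> zs Fz sz iz; set N := lat D zs.
have sND : smod D N by apply: sadd_smod; [apply: lin_smod; exact: sr_smod|apply: smod_mono sP; exact: subset_trans LF].
have clearN x : F x -> exists n, forall n', (n <= n')%N -> N (t ^+ n' * x).
  move=> /sz [y [p [ly Pp ->]]].
  suff [n hn] : exists n, lin D zs (t ^+ n * y).
    exists n => n' le; rewrite -(subnK le) exprD -mulrA; apply: (smM sND); first exact: srX.
    exists (t ^+ n * y), (t ^+ n * p); split=> //; last by rewrite mulrDr.
    by apply: (smM sP) => //; exact: srX.
  have slD ys : smod D (lin D ys) by apply: lin_smod; exact: sr_smod.
  elim: (zs) y ly => [|z zs' IH] y /=; first by move=> ->; exists 0%N; rewrite mulr0.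
  move=> [a [y' [La ly' ->]]]; have [n1 h1'] := IH _ ly'.
  have [n2 h2] := tfield_pole Ft tr La.
  exists (n1 + n2)%N, (t ^+ n1 * (t ^+ n2 * a)), (t ^+ n2 * (t ^+ n1 * y')); split.
  - by apply: srM => //; exact: srX.
  - by apply: (smM (slD _)) => //; exact: srX.
  - by rewrite exprD; ring.
have [b hb] : exists b, forall x, N x -> J (t ^+ b * x).
  have [b hb] : exists b, forall z, z \in zs -> J (t ^+ b * z).
    elim: (zs) Fz => [|z zs' IH] Fz; first by exists 0%N.
    have [|b hb] := IH; first by move=> y hy; apply: Fz; rewrite inE hy orbT.
    have [b' hb'] := clear z (Fz _ (mem_head _ _)).
    exists (b + b')%N => y; rewrite inE => /orP[/eqP ->|hy]; rewrite exprD.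
      by rewrite -mulrA; apply: (srM hJ (srX _ hJ Jt) hb').
    have -> : t ^+ b * t ^+ b' * y = t ^+ b' * (t ^+ b * y) by ring.
    by apply: (srM hJ (srX _ hJ Jt)); exact: hb.
  have DJ : D `<=` J.
    move=> x Dx; split; first exact: LF _ (DL _ Dx).
    move=> R /RpP [XR lt nR]; have cR := hc XR lt.
    have [Fx [q [s [s0 h]]]] := Dx.
    have Rt := nu_sub nR; have Rj c : hat R (j c) by apply: (cr_A cR); exact: jA.
    have Rev r : hat R (ev1 r t) by exact: (ev1_sr _ (cr_sub cR)).
    have [sn0 Rs'] := ev1_unit (cr_loc cR) (cr_A cR) nR s0.
    have -> : x = (ev1 q t + (x * ev1 s t - ev1 q t)) / ev1 s t by field.
    apply: (srM (cr_sub cR)) => //; apply: (srD (cr_sub cR)) => //; exact: (cr_P cR).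
  exists b => x [y [p [ly Pp ->]]]; rewrite mulrDr; apply: (srD hJ); last first.
    by apply: PJ; apply: (smM sP) => //; exact: srX.
  have sJD : smod D [set y | J (t ^+ b * y)].
    split.
    - by rewrite /= mulr0; exact: sr0.
    - by move=> y1 y2 /= h2 h3; rewrite mulrDr; exact: (srD hJ).
    - by move=> c y1 Dc /= h2; rewrite /GRing.scale /= mulrCA; apply: (srM hJ) => //; exact: DJ.
  by apply: (@lin_sub _ D D [set y | J (t ^+ b * y)] zs sJD _ hb y ly).
have [a ha] : exists a, forall x, J x -> N (t ^+ a * x).
  have [a ha] : exists a, forall w, w \in ws -> N (t ^+ a * w).
    suff [a ha] : exists a, forall a', (a <= a')%N -> forall w, w \in ws -> N (t ^+ a' * w).
      by exists a; exact: ha.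
    elim: (ws) Fws => [|w ws' IH] Fw; first by exists 0%N.
    have [|a ha] := IH; first by move=> y hy; apply: Fw; rewrite inE hy orbT.
    have [a' ha'] := clearN w (Fw _ (mem_head _ _)).
    exists (maxn a a') => n; rewrite geq_max => /andP[l1 l2] y.
    by rewrite inE => /orP[/eqP ->|hy]; [exact: ha'|exact: ha].
  exists a => x /hws; have sN' : smod D [set y | N (t ^+ a * y)].
    split.
    - by rewrite /= mulr0; exact: sm0 sND.
    - by move=> y1 y2 /= h2 h3; rewrite mulrDr; exact: smD sND _ _.
    - by move=> c y1 Dc /= h2; rewrite /GRing.scale /= mulrCA; exact: smM sND _ _.
  by apply: (@lin_sub _ D D [set y | N (t ^+ a * y)] ws sN' _ ha).
have sJ : smod A J by apply: smod_mono AJ _; exact: sr_smod.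
have nt1 : ~ prin t D 1 by rewrite -nD; exact: nu1.
have h2 := lat_index hL LF hD AD DL Dt PtD resD Pt nt1 iz Fz sJ _ hb ha.
by apply: (len_uniq _ h1); apply: h2 => x Jx; exact: (srM hJ).
Qed.

Lemma goodV t : good t -> good t^-1.
Proof. by move=> gt R XR lt; rewrite invrK; case: (gt R XR lt); [right|left]. Qed.

Lemma coversV Rs t : covers Rs t -> covers Rs t^-1.
Proof. by move=> [h1 h2]; split=> // R XR lt; rewrite invrK => h; apply: h2 => // -[h3 h4]; apply: h. Qed.

(** The zeros of [t] and those of [1 / t] both number the degree over [k(t)], and at all other
    points [t] is a unit. A [t] that is constant modulo [P] is a unit everywhere. *)
Lemma good_deg0 t Rs : F t -> ~ P t -> good t -> uniq Rs -> covers Rs t ->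
  \sum_(R <- Rs) cdeg (hat R) t = 0.
Proof.
move=> Ft Pt gt uRs cRs; have [XRs cov] := cRs; have [t0 Ft'] := nP_inv Ft Pt.
case: (pselect (transc t)) => tr; last first.
  have [c hc'] : exists c, P (t - j c) by apply: contrapT => h; apply: tr => c hc'; apply: h; exists c.
  rewrite big_seq big1 // => R Rin; have [XR lt] := XRs R Rin; have cR := hc XR lt.
  have lR := cr_loc cR; have [_ mR] := (cr_A cR, cr_m cR).
  have Rj : hat R (j c) by apply: (cr_A cR); exact: jA.
  have nP : nonunits (hat R) (t - j c).
    by rewrite (hat_nu (pt_oncurve XR lt)); apply: sadd_subr hc'; exact: sm0 (nu_smod (X_local XR)).
  have nj : ~ nonunits (hat R) (j c).
    move=> h; apply: Pt; rewrite -(subrK (j c) t).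
    by move: hc'; rewrite (j_unit lR (cr_A cR) h) rmorph0 subr0 addr0.
  have Rt : hat R t by rewrite -(subrK (j c) t); apply: (srD (cr_sub cR)) => //; exact: nu_sub.
  have nt : ~ nonunits (hat R) t.
    by have := nu_unitD lR Rj nj nP; rewrite addrC subrK.
  have [_ Rt'] := nu_inv Rt nt; exact: (cdeg_unit cR).
have Pt' : ~ P t^-1 by move=> h; apply: (nu_not h); rewrite ?invr_neq0 // invrK.
have hL : subring (tfield t) by exact: tfield_sub.
have LF : tfield t `<=` F by exact: tfield_F.
have LV x : tfield t x -> ~ P x -> tfield t x^-1 by exact: tfield_inv.
have [n hn [[ws [Fws szs]] sn]] := good_sum Ft tr gt uRs cRs.
have [n' hn' [_ sn']] := good_sum Ft' (transcV Ft tr) (goodV gt) uRs (coversV cRs).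
have PL : P `<=` tfield t by exact: tfield_P.
have [zs [Fz sz iz]] := span_min hL LF LV Fws szs.
have E : n = n'.
  rewrite -(hn zs Fz sz iz); apply: hn' => //; by rewrite tfieldV.
subst n'; rewrite (bigID (fun R => `[< nonunits (hat R) t >])) /= sn.
rewrite (bigID (fun R => `[< nonunits (hat R) t^-1 >])) /=.
rewrite [X in _ + (_ + X)]big_seq_cond [X in _ + (_ + X)]big1 ?addr0; last first.
  move=> R /and3P [Rin /asboolPn n1 /asboolPn n2]; have [XR lt] := XRs R Rin; have cR := hc XR lt.
  apply: (cdeg_unit cR) => //; case: (gt R XR lt) => // h.
  - by have [_] := nu_inv h n2; rewrite invrK.
  - by have [] := nu_inv h n1.
have -> : \sum_(R <- Rs | ~~ `[< nonunits (hat R) t >] && `[< nonunits (hat R) t^-1 >]) cdeg (hat R) t =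
    - \sum_(R <- Rs | `[< nonunits (hat R) t^-1 >]) cdeg (hat R) t^-1.
  rewrite -sumrN [LHS]big_seq_cond [RHS]big_seq_cond; apply: eq_big => [R|R /and3P [Rin _ _]].
    case: (R \in Rs) => //=; case: asboolP => //= n1; case: asboolP => //= n2.
    by case: (nu_not n2); rewrite ?invr_neq0 // invrK; exact: nu_sub.
  by have [XR lt] := XRs R Rin; rewrite (cdegV (hc XR lt)) // opprK.
by rewrite sn' subrr.
Qed.

Lemma ev1_unif Q w f : local_ring Q -> A `<=` Q -> nonunits Q w -> f != 0 ->
  exists m u, [/\ ev1 f w = w ^+ m * u, Q u, Q u^-1 & u != 0].
Proof.
move=> lQ AQ nw f0; have [m [q ]] := multiplicity_XsubC f 0; rewrite f0 subr0 /= => q0 fE.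
have [u0 Qu'] := ev1_unit lQ AQ nw q0; exists m, (ev1 q w); split=> //.
- by rewrite fE ev1M ev1E ev1_X mulrC.
- by apply: ev1_sr; [case: lQ|move=> c; exact/AQ/jA|exact: nu_sub].
Qed.

(** When [w] is in the maximal ideal, nonzero polynomials in [w] are powers of [w] times units, so
    of a ratio and its inverse one is regular. *)
Lemma ev1_ratio Q w f h z : local_ring Q -> A `<=` Q -> nonunits Q w -> w != 0 -> f != 0 -> h != 0 ->
  z * ev1 h w = ev1 f w -> Q z \/ Q z^-1.
Proof.
move=> lQ AQ nw w0 f0 h0; have hQ : subring Q by case: lQ.
have Qw := nu_sub nw.
have [a [u [-> Qu Qu' u0]]] := ev1_unif lQ AQ nw f0.
have [b [v [-> Qv Qv' v0]]] := ev1_unif lQ AQ nw h0 => E.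
have wb : w ^+ b * v != 0 by rewrite mulf_neq0 ?expf_neq0.
case: (leqP b a) => le; [left|right].
  have -> : z = w ^+ (a - b) * (u / v).
    by apply: (mulIf wb); rewrite E -{1}(subnK le) exprD; field.
  by apply: srM => //; [exact: srX|exact: srM].
have -> : z^-1 = w ^+ (b - a) * (v / u).
  have -> : z = (w ^+ a * u) / (w ^+ b * v) by rewrite -E mulfK.
  rewrite -{1}(subnK (ltnW le)) exprD; field; by rewrite v0 u0 !expf_neq0.
by apply: srM => //; [exact: srX|exact: srM].
Qed.

(** Reversing the coefficients expresses a polynomial in [t] through [1 / t]. *)
Lemma ev1_rev f t : t != 0 -> exists h m, ev1 f t * t^-1 ^+ m = ev1 h t^-1.
Proof.
move=> t0; exists (\sum_(i < size f) f`_i *: 'X^((size f).-1 - i)), (size f).-1.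
rewrite /ev1 rmorph_sum horner_sum /= horner_coef size_map_poly mulr_suml.
apply: eq_bigr => i _; rewrite coef_map map_polyZ map_polyXn hornerZ hornerXn.
case: i => i lt /=; have le : (i <= (size f).-1)%N by case: (size f) lt.
rewrite -{1}(subnK le) exprD -mulrA; congr (_ * _).
by rewrite [t ^+ i * _]mulrCA -exprMn mulfV // expr1n mulr1.
Qed.

Lemma covers_ex u : F u -> ~ P u -> exists2 Rs, uniq Rs & covers Rs u.
Proof.
move=> Fu Pu; have [u0 Fu'] := nP_inv Fu Pu; have [s hs] := fin_pts pF u0 Fu Fu'.
exists (undup [seq R <- s | `[< X R /\ R `<` F >]]); first exact: undup_uniq.
split=> [R|R XR lt h]; rewrite mem_undup mem_filter; first by move=> /andP[/asboolP].
apply/andP; split; first exact/asboolP.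
by apply: hs => // -[h1 h2]; apply: h; split; exact: (@hat_sub R).
Qed.

Lemma covers_sum Rs Rs' u : uniq Rs -> uniq Rs' -> u != 0 -> covers Rs u -> {subset Rs <= Rs'} ->
  (forall R, R \in Rs' -> X R /\ R `<` F) ->
  \sum_(R <- Rs') cdeg (hat R) u = \sum_(R <- Rs) cdeg (hat R) u.
Proof.
move=> uRs uRs' u0 [_ cov] sub h; rewrite (bigID (fun R => R \in Rs)) /= addrC.
rewrite big_seq_cond big1 ?add0r; last first.
  move=> R /andP[Rin nR]; have [XR lt] := h R Rin.
  have [h1 h2] : hat R u /\ hat R u^-1 by apply: contrapT => h'; move: nR; rewrite (cov _ XR lt h').
  exact: (cdeg_unit (hc XR lt)).
rewrite -big_filter; apply: perm_big; apply: uniq_perm => //; first exact: filter_uniq.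
by move=> R; rewrite mem_filter; case: (boolP (R \in Rs)) => //= /sub.
Qed.

(** ** Principal divisors on an exceptional curve *)

Lemma pin_powin (Q n J : set K) N (r : {poly K}) : subring Q -> n `<=` Q -> smod Q J -> powin n J N -> pin n r ->
  pin J (r ^+ N).
Proof.
move=> hQ nQ sJ hN nr.
(* The residual of [J] by [n ^ (N - m)]: each further factor [r] lowers the missing power by one. *)
pose Jm m : set K := [set x | forall y : nat -> K, (forall i, (i < N - m)%N -> n (y i)) ->
  J (x * \prod_(i < N - m) y i)].
suff h m : (m <= N)%N -> pin (Jm m) (r ^+ m).
  move=> i; have := h N (leqnn N) i (fun=> 0); rewrite subnn big_ord0 mulr1; exact.
have sJm l : (l <= N)%N -> forall (I : Type) (s : seq I) (G : I -> K),
    (forall i, Jm l (G i)) -> Jm l (\sum_(i <- s) G i).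
  move=> _ I s G hG y hy; rewrite mulr_suml; apply: (sm_sum _ sJ) => i _; exact: hG.
elim: m => [|m IH] lm.
  move=> i y hy; rewrite expr0 coef1; case: (i == 0)%N; last by rewrite mul0r; exact: sm0 sJ.
  by rewrite mul1r subn0; apply: hN; rewrite subn0 in hy.
move=> i; rewrite exprS coefM; apply: sJm => // l y hy.
have le : (N - m = (N - m.+1).+1)%N by rewrite subnS prednK // subn_gt0.
have := IH (ltnW lm) (i - l)%N (fun i0 => if i0 is i1.+1 then y i1 else r`_l).
rewrite le big_ord_recl /= => h.
have -> : r`_l * (r ^+ m)`_(i - l) * (\prod_(i0 < N - m.+1) y i0) =
  (r ^+ m)`_(i - l) * (r`_l * \prod_(i0 < N - m.+1) y i0) by ring.
apply: h; case=> [|i0] //=; rewrite ltnS; exact: hy.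
Qed.

(** Reducing the coefficients of the integral equation of [t] to [k] gives [q(t) = r(t)] with [r]
    over the maximal ideal. The coefficients of [r ^ N] are divisible by [b * y], where [b] clears
    the denominators of the ring generated by [t] and [y] is in the maximal ideal. *)
Lemma clear_pole R t : X R -> R `<` F -> F t -> intg (hat R) t ->
  exists2 f, f != 0 & forall h, nonunits (hat R) (ev1 (f * h) t).
Proof.
move=> XR lt Ft it; have cR := hc XR lt; have hR := cr_sub cR; have lR := cr_loc cR.
have sn := nu_smod lR.
have [y ny Py] := X_notsub XF XR lt.
have nhy : nonunits (hat R) y.
  by rewrite (hat_nu (pt_oncurve XR lt)); apply: sadd_subl ny; exact: sm0 sP.
have Rj c : hat R (j c) by apply: (cr_A cR); exact: jA.
have fT : fin (hat R) (adjoin (hat R) [set t]) by apply: fin_adjoin => //; exact: fin_self.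
set T := adjoin _ _ in fT; have hT : subring T by exact: adjoin_subring.
have RT : hat R `<=` T by exact: adjoinSl.
have Tt : T t by exact: (@adjoinSr _ (hat R) [set t]).
have [b [Rb Pb hb]] := fin_bd cR fT.
have Rby : hat R (b * y) by apply: srM => //; exact: nu_sub.
have Pby : ~ P (b * y) by apply: (prime_nmul pP) => //; apply: (cr_F cR) => //; exact: nu_sub.
have [N hN] := cr_pow cR Rby Pby.
have [s [p [Rp sp E]]] := it.
have [c hc'] : exists c : nat -> k, forall i, nonunits (hat R) (p`_i - j (c i)).
  have : forall i, exists c, nonunits (hat R) (p`_i - j c) by move=> i; exact: (cr_res cR).
  by move=> /choice [c hc']; exists c.
pose q : {poly k} := 'X^s - \poly_(i < s) c i.
pose r : {poly K} := \poly_(i < s) (p`_i - j (c i)).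
have nr : pin (nonunits (hat R)) r.
  by move=> i; rewrite coef_poly; case: ifP => // _; exact: sm0 sn.
have qr : ev1 q t = r.[t].
  rewrite ev1B ev1E ev1_X E (horner_coef_wide _ sp) /ev1.
  have szm : (size (map_poly j (\poly_(i < s) c i)) <= s)%N by rewrite size_map_poly size_poly.
  rewrite (horner_coef_wide _ szm) (horner_coef_wide _ (size_poly _ _)) -sumrB.
  by apply: eq_bigr => -[i lt'] _ /=; rewrite coef_map !coef_poly lt' mulrBl.
exists (q ^+ N).
  rewrite expf_neq0 //; apply/eqP => /(congr1 (fun p : {poly k} => p`_s)).
  rewrite coefB coefXn eqxx coef_poly ltnn subr0 coef0 => /eqP; by rewrite oner_eq0.
move=> h; rewrite ev1M ev1E qr -horner_exp.
have sp' := prin_smod (b * y) hR.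
have hrN := pin_powin hR (@nu_sub _ _) sp' hN nr.
have Th : T (ev1 h t) := ev1_sr h hT (fun d => RT _ (Rj d)) Tt.
rewrite horner_coef mulr_suml; apply: (sm_sum _ sn) => i _.
have [w Rw <-] := hrN i.
have -> : b * y * w * t ^+ i * ev1 h t = y * (w * (b * (t ^+ i * ev1 h t))) by ring.
apply: (smMr sn) => //; apply: srM => //; apply: hb; exact: (srM hT (srX i hT Tt) Th).
Qed.

(** At the finitely many points [Bs] where neither [u] nor its inverse is regular, [z = f(t)] with
    [t = 1 / (u + c)] vanishes, so that [v = z ^ N * u] is regular there. Both [z] and [v] satisfy
    [good], and the degree of [v] is [N] times that of [z] plus that of [u]. *)
Lemma deg0 u Rs : F u -> ~ P u -> uniq Rs -> covers Rs u ->
  \sum_(R <- Rs) cdeg (hat R) u = 0.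
Proof.
move=> Fu Pu uRs cRs; case: (pselect (transc u)) => tr; last first.
  apply: good_deg0 => // R XR lt; left; have cR := hc XR lt.
  have [c hc'] : exists c, P (u - j c) by apply: contrapT => h; apply: tr => c hc'; apply: h; exists c.
  rewrite -(subrK (j c) u); apply: (srD (cr_sub cR)); first exact: (cr_P cR).
  by apply: (cr_A cR); exact: jA.
have [u0 Fu'] := nP_inv Fu Pu; have [XRs cov] := cRs.
pose bad R := ~ (hat R u \/ hat R u^-1).
pose Bs := [seq R <- Rs | `[< bad R >]].
have BsP R : R \in Bs -> [/\ X R, R `<` F & bad R].
  by rewrite mem_filter => /andP[/asboolP h /XRs []].
have [bd hbd] : exists bd : seq k, forall c, c \notin bd -> forall R, R \in Bs -> intg (hat R) (u + j c)^-1.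
  elim: (Bs) BsP => [|R L IH] BL; first by exists [::].
  have [|b1 h1] := IH; first by move=> R' h; apply: BL; rewrite inE h orbT.
  have [XR lt _] := BL R (mem_head _ _); have [b2 h2] := gen_intg (hc XR lt) Fu.
  exists (b1 ++ b2) => c; rewrite mem_cat negb_or => /andP[c1 c2] R'.
  by rewrite inE => /orP[/eqP ->|]; [have [] := h2 c c2|exact: h1].
have [c cbd] := k_fresh bd; set w := u + j c; pose t := w^-1.
have Fw : F w by exact: srD.
have trw : transc w.
  by move=> d; have := tr (d - c); rewrite rmorphB /w opprB addrA.
have Pw : ~ P w by have := trw 0; rewrite rmorph0 subr0.
have [w0 Ft] := nP_inv Fw Pw; have trt := transcV Fw trw.
have t0 : t != 0 by rewrite invr_neq0.
have uE : u = t^-1 - j c by rewrite /t invrK /w addrK.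
have [f f0 hf] : exists2 f, f != 0 & forall R, R \in Bs -> forall h, nonunits (hat R) (ev1 (f * h) t).
  have := hbd c cbd; elim: (Bs) BsP => [|R L IH] BL iL; first by exists 1; rewrite ?oner_neq0.
  have [||f1 f10 h1] := IH.
  - by move=> R' h; apply: BL; rewrite inE h orbT.
  - by move=> R' h; apply: iL; rewrite inE h orbT.
  have [XR lt _] := BL R (mem_head _ _).
  have [f2 f20 h2] := clear_pole XR lt Ft (iL R (mem_head _ _)).
  exists (f1 * f2); first by rewrite mulf_neq0.
  move=> R'; rewrite inE => /orP[/eqP ->|h] g; last by rewrite -mulrA; exact: h1.
  by rewrite [f1 * f2]mulrC -mulrA.
pose z := ev1 f t.
have Fev q : F (ev1 q t) by exact: ev1_sr.
have Fz : F z by exact: Fev.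
have Pz : ~ P z by move=> /(transcP Ft trt) E; rewrite E eqxx in f0.
have [z0 _] := nP_inv Fz Pz.
have nz R : R \in Bs -> nonunits (hat R) z by move=> h; have := hf R h 1; rewrite mulr1.
have [N hN] : exists N, (0 < N)%N /\ forall R, R \in Bs -> hat R (z ^+ N * u).
  suff [N hN] : exists N, forall n, (N <= n)%N -> forall R, R \in Bs -> hat R (z ^+ n * u).
    by exists N.+1; split=> //; exact: hN.
  elim: (Bs) BsP nz => [|R L IH] BL nz; first by exists 0%N.
  have [||N hN] := IH.
  - by move=> R' h; apply: BL; rewrite inE h orbT.
  - by move=> R' h; apply: nz; rewrite inE h orbT.
  have [XR lt _] := BL R (mem_head _ _).
  have [N' hN'] := pole_clear (hc XR lt) Fu (nz R (mem_head _ _)).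
  exists (maxn N N') => n; rewrite geq_max => /andP[l1 l2] R'.
  by rewrite inE => /orP[/eqP ->|h]; [exact: hN'|exact: hN].
have [N0 {}hN] := hN; pose v := z ^+ N * u.
have FzN : F (z ^+ N) by exact: srX.
have PzN : ~ P (z ^+ N) by move/(prime_exp hF pP Fz).
have Fv : F v by exact: srM.
have Pv : ~ P v by exact: (prime_nmul pP).
have v0 : v != 0 by have [] := nP_inv Fv Pv.
have ratz : z * ev1 1 t = ev1 f t by rewrite -[1]/(1%:P) ev1C rmorph1 mulr1.
have ratv : v * ev1 'X t = ev1 (f ^+ N * (1 - c%:P * 'X)) t.
  rewrite ev1M ev1E ev1B ev1M !ev1C !ev1_X rmorph1 /v uE /z; field; exact: t0.
have hf2 : f ^+ N * (1 - c%:P * 'X) != 0.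
  rewrite mulf_neq0 ?expf_neq0 //; apply/eqP => /(congr1 (fun p : {poly k} => p`_0)).
  by rewrite coefB coef1 coefCM coefX mulr0 subr0 coef0 => /eqP; rewrite oner_eq0.
(* At the poles of [t], ratios of polynomials in [t] must be rewritten in [w = 1 / t] before
   [ev1_ratio] applies. *)
have rat_inv q h x : h != 0 -> q != 0 -> x != 0 -> x * ev1 h t = ev1 q t ->
    exists q' h', [/\ q' != 0, h' != 0 & x * ev1 h' w = ev1 q' w].
  move=> h0 q0 x0 E; have [q' [m Eq]] := ev1_rev q t0; have [h' [m' Eh]] := ev1_rev h t0.
  have ne p : p != 0 -> ev1 p t != 0.
    by move=> p0; have [|//] := nP_inv (Fev p) _; move/(transcP Ft trt) => E'; rewrite E' eqxx in p0.
  have nz' (p : {poly k}) : ev1 p t^-1 != 0 -> p != 0.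
    by apply: contraNneq => ->; rewrite -[0]/(0%:P) ev1C rmorph0.
  have q'0 : q' != 0 by apply: nz'; rewrite -Eq mulf_neq0 ?ne ?expf_neq0 ?invr_neq0.
  have h'0 : h' != 0 by apply: nz'; rewrite -Eh mulf_neq0 ?ne ?expf_neq0 ?invr_neq0.
  exists (q' * 'X^m'), (h' * 'X^m); rewrite !mulf_neq0 ?expf_neq0 ?polyX_eq0 //; split=> //.
  rewrite !ev1M !ev1E !ev1_X -[w]invrK -/t -Eq -Eh -E; ring.
have goods q h x : h != 0 -> q != 0 -> x != 0 -> x * ev1 h t = ev1 q t -> forall R, X R -> R `<` F ->
    nonunits (hat R) t \/ nonunits (hat R) w -> hat R x \/ hat R x^-1.
  move=> h0 q0 x0 E R XR lt; have cR := hc XR lt; have lR := cr_loc cR; case=> nt.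
    exact: (ev1_ratio lR (cr_A cR) nt t0 q0 h0 E).
  have [q' [h' [q0' h0' E']]] := rat_inv q h x h0 q0 x0 E.
  exact: (ev1_ratio lR (cr_A cR) nt w0 q0' h0' E').
have one0 : (1 : {poly k}) != 0 by exact: oner_neq0.
have trich R : X R -> R `<` F -> [\/ nonunits (hat R) t \/ nonunits (hat R) w, R \in Bs | hat R t /\ hat R u].
  move=> XR lt; have cR := hc XR lt; have lR := cr_loc cR; have hR := cr_sub cR.
  have Rj d : hat R (j d) by apply: (cr_A cR); exact: jA.
  case: (pselect (hat R u)) => Ru.
    have Rw : hat R w by exact: srD.
    case: (pselect (nonunits (hat R) w)) => nw; first by apply: Or31; right.
    by apply: Or33; split=> //; have [] := nu_inv Rw nw.
  case: (pselect (hat R u^-1)) => Ru'; last first.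
    apply: Or32; rewrite mem_filter; apply/andP; split; first by apply/asboolP => -[].
    by apply: cov => // -[].
  have nu' : nonunits (hat R) u^-1 by apply/nuP; split=> //; right; rewrite invrK.
  apply: Or31; left.
  have [i0 Ri] := nu_1B lR (smM (nu_smod lR) (srN hR (Rj c)) nu').
  have -> : t = u^-1 * (1 - - j c * u^-1)^-1.
    rewrite /t /w; field; rewrite u0 /=; move: i0; rewrite mulNr opprK => i0.
    by rewrite opprK.
  exact: smMr (nu_smod lR) _ _.
have gz : good z.
  move=> R XR lt; have [h|h|[h _]] := trich R XR lt.
  - exact: (goods f 1 z).
  - by left; exact: nu_sub (nz R h).
  - have cR := hc XR lt; left; apply: ev1_sr => //; first exact: cr_sub cR.
    by move=> d; apply: (cr_A cR); exact: jA.
have gv : good v.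
  move=> R XR lt; have [h|h|[h1 h2]] := trich R XR lt.
  - apply: (goods (f ^+ N * (1 - c%:P * 'X)) 'X v) => //; by rewrite polyX_eq0.
  - by left; exact: hN.
  - have cR := hc XR lt; left; apply: (srM (cr_sub cR)) => //; apply: (srX _ (cr_sub cR)).
    apply: ev1_sr => //; first exact: cr_sub cR.
    by move=> d; apply: (cr_A cR); exact: jA.
have [Rz uRz cRz] := covers_ex Fz Pz; have [Rv uRv cRv] := covers_ex Fv Pv.
pose Rs' := undup (Rs ++ Rz ++ Rv).
have uRs' : uniq Rs' by exact: undup_uniq.
have XRs' R : R \in Rs' -> X R /\ R `<` F.
  rewrite mem_undup !mem_cat => /or3P [|h|h]; first exact: XRs.
    by case: cRz => + _; apply.
  by case: cRv => + _; apply.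
have s1 : {subset Rs <= Rs'} by move=> R h; rewrite mem_undup mem_cat h.
have s2 : {subset Rz <= Rs'} by move=> R h; rewrite mem_undup !mem_cat h orbT.
have s3 : {subset Rv <= Rs'} by move=> R h; rewrite mem_undup !mem_cat h !orbT.
have e2 := good_deg0 Fz Pz gz uRz cRz; have e3 := good_deg0 Fv Pv gv uRv cRv.
rewrite -(covers_sum uRz uRs' z0 cRz s2 XRs') in e2.
rewrite -(covers_sum uRv uRs' v0 cRv s3 XRs') in e3.
rewrite -(covers_sum uRs uRs' u0 cRs s1 XRs').
have : \sum_(R <- Rs') cdeg (hat R) v =
  (\sum_(R <- Rs') cdeg (hat R) z) *+ N + \sum_(R <- Rs') cdeg (hat R) u.
  rewrite -sumrMnl -big_split /= big_seq [RHS]big_seq; apply: eq_bigr => R Rin.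
  have [XR lt] := XRs' R Rin; have cR := hc XR lt.
  by rewrite /v (cdegM cR) // (cdegX cR).
by rewrite e2 e3 mul0rn add0r.
Qed.

End Exceptional.
End Curve.

(** ** Valuations of prime divisors *)

Lemma val_geP (E : set K) t n x : dvr E t -> val_ge E n x <-> E (t ^ (- n) * x).
Proof.
move=> dE; have hE := dvr_subring dE; have t0 := dvr_n0 dE; have [_ _ nE _] := dE.
split; last first.
  by move=> h; exists t, (t ^ (- n) * x); split=> //; rewrite mulrA -expfzDr // subrr mul1r.
move=> [t' [y [nE' Ey ->]]].
have [w Ew tE] : prin t' E t by rewrite -nE' nE; exact: prin_self.
have [z Ez tE'] : prin t E t' by rewrite -nE nE'; exact: prin_self.
have wz : w * z = 1 by apply: (mulfI t0); rewrite mulr1 -[in RHS]tE -tE'; ring.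
have z0 : z != 0 by apply: contra_eq_neq wz => ->; rewrite mulr0 eq_sym oner_neq0.
have Ez' : E z^-1 by rewrite -[z^-1]mul1r -wz mulfK.
have Ezn : E (z ^ n).
  by case: n {Ey} => m; [exact: srX|rewrite NegzE -exprnN -exprVn; exact: srX].
have -> : t ^ (- n) * (t' ^ n * y) = z ^ n * y.
  rewrite -tE' expfzMl !mulrA -expfzDr // addNr mul1r //.
exact: srM.
Qed.

Lemma val_ge_zero (E : set K) n : prime_divisor X E -> val_ge E n 0.
Proof.
move=> /pdiv_dvr [t dE]; apply/(val_geP _ _ dE); rewrite mulr0; exact: sr0 (dvr_subring dE).
Qed.

(** For a prime divisor the default value occurs only at [x = 0], which is why nonzero arguments are
    required throughout. *)
Definition vv (E : set K) (x : K) : int := xget 0 [set n | val_ge E n x /\ ~ val_ge E (n + 1) x].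

Lemma vvE E t n u : dvr E t -> u != 0 -> E u -> E u^-1 -> vv E (t ^ n * u) = n.
Proof.
move=> dE u0 Eu Eu'; have t0 := dvr_n0 dE; have hE := dvr_subring dE.
have key m : val_ge E m (t ^ n * u) <-> (m <= n)%R.
  rewrite (val_geP _ _ dE) mulrA -expfzDr // addrC; split.
    move=> h; rewrite -subr_ge0; apply/(dvr_expz _ dE).
    by rewrite -(mulfK u0 (t ^ (n - m))); exact: srM.
  by rewrite -subr_ge0 => /(dvr_expz _ dE) h; exact: srM.
rewrite /vv; case: xgetP => [m _ [/key h1 h2]|/(_ n)].
  have {h2} : ~ (m + 1 <= n)%R by move/key.
  by lia.
by case; split; [apply/key|move/key; lia].
Qed.

Lemma vv_ex E x : prime_divisor X E -> x != 0 -> exists t u, [/\ dvr E t, u != 0, E u, E u^-1 & x = t ^ (vv E x) * u].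
Proof.
move=> /pdiv_dvr [t dE] x0; have [_ _ _ /(_ x x0) [n [u [u0 Eu Eu' xE]]]] := dE.
by exists t, u; split=> //; rewrite {2}xE (vvE _ dE).
Qed.

Lemma vv_ge E n x : prime_divisor X E -> x != 0 -> val_ge E n x <-> (n <= vv E x)%R.
Proof.
move=> pE x0; have [t [u [dE u0 Eu Eu' xE]]] := vv_ex pE x0.
have t0 := dvr_n0 dE; have hE := dvr_subring dE.
rewrite (val_geP _ _ dE) {1}xE mulrA -expfzDr // addrC; split.
  move=> h; rewrite -subr_ge0; apply/(dvr_expz _ dE).
  by rewrite -(mulfK u0 (t ^ (_ - n))); exact: srM.
by rewrite -subr_ge0 => /(dvr_expz _ dE) h; exact: srM.
Qed.

Lemma vvM E x y : prime_divisor X E -> x != 0 -> y != 0 -> vv E (x * y) = vv E x + vv E y.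
Proof.
move=> pE x0 y0; have [t [u [dE u0 Eu Eu' xE]]] := vv_ex pE x0.
have t0 := dvr_n0 dE; have hE := dvr_subring dE.
have [_ _ _ /(_ y y0) [n [v [v0 Ev Ev' yE]]]] := dE.
rewrite {1}xE {1}yE mulrACA -expfzDr // (vvE _ dE) ?mulf_neq0 //; try exact: srM.
  by rewrite [in RHS]yE (vvE _ dE).
by rewrite invfM; exact: srM.
Qed.

Lemma vv1 E : prime_divisor X E -> vv E 1 = 0.
Proof.
move=> pE; apply: (@addrI _ (vv E 1)); by rewrite -vvM ?oner_neq0 // mulr1 addr0.
Qed.

Lemma vvV E x : prime_divisor X E -> x != 0 -> vv E x^-1 = - vv E x.
Proof.
move=> pE x0; apply/eqP; rewrite -addr_eq0 -vvM ?invr_neq0 // mulVf // vv1 //.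
Qed.

Lemma vvX E x n : prime_divisor X E -> x != 0 -> vv E (x ^+ n) = vv E x *+ n.
Proof.
move=> pE x0; elim: n => [|n IH]; first by rewrite expr0 vv1.
by rewrite exprS vvM ?expf_neq0 // IH mulrS.
Qed.

Lemma pdiv_local E : prime_divisor X E -> local_ring E.
Proof. by move=> [XE _]; exact: X_local. Qed.
Lemma pdiv_subring E : prime_divisor X E -> subring E.
Proof. by move=> /pdiv_local []. Qed.

Lemma vv_in E x : prime_divisor X E -> x != 0 -> E x <-> (0 <= vv E x)%R.
Proof.
move=> pE x0; rewrite -(vv_ge _ pE x0); have [t dE] := pdiv_dvr pE.
by rewrite (val_geP _ _ dE) oppr0 expr0z mul1r.
Qed.

Lemma vv_nu E x : prime_divisor X E -> x != 0 -> nonunits E x <-> (0 < vv E x)%R.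
Proof.
move=> pE x0; rewrite nuP; have x0' : x^-1 != 0 by rewrite invr_neq0.
rewrite (vv_in pE x0) (vv_in pE x0') vvV //; split.
  by move=> [h [/eqP|h']]; [rewrite (negPf x0)|lia].
by move=> h; split; [lia|right; lia].
Qed.

Lemma vv_unit E x : prime_divisor X E -> E x -> ~ nonunits E x -> vv E x = 0.
Proof.
move=> pE Ex nx; have [x0 Ex'] := nu_inv Ex nx.
by apply/eqP; rewrite eq_le; apply/andP; split; [rewrite leNgt; apply/negP => /(vv_nu pE x0)|apply/(vv_in pE x0)].
Qed.

(** ** Two-dimensional normal local rings between [A] and [K] *)

(** The base ring [A] itself and the closed points of [X]. *)
Record surf (S : set K) : Prop := Surf {
  sf_loc : local_ring S;
  sf_noeth : noetherian S;
  sf_A : A `<=` S;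
  sf_m : nonunits A `<=` nonunits S;
  sf_res : forall x, S x -> exists c, nonunits S (x - j c);
  sf_depth : forall x, (forall v, nonunits S v -> S (v * x)) -> S x;
  sf_primes : forall Q, prime_ideal S Q -> [\/ Q = [set 0], Q = nonunits S |
    exists F, [/\ prime_divisor X F, S `<=` F, ~ nonunits S `<=` nonunits F & Q = nonunits F `&` S]];
  sf_div : forall F, prime_divisor X F -> S `<=` F -> ~ nonunits S `<=` nonunits F ->
    F = localization S (nonunits F `&` S);
  sf_nprin : forall p r, nonunits S p -> ~ powin (nonunits S) (prin p S) r
}.

Definition sdiv S F := [/\ prime_divisor X F, S `<=` F & ~ nonunits S `<=` nonunits F].

Lemma nexc_sdiv F : prime_divisor X F -> ~ exceptional A X F -> sdiv A F.
Proof.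
move=> pF nE; split=> //; first by apply: X_A; case: pF.
exact: (nexc_m pF nE).
Qed.

Lemma sdiv_nexc F : sdiv A F -> ~ exceptional A X F.
Proof. by move=> [_ _ h] [_ [_]]. Qed.

Lemma surf_A : surf A.
Proof.
split=> //; first exact: A_depth.
- move=> Q pQ; case: (pselect (Q = [set 0])) => [->|n0]; first exact: Or31.
  case: (pselect (Q = nonunits A)) => [->|nm]; first exact: Or32.
  apply: Or33; exists (localization A Q); split.
  + exact: loc_pdiv.
  + exact: loc_sub.
  + move=> h; apply: nm; rewrite eqEsubset; split.
      by apply: ideal_proper => //; [case: pQ|exact: prime_n1 pQ].
    by rewrite -[X in _ `<=` X](loc_contr hA pQ) => x nx; split; [exact: h|exact: nu_sub].
  + by rewrite loc_contr.
- by move=> F pF AF h; apply: (nexc_loc pF) => // -[_ [_]].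
- exact: A_nprin.
Qed.

Lemma cpt_pdiv R F : cpt R -> prime_divisor X F -> R `<=` F -> R `<` F /\ sdiv R F.
Proof.
move=> cR pF RF; have XR := cpt_X cR; have [XF _] := pF.
have lt : R `<` F.
  split=> // FR; have [_ [E eE [RE nRE]]] := cR; have [pE _] := eE.
  by apply: nRE; rewrite -(pdiv_eq pF pE (subset_trans FR RE)).
split=> //; split=> // h; have [y ny] := X_notsub XF XR lt; apply; exact: h.
Qed.

(** ** Regular closed points *)

Lemma cpt_pdiv_ex R : cpt R -> exists F, exceptional A X F /\ R `<` F.
Proof. by move=> [_ [E eE lt]]; exists E. Qed.

Lemma cpt_prime_pdiv R Q : cpt R -> prime_ideal R Q -> Q <> [set 0] -> Q <> nonunits R ->
  exists F, [/\ sdiv R F, Q = nonunits F `&` R & F = localization R Q].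
Proof.
move=> cR pQ n0 nn; have XR := cpt_X cR; have lR := X_local XR; have hR : subring R by case: lR.
have [//|//|pF] := cpt_primes cR pQ; exists (localization R Q).
have RF : R `<=` localization R Q by exact: loc_sub.
by split=> //; [have [_] := cpt_pdiv cR pF RF|rewrite loc_contr].
Qed.

Lemma sdiv_prime S F : local_ring S -> sdiv S F -> prime_ideal S (nonunits F `&` S).
Proof. by move=> lS [pF SF _]; apply: nu_contr => //; [exact: pdiv_local|case: lS]. Qed.

Lemma cpt_div R F : cpt R -> prime_divisor X F -> R `<=` F -> F = localization R (nonunits F `&` R).
Proof. by move=> cR [XF _] RF; apply: X_gen => //; exact: cpt_X. Qed.

Lemma sdiv_n0 S F : (forall x : K, exists a b, [/\ S a, S b, b != 0 & x = a / b]) ->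
  F = localization S (nonunits F `&` S) -> prime_divisor X F -> nonunits F `&` S <> [set 0].
Proof.
move=> frS FE pF E; have [t dt] := pdiv_dvr pF; apply: (dvr_set0 dt).
rewrite eqEsubset; split=> // x _; have [a [b [Sa Sb b0 xE]]] := frS x.
by rewrite FE; exists a, b; split=> //; rewrite E; exact/eqP.
Qed.

Lemma over_frac S x : A `<=` S -> exists a b, [/\ S a, S b, b != 0 & x = a / b].
Proof. by move=> AS; have [a [b [Aa Ab b0 xE]]] := frA x; exists a, b; split=> //; exact: AS. Qed.

Lemma cpt_nprin R p r : cpt R -> nonunits R p -> ~ powin (nonunits R) (prin p R) r.
Proof.
move=> cR np hr; have XR := cpt_X cR; have lR := X_local XR; have hR : subring R by case: lR.
have [E [eE lt]] := cpt_pdiv_ex cR; have pE := exc_pdiv eE.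
have [_ [_ RE h]] := cpt_pdiv cR pE (properW lt).
have pQ := @sdiv_prime R E lR (And3 pE RE h).
have [h'|h'] := pit lR (X_noeth XR) np hr pQ.
  by apply: h; apply: subset_trans h' _; exact: subIsetl.
apply: (@sdiv_n0 R E) => //.
- by move=> x; apply: over_frac; exact: X_A.
- exact: cpt_div (properW lt).
- by rewrite eqEsubset; split=> // x ->; split; [exact: sm0 (nu_smod (pdiv_local pE))|exact: sr0].
Qed.

(** Nonzero nonmaximal primes of [R] are prime divisors by [cpt_prime_pdiv], and nested prime
    divisors are equal. With the dimension known, regularity provides exactly two generators of the
    maximal ideal. *)
Lemma cpt_krull R : cpt R -> krull_dim R 2.
Proof.
move=> cR; have XR := cpt_X cR; have lR := X_local XR; have hR : subring R by case: lR.
have [E [eE lt]] := cpt_pdiv_ex cR; have pE := exc_pdiv eE.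
have [_ sE] := cpt_pdiv cR pE (properW lt); have pQ := sdiv_prime lR sE; have [_ RE h] := sE.
have Q0 : nonunits E `&` R <> [set 0].
  by apply: sdiv_n0 => //; [move=> x; apply: over_frac; exact: X_A|exact: cpt_div].
have Qn : nonunits E `&` R <> nonunits R by move=> e; apply: h; rewrite -e; exact: subIsetl.
have Qsub : nonunits E `&` R `<=` nonunits R.
  by apply: ideal_proper => //; [case: pQ|exact: prime_n1 pQ].
split.
  exists (fun i => if i is i'.+1 then if i' is 0%N then nonunits E `&` R else nonunits R else [set 0]).
  split; first by case=> [|[|i]] _; [exact: prime0|exact: pQ|exact: nu_prime].
  case=> [|[|i]] //= _; split.
  - by move=> x ->; exact: sm0 (prime_smod pQ).
  - by move=> e; apply: Q0; rewrite eqEsubset; split=> // x ->; exact: sm0 (prime_smod pQ).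
  - exact: Qsub.
  - by move=> e; apply: Qn; rewrite eqEsubset.
move=> n C [hC sC]; rewrite leqNgt; apply/negP => lt2.
have [C1 C2] : prime_ideal R (C 1%N) /\ prime_ideal R (C 2%N) by split; apply: hC; lia.
have l01 : C 0%N `<` C 1%N by apply: sC; lia.
have l12 : C 1%N `<` C 2%N by apply: sC; lia.
have l23 : C 2%N `<` C 3%N by apply: sC; lia.
have mid Q Q1 Q2 : prime_ideal R Q1 -> prime_ideal R Q -> prime_ideal R Q2 -> Q1 `<` Q -> Q `<` Q2 ->
    Q <> [set 0] /\ Q <> nonunits R.
  move=> p1 pQ' p2 [s1 n1] [s2 n2]; split=> e.
    by apply: n1; rewrite e => x ->; exact: sm0 (prime_smod p1).
  by apply: n2; rewrite e; apply: ideal_proper => //; [case: p2|exact: prime_n1 p2].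
have [a1 b1] := mid _ _ _ (hC 0%N isT) C1 C2 l01 l12.
have p3 : prime_ideal R (C 3%N) by apply: hC; lia.
have [a2 b2] := mid _ _ _ C1 C2 p3 l12 l23.
have [F1 [[pF1 _ _] e1 f1]] := cpt_prime_pdiv cR C1 a1 b1.
have [F2 [[pF2 _ _] e2 f2]] := cpt_prime_pdiv cR C2 a2 b2.
have := @loc_antimono R _ _ (properW l12); rewrite -f1 -f2 => /(pdiv_eq pF2 pF1) e.
by case: l12 => _; apply; rewrite e1 e2 e.
Qed.

(** That is, [p R] is a prime ideal and [R / p R] is a discrete valuation ring. *)
Lemma cpt_params R : cpt R -> exists p q, [/\ nonunits R p, nonunits R q, p != 0,
  forall x, R x -> prin p R x \/ exists l u v, [/\ R u, R u^-1, u != 0, R v & x = u * q ^+ l + p * v]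
  & forall x, R x -> prin p R (q * x) -> prin p R x].
Proof.
move=> cR; have XR := cpt_X cR; have lR := X_local XR; have hR : subring R by case: lR.
have nR := X_noeth XR; have sn := nu_smod lR.
have [_ _ [s [ks nE]]] := X_regular XR.
have := krull_uniq ks (cpt_krull cR); case: s nE ks => [|p [|q [|? ?]]] //= nE _ _.
have np : nonunits R p by rewrite nE; apply: ideal_spanS; rewrite /= mem_head.
have nq : nonunits R q by rewrite nE; apply: ideal_spanS; rewrite /= !inE eqxx orbT.
have sp := prin_smod p hR.
have nsub : nonunits R `<=` sadd (prin p R) (prin q R).
  rewrite nE ideal_span_lin // => x [a [y [Ra [b [z [Rb -> ->]]] ->]]].
  by exists (p * a), (q * b); split; [exists a|exists b|ring].
(* Otherwise a power of the maximal ideal would lie in [p R], against the principal ideal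
   theorem. *)
have nql l : ~ prin p R (q ^+ l).
  move=> h; apply: (cpt_nprin (r := l.+1) cR np) => y hy.
  have [c hc'] : exists c, forall i, (i < l.+1)%N -> R (c i) /\ prin p R (y i - q * c i).
    have : forall i, exists c, (i < l.+1)%N -> R c /\ prin p R (y i - q * c).
      move=> i; case: (ltnP i l.+1) => lti; last by exists 0.
      have [a [_ [[b Rb <-] [c Rc <-] ->]]] := nsub _ (hy i lti).
      by exists c => _; split=> //; exists b => //; ring.
    by move=> /choice [c hc']; exists c.
  have : prin p R (\prod_(i < l.+1) y i - \prod_(i < l.+1) (q * c i)).
    elim: (l.+1) hc' hy => [|m IH] hc' hy; first by rewrite !big_ord0 subrr; exact: sm0 sp.
    rewrite !big_ord_recr /=; set a1 := \prod_(i < m) y i; set b1 := \prod_(i < m) _.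
    have h1 : prin p R (a1 - b1) by apply: IH => i lti; [apply: hc'|apply: hy]; exact: ltnW.
    have [Rc h2] := hc' m (ltnSn m); have Rym := nu_sub (hy m (ltnSn m)).
    have Rb1 : R b1.
      apply: sr_prod => // i _; have [Rci _] := hc' i (leqW (ltn_ord i)); apply: srM => //; exact: nu_sub.
    have -> : a1 * y m - b1 * (q * c m) = y m * (a1 - b1) + b1 * (y m - q * c m) by ring.
    by apply: (smD sp); exact: (smM sp).
  move=> h1; rewrite -(subrK (\prod_(i < l.+1) (q * c i)) (\prod_(i < l.+1) y i)); apply: (smD sp) => //.
  rewrite big_split /= prodr_const card_ord exprSr -mulrA; apply: (smMr sp) => //.
  apply: srM => //; first exact: nu_sub.
  by apply: sr_prod => // i _; have [] := hc' i (ltn_ord i).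
have p0 : p != 0.
  apply/eqP => p0; apply: (cpt_nprin (r := 1) cR nq) => y hy; rewrite big_ord1.
  by have [_ [_ [[b Rb <-] [c Rc <-] ->]]] := nsub _ (hy 0%N isT); rewrite p0 mul0r add0r; exists c.
(* If division by [q] modulo [p] never reached a unit, the ideals generated by [p] and the
   successive quotients would become constant all the same, which forces a quotient into [p R]. *)
have dec x : R x -> prin p R x \/ exists l u v, [/\ R u, R u^-1, u != 0, R v & x = u * q ^+ l + p * v].
  move=> Rx; case: (pselect (prin p R x)) => px; [by left|right].
  apply: contrapT => nx.
  have step y : exists z, R y -> ~ prin p R y -> nonunits R y -> R z /\ prin p R (y - q * z).
    case: (pselect (nonunits R y)) => ny; last by exists 0 => _ _ /ny.
    have [a [_ [[b Rb <-] [c Rc <-] ->]]] := nsub _ ny.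
    by exists c => _ _ _; split=> //; exists b => //; ring.
  have [z hz] := choice step; pose y i := iter i z x.
  have hy i : [/\ R (y i), prin p R (x - q ^+ i * y i) & nonunits R (y i)].
    elim: i => [|i [Ry h ny]].
      have h0 : prin p R (x - q ^+ 0 * y 0%N) by rewrite expr0 mul1r /y subrr; exact: sm0 sp.
      split=> //; apply: contrapT => n; apply: nx; have [x0 Rx'] := nu_inv Rx n.
      by exists 0%N, x, 0; split=> //; [exact: sr0|rewrite expr0 mulr1 mulr0 addr0].
    have npy : ~ prin p R (y i).
      move=> h'; apply: px; rewrite -(subrK (q ^+ i * y i) x); apply: (smD sp) => //.
      by apply: (smM sp) => //; apply: srX => //; exact: nu_sub.
    have [Rz h2] := hz (y i) Ry npy ny.
    have h1 : prin p R (x - q ^+ i.+1 * y i.+1).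
      have -> : x - q ^+ i.+1 * y i.+1 = (x - q ^+ i * y i) + q ^+ i * (y i - q * z (y i)).
        by rewrite /y iterS exprS; ring.
      by apply: (smD sp) => //; apply: (smM sp) => //; apply: srX => //; exact: nu_sub.
    split=> //; apply: contrapT => n; apply: nx; have [y0 Ry'] := nu_inv Rz n.
    have [v Rv vE] := h1; exists i.+1, (y i.+1), v; split=> //.
    by rewrite [X in _ + X]vE; ring.
  pose C i := sadd (prin p R) (prin (y i) R).
  have iC i : ideal R (C i).
    have [Ry _ _] := hy i; apply: sadd_ideal => //; apply: prin_ideal => //; exact: nu_sub.
  have yC i : y i - q * y i.+1 = y i - q * z (y i) by rewrite /y iterS.
  have npy i : ~ prin p R (y i).
    have [Ry h _] := hy i; move=> h'; apply: px; rewrite -(subrK (q ^+ i * y i) x).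
    by apply: (smD sp) => //; apply: (smM sp) => //; apply: srX => //; exact: nu_sub.
  have [|n hn] := noeth_acc nR iC.
    move=> i; have [_ sC] := iC i.+1; apply: (sadd_min sC).
      by apply: sadd_subl; exact: sm0 (prin_smod _ hR).
    have [Ry _ ny] := hy i; have [_ h2] := hz (y i) Ry (npy i) ny.
    apply: prin_sub => //; rewrite -(subrK (q * y i.+1) (y i)); apply: (smD sC).
      rewrite yC; apply: sadd_subl => //; exact: sm0 (prin_smod _ hR).
    apply: (smM sC); first exact: nu_sub.
    by apply: sadd_subr; [exact: sm0 sp|exact: prin_self].
  have : C n (y n.+1).
    by rewrite -(hn n.+1) //; apply: sadd_subr; [exact: sm0 sp|exact: prin_self].
  move=> [a [_ [pa [b Rb <-] yE]]]; have [Ry _ ny] := hy n; have [_ h2] := hz (y n) Ry (npy n) ny.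
  apply: (npy n.+1); have [i0 Ri] := nu_1B lR (smMr sn Rb nq).
  have -> : y n.+1 = (1 - q * b)^-1 * (a + b * (y n - q * y n.+1)).
    by apply: (mulfI i0); rewrite mulVKf // mulrBl mul1r {1}yE; ring.
  apply: (smM sp) => //; apply: (smD sp) => //; apply: (smM sp) => //; by rewrite yC.
exists p, q; split=> // x Rx h; have [//|[l [u [v [Ru Ru' u0 Rv xE]]]]] := dec x Rx.
case: (nql l.+1); have -> : q ^+ l.+1 = u^-1 * (q * x - p * (q * v)).
  by rewrite xE exprS; field.
apply: (smM sp) => //; apply: (smB hR sp) => //; exists (q * v) => //; apply: srM => //; exact: nu_sub.
Qed.

(** [p], [q] is a regular sequence: [q (p x) = p (q x)] is in [p R], hence [p x] is. *)
Lemma cpt_depth R x : cpt R -> (forall v, nonunits R v -> R (v * x)) -> R x.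
Proof.
move=> cR h; have [p [q [np nq p0 dec hq]]] := cpt_params cR.
have [y Ry] : prin p R (p * x).
  by apply: hq; [exact: h|exists (q * x); [exact: h|ring]].
by move=> /(mulfI p0) <-.
Qed.

Lemma surf_cpt R : cpt R -> surf R.
Proof.
move=> cR; have XR := cpt_X cR; have lR := X_local XR; have hR : subring R by case: lR.
split=> //.
- exact: X_noeth.
- exact: X_A.
- by have [] := cpt_dom cR.
- exact: cpt_res.
- by move=> x; exact: cpt_depth.
- move=> Q pQ; case: (pselect (Q = [set 0])) => [->|n0]; first exact: Or31.
  case: (pselect (Q = nonunits R)) => [->|nn]; first exact: Or32.
  by apply: Or33; have [F [[a b c] e _]] := cpt_prime_pdiv cR pQ n0 nn; exists F.
- by move=> F pF RF _; exact: cpt_div.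
- by move=> p r; exact: cpt_nprin.
Qed.

(** ** Local generators of invertible sheaves *)

(** The denominators of [x] lie in no prime but the maximal ideal, so they include a power of it;
    depth two removes this power one factor at a time. *)
Lemma surf_inter S x : surf S -> (forall F, sdiv S F -> F x) -> S x.
Proof.
move=> sS hx; have lS := sf_loc sS; have hS : subring S by case: lS.
pose J : set K := [set r | S r /\ S (r * x)].
have iJ : ideal S J.
  split; first by move=> r [].
  split.
  - by split; rewrite ?mul0r; exact: sr0.
  - by move=> r s [Sr h] [Ss h']; split; [exact: srD|rewrite mulrDl; exact: srD].
  - move=> c r Sc [Sr h]; split; first exact: srM.
    by rewrite /GRing.scale /= -mulrA; exact: srM.
have [r hr] : exists r, powin (nonunits S) J r.
  apply: prim_powin => //; first exact: sf_noeth.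
  move=> Q pQ JQ; have [Q0|//|[F [pF SF nF QE]]] := sf_primes sS pQ.
    have [a [b [Sa Sb b0 xE]]] := over_frac x (sf_A sS).
    have : Q b by apply: JQ; split=> //; rewrite xE mulrC divfK.
    by rewrite Q0 => /eqP; rewrite (negPf b0).
  have Fx := hx F (And3 pF SF nF).
  move: (Fx); rewrite (sf_div sS pF SF nF) => -[a [b [Sa Sb nb xE]]].
  case: (nb); rewrite -QE; apply: JQ; split=> //.
  rewrite xE mulrC divfK //; apply/eqP => b0; apply: nb; rewrite b0.
  by split; [exact: sm0 (nu_smod (pdiv_local pF))|exact: sr0].
suff key : forall r y, (forall v : nat -> K, (forall i, (i < r)%N -> nonunits S (v i)) ->
    S ((\prod_(i < r) v i) * y)) -> S y.
  by apply: (key r) => v /hr [].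
elim=> [|n IH] y h; first by have := h (fun=> 0); rewrite big_ord0 mul1r; apply.
apply: (sf_depth sS) => w nw; apply: IH => v hv.
have := h (fun i => if i == n then w else v i); rewrite big_ord_recr /= eqxx mulrA => h'.
have -> : (\prod_(i < n) v i) * w = (\prod_(i < n) (if i == n :> nat then w else v i)) * w.
  by congr (_ * _); apply: eq_bigr => -[i lt] _ /=; rewrite (ltn_eqF lt).
by apply: h' => i; rewrite ltnS leq_eqVlt; case: eqP => //= _; exact: hv.
Qed.

Lemma X_inter R x : X R -> (forall F, prime_divisor X F -> R `<=` F -> F x) -> R x.
Proof.
move=> XR h; have [->|pR|cR] := X_class XR => //; first exact: h.
by apply: surf_inter; [exact: surf_cpt|move=> F [pF RF _]; exact: h].
Qed.

(** [t] generates [O_X(-W)] at [R]. *)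
Definition lgen (W : set K -> int) R t := t != 0 /\ forall F, prime_divisor X F -> R `<=` F -> vv F t = W F.

Lemma stalkP (W : set K -> int) R x : stalk X W R x <-> forall F, prime_divisor X F -> R `<=` F -> val_ge F (W F) x.
Proof.
split=> [h F [XF kF] RF|h F [[XF RF] kF]]; first by apply: h; split.
by apply: h.
Qed.

Lemma val_ge_smod E n : prime_divisor X E -> smod E [set x | val_ge E n x].
Proof.
move=> pE; have [t dE] := pdiv_dvr pE; have hE := dvr_subring dE; split.
- exact: val_ge_zero.
- by move=> x y /(val_geP _ _ dE) h1 /(val_geP _ _ dE) h2; apply/(val_geP _ _ dE); rewrite mulrDr; exact: srD.
- by move=> a x Ea /(val_geP _ _ dE) h; apply/(val_geP _ _ dE); rewrite /GRing.scale /= mulrCA; exact: srM.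
Qed.

Lemma stalk_smod W R : subring R -> smod R (stalk X W R).
Proof.
move=> hR; split.
- by apply/stalkP => F pF RF; exact: val_ge_zero.
- by move=> x y /stalkP hx /stalkP hy; apply/stalkP => F pF RF; apply: (smD (val_ge_smod _ pF)); [exact: hx|exact: hy].
- move=> a x Ra /stalkP hx; apply/stalkP => F pF RF; apply: (smM (val_ge_smod _ pF)); [exact: RF|exact: hx].
Qed.

Lemma lgen_stalk W R t : X R -> lgen W R t -> stalk X W R = prin t R.
Proof.
move=> XR [t0 ht]; rewrite eqEsubset; split=> x.
  move=> /stalkP hx; apply/(prinP _ _ t0); apply: X_inter => // F pF RF.
  case: (eqVneq x 0) => [->|x0]; first by rewrite mul0r; exact: sr0 (pdiv_subring pF).
  apply/(vv_in pF); first by rewrite mulf_neq0 ?invr_neq0.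
  by rewrite vvM ?invr_neq0 // vvV // ht // subr_ge0; apply/(vv_ge _ pF x0); exact: hx.
move=> [y Ry <-]; apply/stalkP => F pF RF; rewrite -ht //.
case: (eqVneq y 0) => [->|y0]; first by rewrite mulr0; exact: val_ge_zero.
apply/(vv_ge _ pF); first exact: mulf_neq0.
by rewrite vvM // ler_wpDr //; apply/(vv_in pF y0); exact: RF.
Qed.

(** Otherwise [J] would generate at [F] only functions of value at least [W F + 1]. *)
Lemma gen_elt J W F : generates X J W -> prime_divisor X F -> exists f, [/\ J f, f != 0 & vv F f = W F].
Proof.
move=> gJ pF; have [XF _] := pF; apply: contrapT => h.
have [t dF] := pdiv_dvr pF; have t0 := dvr_n0 dF; have hF := dvr_subring dF.
have sub : ideal_span F J `<=` [set x | val_ge F (W F + 1) x].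
  apply: ideal_span_min; first exact: val_ge_smod.
  move=> f Jf; case: (eqVneq f 0) => [->|f0]; first exact: val_ge_zero.
  apply/(vv_ge _ pF f0).
  have le : (W F <= vv F f)%R.
    apply/(vv_ge _ pF f0); have : stalk X W F f by rewrite -gJ //; exact: ideal_spanS.
    by move/stalkP; apply.
  have ne : vv F f <> W F by move=> e; apply: h; exists f.
  lia.
have : stalk X W F (t ^ W F).
  apply/stalkP => G pG FG; have <- := pdiv_eq pF pG FG.
  by apply/(val_geP _ _ dF); rewrite -expfzDr // addNr expr0z; exact: sr1.
rewrite -gJ // => /sub /(val_geP _ _ dF).
rewrite -expfzDr // opprD addrAC addNr add0r => /(dvr_expz _ dF); lia.
Qed.

Lemma gen_ge J W F f : generates X J W -> prime_divisor X F -> J f -> f != 0 -> (W F <= vv F f)%R.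
Proof.
move=> gJ pF Jf f0; apply/(vv_ge _ pF f0); have [XF _] := pF.
have : stalk X W F f by rewrite -gJ //; exact: ideal_spanS.
by move/stalkP; apply.
Qed.

(** By [cpt_params], [p] is a prime element; near [R] its divisor is the one curve [Fp], with
    multiplicity one. *)
Lemma cpt_prime_elt R : cpt R -> exists p q Fp, [/\ [/\ nonunits R p, p != 0,
   forall x, R x -> prin p R x \/ exists l u v, [/\ R u, R u^-1, u != 0, R v & x = u * q ^+ l + p * v]
   & R q], prime_divisor X Fp, R `<=` Fp, vv Fp p = 1 &
   forall F, prime_divisor X F -> R `<=` F -> F <> Fp -> vv F p = 0].
Proof.
move=> cR; have XR := cpt_X cR; have lR := X_local XR; have hR : subring R by case: lR.
have [p [q [np nq p0 dec hq]]] := cpt_params cR; have Rp := nu_sub np; have Rq := nu_sub nq.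
have sp := prin_smod p hR.
have hql l x : R x -> prin p R (q ^+ l * x) -> prin p R x.
  elim: l => [|l IH] Rx; first by rewrite expr0 mul1r.
  by rewrite exprS -mulrA => /hq h; apply: IH => //; apply: h; apply: srM => //; exact: srX.
have pQ : prime_ideal R (prin p R).
  split; first exact: prin_ideal.
    by move=> h; apply: (nu1 hR); apply: (prin_sub (nu_smod lR) np h).
  move=> x y Rx Ry hxy; have [hx|[l [u [v [Ru Ru' u0 Rv xE]]]]] := dec x Rx; first by left.
  right; apply: (hql l) => //.
  have -> : q ^+ l * y = u^-1 * (x * y - p * (v * y)) by rewrite xE; field.
  by apply: (smM sp) => //; apply: (smB hR sp) => //; exists (v * y) => //; exact: srM.
have Q0 : prin p R <> [set 0].
  by move=> e; have := prin_self p hR; rewrite e => /eqP; rewrite (negPf p0).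
have Qn : prin p R <> nonunits R.
  by move=> e; apply: (cpt_nprin (r := 1) cR np) => y hy; rewrite big_ord1 e; exact: hy.
have [Fp [[pF RF nF] QE FE]] := cpt_prime_pdiv cR pQ Q0 Qn.
exists p, q, Fp; split=> //.
- have Pp : nonunits Fp p.
    have [//] : (nonunits Fp `&` R) p by rewrite -QE; exact: prin_self.
  have h1 := (vv_nu pF p0).1 Pp.
  have [t dF] := pdiv_dvr pF; have t0 := dvr_n0 dF; have hF := dvr_subring dF.
  have vt : vv Fp t = 1.
    by have := vvE 1 dF (oner_neq0 _) (sr1 hF); rewrite invr1 expr1z mulr1; apply; exact: sr1.
  have : nonunits (localization R (prin p R)) t.
    by rewrite -FE; have [_ _ -> _] := dF; exact: prin_self.
  move=> /(loc_nuP pQ) [_ [b [[c Rc <-] Rb nb tE]]].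
  have b0 : b != 0 by exact: prime_n0 pQ nb.
  have cb0 : c / b != 0 by apply: contraNneq t0 => e; rewrite tE -mulrA e mulr0.
  have Fcb : Fp (c / b) by rewrite FE; exists c, b.
  have : vv Fp t = vv Fp p + vv Fp (c / b) by rewrite -vvM // mulrA -tE.
  rewrite vt; have := (vv_in pF cb0).1 Fcb; lia.
- move=> F pF' RF' ne; apply: vv_unit => //; first exact: RF'.
  move=> Pp; apply: ne; apply: pdiv_eq => //.
  rewrite (cpt_div cR pF' RF') FE; apply: loc_antimono => _ [y Ry <-].
  split; last exact: srM.
  exact: (smMr (nu_smod (pdiv_local pF')) (RF' _ Ry) Pp).
Qed.

(** Divisors are principal at a regular point. The multiplicity [a] of [Fp] is removed by dividing
    by [p ^ a]. The module [J'] that remains contains any [z] of [R] with [p z] in it, and an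
    element [u * q ^ l + p * v] of [J'] with least [l] generates [J'] modulo [p J'], hence generates
    it by Nakayama. *)
Lemma cpt_lgen J W R : J `<=` A -> generates X J W -> cpt R -> exists t, lgen W R t.
Proof.
move=> JA gJ cR; have XR := cpt_X cR; have lR := X_local XR; have hR : subring R by case: lR.
have [p [q [Fp [[np p0 dec Rq] pF RF vp vp0]]]] := cpt_prime_elt cR; have Rp := nu_sub np.
have [f [Jf f0 vf]] := gen_elt gJ pF.
have [a aE] : exists a : nat, W Fp = a%:Z.
  have : (0 <= W Fp)%R by rewrite -vf; apply/(vv_in pF f0)/RF/(X_A XR)/JA.
  by case: (W Fp) => // n _; exists n.
have pa0 : p ^+ a != 0 by rewrite expf_neq0.
pose W' F := if `[< F = Fp >] then 0 else W F.
have W'n F : F <> Fp -> W' F = W F by move=> ne; rewrite /W'; case: asboolP.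
have W'p : W' Fp = 0 by rewrite /W'; case: asboolP.
have Wge F : prime_divisor X F -> R `<=` F -> (0 <= W F)%R.
  move=> pF' RF'; have [g [Jg g0 <-]] := gen_elt gJ pF'.
  by apply/(vv_in pF' g0)/RF'/(X_A XR)/JA.
have W'0 F : prime_divisor X F -> R `<=` F -> (0 <= W' F)%R.
  by move=> pF' RF'; rewrite /W'; case: asboolP => // _; exact: Wge.
set J' := stalk X W' R; have sJ' : smod R J' by exact: stalk_smod.
have J'R : J' `<=` R.
  move=> x /stalkP h; apply: X_inter => // F pF' RF'; case: (eqVneq x 0) => [->|x0].
    exact: sr0 (pdiv_subring pF').
  by apply/(vv_in pF' x0); apply: le_trans (W'0 F pF' RF') _; apply/(vv_ge _ pF' x0); exact: h.
have divJ g : J g -> g != 0 -> J' (g / p ^+ a).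
  move=> Jg g0; apply/stalkP => F pF' RF'; apply/(vv_ge _ pF'); first by rewrite mulf_neq0 ?invr_neq0.
  rewrite vvM ?invr_neq0 // vvV // vvX //; have := gen_ge gJ pF' Jg g0.
  case: (pselect (F = Fp)) => [->|ne]; first by rewrite W'p vp aE; lia.
  by rewrite W'n // vp0 // mul0rn subr0.
have cancel_p z : R z -> J' (p * z) -> J' z.
  move=> Rz /stalkP h; case: (eqVneq z 0) => [->|z0]; first exact: sm0 sJ'.
  apply/stalkP => F pF' RF'; apply/(vv_ge _ pF' z0).
  case: (pselect (F = Fp)) => [->|ne]; first by rewrite W'p; apply/(vv_in pF z0); exact: RF.
  have := h F pF' RF'; move/(vv_ge _ pF' (mulf_neq0 p0 z0)).
  by rewrite vvM // vp0 // add0r.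
have npJ y : prin p R y -> y != 0 -> (1 <= vv Fp y)%R.
  move=> [z Rz <-] pz0; have z0 : z != 0 by apply: contraNneq pz0 => ->; rewrite mulr0.
  by rewrite vvM // vp ler_wpDr //; apply/(vv_in pF z0); exact: RF.
set y1 := f / p ^+ a; have y10 : y1 != 0 by rewrite mulf_neq0 ?invr_neq0.
have vy1 : vv Fp y1 = 0.
  by rewrite vvM ?invr_neq0 // vvV // vvX // vp vf aE -mulr_natr natz mul1r subrr.
have J'y1 : J' y1 by exact: divJ.
pose PP l := `[< exists y u v, [/\ J' y, R u, R u^-1, u != 0 & R v /\ y = u * q ^+ l + p * v] >].
have exPP : exists l, PP l.
  have [h|[l [u [v [Ru Ru' u0 Rv yE]]]]] := dec y1 (J'R _ J'y1).
    by have := npJ y1 h y10; rewrite vy1.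
  by exists l; apply/asboolP; exists y1, u, v.
have [y [u [v [J'y Ru Ru' u0 [Rv yE]]]]] : exists y u v, [/\ J' y, R u, R u^-1, u != 0 &
    R v /\ y = u * q ^+ (ex_minn exPP) + p * v] by apply/asboolP; case: ex_minnP.
set l := ex_minn exPP in yE.
have lmin l' : PP l' -> (l <= l')%N by rewrite /l; case: ex_minnP => m _ h; exact: h.
have J'E : J' `<=` prin y R.
  apply: (nakayama_prin lR (X_noeth XR) _ (prin_smod y hR) np); first by split.
  move=> x J'x; have [[z Rz zE]|[l' [u' [v' [Ra Ra' a0 Rv' xE]]]]] := dec x (J'R _ J'x).
    exists 0, x; split; [exact: sm0 (prin_smod y hR)| |by rewrite add0r].
    by exists z => //; apply: cancel_p; rewrite ?zE.
  have le : (l <= l')%N by apply: lmin; apply/asboolP; exists x, u', v'.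
  pose c := u' / u * q ^+ (l' - l); have Rc : R c by apply: srM; [|exact: srM|exact: srX].
  have E : x - y * c = p * (v' - v * c).
    rewrite xE yE /c -{1}(subnK le) exprD; field; exact: u0.
  exists (y * c), (p * (v' - v * c)); split; [by exists c| |by rewrite -E; ring].
  have Rz : R (v' - v * c) by apply: srB => //; exact: srM.
  exists (v' - v * c) => //; apply: cancel_p => //; rewrite -E.
  by apply: (smB hR sJ') => //; exact: (smMr sJ').
have y0 : y != 0.
  by have [z _ zE] := J'E _ J'y1; apply: contraNneq y10 => e; rewrite -zE e mul0r.
have low F g : prime_divisor X F -> R `<=` F -> J' g -> g != 0 -> (vv F y <= vv F g)%R.
  move=> pF' RF' /J'E [z Rz <-] yz0; have z0 : z != 0 by apply: contraNneq yz0 => ->; rewrite mulr0.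
  by rewrite vvM // ler_wpDr //; apply/(vv_in pF' z0); exact: RF'.
exists (p ^+ a * y); split; first by rewrite mulf_neq0.
move=> F pF' RF'; rewrite vvM // vvX //.
have ge := (vv_ge _ pF' y0).1 ((stalkP W' R y).1 J'y F pF' RF').
case: (pselect (F = Fp)) => [e|ne].
  subst F; have := low Fp y1 pF RF J'y1 y10; rewrite vy1 vp aE; rewrite W'p in ge.
  rewrite -mulr_natr natz mul1r; lia.
have [g [Jg g0 vg]] := gen_elt gJ pF'.
have gp0 : g / p ^+ a != 0 by rewrite mulf_neq0 ?invr_neq0.
have := low F _ pF' RF' (divJ g Jg g0) gp0; rewrite vvM ?invr_neq0 // vvV // vvX //.
by rewrite vp0 // mul0rn subr0 add0r vg; rewrite W'n // in ge; lia.
Qed.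

Lemma lgen_ex J W R : J `<=` A -> generates X J W -> X R -> exists t, lgen W R t.
Proof.
move=> JA gJ XR; have [RE|pR|cR] := X_class XR; last exact: (cpt_lgen JA gJ cR).
- exists 1; split; first exact: oner_neq0.
  move=> F pF RF; have [t dF] := pdiv_dvr pF; case: (dvr_set0 dF); rewrite eqEsubset; split=> // x _.
  by apply: RF; rewrite RE.
- have [t dR] := pdiv_dvr pR; have hR := dvr_subring dR.
  exists (t ^ W R); split; first by rewrite expfz_neq0 // (dvr_n0 dR).
  move=> F pF RF; have <- := pdiv_eq pR pF RF.
  have := vvE (W R) dR (oner_neq0 _) (sr1 hR); rewrite invr1 mulr1; apply; exact: sr1.
Qed.

(** ** The associativity formula *)

Lemma surf_oncurve S F : surf S -> sdiv S F -> oncurve F S.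
Proof.
move=> sS sF; have [pF SF nF] := sF; have lS := sf_loc sS; have pQ := sdiv_prime lS sF.
split=> //.
- exact: sf_noeth.
- exact: sf_A.
- exact: sf_m.
- by apply: ideal_proper => //; [case: pQ|exact: prime_n1 pQ].
- exact: sf_res.
- move=> Q y pQ' sub Qy Py; have [Q0|//|[G [pG SG nG QE]]] := sf_primes sS pQ'.
    by case: Py; move: Qy; rewrite Q0 => ->; exact: sm0 (nu_smod (pdiv_local pF)).
  case: Py; suff <- : G = F by move: Qy; rewrite QE => -[].
  apply: pdiv_eq => //; rewrite (sf_div sS pG SG nG) (sf_div sS pF SF nF).
  by apply: loc_antimono; rewrite -QE.
- exact: sf_div.
Qed.

(** The local intersection number at [S] of the curve [F] with the divisor of [r]. *)
Definition ol (F S : set K) (r : K) : nat :=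
  xget 0%N [set n | len A (S : set K^o) (sadd (nonunits F `&` S) (prin r S)) n].

Lemma olP F S r : prime_divisor X F -> oncurve F S -> S r -> ~ nonunits F r ->
  len A (S : set K^o) (sadd (nonunits F `&` S) (prin r S)) (ol F S r).
Proof.
move=> pF oS Sr nr; rewrite /ol; case: xgetP => [n -> //|h].
by have [l hl] := pt_len pF oS Sr nr; case: (h l).
Qed.

Lemma olE F S r n : len A (S : set K^o) (sadd (nonunits F `&` S) (prin r S)) n -> ol F S r = n.
Proof.
by move=> hn; rewrite /ol; case: xgetP => [m -> hm|/(_ n)]; [exact: len_uniq hm hn|case].
Qed.

Section Assoc.
Variables (S : set K) (f g : K).
Hypotheses (sS : surf S) (Sf : S f) (Sg : S g) (f0 : f != 0).
Hypothesis cop : forall F, sdiv S F -> nonunits F f -> ~ nonunits F g.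
Let lS : local_ring S. Proof. exact: sf_loc. Qed.
Let hS : subring S. Proof. by case: lS. Qed.
Let AS : A `<=` S. Proof. exact: sf_A. Qed.

(** The functions whose divisor is at least the sum of the members of [ds]. *)
Definition jdl (ds : seq (set K)) : set K :=
  [set x | S x /\ forall F, sdiv S F -> val_ge F (count_mem F ds)%:Z x].

Lemma jdl_smod ds : smod S (jdl ds).
Proof.
split.
- by split; [exact: sr0|move=> F [pF _ _]; exact: val_ge_zero].
- move=> x y [Sx hx] [Sy hy]; split; first exact: srD.
  by move=> F sF; have [pF _ _] := sF; apply: (smD (val_ge_smod _ pF)); [exact: hx|exact: hy].
- move=> a x Sa [Sx hx]; split; first exact: srM.
  by move=> F sF; have [pF SF _] := sF; apply: (smM (val_ge_smod _ pF)); [exact: SF|exact: hx].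
Qed.

Lemma jdl_sub ds : jdl ds `<=` S. Proof. by move=> x []. Qed.

Lemma sdiv_unif F : sdiv S F -> exists p, [/\ S p, p != 0 & vv F p = 1].
Proof.
move=> sF; have [pF SF nF] := sF; have pQ := sdiv_prime lS sF.
have [t dF] := pdiv_dvr pF; have t0 := dvr_n0 dF; have hF := dvr_subring dF.
have vt : vv F t = 1.
  by have := vvE 1 dF (oner_neq0 _) (sr1 hF); rewrite invr1 expr1z mulr1; apply; exact: sr1.
have : nonunits (localization S (nonunits F `&` S)) t.
  by rewrite -(sf_div sS pF SF nF); have [_ _ -> _] := dF; exact: prin_self.
move=> /(loc_nuP pQ) [a [b [[Pa Sa] Sb nb tE]]].
have b0 : b != 0 by exact: prime_n0 pQ nb.
have a0 : a != 0 by apply: contraNneq t0 => e; rewrite tE e mul0r.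
exists a; split=> //; rewrite -vt tE vvM ?invr_neq0 // vvV //.
by rewrite (@vv_unit F b) ?subr0 //; [exact: SF|move=> Pb; exact: nb].
Qed.

Lemma sdiv_sep F G : sdiv S F -> sdiv S G -> F <> G -> exists p, [/\ S p, p != 0, nonunits G p & ~ nonunits F p].
Proof.
move=> sF sG ne; have [pF SF nF] := sF; have [pG SG nG] := sG.
apply: contrapT => h; apply: ne; apply: pdiv_eq => //.
rewrite (sf_div sS pF SF nF) (sf_div sS pG SG nG); apply: loc_antimono => p [Gp Sp].
split=> //; apply: contrapT => Fp; apply: h; exists p; split=> //.
by apply: contra_notN Fp => /eqP ->; exact: sm0 (nu_smod (pdiv_local pF)).
Qed.

Lemma jdl_pick F ds : sdiv S F -> (forall G, G \in ds -> sdiv S G) ->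
  exists y, [/\ jdl ds y, y != 0 & vv F y = (count_mem F ds)%:Z].
Proof.
move=> sF; have [pF SF nF] := sF; elim: ds => [|G ds IH] hds.
  exists 1; rewrite oner_neq0 vv1 //; split=> //; split; first exact: sr1.
  by move=> H [pH _ _]; apply/(vv_ge _ pH (oner_neq0 _)); rewrite vv1.
have [|y [[Sy hy] y0 vy]] := IH; first by move=> H h; apply: hds; rewrite inE h orbT.
have sG := hds G (mem_head _ _); have [pG SG nG] := sG.
have mk p : S p -> p != 0 -> nonunits G p -> vv F p = (G == F)%:Z ->
    exists y, [/\ jdl (G :: ds) y, y != 0 & vv F y = (count_mem F (G :: ds))%:Z].
  move=> Sp p0 Gp vp; exists (p * y); rewrite mulf_neq0 // vvM // vp vy /= PoszD; split=> //.
  split; first exact: srM.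
  move=> H sH; have [pH SH _] := sH; apply/(vv_ge _ pH (mulf_neq0 p0 y0)); rewrite vvM //= PoszD.
  apply: lerD; last exact/(vv_ge _ pH y0)/hy.
  case: eqP => [e|_]; last exact: (vv_in pH p0).1 (SH _ Sp).
  by subst H; exact: (vv_nu pG p0).1 Gp.
case: (eqVneq G F) => [e|/eqP ne].
  subst G; have [p [Sp p0 vp]] := sdiv_unif sF; apply: (mk p) => //; last by rewrite eqxx vp.
  by apply/(vv_nu pF p0); rewrite vp.
have [p [Sp p0 Gp Fp]] := sdiv_sep sF sG (fun e => ne (esym e)); apply: (mk p) => //.
by rewrite (vv_unit pF (SF _ Sp) Fp); case: eqP.
Qed.

(** Division by [y], of least value at [F] in [jdl ds], embeds [jdl ds / jdl (F :: ds)] in [F / P]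
    as a lattice, on which [g] has index [ol F S g] by [len_index]. Since [g] is a nonzerodivisor on
    this quotient, the rest is the length for [jdl (F :: ds)]. *)
Lemma assoc_step F ds n : sdiv S F -> nonunits F f -> (forall G, G \in ds -> sdiv S G) ->
  (forall x, S x -> jdl (F :: ds) (f * x)) ->
  len A (jdl (F :: ds) : set K^o) (sadd (prin f S) (prin g (jdl (F :: ds)))) n ->
  len A (jdl ds : set K^o) (sadd (prin f S) (prin g (jdl ds))) (ol F S g + n).
Proof.
move=> sF Pf hds fJ' hn; have [pF SF nF] := sF; have Pg := cop sF Pf.
have lF := pdiv_local pF; have hF : subring F by case: lF.
have sP := nu_smod lF; have pP := nu_prime lF.
have oS := surf_oncurve sS sF; have cQ := hat_cring pF oS.
set Q := hat F S in cQ; set P := nonunits F in Pg sP pP *.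
have hQ : subring Q := cr_sub cQ.
have g0 : g != 0 by exact: prime_n0 pP Pg.
set J := jdl ds; set J' := jdl (F :: ds) in fJ' hn *.
have sJ : smod S J by exact: jdl_smod. have sJ' : smod S J' by exact: jdl_smod.
have sJA := smod_mono AS sJ. have sJA' := smod_mono AS sJ'.
have J'J : J' `<=` J.
  move=> x [Sx hx]; split=> // G sG; have [pG _ _] := sG.
  case: (eqVneq x 0) => [->|x0]; first exact: val_ge_zero.
  apply/(vv_ge _ pG x0); have := (vv_ge _ pG x0).1 (hx G sG); rewrite /= PoszD; lia.
have [y [Jy y0 vy]] := jdl_pick sF hds; have [Sy hy] := Jy.
have Jdiv x : J x -> F (y^-1 * x).
  move=> [Sx hx]; case: (eqVneq x 0) => [->|x0]; first by rewrite mulr0; exact: sr0.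
  apply/(vv_in pF); first by rewrite mulf_neq0 ?invr_neq0.
  rewrite vvM ?invr_neq0 // vvV // vy addrC subr_ge0; exact/(vv_ge _ pF x0)/hx.
have J'P x : J x -> P (y^-1 * x) <-> J' x.
  move=> Jx; have [Sx hx] := Jx; case: (eqVneq x 0) => [->|x0].
    by rewrite mulr0; split=> _; [exact: sm0 sJ'|exact: sm0 sP].
  have yx0 : y^-1 * x != 0 by rewrite mulf_neq0 ?invr_neq0.
  rewrite /P (vv_nu pF yx0) vvM ?invr_neq0 // vvV // vy; split.
    move=> lt; split=> // G sG; have [pG _ _] := sG; apply/(vv_ge _ pG x0) => /=.
    have := (vv_ge _ pG x0).1 (hx G sG); case: eqP => [e|_]; last by rewrite add0n.
    have key (c : nat) (v : int) : 0 < - c%:Z + v -> (1 + c)%N%:Z <= v by lia.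
    by move=> _; subst G; exact: key.
  by move=> [_ /(_ F sF) /(vv_ge _ pF x0)] /=; rewrite eqxx PoszD; lia.
set N := sadd (prin y^-1 J) P.
have PN : P `<=` N by apply: sadd_subr; exists 0; rewrite ?mulr0 //; exact: sm0 sJ.
have NF : N `<=` F.
  by move=> _ [_ [p [[x Jx <-] Pp ->]]]; apply: srD => //; [exact: Jdiv|exact: nu_sub].
have sNS : smod S N.
  apply: sadd_smod; [exact: img_smod|exact: smod_mono SF sP].
have sN : smod Q N.
  split; [exact: sm0 sNS|by move=> *; exact: smD sNS _ _|].
  move=> _ z [s [p [Ss Pp ->]]] Nz; rewrite /GRing.scale /= mulrDl; apply: (smD sNS).
    exact: (smM sNS).
  by apply: PN; apply: (smMr sP) => //; exact: NF.
have N1 : N 1 by exists 1, 0; split; [exists y; rewrite ?mulVf|exact: sm0 sP|rewrite addr0].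
have QN : Q `<=` N by move=> x Qx; rewrite -[x]mulr1; exact: smM sN _ _.
have [b [Qb Pb hb]] : exists b, [/\ Q b, ~ P b & forall x, N x -> Q (b * x)].
  apply: (fin_bd pF cQ).
  have [s sE] := sf_noeth sS (conj (@jdl_sub ds) sJ); rewrite -/J in sE.
  exists (1 :: [seq y^-1 * x | x <- s]); split.
    move=> z; rewrite inE => /orP[/eqP ->|/mapP [x xs ->]]; first exact: sr1.
    by apply: Jdiv; rewrite sE; exact: ideal_spanS.
  set zs := (1 :: _); have sL : smod Q (lin Q zs) by apply: lin_smod; exact: sr_smod.
  have SQ : S `<=` Q by exact: hat_sub.
  move=> _ [_ [p [[x Jx <-] Pp ->]]]; apply: (smD sL).
    have : [set x | lin Q zs (y^-1 * x)] x.
      move: Jx; rewrite sE; apply: ideal_span_min.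
        split; first by rewrite /= mulr0; exact: sm0 sL.
          by move=> u v /= hu hv; rewrite mulrDr; exact: smD sL _ _.
        by move=> c u Sc /= hu; rewrite /GRing.scale /= mulrCA; apply: (smM sL) => //; exact: SQ.
      move=> u us; have uz : y^-1 * u \in zs by rewrite inE; apply/orP; right; apply: map_f.
      exact: (lin_mem hQ uz).
    by [].
  rewrite -[p]mulr1; apply: (smM sL); first exact: (cr_P cQ).
  exact: (lin_mem hQ (mem_head _ _)).
have [l hl] := fin_colen pF cQ sN QN Qb Pb hb.
have AQ := cr_A cQ; have sNA := smod_mono AQ sN; have sQA := smod_mono AQ (sr_smod hQ).
have Qg : Q g by exact: hat_sub.
have gQ x : Q x -> Q (g * x) by exact: srM.
have gN x : N x -> N (g * x) by move=> Nx; exact: smM sN _ _.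
have hNg : len A (N : set K^o) (prin g N) (ol F S g).
  apply: (len_index _ sQA sNA QN gQ gN g0 hl).1.
  exact: ((len_hat pF oS _ Sg Pg).1 (olP pF oS Sg Pg)).
have sfS : smod A (prin f S) by apply: smod_mono AS _; exact: prin_smod.
have sgJ : smod A (prin g J) by exact: img_smod.
have sgJ' : smod A (prin g J') by exact: img_smod.
have gJJ x : J x -> J (g * x) by move=> Jx; exact: smM sJ _ _.
have gNA : smod A (prin g N) by exact: img_smod.
have h1 : len A (J : set K^o) (sadd J' (prin g J)) (ol F S g).
  apply: (@len_mul2 _ A J (sadd J' (prin g J)) N (prin g N) y^-1 _ hA sJA (sadd_smod sJA' sgJ) _ sNA gNA _ _ _ _ hNg).
  - by apply: (sadd_min sJA J'J) => _ [x Jx <-]; exact: gJJ.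
  - by move=> _ [x Nx <-]; exact: gN.
  - by move=> x Jx; apply: sadd_subl; [exact: sm0 sP|exists x].
  - move=> _ [_ [p [[x Jx <-] Pp ->]]]; exists x => //; rewrite addrAC subrr add0r.
    have [_ Fg'] := nP_inv (SF _ Sg) Pg; exists (g^-1 * p); last by rewrite mulVKf.
    by apply: PN; exact: smM sP _ _.
  - move=> x Jx; split.
      move=> [_ [_ [p [[z Jz <-] Pp ->]]] E].
      exists (x - g * z), (g * z); split; [|by exists z|by rewrite subrK].
      apply/J'P; first by apply: (smB hS sJ) => //; exact: gJJ.
      have -> : y^-1 * (x - g * z) = g * p by rewrite mulrBr -E; ring.
      by apply: (smM sP) => //; exact: SF.
    move=> [x' [_ [J'x' [z Jz <-] ->]]].
    have /J'P Px' : J x' by exact: J'J.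
    have [_ Fg'] := nP_inv (SF _ Sg) Pg.
    exists (y^-1 * z + g^-1 * (y^-1 * x')); last by rewrite mulrDr mulVKf //; ring.
    exists (y^-1 * z), (g^-1 * (y^-1 * x')); split=> //; first by exists z.
    by apply: (smM sP) => //; apply/J'P => //; exact: J'J.
have h2 : len A (sadd J' (prin g J) : set K^o) (sadd (prin f S) (prin g J)) n.
  have sub1 : sadd (prin f S) (prin g J') `<=` J'.
    apply: (sadd_min sJA'); first by move=> _ [x Sx <-]; exact: fJ'.
    by move=> _ [x Jx <-]; exact: smM sJ' _ _.
  have sub2 : sadd (prin f S) (prin g J) `<=` sadd J' (prin g J).
    apply: (sadd_min (sadd_smod sJA' sgJ)).
      by move=> _ [x Sx <-]; apply: sadd_subl; [exact: sm0 sgJ|exact: fJ'].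
    by apply: sadd_subr; exact: sm0 sJ'.
  apply: (@len_mul1 _ A J' _ _ _ 1 _ hA sJA' (sadd_smod sfS sgJ') sub1 (sadd_smod sJA' sgJ) (sadd_smod sfS sgJ) sub2 _ _ _ hn).
  - by move=> x J'x; rewrite mul1r; apply: sadd_subl => //; exact: sm0 sgJ.
  - move=> _ [x [_ [J'x [z Jz <-] ->]]]; exists x => //.
    have -> : x + g * z - 1 * x = g * z by ring.
    by apply: sadd_subr; [exact: sm0 sfS|exists z].
  - move=> x J'x; rewrite mul1r; split; last first.
      move=> [u [_ [hu [z J'z <-] ->]]]; exists u, (g * z); split=> //; exists z => //; exact: J'J.
    move=> [_ [_ [[s Ss <-] [z Jz <-] E]]]; exists (f * s), (g * z); split=> //; first by exists s.
    exists z => //; apply/J'P => //.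
    have h : P (y^-1 * (g * z)).
      apply/J'P; first exact: gJJ.
      have -> : g * z = x - f * s by rewrite E; ring.
      by apply: (smB hS sJ') => //; exact: fJ'.
    have [_ Fg'] := nP_inv (SF _ Sg) Pg.
    have -> : y^-1 * z = g^-1 * (y^-1 * (g * z)) by field; rewrite y0 g0.
    exact: smM sP _ _.
exact: (len_add AN1 h1 h2).
Qed.

(** The components of [f] pass from [pre] to [suf] one at a time; when all are in [suf], [jdl suf]
    is [f S] and the length is zero. *)
Lemma assoc_list pre suf : (forall G, G \in pre ++ suf -> sdiv S G /\ nonunits G f) ->
  (forall F, sdiv S F -> vv F f = (count_mem F pre + count_mem F suf)%:Z) ->
  len A (jdl suf : set K^o) (sadd (prin f S) (prin g (jdl suf))) (\sum_(F <- pre) ol F S g)%N.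
Proof.
elim: pre suf => [|F pre IH] suf hds cnt.
  rewrite big_nil; have E : jdl suf = prin f S.
    rewrite eqEsubset; split.
      move=> x [Sx hx]; apply/(prinP _ _ f0); apply: surf_inter => // F sF; have [pF SF _] := sF.
      case: (eqVneq x 0) => [->|x0]; first by rewrite mul0r; exact: sr0 (pdiv_subring pF).
      apply/(vv_in pF); first by rewrite mulf_neq0 ?invr_neq0.
      rewrite vvM ?invr_neq0 // vvV // cnt // add0n subr_ge0; exact/(vv_ge _ pF x0)/hx.
    move=> _ [s Ss <-]; split; first exact: srM.
    move=> F sF; have [pF SF _] := sF; case: (eqVneq s 0) => [->|s0]; first by rewrite mulr0; exact: val_ge_zero.
    apply/(vv_ge _ pF (mulf_neq0 f0 s0)); rewrite vvM // cnt // add0n ler_wpDr //.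
    by apply/(vv_in pF s0); exact: SF.
  rewrite E; have -> : sadd (prin f S) (prin g (prin f S)) = prin f S.
    rewrite eqEsubset; split; last first.
      by apply: sadd_subl; exists 0; rewrite ?mulr0 //; exists 0; rewrite ?mulr0 //; exact: sr0.
    apply: (sadd_min (prin_smod f hS)) => // _ [_ [s Ss <-] <-].
    by exists (g * s); [exact: srM|ring].
  by apply: len0; apply: smod_mono AS _; exact: prin_smod.
have [sF Pf] := hds F (mem_head _ _).
have cnt' G : sdiv S G -> vv G f = (count_mem G pre + count_mem G (F :: suf))%:Z.
  by move=> sG; rewrite (cnt G sG); congr Posz; rewrite /= -addnA; exact: addnCA.
have hds' G : G \in pre ++ F :: suf -> sdiv S G /\ nonunits G f.
  by move=> h; apply: hds; move: h; rewrite !(mem_cat, inE) => /or3P [->|->|->]; rewrite ?orbT.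
rewrite big_cons; apply: assoc_step => //.
- by move=> G h; have [] := hds G; rewrite // inE mem_cat h !orbT.
- move=> x Sx; split; first exact: srM.
  move=> G sG; have [pG SG _] := sG; case: (eqVneq x 0) => [->|x0]; first by rewrite mulr0; exact: val_ge_zero.
  apply/(vv_ge _ pG (mulf_neq0 f0 x0)); rewrite vvM // cnt' // PoszD.
  by apply: ler_wpDr; [exact/(vv_in pG x0)/SG|rewrite lerDr].
- exact: IH.
Qed.

Lemma assoc Fs : uniq Fs -> (forall F, F \in Fs -> sdiv S F) ->
  (forall F, sdiv S F -> nonunits F f -> F \in Fs) ->
  len A (S : set K^o) (sadd (prin f S) (prin g S)) (\sum_(F <- Fs) `|vv F f|%N * ol F S g)%N.
Proof.
move=> uFs hFs cov; pose pre := flatten [seq nseq `|vv F f|%N F | F <- Fs].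
have S0 : jdl [::] = S.
  rewrite eqEsubset; split=> [x []//|x Sx]; split=> // F [pF SF _].
  case: (eqVneq x 0) => [->|x0]; first exact: val_ge_zero.
  by apply/(vv_ge _ pF x0); apply/(vv_in pF x0); exact: SF.
have -> : (\sum_(F <- Fs) `|vv F f|%N * ol F S g = \sum_(F <- pre) ol F S g)%N.
  rewrite /pre; elim: (Fs) => [|F L IH] /=; first by rewrite !big_nil.
  rewrite big_cons big_cat /= IH; congr (_ + _)%N.
  by elim: `|vv F f|%N => [|m IHm] /=; rewrite ?big_nil // big_cons -IHm mulSn.
rewrite -[X in len A X]S0 -[X in prin g X]S0; apply: assoc_list.
- move=> G; rewrite cats0 => /flattenP [_ /mapP [F Fin ->]] /nseqP [-> lt].
  have sF := hFs F Fin; split=> //; have [pF SF _] := sF.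
  apply/(vv_nu pF f0); have := (vv_in pF f0).1 (SF _ Sf); lia.
- move=> F sF; have [pF SF _] := sF; rewrite addn0.
  have ge := (vv_in pF f0).1 (SF _ Sf).
  have -> : count_mem F pre = if F \in Fs then `|vv F f|%N else 0%N.
    rewrite /pre; elim: (Fs) uFs => [|G L IH] //= /andP[nG uL].
    rewrite count_cat IH // count_nseq inE /=; case: (eqVneq G F) => [e|ne] /=.
      by subst G; rewrite (negPf nG) addn0 mul1n mem_head.
    by rewrite mul0n add0n in_cons eq_sym (negPf ne).
  case: ifP => [_|nF]; first by rewrite gez0_abs.
  apply/eqP; rewrite eq_le ge andbT leNgt; apply/negP => /(vv_nu pF f0) h.
  by move: nF; rewrite (cov F sF h).
Qed.

End Assoc.

Lemma fsum_seq (I : choiceType) (D : set I) (G : I -> int) (s : seq I) : uniq s ->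
  (forall i, i \in s -> D i) -> (forall i, D i -> G i != 0 -> i \in s) ->
  (\sum_(i \in D) G i)%R = \sum_(i <- s) G i.
Proof.
move=> us sD cov; rewrite (fsbigE s) //; last first.
  by move=> i Di; apply: contraNeq; exact: cov.
rewrite big_seq_cond [RHS]big_seq_cond; apply: eq_bigl => i.
by case: (boolP (i \in s)) => //= h; rewrite mem_set //; exact: sD.
Qed.

(** * The degree of a cycle on an exceptional curve *)

Section Degree.
Variables (E : set K).
Hypothesis eE : exceptional A X E.
Let pE := exc_pdiv eE.
Let lE : local_ring E. Proof. exact: pdiv_local. Qed.
Let hE : subring E. Proof. by case: lE. Qed.
Let P := nonunits E.

Lemma ol_hat R r : X R -> R `<` E -> R r -> ~ P r -> len A (hat E R : set K^o) (prin r (hat E R)) (ol E R r).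
Proof.
move=> XR lt Rr Pr; have oR := pt_oncurve pE XR lt.
exact: ((len_hat pE oR _ Rr Pr).1 (olP pE oR Rr Pr)).
Qed.

Lemma olM R r s : X R -> R `<` E -> R r -> ~ P r -> R s -> ~ P s -> ol E R (r * s) = (ol E R r + ol E R s)%N.
Proof.
move=> XR lt Rr Pr Rs Ps; have oR := pt_oncurve pE XR lt; have cR := hat_cring pE oR.
have hR := X_subring XR; have sub : R `<=` hat E R by exact: hat_sub.
have Prs : ~ P (r * s) by apply: (prime_nmul (nu_prime lE)) => //; exact: (properW lt).
have h := ord_mul pE cR (sub _ Rr) Pr (sub _ Rs) Ps (ol_hat XR lt Rr Pr) (ol_hat XR lt Rs Ps).
exact: len_uniq (ol_hat XR lt (srM hR Rr Rs) Prs) h.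
Qed.

Lemma ol_unit R r : X R -> R `<` E -> R r -> r != 0 -> R r^-1 -> ol E R r = 0%N.
Proof.
move=> XR lt Rr r0 Rr'; have oR := pt_oncurve pE XR lt; have cR := hat_cring pE oR.
have sub : R `<=` hat E R by exact: hat_sub.
have Pr : ~ P r by move=> h; apply: (nu_not h r0); exact: (properW lt).
exact: (ord_unit cR (sub _ Rr) (sub _ Rr') r0 (ol_hat XR lt Rr Pr)).
Qed.

Lemma ol_length R r : X R -> R `<` E -> R r -> ~ P r ->
  fine (length A (R : set K^o) [set x | exists p y, [/\ R p, nonunits E p, R y & x = p + r * y]]) = (ol E R r)%:Z.
Proof.
move=> XR lt Rr Pr; have oR := pt_oncurve pE XR lt.
have -> : [set x | exists p y, [/\ R p, nonunits E p, R y & x = p + r * y]] = sadd (nonunits E `&` R) (prin r R).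
  rewrite eqEsubset; split=> x.
    by move=> [p [y [Rp Pp Ry ->]]]; exists p, (r * y); split=> //; exists y.
  by move=> [p [_ [[Pp Rp] [y Ry <-] ->]]]; exists p, y.
by rewrite (len_length (olP pE oR Rr Pr)).
Qed.

Variables (Z : set K -> int) (f : K) (t : set K -> K).
Hypotheses (f0 : f != 0) (vf : vv E f = Z E).
Hypothesis ht : forall R, X R -> R `<` E -> lgen Z R (t R) /\ R (f / t R).

Let Pft R : X R -> R `<` E -> ~ P (f / t R).
Proof.
move=> XR lt; have [[t0 tE] _] := ht XR lt; have ft0 : f / t R != 0 by rewrite mulf_neq0 ?invr_neq0.
move/(vv_nu pE ft0); rewrite vvM ?invr_neq0 // vvV // tE //; last exact: (properW lt).
by rewrite vf subrr.
Qed.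

Let local_degreeE h u R : X R -> R `<` E -> h != 0 -> vv E h = Z E -> u = f / h ->
  local_degree A X Z h E R = cdeg E (hat E R) u - (ol E R (f / t R))%:Z.
Proof.
move=> XR lt h0 vh uE; have oR := pt_oncurve pE XR lt; have cR := hat_cring pE oR.
have lR := X_local XR; have hR : subring R by case: lR.
have [[t0 tE] Rft] := ht XR lt; have lg : lgen Z R (t R) by [].
have sub : R `<=` hat E R by exact: hat_sub. have RE := properW lt.
have key a b : R a -> ~ P a -> R b -> ~ P b -> stalk X Z R = [set (h * a / b) * y | y in R] ->
    (ol E R a)%:Z - (ol E R b)%:Z = cdeg E (hat E R) u - (ol E R (f / t R))%:Z.
  move=> Ra Pa Rb Pb; rewrite (lgen_stalk XR lg) => e.
  have b0 := prime_n0 (nu_prime lE) Pb; have a0 := prime_n0 (nu_prime lE) Pa.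
  have [w Rw wE] : prin (t R) R (h * a / b) by rewrite e; exact: prin_self.
  have [w' Rw' wE'] : prin (h * a / b) R (t R) by rewrite -e; exact: prin_self.
  have ww : w * w' = 1 by apply: (mulfI t0); rewrite mulrA wE wE' mulr1.
  have w0 : w != 0 by apply: contra_eq_neq ww => ->; rewrite mul0r eq_sym oner_neq0.
  have w'E : w' = w^-1 by rewrite -[RHS]mulr1 -ww mulKf.
  rewrite w'E in Rw'; have Pw : ~ P w by move=> hw; apply: (nu_not hw w0); exact: RE.
  have Pft' := Pft XR lt.
  have Raf : R (a * (f / t R)) by exact: srM. have Rbw : R (b * w) by exact: srM.
  have Paf : ~ P (a * (f / t R)) by apply: (prime_nmul (nu_prime lE)) => //; exact: RE.
  have Pbw : ~ P (b * w) by apply: (prime_nmul (nu_prime lE)) => //; exact: RE.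
  have E1 : u * (b * w) = a * (f / t R).
    have -> : w = h * a / b / t R by rewrite -wE mulrC mulKf.
    by rewrite uE; field; rewrite t0 h0 b0.
  rewrite (cdegE pE cR (sub _ Raf) Paf (sub _ Rbw) Pbw E1 (ol_hat XR lt Raf Paf) (ol_hat XR lt Rbw Pbw)).
  by rewrite (olM XR lt Ra Pa Rft Pft') (olM XR lt Rb Pb Rw Pw) (ol_unit XR lt Rw w0 Rw') !PoszD; lia.
rewrite /local_degree; case: xgetP => [n -> [a [b [[Ra Pa] [Rb Pb] e ->]]]|].
  by rewrite (ol_length XR lt Ra Pa) (ol_length XR lt Rb Pb); exact: key.
have th0 : t R / h != 0 by rewrite mulf_neq0 ?invr_neq0.
have vth : vv E (t R / h) = 0 by rewrite vvM ?invr_neq0 // vvV // tE // vh subrr.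
have Eth : E (t R / h) by apply/(vv_in pE th0); rewrite vth.
have := Eth; rewrite {1}(oc_frac oR) => -[a [b [Ra Rb nb thE]]].
have Pb : ~ P b by move=> Pb; apply: nb.
have b0 := prime_n0 (nu_prime lE) Pb.
have Pa : ~ P a.
  move=> Pa; have aE : a = t R / h * b by rewrite thE divfK.
  have : P (t R / h).
    have [_ Eb'] := nu_inv (RE _ Rb) Pb; rewrite thE; exact: (smMr (nu_smod lE)).
  by move/(vv_nu pE th0); rewrite vth.
move=> /(_ ((ol E R a)%:Z - (ol E R b)%:Z)) []; exists a, b; split=> //.
- rewrite (lgen_stalk XR lg); have -> : t R = h * a / b by rewrite -mulrA -thE mulrC divfK.
  done.
- by rewrite (ol_length XR lt Ra Pa) (ol_length XR lt Rb Pb).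
Qed.

(** The degree of [O_X(-Z)] on [E] is the number of zeros on [E] of its section [f]. The choice of
    [h] in [degree_on] changes the sum by the degree of the function [f / h] on [E], which is zero
    by [deg0]. *)
Lemma degreeE L : uniq L -> (forall R, R \in L -> X R /\ R `<` E) ->
  (forall R, X R -> R `<` E -> nonunits R (f / t R) -> R \in L) ->
  degree_on A X Z E = - \sum_(R <- L) (ol E R (f / t R))%:Z.
Proof.
move=> uL XL cov.
have key h : h != 0 -> vv E h = Z E ->
    (\sum_(R \in [set R | X R /\ R `<` E]) local_degree A X Z h E R)%R = - \sum_(R <- L) (ol E R (f / t R))%:Z.
  move=> h0 vh; pose u := f / h; have u0 : u != 0 by rewrite mulf_neq0 ?invr_neq0.
  have vu : vv E u = 0 by rewrite vvM ?invr_neq0 // vvV // vf vh subrr.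
  have Eu : E u by apply/(vv_in pE u0); rewrite vu.
  have Pu : ~ P u by move/(vv_nu pE u0); rewrite vu.
  have [Lu uLu cLu] := covers_ex pE Eu Pu; have [XLu covu] := cLu.
  pose L' := undup (L ++ Lu); have uL' : uniq L' by exact: undup_uniq.
  have XL' R : R \in L' -> X R /\ R `<` E by rewrite mem_undup mem_cat => /orP[/XL|/XLu].
  have olz R : X R -> R `<` E -> R \notin L -> ol E R (f / t R) = 0%N.
    move=> XR lt nR; have [[t0 _] Rft] := ht XR lt.
    have nn : ~ nonunits R (f / t R) by move=> /(cov _ XR lt) hL; rewrite hL in nR.
    by have [ft0 Rft'] := nu_inv Rft nn; exact: ol_unit.
  have cdz R : X R -> R `<` E -> R \notin Lu -> cdeg E (hat E R) u = 0.
    move=> XR lt nR; have cR := hat_cring pE (pt_oncurve pE XR lt).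
    have [h1 h2] : hat E R u /\ hat E R u^-1 by apply: contrapT => hh; move: nR; rewrite (covu _ XR lt hh).
    exact: (cdeg_unit pE cR).
  rewrite (@fsum_seq _ _ _ L') //; last first.
    move=> R [XR lt]; apply: contraR; rewrite mem_undup mem_cat negb_or => /andP[nL nLu].
    by rewrite (local_degreeE XR lt h0 vh (erefl u)) olz // cdz.
  rewrite (eq_big_seq (fun R => cdeg E (hat E R) u - (ol E R (f / t R))%:Z)); last first.
    by move=> R /XL' [XR lt]; rewrite (local_degreeE XR lt h0 vh (erefl u)).
  rewrite sumrB (covers_sum pE uLu uL' u0 cLu _ XL'); last first.
    by move=> R hR; rewrite mem_undup mem_cat hR orbT.
  rewrite (deg0 pE eE Eu Pu uLu cLu) sub0r; congr (- _).
  rewrite (bigID (fun R => R \in L)) /= addrC big_seq_cond big1 ?add0r; last first.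
    by move=> R /andP[/XL' [XR lt] nR]; rewrite olz.
  rewrite -big_filter; apply: perm_big; apply: uniq_perm => //; first exact: filter_uniq.
  by move=> R; rewrite mem_filter mem_undup mem_cat; case: (R \in L).
rewrite /degree_on; case: xgetP => [n -> [h [h0 h1 h2 ->]]|].
  apply: key => //; have h0' : h^-1 != 0 by rewrite invr_neq0.
  have := (vv_ge _ pE h0).1 h1; have := (vv_ge _ pE h0').1 h2; rewrite vvV //; lia.
move=> /(_ (- \sum_(R <- L) (ol E R (f / t R))%:Z)) []; exists f; split=> //; last by rewrite key.
- by apply/(vv_ge _ pE f0); rewrite vf.
- by apply/(vv_ge _ pE); rewrite ?invr_neq0 // vvV // vf.
Qed.

End Degree.

(** ** The colength of two general elements *)

Variables (Z : set K -> int) (I : set K).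
Hypotheses (cZ : Defs.cycle A X Z) (gZ : generates X I Z) (iI : ideal A I) (Im : I `<=` nonunits A).

Let IA : I `<=` A. Proof. by case: iI. Qed.
Let mA : nonunits A `<=` A. Proof. exact: nu_sub. Qed.

Lemma nexc0 W F : Defs.cycle A X W -> ~ exceptional A X F -> W F = 0.
Proof. by move=> cW nE; apply/eqP; apply: contrapT => /negP /cW. Qed.

Lemma sdivE F : sdiv A F <-> prime_divisor X F /\ ~ exceptional A X F.
Proof. by split=> [sF|[pF nE]]; [have [pF _ _] := sF; split=> //; exact: sdiv_nexc|exact: nexc_sdiv]. Qed.

Lemma exc_nu E x : exceptional A X E -> nonunits A x -> nonunits E x.
Proof. by move=> [_ [_ mE]]; exact: mE. Qed.

Lemma M_pos E : exceptional A X E -> (0 < M E)%R.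
Proof.
move=> eE; have pE := exc_pdiv eE; have [x [mx x0 <-]] := gen_elt gM pE.
by apply/(vv_nu pE x0); exact: exc_nu.
Qed.

Lemma exists_exc : exists E, exceptional A X E.
Proof.
have [V [vV dV]] := local_val lA; have [R XR dR] := X_val vV (proj1 dV).
have dRA : dominates R A.
  split; first exact: X_A.
  move=> x mx; apply/nuP; split; first exact: (X_A XR (nu_sub mx)).
  case: (eqVneq x 0) => [->|x0]; [by left|right] => Rx.
  by have [RV nRV] := dR; apply: (nu_not (dV.2 _ mx) x0); exact: RV.
by have [E eE _] := dom_exc XR dRA; exists E.
Qed.

Lemma unit_nexc x : A x -> x != 0 -> (forall F, prime_divisor X F -> ~ exceptional A X F -> vv F x = 0) ->
  ~ nonunits A x.
Proof.
move=> Ax x0 h mx; apply: (nu_not mx x0); apply: surf_inter; first exact: surf_A.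
move=> F /sdivE [pF nE]; apply/(vv_in pF); rewrite ?invr_neq0 // vvV // h // oppr0 //.
Qed.

Lemma lgen_prin W R s s' : X R -> lgen W R s -> lgen W R s' -> prin s R = prin s' R.
Proof. by move=> XR h h'; rewrite -(lgen_stalk XR h) (lgen_stalk XR h'). Qed.

Lemma saddC (N P : set K) : sadd N P = sadd P N.
Proof. by rewrite eqEsubset; split=> _ [x [y [h1 h2 ->]]]; exists y, x; rewrite addrC. Qed.

Definition divlist a (Fs : seq (set K)) := uniq Fs /\ forall F, F \in Fs <->
  [/\ prime_divisor X F, ~ exceptional A X F & nonunits F a].
Definition ptlist F (Rs : seq (set K)) := uniq Rs /\ forall R, R \in Rs <-> X R /\ R `<` F.

Lemma divlist_ex a : a != 0 -> exists Fs, divlist a Fs.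
Proof.
move=> /fin_pdiv [s hs].
exists (undup [seq F <- s | `[< [/\ prime_divisor X F, ~ exceptional A X F & nonunits F a] >]]).
split; first exact: undup_uniq.
move=> F; rewrite mem_undup mem_filter; split=> [/andP[/asboolP //]|h].
by apply/andP; split; [exact/asboolP|case: h => pF _; exact: hs].
Qed.

Lemma ptlist_ex F b : prime_divisor X F -> nonunits A b -> ~ nonunits F b -> exists Rs, ptlist F Rs.
Proof.
move=> pF mb nb; have [XF _] := pF; have Fb : F b by exact/(X_A XF)/mA.
have [b0 Fb'] := nu_inv Fb nb; have [s hs] := fin_pts pF b0 Fb Fb'.
exists (undup [seq R <- s | `[< X R /\ R `<` F >]]); split; first exact: undup_uniq.
move=> R; rewrite mem_undup mem_filter; split=> [/andP[/asboolP //]|h].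
apply/andP; split; first exact/asboolP.
have [XR lt] := h; apply: hs => // -[Rb Rb'].
have [_ mR] := cpt_dom (pt_cpt pF XR lt); exact: (nu_not (mR _ mb) b0).
Qed.


Section Pair.
Variables (W1 W2 : set K -> int) (x y : K).
Hypotheses (cW1 : Defs.cycle A X W1) (cW2 : Defs.cycle A X W2).

Definition gen2 := [/\ nonunits A x, nonunits A y & forall R, X R -> lgen W1 R x \/ lgen W2 R y].
Hypothesis gp : gen2.

(** Such a [z] would have no zeros outside the exceptional curves, and would be a unit of [A], the
    intersection of the nonexceptional valuation rings. *)
Lemma lgen_nunit W z : Defs.cycle A X W -> nonunits A z -> ~ (forall R, X R -> lgen W R z).
Proof.
move=> cW mz h; have [E eE] := exists_exc; have [z0 _] := h E (exc_X eE).
apply: (unit_nexc (mA mz) z0 _ mz) => F pF nE.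
have [XF _] := pF; have [_ ->] // := h F XF; exact: nexc0.
Qed.

Lemma gen2_n0 : x != 0 /\ y != 0.
Proof.
have [mx my h] := gp; split; apply/eqP => e.
  by apply: (lgen_nunit cW2 my) => R /h [[]|//]; rewrite e eqxx.
by apply: (lgen_nunit cW1 mx) => R /h [//|[]]; rewrite e eqxx.
Qed.

Lemma gen2_nexc F : prime_divisor X F -> ~ exceptional A X F -> nonunits F x -> ~ nonunits F y.
Proof.
move=> pF nE na; have [x0 y0] := gen2_n0; have [_ _ h] := gp; have [XF _] := pF.
have va := (vv_nu pF x0).1 na; have [[_ /(_ F pF)]|[_ /(_ F pF)]] := h F XF.
  by rewrite nexc0 // => /(_ (@subset_refl _ _)) e; rewrite e in va.
by rewrite nexc0 // => /(_ (@subset_refl _ _)) e /(vv_nu pF y0); rewrite e.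
Qed.

Lemma gen2_lgen F R : prime_divisor X F -> ~ exceptional A X F -> nonunits F x ->
  X R -> R `<` F -> lgen W2 R y.
Proof.
move=> pF nE na XR lt; have [x0 _] := gen2_n0; have [_ _ h] := gp.
have [[_ /(_ F pF (properW lt))]|//] := h R XR.
by have := (vv_nu pF x0).1 na; rewrite (nexc0 cW1 nE) => /[swap] ->.
Qed.

Lemma gen2_lists : exists Fs PF, divlist x Fs /\ forall F, F \in Fs -> ptlist F (PF F).
Proof.
have [x0 _] := gen2_n0; have [_ my _] := gp; have [Fs hFs] := divlist_ex x0.
have : forall F, exists Rs, F \in Fs -> ptlist F Rs.
  move=> F; case: (boolP (F \in Fs)) => [Fin|_]; last by exists [::].
  have [pF nE na] := (hFs.2 F).1 Fin.
  by have [Rs h] := ptlist_ex pF my (gen2_nexc pF nE na); exists Rs.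
by move=> /choice [PF h]; exists Fs, PF.
Qed.

(** The right side does not mention [y]: at the points of a nonexceptional component of [x], [x]
    cannot generate [O_X(-W1)], so [y] generates [O_X(-W2)] and may be replaced by any local
    generator [s R]. *)
Lemma len_gen2 Fs (PF : set K -> seq (set K)) (s : set K -> K) : divlist x Fs ->
  (forall F, F \in Fs -> ptlist F (PF F)) -> (forall R, X R -> lgen W2 R (s R)) ->
  len A (A : set K^o) (sadd (prin x A) (prin y A))
    (\sum_(F <- Fs) `|vv F x|%N * \sum_(R <- PF F) ol F R (s R))%N.
Proof.
move=> [uFs hFs] hPF hs; have [x0 y0] := gen2_n0; have [mx my h] := gp.
have := assoc (f := x) (g := y) surf_A (mA mx) (mA my) x0 _ uFs _ _.
have -> : (\sum_(F <- Fs) `|vv F x|%N * ol F A y = \sum_(F <- Fs) `|vv F x|%N * \sum_(R <- PF F) ol F R (s R))%N.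
  rewrite big_seq [RHS]big_seq; apply: eq_bigr => F Fin; congr (_ * _)%N.
  have [pF nE na] := (hFs F).1 Fin; have [uR hR] := hPF F Fin.
  have nb := gen2_nexc pF nE na; apply: olE.
  apply: (len_transversal pF nE my nb uR hR (l := fun R => ol F R (s R))) => R Rin.
  have [XR lt] := (hR R).1 Rin; have lg := gen2_lgen pF nE na XR lt.
  have -> : ol F R (s R) = ol F R y by rewrite /ol (lgen_prin XR (hs R XR) lg).
  by apply: olP => //; [exact: pt_oncurve|exact/(X_A XR)/mA].
apply.
- by move=> F /sdivE [pF nE] na; exact: gen2_nexc pF nE na.
- by move=> F /hFs [pF nE _]; apply/sdivE.
- by move=> F /sdivE [pF nE] na; apply/hFs.
Qed.

End Pair.

Lemma gen2_sym W1 W2 x y : gen2 W1 W2 x y -> gen2 W2 W1 y x.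
Proof. by move=> [mx my h]; split=> // R /h []; [right|left]. Qed.

Lemma lgen_choice J W : J `<=` A -> generates X J W -> exists s, forall R, X R -> lgen W R (s R).
Proof.
move=> JA gJ; have : forall R, exists s, X R -> lgen W R s.
  by move=> R; case: (pselect (X R)) => [/(lgen_ex JA gJ) [s h]|h]; [exists s|exists 0].
by move=> /choice [s h]; exists s.
Qed.

Lemma len_gen2_ind J W1 W2 x y y' n : Defs.cycle A X W1 -> Defs.cycle A X W2 -> J `<=` A ->
  generates X J W2 -> gen2 W1 W2 x y -> gen2 W1 W2 x y' ->
  len A (A : set K^o) (sadd (prin x A) (prin y A)) n -> len A (A : set K^o) (sadd (prin x A) (prin y' A)) n.
Proof.
move=> c1 c2 JA gJ gp gp' hn; have [Fs [PF [h1 h2]]] := gen2_lists c1 c2 gp.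
have [s hs] := lgen_choice JA gJ.
rewrite (len_uniq hn (len_gen2 c1 c2 gp h1 h2 hs)); exact: (len_gen2 c1 c2 gp' h1 h2 hs).
Qed.

Definition gpair a b := I a /\ gen2 Z M a b.

(** The condition on [a] makes [a' R = a / t R] a local equation of the nonexceptional part of the
    divisor of [a]. It has no component in common with the divisor of [s R], which is
    exceptional. *)
Lemma len_star a b : gpair a b -> (forall E, exceptional A X E -> vv E a = Z E) ->
  exists2 n, len A (A : set K^o) (sadd (prin a A) (prin b A)) n & n%:Z = - intersection A X M Z.
Proof.
move=> [Ia gp] va; have [a0 b0] := gen2_n0 cZ cM gp.
have [Fs [PF [dl pl]]] := gen2_lists cZ cM gp; have [s hs] := lgen_choice mA gM.
have hn := len_gen2 cZ cM gp dl pl hs; have [uFs hFs] := dl.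
exists (\sum_(F <- Fs) `|vv F a|%N * \sum_(R <- PF F) ol F R (s R))%N => //.
have [t ht] := lgen_choice IA gZ.
have [Es [uEs hEs]] := fin_exc.
pose a' R := a / t R.
have Ra' R : X R -> R (a' R).
  move=> XR; have [t0 _] := ht R XR; apply/(prinP _ _ t0); rewrite -(lgen_stalk XR (ht R XR)) -gZ //.
  exact: ideal_spanS.
have a'0 R : X R -> a' R != 0 by move=> XR; have [t0 _] := ht R XR; rewrite mulf_neq0 ?invr_neq0.
have va' R F : X R -> prime_divisor X F -> R `<=` F -> vv F (a' R) = vv F a - Z F.
  by move=> XR pF RF; have [t0 tE] := ht R XR; rewrite vvM ?invr_neq0 // vvV // tE.
pose Om := undup (flatten [seq PF F | F <- Fs]).
have uOm : uniq Om by exact: undup_uniq.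
have hOm R : R \in Om <-> exists2 F, F \in Fs & X R /\ R `<` F.
  rewrite mem_undup; split=> [/flattenP [_ /mapP [F Fin ->] Rin]|[F Fin h]].
    by exists F => //; have [_ hR] := pl F Fin; apply/hR.
  by apply/flattenP; exists (PF F); [exact: map_f|have [_ hR] := pl F Fin; apply/hR].
have cOm R : R \in Om -> cpt R.
  by move=> /hOm [F Fin [XR lt]]; have [pF _ _] := (hFs F).1 Fin; exact: pt_cpt lt.
have swap (G : set K -> set K -> nat) (L : seq (set K)) (w : set K -> nat) :
    (\sum_(F <- L) w F * \sum_(R <- Om | `[< R `<` F >]) G F R =
     \sum_(R <- Om) \sum_(F <- [seq F <- L | `[< R `<` F >]]) w F * G F R)%N.
  rewrite (eq_bigr (fun F => \sum_(R <- Om | `[< R `<` F >]) w F * G F R)%N); last first.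
    by move=> F _; rewrite big_distrr.
  rewrite (exchange_big_dep predT) //=; apply: eq_bigr => R _; by rewrite big_filter.
have e1 : (\sum_(F <- Fs) `|vv F a|%N * \sum_(R <- PF F) ol F R (s R) =
    \sum_(F <- Fs) `|vv F a|%N * \sum_(R <- Om | `[< R `<` F >]) ol F R (s R))%N.
  rewrite big_seq [RHS]big_seq; apply: eq_bigr => F Fin; congr (_ * _)%N.
  have [uR hR] := pl F Fin; rewrite -[RHS]big_filter; apply: perm_big; apply: uniq_perm => //.
    exact: filter_uniq.
  move=> R; rewrite mem_filter; apply/idP/idP => [/hR [XR lt]|/andP[/asboolP lt /cOm cR]].
    by apply/andP; split; [exact/asboolP|apply/hOm; exists F].
  by apply/hR; split=> //; exact: cpt_X.
(* Both sides are the length of [R] modulo [a' R] and [s R], by associativity in the two orders: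
   over the components of [a' R], and over those of [s R], which have multiplicities [M E]. *)
have e2 R : R \in Om -> (\sum_(F <- [seq F <- Fs | `[< R `<` F >]]) `|vv F a|%N * ol F R (s R) =
    \sum_(E <- [seq E <- Es | `[< R `<` E >]]) `|M E|%N * ol E R (a' R))%N.
  move=> Rin; have cR := cOm R Rin; have XR := cpt_X cR; have sR := surf_cpt cR.
  have [s0 sE] := hs R XR; have Rs : R (s R).
    apply: X_inter => // F pF RF; apply/(vv_in pF s0); rewrite sE //.
    have [x [mx x0 <-]] := gen_elt gM pF; apply/(vv_in pF x0).
    by apply: (X_A _); [case: pF|exact: mA].
  have excM F : sdiv R F -> nonunits F (s R) -> exceptional A X F.
    move=> [pF RF _] /(vv_nu pF s0); rewrite sE // => h; apply: cM.
    by apply: contraTneq h => ->.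
  have exca F : sdiv R F -> exceptional A X F -> ~ nonunits F (a' R).
    by move=> [pF RF _] eF /(vv_nu pF (a'0 R XR)); rewrite va' // va // subrr.
  have h1 : len A (R : set K^o) (sadd (prin (a' R) R) (prin (s R) R))
      (\sum_(F <- [seq F <- Fs | `[< R `<` F >]]) `|vv F (a' R)|%N * ol F R (s R))%N.
    apply: (assoc sR (Ra' R XR) Rs (a'0 R XR)); last 2 first.
    - move=> F; rewrite mem_filter => /andP[/asboolP lt /hFs [pF _ _]].
      by have [] := cpt_pdiv cR pF (properW lt).
    - move=> F sF na; have [pF RF _] := sF.
      have nE : ~ exceptional A X F by move=> eF; exact: (exca F sF eF).
      rewrite mem_filter; apply/andP; split.
        by apply/asboolP; have [] := cpt_pdiv cR pF RF.
      apply/hFs; split=> //; apply/(vv_nu pF a0).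
      by move/(vv_nu pF (a'0 R XR)): na; rewrite va' // (nexc0 cZ nE) subr0.
    - by move=> F sF na /(excM F sF) eF; exact: (exca F sF eF).
    - exact: filter_uniq.
  have h2 : len A (R : set K^o) (sadd (prin (s R) R) (prin (a' R) R))
      (\sum_(E <- [seq E <- Es | `[< R `<` E >]]) `|vv E (s R)|%N * ol E R (a' R))%N.
    apply: (assoc sR Rs (Ra' R XR) s0); last 2 first.
    - move=> E; rewrite mem_filter => /andP[/asboolP lt /hEs eE].
      by have [] := cpt_pdiv cR (exc_pdiv eE) (properW lt).
    - move=> E sE' ns; have eE := excM E sE' ns; rewrite mem_filter; apply/andP; split; last exact/hEs.
      by apply/asboolP; have [pE RE _] := sE'; have [] := cpt_pdiv cR pE RE.
    - by move=> F sF ns na; exact: (exca F sF (excM F sF ns)).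
    - exact: filter_uniq.
  rewrite saddC in h2; have := len_uniq h1 h2.
  rewrite big_seq [in X in _ = X -> _]big_seq => e; rewrite big_seq [RHS]big_seq.
  rewrite (eq_bigr (fun F => `|vv F (a' R)| * ol F R (s R))%N) ?e.
    apply: eq_bigr => E; rewrite mem_filter => /andP[/asboolP lt /hEs eE].
    by rewrite sE //; [exact: exc_pdiv|exact: properW].
  move=> F; rewrite mem_filter => /andP[/asboolP lt /hFs [pF nE _]].
  by rewrite va' //; [rewrite (nexc0 cZ nE) subr0|exact: properW].
(* A zero of [a'] on [E] lies on a nonexceptional component of [a], so the points of [Om]
   suffice. *)
have deg E : E \in Es -> degree_on A X Z E = - (\sum_(R <- Om | `[< R `<` E >]) ol E R (a' R))%N%:Z.
  move=> /hEs eE; have hta R : X R -> R `<` E -> lgen Z R (t R) /\ R (a / t R).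
    by move=> XR _; split; [exact: ht|exact: Ra'].
  rewrite (degreeE eE a0 (va E eE) hta (L := [seq R <- Om | `[< R `<` E >]])).
  - by rewrite big_filter (big_morph Posz PoszD (erefl _)).
  - exact: filter_uniq.
  - by move=> R; rewrite mem_filter => /andP[/asboolP lt /cOm /cpt_X].
  - move=> R XR lt na; have cR := pt_cpt (exc_pdiv eE) XR lt; have sR := surf_cpt cR.
    rewrite mem_filter; apply/andP; split; first exact/asboolP.
    have [F sF nFa] : exists2 F, sdiv R F & nonunits F (a' R).
      apply: contrapT => h.
      have h' : R (a' R)^-1.
        apply: surf_inter => // F sF; have [pF RF _] := sF.
        have nn : ~ nonunits F (a' R) by move=> nn; apply: h; exists F.
        by have [] := nu_inv (RF _ (Ra' R XR)) nn.
      exact: (nu_not na (a'0 R XR)).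
    have [pF RF _] := sF.
    have vF := (vv_nu pF (a'0 R XR)).1 nFa; rewrite va' // in vF.
    have nE : ~ exceptional A X F by move=> eF; move: vF; rewrite va // subrr.
    apply/hOm; exists F; last by split=> //; have [] := cpt_pdiv cR pF RF.
    by apply/hFs; split=> //; apply/(vv_nu pF a0); rewrite (nexc0 cZ nE) subr0 in vF.
rewrite e1 (swap (fun F R => ol F R (s R))) big_seq (eq_bigr _ (fun R h => e2 R h)) -big_seq.
rewrite -(swap (fun E R => ol E R (a' R))) /intersection (@fsum_seq _ _ _ Es) //; last first.
- by move=> E eE _; apply/hEs.
- by move=> E /hEs.
rewrite (big_morph Posz PoszD (erefl _)) -sumrN big_seq [RHS]big_seq; apply: eq_bigr => E Ein.
rewrite deg // PoszM mulrN opprK gez0_abs //; apply: ltW; apply: M_pos; exact/hEs.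
Qed.

(** ** Existence of general elements *)

(** For a local generator [t] of [O_X(-W)] at [R], the sections that do not generate it. *)
Definition wset R t : set K := prin t (nonunits R).

Lemma wset_ksub R t : X R -> ksub (wset R t).
Proof.
move=> XR; have lR := X_local XR; apply: (@smod_ksub R); first exact: X_A.
exact/img_smod/nu_smod.
Qed.

Lemma wset_lgen W J R t x : X R -> J `<=` A -> generates X J W -> lgen W R t -> J x -> ~ wset R t x -> lgen W R x.
Proof.
move=> XR JA gJ lt Jx nw; have [t0 tE] := lt; have hR := X_subring XR.
have [y Ry yE] : prin t R x by rewrite -(lgen_stalk XR lt) -gJ //; exact: ideal_spanS.
have ny : ~ nonunits R y by move=> ny; apply: nw; exists y.
have [y0 Ry'] := nu_inv Ry ny; rewrite -yE; split; first exact: mulf_neq0.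
move=> F pF RF; rewrite vvM // tE // (vv_unit pF (RF _ Ry)) ?addr0 // => h.
by apply: (nu_not h y0); exact: RF.
Qed.

Lemma wset_nsub W J R t : X R -> generates X J W -> lgen W R t -> ~ J `<=` wset R t.
Proof.
move=> XR gJ lt h; have [t0 _] := lt; have lR := X_local XR; have hR : subring R by case: lR.
have : ideal_span R J t by rewrite gJ // (lgen_stalk XR lt); exact: prin_self.
move=> /(ideal_span_min (img_smod t (nu_smod lR)) h) [y ny yE].
apply: (nu1 hR); have -> : 1 = y by apply: (mulfI t0); rewrite mulr1.
exact: ny.
Qed.

Lemma generic J W (Rs : seq (set K)) : ideal A J -> generates X J W -> (forall R, R \in Rs -> X R) ->
  exists2 x, J x & forall R, R \in Rs -> lgen W R x.
Proof.
move=> [JA sJ] gJ XRs; have [s hs] := lgen_choice JA gJ.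
have [|||x Jx hx] := @avoid J _ Rs (fun R => wset R (s R)).
- exact: smod_ksub sJ.
- by move=> R /XRs XR; exact: wset_ksub.
- by move=> R /XRs XR; exact: wset_nsub XR gJ (hs R XR).
exists x => // R Rin; have XR := XRs R Rin; apply: (wset_lgen XR JA gJ (hs R XR) Jx); exact: hx.
Qed.

(** A function without poles on a complete curve is constant. *)
Lemma const_exc E u R0 : exceptional A X E -> E u -> (forall R, X R -> R `<` E -> R u) ->
  X R0 -> R0 `<` E -> exists c, nonunits E (u - j c).
Proof.
move=> eE Eu Ru XR0 lt0; have pE := exc_pdiv eE.
have [c hc] := cpt_res (pt_cpt pE XR0 lt0) (Ru R0 XR0 lt0); exists c; apply: contrapT => nP.
set v := u - j c in hc nP; have AE := X_A (exc_X eE).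
have Ev : E v by apply: (srB (pdiv_subring pE)) => //; exact/AE/jA.
have Rv R : X R -> R `<` E -> R v.
  by move=> XR lt; apply: (srB (X_subring XR)); [exact: Ru|exact/(X_A XR)/jA].
have [L uL cL] := covers_ex pE Ev nP; have [XL cov] := cL.
have R0in : R0 \in L.
  apply: cov => // -[_ h]; have oR := pt_oncurve pE XR0 lt0.
  have : nonunits (hat E R0) v.
    by rewrite (hat_nu pE oR); apply: sadd_subl hc; exact: sm0 (nu_smod (pdiv_local pE)).
  have [v0 _] := nu_inv Ev nP; by move=> /nu_not /(_ v0).
have cE R : R \in L -> cdeg E (hat E R) v = (ol E R v)%:Z.
  move=> /XL [XR lt]; have cR := hat_cring pE (pt_oncurve pE XR lt).
  apply: (cdeg_int pE cR) => //; first by apply: (hat_sub pE); exact: Rv.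
  by apply: (ol_hat eE) => //; exact: Rv.
have := deg0 pE eE Ev nP uL cL.
rewrite (eq_big_seq (fun R => (ol E R v)%:Z) cE) -(big_morph Posz PoszD (erefl _)).
rewrite (big_rem R0 R0in) /= => -[] /eqP; rewrite addn_eq0 => /andP[/eqP e _].
have oR := pt_oncurve pE XR0 lt0; have hl := olP pE oR (Rv R0 XR0 lt0) nP.
rewrite e in hl; have lR := X_local XR0; have hR : subring R0 by case: lR.
have : sadd (nonunits E `&` R0) (prin v R0) 1 by rewrite -(len0_eq hl); exact: sr1.
have sn := nu_smod lR; move=> h1; apply: (nu1 hR); move: h1; apply: (sadd_min sn).
  exact: (X_gen_nu XR0 (exc_X eE) (properW lt0)).
exact: prin_sub.
Qed.

(** The quotient [y / x] is regular along [E], hence constant modulo the ideal of [E] by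
    [const_exc]. The constant is nonzero because [y] generates at [E], so [y / x] is a unit at every
    point. *)
Lemma lgen_curve W J E x y : J `<=` A -> generates X J W -> exceptional A X E -> J x -> J y ->
  (forall R, X R -> R `<=` E -> lgen W R x) -> lgen W E y -> forall R, X R -> R `<=` E -> lgen W R y.
Proof.
move=> JA gJ eE Jx Jy hx hy R XR RE; have pE := exc_pdiv eE; have XE := exc_X eE.
have lE := pdiv_local pE; have hE : subring E by case: lE.
case: (pselect (E `<=` R)) => [ER|nER]; first by have <- : E = R by rewrite eqEsubset.
have lt : R `<` E by [].
have [x0 xE] := hx E XE (@subset_refl _ _); have [y0 yE] := hy.
pose u := y / x; have u0 : u != 0 by rewrite mulf_neq0 ?invr_neq0.
have Ru R' : X R' -> R' `<=` E -> R' u.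
  move=> XR' RE'; apply/(prinP _ _ x0); rewrite -(lgen_stalk XR' (hx R' XR' RE')) -gJ //.
  exact: ideal_spanS.
have Eu : E u by exact: Ru.
have vu : vv E u = 0 by rewrite vvM ?invr_neq0 // vvV // xE // yE // subrr.
have [c hc] := const_exc eE Eu (fun R' XR' lt' => Ru R' XR' (properW lt')) XR lt.
have c0 : c != 0.
  apply/eqP => e; move: hc; rewrite e rmorph0 subr0 => /(vv_nu pE u0); by rewrite vu.
have lR := X_local XR; have hR : subring R by case: lR.
have Rj d : R (j d) by exact/(X_A XR)/jA.
have nu_u : ~ nonunits R u.
  move=> nu; case/eqP: c0; apply: (j_unit lR (X_A XR)).
  have -> : j c = u - (u - j c) by ring.
  apply: (smB hR (nu_smod lR)) => //; apply: (X_gen_nu XR XE RE); split=> //.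
  by apply: srB => //; exact: Ru.
have [_ Ru'] := nu_inv (Ru R XR RE) nu_u.
have [_ xR] := hx R XR RE; split=> // F pF RF.
have yxu : y = x * u by rewrite /u mulrC divfK.
rewrite yxu vvM // xR // (vv_unit pF (RF _ (Ru R XR RE))) ?addr0 // => h.
by apply: (nu_not h u0); exact: RF.
Qed.

(** [a] generates at the exceptional curves, at the nonexceptional components of [b] and at the
    points of the latter. Any other point where [b] does not generate [O_X(-M)] lies on an
    exceptional curve with excess value of [b]; there the hypothesis and [lgen_curve] make [a]
    generate. *)
Lemma gpair_ex b : nonunits A b -> b != 0 ->
  (forall E, exceptional A X E -> (M E < vv E b)%R ->
     exists2 a', I a' & forall R, X R -> R `<=` E -> lgen Z R a') ->
  exists2 a, gpair a b & forall E, exceptional A X E -> vv E a = Z E.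
Proof.
move=> mb b0 hE; have [Es [uEs hEs]] := fin_exc; have [Fs [uFs hFs]] := divlist_ex b0.
have [PF hPF] : exists PF, forall F, F \in Fs -> ptlist F (PF F).
  have : forall F, exists Rs, F \in Fs -> ptlist F Rs.
    move=> F; case: (boolP (F \in Fs)) => [Fin|_]; last by exists [::].
    have [pF nE _] := (hFs F).1 Fin.
    have [y my ny] : exists2 y, nonunits A y & ~ nonunits F y.
      apply: contrapT => h; apply: (nexc_m pF nE) => y my; apply: contrapT => ny; apply: h; by exists y.
    by have [Rs h] := ptlist_ex pF my ny; exists Rs.
  by move=> /choice [PF h]; exists PF.
pose Rs := Es ++ Fs ++ flatten [seq PF F | F <- Fs].
have [|a Ia ha] := @generic I Z Rs iI gZ.
  move=> R; rewrite !mem_cat => /or3P [/hEs /exc_X //|/hFs [[]]//|/flattenP [_ /mapP [F Fin ->]]].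
  by have [_ h] := hPF F Fin => /h [].
have aE E : exceptional A X E -> lgen Z E a.
  by move=> eE; apply: ha; rewrite mem_cat; apply/orP; left; apply/hEs.
have [s hs] := lgen_choice mA gM.
exists a; last by move=> E eE; have [_ h] := aE E eE; apply: h => //; exact: exc_pdiv.
split=> //; split=> //; first exact: Im.
move=> R XR; have [RE|pR|cR] := X_class XR.
- left; have [E eE] := exists_exc; have [a0 _] := aE E eE; split=> // F pF RF.
  have [t dF] := pdiv_dvr pF; case: (dvr_set0 dF); rewrite eqEsubset; split=> // x _.
  by apply: RF; rewrite RE.
- case: (pselect (exceptional A X R)) => eR; first by left; exact: aE.
  case: (pselect (nonunits R b)) => nb.
    by left; apply: ha; rewrite !mem_cat; apply/or3P; apply: Or32; apply/hFs.
  right; split=> // F pF RF; have <- := pdiv_eq pR pF RF; rewrite (nexc0 cM eR).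
  by apply: vv_unit => //; exact/(X_A XR)/mA.
have [s0 sE] := hs R XR; pose b' := b / s R; have b'0 : b' != 0 by rewrite mulf_neq0 ?invr_neq0.
have Rb' : R b'.
  by apply/(prinP _ _ s0); rewrite -(lgen_stalk XR (hs R XR)) -gM //; exact: ideal_spanS.
have vb' F : prime_divisor X F -> R `<=` F -> vv F b' = vv F b - M F.
  by move=> pF RF; rewrite vvM ?invr_neq0 // vvV // sE.
case: (pselect (nonunits R b')) => nb'; last first.
  have [_ Rb''] := nu_inv Rb' nb'; right; split=> // F pF RF.
  have : vv F b' = 0 by apply: vv_unit => //; [exact: RF|move=> h; apply: (nu_not h b'0); exact: RF].
  by rewrite vb' // => /eqP; rewrite subr_eq0 => /eqP.
left; have [F sF nFb] : exists2 F, sdiv R F & nonunits F b'.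
  apply: contrapT => h; have h' : R b'^-1.
    apply: surf_inter; first exact: surf_cpt.
    move=> F sF; have [pF RF _] := sF.
    have nn : ~ nonunits F b' by move=> nn; apply: h; exists F.
    by have [] := nu_inv (RF _ Rb') nn.
  exact: (nu_not nb' b'0).
have [pF RF _] := sF; have vF := (vv_nu pF b'0).1 nFb; rewrite vb' // subr_gt0 in vF.
have [lt _] := cpt_pdiv cR pF RF.
case: (pselect (exceptional A X F)) => eF.
  have [a' Ia' ha'] := hE F eF vF; exact: (lgen_curve IA gZ eF Ia' Ia ha' (aE F eF)).
have Fin : F \in Fs by apply/hFs; split=> //; apply/(vv_nu pF b0); rewrite (nexc0 cM eF) in vF.
apply: ha; rewrite !mem_cat; apply/or3P; apply: Or33; apply/flattenP; exists (PF F); first exact: map_f.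
by have [_ h] := hPF F Fin; apply/h.
Qed.

(** For [b] generic along all exceptional curves the hypothesis of [gpair_ex] is void. *)
Lemma gpair_exists : exists a b, gpair a b.
Proof.
have [Es [uEs hEs]] := fin_exc.
have [|b mb hb] := @generic (nonunits A) M Es (nu_ideal lA) gM; first by move=> E /hEs /exc_X.
have bE E : exceptional A X E -> lgen M E b by move=> eE; apply: hb; apply/hEs.
have [E0 eE0] := exists_exc; have [b0 _] := bE E0 eE0.
have [|a gp _] := gpair_ex mb b0; last by exists a, b.
move=> E eE; have [_ h] := bE E eE; rewrite h ?ltxx //; exact: exc_pdiv.
Qed.

(** Where [b] has excess value along a curve, [a] itself generates [O_X(-Z)], the pair being
    general; so [b] has another partner [a1], to which [len_star] applies. *)
Lemma len_gpair a b : gpair a b ->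
  exists2 n, len A (A : set K^o) (sadd (prin a A) (prin b A)) n & n%:Z = - intersection A X M Z.
Proof.
move=> [Ia gp]; have [a0 b0] := gen2_n0 cZ cM gp; have [_ mb h] := gp.
have [|a1 gp1 va1] := gpair_ex mb b0.
  move=> E eE lt; exists a => // R XR RE; have [//|[_ h']] := h R XR.
  by move: lt; rewrite h' ?ltxx //; exact: exc_pdiv.
have [n hn nE] := len_star gp1 va1; exists n => //; have [_ {}gp1] := gp1.
rewrite saddC; rewrite saddC in hn.
exact: (len_gen2_ind cM cZ IA gZ (gen2_sym gp1) (gen2_sym gp) hn).
Qed.

(** ** General elements and the module [I / (a m + b I)] *)

Hypothesis IZ : I = sections X Z.
Hypothesis pI : max_primary A I.

Lemma sectionsP (W : set K -> int) x : sections X W x <-> forall F, prime_divisor X F -> val_ge F (W F) x.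
Proof. by []. Qed.

Lemma sections_M : sections X M = nonunits A.
Proof.
rewrite eqEsubset; split=> x.
  move=> /sectionsP h; have Ax : A x.
    apply: surf_inter; first exact: surf_A.
    move=> F /sdivE [pF nE]; have := h F pF; rewrite (nexc0 cM nE).
    case: (eqVneq x 0) => [-> _|x0]; first exact: sr0 (pdiv_subring pF).
    by move/(vv_ge _ pF x0)/(vv_in pF x0).
  apply/nuP; split=> //; case: (eqVneq x 0) => [|x0]; [by left|right] => Ax'.
  have [E eE] := exists_exc; have pE := exc_pdiv eE.
  have := (vv_ge _ pE x0).1 (h E pE); have := M_pos eE.
  have : (0 <= vv E x^-1)%R by apply/(vv_in pE); [rewrite invr_neq0|exact: (X_A (exc_X eE))].
  rewrite vvV //; lia.
move=> mx; apply/sectionsP => F pF; case: (eqVneq x 0) => [->|x0]; first exact: val_ge_zero.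
by apply/(vv_ge _ pF x0); exact: gen_ge gM pF mx x0.
Qed.

Lemma lgen_mul W1 W2 R t s : lgen W1 R t -> lgen W2 R s -> lgen (W1 \+ W2) R (t * s).
Proof. by move=> [t0 ht] [s0 hs]; split; [exact: mulf_neq0|move=> F pF RF; rewrite vvM // ht // hs]. Qed.

Lemma lgen_unit W R t y : X R -> lgen W R t -> R y -> ~ nonunits R y -> lgen W R (t * y).
Proof.
move=> XR [t0 tE] Ry ny; have [y0 Ry'] := nu_inv Ry ny; split; first exact: mulf_neq0.
move=> F pF RF; rewrite vvM // tE // (vv_unit pF (RF _ Ry)) ?addr0 // => h.
by apply: (nu_not h y0); exact: RF.
Qed.

Lemma sections_stalk W R x : X R -> sections X W x -> stalk X W R x.
Proof. by move=> XR /sectionsP h; apply/stalkP => F pF _; exact: h. Qed.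

(** * Exactness of the sequence of two sections, and general pairs *)

Section General.
Variables (W1 W2 : set K -> int) (f1 f2 : K).
Hypotheses (g1 : forall R, X R -> exists t, lgen W1 R t) (g2 : forall R, X R -> exists t, lgen W2 R t).

(** If both were nonunit multiples of the local generators [t] and [s], surjectivity at [t * s]
    would make [1] a nonunit. *)
Lemma general_lgen : general X W1 W2 f1 f2 -> forall R, X R -> lgen W1 R f1 \/ lgen W2 R f2.
Proof.
move=> [s1 s2 ex] R XR; have [_ _ sur] := ex R XR; have lR := X_local XR; have hR : subring R by case: lR.
have [t ht] := g1 XR; have [s hs] := g2 XR; have [t0 _] := ht; have [s0 _] := hs.
have [x Rx f1E] : prin t R f1 by rewrite -(lgen_stalk XR ht); exact: sections_stalk.
have [y Ry f2E] : prin s R f2 by rewrite -(lgen_stalk XR hs); exact: sections_stalk.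
have ts : stalk X (W1 \+ W2) R (t * s) by rewrite (lgen_stalk XR (lgen_mul ht hs)); exact: prin_self.
have [a [b []]] := sur _ ts; rewrite (lgen_stalk XR ht) (lgen_stalk XR hs) => -[a' Ra <-] [b' Rb <-] E.
case: (pselect (nonunits R x)) => nx; last by left; rewrite -f1E; exact: lgen_unit.
case: (pselect (nonunits R y)) => ny; last by right; rewrite -f2E; exact: lgen_unit.
case: (nu1 hR); have -> : 1 = x * b' - y * a'.
  by apply: (mulfI (mulf_neq0 t0 s0)); rewrite mulr1 {1}E -f1E -f2E; ring.
have sn := nu_smod lR; by apply: (smB hR sn); exact: (smMr sn).
Qed.

Lemma lgen_general : sections X W1 f1 -> sections X W2 f2 ->
  (forall R, X R -> lgen W1 R f1 \/ lgen W2 R f2) -> general X W1 W2 f1 f2.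
Proof.
move=> s1 s2 h; split=> // R XR; have hR := X_subring XR.
have [t ht] := g1 XR; have [s hs] := g2 XR; have [t0 _] := ht; have [s0 _] := hs.
have st1 := lgen_stalk XR ht; have st2 := lgen_stalk XR hs.
have [hf|hf] := h R XR; have [f0 _] := hf; split.
- by move=> u Ru /eqP; rewrite mulf_eq0 (negPf f0) => /eqP.
- move=> a b; rewrite (lgen_stalk XR hf) => -[u Ru <-] _ E; exists u; split=> //.
  apply: (mulfI f0); apply/eqP; rewrite -subr_eq0 -E; apply/eqP; ring.
- move=> c; rewrite (lgen_stalk XR (lgen_mul hf hs)) => -[u Ru <-].
  exists 0, (s * u); rewrite st1 st2; split; [exact: sm0 (prin_smod t hR)|by exists u|ring].
- by move=> u Ru _ /eqP; rewrite mulf_eq0 (negPf f0) => /eqP.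
- move=> a b _; rewrite (lgen_stalk XR hf) => -[u Ru <-] E; exists u; split=> //.
  apply: (mulfI f0); apply/eqP; rewrite -subr_eq0 -[_ - _]opprK oppr_eq0 -E; apply/eqP; ring.
- move=> c; rewrite (lgen_stalk XR (lgen_mul ht hf)) => -[u Ru <-].
  exists (t * - u), 0; rewrite st1 st2; split; [by exists (- u) => //; exact: srN|exact: sm0 (prin_smod s hR)|ring].
Qed.

End General.

Let gZ1 R : X R -> exists t, lgen Z R t. Proof. exact: lgen_ex IA gZ. Qed.
Let gM1 R : X R -> exists t, lgen M R t. Proof. exact: lgen_ex mA gM. Qed.

Lemma general_gpair a b : general X Z M a b <-> gpair a b.
Proof.
split=> [gen|[Ia [_ mb h]]].
  have [s1 s2 _] := gen; have h := general_lgen gZ1 gM1 gen.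
  rewrite -IZ in s1; rewrite sections_M in s2; split=> //; split=> //; exact: Im.
by apply: lgen_general => //; [rewrite -IZ|rewrite sections_M].
Qed.

Lemma general_gpair' a b : general X M Z b a -> gpair a b.
Proof.
move=> gen; have [s1 s2 _] := gen; have h := general_lgen gM1 gZ1 gen.
rewrite -IZ in s2; rewrite sections_M in s1; split=> //; split=> //; first exact: Im.
by move=> R /h []; [right|left].
Qed.

Lemma gpair_reg a b x : gpair a b -> A x -> prin a A (b * x) -> prin a A x.
Proof.
move=> [Ia gp] Ax [y Ay E]; have [a0 b0] := gen2_n0 cZ cM gp; apply/(prinP _ _ a0).
apply: surf_inter; first exact: surf_A.
move=> F /sdivE [pF nE]; have [XF _] := pF; have FA := X_A XF.
case: (pselect (nonunits F a)) => na; last first.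
  by apply: (srM (pdiv_subring pF)); [exact: FA|have [] := nu_inv (FA _ (IA Ia)) na].
have nb := gen2_nexc cZ cM gp pF nE na; have [_ mb _] := gp.
have [_ Fb'] := nu_inv (FA _ (mA mb)) nb.
have -> : x / a = y * b^-1 by rewrite -[x](mulKf b0) -E; field; rewrite a0 b0.
by apply: (srM (pdiv_subring pF)) => //; exact: FA.
Qed.

Lemma gpair_reg' a b x : gpair a b -> A x -> prin b A (a * x) -> prin b A x.
Proof.
move=> gp Ax [y Ay E]; have [_ gp2] := gp; have [a0 b0] := gen2_n0 cZ cM gp2.
have [z Az zE] : prin a A y by apply: (gpair_reg gp Ay); exists x.
by exists z => //; apply: (mulfI a0); rewrite -E -zE; ring.
Qed.

Lemma len_AI : exists l, len A (A : set K^o) I l.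
Proof.
have [r hr] : exists r, powin (nonunits A) I r.
  apply: prim_powin => // Q pQ IQ; rewrite eqEsubset; split.
    by apply: ideal_proper => //; [case: pQ|exact: prime_n1 pQ].
  have [_ <-] := pI; move=> x [Ax [n In]]; exact: (prime_exp hA pQ Ax (IQ _ In)).
exact: finlen residual_AA nA iI hr.
Qed.

Lemma len_residue : len A (A : set K^o) (nonunits A) 1.
Proof.
have E : A = sadd (nonunits A) (prin 1 A).
  rewrite eqEsubset; split; last first.
    by apply: (sadd_min (sr_smod hA) mA) => _ [a Aa <-]; rewrite mul1r.
  by move=> x Ax; exists 0, x; split; [exact: sm0 (nu_smod lA)|exists x; rewrite ?mul1r|rewrite add0r].
rewrite [X in len A X]E; apply: (len_simple residual_AA).
- exact: nu_smod.
- exact: sr1.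
- exact: nu1.
- by move=> v nv; rewrite mulr1.
Qed.

(** Regularity gives [J2 / J1 = A / I] and [J1 / J0 = A / m]. Descending from [A] to [J1] through
    [J2] and through [I], one finds that [I / J1] has length [n]; the step to [J0] adds one. *)
Lemma len_colon a b n : gpair a b -> len A (A : set K^o) (sadd (prin a A) (prin b A)) n ->
  len A (I : set K^o) (sadd (prin a (nonunits A)) (prin b I)) n.+1.
Proof.
move=> gp hn; have [Ia gp2] := gp; have [a0 b0] := gen2_n0 cZ cM gp2; have [ma mb _] := gp2.
have [_ sI] := iI; have sm := nu_smod lA; have sA := sr_smod hA.
have spa := prin_smod a hA; have sbI := img_smod b sI; have sam := img_smod a sm.
have spb := prin_smod b hA.
set J1 := sadd (prin a A) (prin b I); have sJ1 : smod A J1 by exact: sadd_smod.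
set J0 := sadd (prin a (nonunits A)) (prin b I); have sJ0 : smod A J0 by exact: sadd_smod.
set J2 := sadd (prin a A) (prin b A) in hn; have sJ2 : smod A J2 by exact: sadd_smod.
have J12 : J1 `<=` J2.
  apply: (sadd_min sJ2); first by apply: sadd_subl; exact: sm0 spb.
  by move=> _ [i Ii <-]; apply: sadd_subr; [exact: sm0 spa|exists i => //; exact: IA].
have J1I : J1 `<=` I.
  apply: (sadd_min sI); first by move=> _ [x Ax <-]; exact: (smMr sI).
  by move=> _ [i Ii <-]; apply: (smM sI) => //; exact: mA.
have J01 : J0 `<=` J1.
  apply: (sadd_min sJ1).
    by move=> _ [x mx <-]; apply: sadd_subl; [exact: sm0 sbI|exists x => //; exact: mA].
  by apply: sadd_subr; exact: sm0 spa.
have [l hl] := len_AI.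
have h1 : len A (J2 : set K^o) J1 l.
  apply: (@len_mul1 _ A A I _ _ b _ hA sA sI IA sJ2 sJ1 J12 _ _ _ hl).
  - by move=> x Ax; apply: sadd_subr; [exact: sm0 spa|exists x].
  - move=> _ [_ [_ [[x Ax <-] [y Ay <-] ->]]]; exists y => //; rewrite addrK.
    by apply: sadd_subl; [exact: sm0 sbI|exists x].
  - move=> x Ax; split; last by move=> Ix; apply: sadd_subr; [exact: sm0 spa|exists x].
    move=> [_ [_ [[z Az <-] [i Ii <-] E]]].
    have : prin a A (x - i).
      apply: (gpair_reg gp); first by apply: srB => //; exact: IA.
      by exists z => //; rewrite mulrBr E addrK.
    move=> [w Aw e]; rewrite -(subrK i x) -e; apply: (smD sI) => //; exact: (smMr sI).
have h2 : len A (I : set K^o) J1 n.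
  have h := len_add AN1 hn h1; have [u [v [hu hv e]]] := len_split AN1 h sI J1I IA.
  have eu := len_uniq hu hl; subst u.
  by have -> : n = v by move/eqP: e; rewrite addnC eqn_add2l => /eqP.
have h3 : len A (J1 : set K^o) J0 1.
  apply: (@len_mul1 _ A A (nonunits A) _ _ a _ hA sA sm mA sJ1 sJ0 J01 _ _ _ len_residue).
  - by move=> x Ax; apply: sadd_subl; [exact: sm0 sbI|exists x].
  - move=> _ [_ [_ [[x Ax <-] [i Ii <-] ->]]]; exists x => //; rewrite addrC addrA addNr add0r.
    by apply: sadd_subr; [exact: sm0 sam|exists i].
  - move=> x Ax; split; last by move=> mx; apply: sadd_subl; [exact: sm0 sbI|exists x].
    move=> [_ [_ [[v mv <-] [i Ii <-] E]]].
    have : prin b A (x - v).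
      apply: (gpair_reg' gp); first by apply: srB => //; exact: mA.
      by exists i; [exact: IA|rewrite mulrBr E addrAC subrr add0r].
    move=> [w Aw e]; rewrite -(subrK v x) -e; apply: (smD sm) => //; exact: (smMr sm).
by have := len_add AN1 h2 h3; rewrite addn1.
Qed.

(** ** The integral closure of [I m] *)

Definition ZM := Z \+ M.
Let IM := ideal_mul A I (nonunits A).

Lemma IM_mem x y : I x -> nonunits A y -> IM (x * y).
Proof. by move=> Ix my; apply: ideal_spanS; exists x, y. Qed.

Lemma exp_smod n : smod A (ideal_exp A IM n).
Proof. by case: n => [|n]; [exact: sr_smod|exact: ideal_span_smod]. Qed.

Lemma exp_mul a b x y : ideal_exp A IM a x -> ideal_exp A IM b y -> ideal_exp A IM (a + b) (x * y).
Proof.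
move=> hx hy; elim: a x hx => [|a IH] x /=; first by move=> Ax; rewrite add0n; exact: (smM (exp_smod b)).
apply: (@ideal_span_min _ A _ [set x | ideal_exp A IM (a.+1 + b) (x * y)]).
  have s := exp_smod (a.+1 + b); split.
  - by rewrite /= mul0r; exact: sm0 s.
  - by move=> u v /= hu hv; rewrite mulrDl; exact: smD s _ _.
  - by move=> c u Ac /= hu; rewrite /GRing.scale /= -mulrA; exact: smM s _ _.
move=> _ [u [v [hu hv ->]]] /=; apply: ideal_spanS; exists u, (v * y).
by split=> //; [exact: IH|rewrite mulrA].
Qed.

Lemma exp_val F n x : prime_divisor X F -> ideal_exp A IM n x -> val_ge F (ZM F *+ n) x.
Proof.
move=> pF; elim: n x => [|n IH] x /=.
  move=> Ax; rewrite mulr0n; apply: val_ge0 => //; apply: (X_A _ Ax); by case: pF.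
have mulv u v p q : val_ge F p u -> val_ge F q v -> val_ge F (p + q) (u * v).
  case: (eqVneq u 0) => [->|u0]; first by move=> *; rewrite mul0r; exact: val_ge_zero.
  case: (eqVneq v 0) => [->|v0]; first by move=> *; rewrite mulr0; exact: val_ge_zero.
  move=> /(vv_ge _ pF u0) h1 /(vv_ge _ pF v0) h2; apply/(vv_ge _ pF (mulf_neq0 u0 v0)).
  by rewrite vvM // lerD.
have AF : A `<=` F by apply: X_A; case: pF.
apply: ideal_span_min; first by apply: smod_mono AF _; exact: val_ge_smod.
move=> _ [u [v [hu hv ->]]] /=; rewrite mulrS; apply: (mulv); last exact: IH.
move: u hu; apply: ideal_span_min; first by apply: smod_mono AF _; exact: val_ge_smod.
move=> _ [s [t [Is mt ->]]] /=; apply: mulv.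
- by case: (eqVneq s 0) => [->|s0]; [exact: val_ge_zero|apply/(vv_ge _ pF s0); exact: gen_ge gZ pF Is s0].
- by case: (eqVneq t 0) => [->|t0]; [exact: val_ge_zero|apply/(vv_ge _ pF t0); exact: gen_ge gM pF mt t0].
Qed.

(** If [x] had value less than [ZM F], the other terms of the integral equation would all have
    greater value than [x ^ n]. *)
Lemma closure_sections x : integral_closure A IM x -> sections X ZM x.
Proof.
move=> [Ax [n [c [n0 hc E]]]]; apply/sectionsP => F pF.
case: (eqVneq x 0) => [->|x0]; first exact: val_ge_zero.
apply/(vv_ge _ pF x0); rewrite leNgt; apply/negP => lt; set v := vv F x in lt.
have sv := val_ge_smod (v *+ n + 1) pF; have hF := pdiv_subring pF.
have : val_ge F (v *+ n + 1) (x ^+ n).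
  have -> : x ^+ n = - \sum_(1 <= i < n.+1) c i * x ^+ (n - i).
    by apply/eqP; rewrite -addr_eq0; apply/eqP.
  apply: (smN hF sv); rewrite big_nat_cond; apply: (sm_sum _ sv) => i; rewrite andbT => /andP[i1 i2] /=.
  case: (eqVneq (c i) 0) => [->|c0]; first by rewrite mul0r; exact: val_ge_zero.
  apply/(vv_ge _ pF); first by rewrite mulf_neq0 ?expf_neq0.
  rewrite vvM ?expf_neq0 // vvX // -/v.
  have hi : (1 <= i <= n)%N by rewrite i1.
  have := (vv_ge _ pF c0).1 (exp_val pF (hc i hi)).
  have ei : v *+ n = v *+ i + v *+ (n - i) by rewrite -mulrnDr subnKC //; case/andP: hi.
  have h : (v *+ i + 1 <= ZM F *+ i)%R.
    apply: (@le_trans _ _ ((v + 1) *+ i)); last by apply: ler_wMn2r; lia.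
    rewrite mulrnDl lerD2l; have : (1%:Z *+ 1 <= 1%:Z *+ i)%R by apply: ler_wpMn2l.
    by [].
  rewrite ei; lia.
by move/(vv_ge _ pF (expf_neq0 n x0)); rewrite vvX // -/v; lia.
Qed.

Lemma sections_ZM_I : sections X ZM `<=` I.
Proof.
move=> x /sectionsP h; rewrite IZ; apply/sectionsP => F pF; have := h F pF.
case: (eqVneq x 0) => [->|x0]; first by move=> _; exact: val_ge_zero.
move=> /(vv_ge _ pF x0) hx; apply/(vv_ge _ pF x0); apply: le_trans hx; rewrite /ZM /= lerDl.
case: (pselect (exceptional A X F)) => [/M_pos/ltW //|nE]; by rewrite (nexc0 cM nE).
Qed.

(** Elements of the Rees algebra of [I m]; their values at [1 / x] form the [A]-algebra generated by
    the [y / x] with [y] in [I m]. *)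
Definition rees (p : {poly K}) := forall i, ideal_exp A IM i p`_i.

Lemma reesM p q : rees p -> rees q -> rees (p * q).
Proof.
move=> hp hq i; rewrite coefM; apply: (sm_sum _ (exp_smod i)) => -[l lt] _ /=.
by rewrite -[i in ideal_exp _ _ i](subnKC (lt : l <= i)%N); exact: exp_mul.
Qed.

Lemma reesD p q : rees p -> rees q -> rees (p + q).
Proof. by move=> hp hq i; rewrite coefD; exact: smD (exp_smod i) _ _. Qed.

Lemma reesB p q : rees p -> rees q -> rees (p - q).
Proof. by move=> hp hq i; rewrite coefB; exact: smB hA (exp_smod i) _ _. Qed.

Lemma reesC a : A a -> rees a%:P.
Proof. by move=> Aa i; rewrite coefC; case: eqP => [->|_] //; exact: sm0 (exp_smod i). Qed.

Lemma reesX a : IM a -> rees (a *: 'X).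
Proof.
move=> ha i; rewrite coefZ coefX; case: eqP => [->|_]; last by rewrite mulr0; exact: sm0 (exp_smod i).
by rewrite mulr1 /=; apply: ideal_spanS; exists a, 1; split=> //; [exact: sr1|rewrite mulr1].
Qed.

(** In a valuation ring containing [y / x] for all [y] in [I m], at whose center
    [I m] is generated by [t s], both [t s / x] and [x / (t s)] are integral. *)
Lemma sections_closure x : sections X ZM x -> integral_closure A IM x.
Proof.
move=> hx; have Ax : A x by apply/IA/sections_ZM_I.
case: (eqVneq x 0) => [->|x0].
  split; first exact: sr0.
  exists 1%N, (fun=> 0); split=> //; first by move=> i _; exact: sm0 (exp_smod i).
  by rewrite expr1 add0r big_nat1 mul0r.
pose G : set K := [set y / x | y in IM].
set S := adjoin A G; have hS : subring S by exact: adjoin_subring.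
have AS : A `<=` S by exact: adjoinSl. have GS : G `<=` S by exact: adjoinSr.
case: (pselect (ideal_span S G 1)) => h1; last first.
  have [V [vV SV GV]] := valuation_over hS h1 GS.
  have lV := val_local vV; have hV : subring V by case: lV.
  have [R XR [RV _]] := X_val vV (subset_trans AS SV).
  have [t ht] := lgen_ex IA gZ XR; have [s hs] := lgen_ex mA gM XR; have [t0 _] := ht; have [s0 _] := hs.
  have ts0 := mulf_neq0 t0 s0.
  have [w Rw wE] : prin (t * s) R x.
    by rewrite -(lgen_stalk XR (lgen_mul ht hs)); exact: sections_stalk.
  have sVx : smod R [set z | nonunits V (z / x)].
    have sn := nu_smod lV; split.
    - by rewrite /= mul0r; exact: sm0 sn.
    - by move=> u v /= hu hv; rewrite mulrDl; exact: smD sn _ _.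
    - by move=> c u Rc /= hu; rewrite /GRing.scale /= -mulrA; apply: (smM sn) => //; exact: RV.
  have gent : ideal_span R I t by rewrite gZ // (lgen_stalk XR ht); exact: prin_self (X_subring XR).
  have gens : ideal_span R (nonunits A) s by rewrite gM // (lgen_stalk XR hs); exact: prin_self (X_subring XR).
  have : nonunits V ((t * s) / x).
    have step z : I z -> nonunits V ((z * s) / x).
      move=> Iz; have : [set s | nonunits V ((z * s) / x)] s; last by [].
      move: gens; apply: ideal_span_min.
        split.
        - by rewrite /= mulr0; exact: sm0 sVx.
        - by move=> u v /= hu hv; rewrite mulrDr; exact: smD sVx _ _.
        - move=> c u Rc /= hu; rewrite /GRing.scale /=.
          have -> : z * (c * u) / x = c * (z * u / x) by ring.
          exact: (smM (nu_smod lV) (RV _ Rc) hu).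
      by move=> y my /=; apply: GV; exists (z * y) => //; exact: IM_mem.
    have : [set t | nonunits V ((t * s) / x)] t; last by [].
    move: gent; apply: ideal_span_min => //; split.
    - by rewrite /= mul0r; exact: sm0 sVx.
    - by move=> u v /= hu hv; rewrite mulrDl; exact: smD sVx _ _.
    - move=> c u Rc /= hu; rewrite /GRing.scale /=.
      have -> : c * u * s / x = c * (u * s / x) by rewrite !mulrA.
      exact: (smM (nu_smod lV) (RV _ Rc) hu).
  move=> nV; case: (nu1 hV); have -> : 1 = w * ((t * s) / x) by rewrite mulrA [w * _]mulrC wE mulfV.
  by apply: (smM (nu_smod lV)) => //; exact: RV.
(* In the remaining case [1] is the value at [1 / x] of a Rees polynomial without constant term;
   multiplied by [x ^ n] this is an integral equation of [x]. *)
split=> //; have Sp z : S z -> exists p, rees p /\ z = p.[x^-1].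
  apply: (@adjoin_min _ A G [set z | exists p, rees p /\ z = p.[x^-1]]).
  - split.
    + by exists 1; rewrite hornerC; split=> //; apply: reesC; exact: sr1.
    + by move=> u v [p [hp ->]] [q [hq ->]]; exists (p - q); rewrite hornerD hornerN; split=> //; exact: reesB.
    + by move=> u v [p [hp ->]] [q [hq ->]]; exists (p * q); rewrite hornerM; split=> //; exact: reesM.
  - by move=> a Aa; exists a%:P; rewrite hornerC; split=> //; exact: reesC.
  - by move=> _ [y hy <-]; exists (y *: 'X); rewrite hornerZ hornerX; split=> //; exact: reesX.
have [p [hp p0 pE]] : exists p, [/\ rees p, p`_0 = 0 & 1 = p.[x^-1]].
  move: h1; apply: (@ideal_span_min _ S G [set z | exists p, [/\ rees p, p`_0 = 0 & z = p.[x^-1]]]).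
    split.
    - exists 0; rewrite coef0 horner0; split=> //; apply: reesC; exact: sr0.
    - move=> u v [q [hq q0 ->]] [r [hr r0 ->]]; exists (q + r).
      by rewrite coefD q0 r0 addr0 hornerD; split=> //; exact: reesD.
    - move=> c u Sc [q [hq q0 ->]]; have [r [hr ->]] := Sp c Sc; exists (r * q).
      by rewrite coefM big_ord1 /= q0 mulr0 /GRing.scale /= hornerM; split=> //; exact: reesM.
  move=> _ [y hy <-]; exists (y *: 'X); rewrite hornerZ hornerX coefZ coefX mulr0; split=> //; exact: reesX.
have [n nE] : exists n, size p = n.+1.
  case E : (size p) => [|n]; last by exists n.
  move/eqP: E; rewrite size_poly_eq0 => /eqP p00.
  by move: pE; rewrite p00 horner0 => /eqP; rewrite oner_eq0.
have n0 : (0 < n)%N.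
  rewrite lt0n; apply/eqP => e; rewrite e in nE.
  by move/eqP: pE; rewrite horner_coef nE big_ord1 p0 mul0r oner_eq0.
exists n, (fun i => - p`_i); split=> //.
  by move=> i _; exact: smN hA (exp_smod i) (hp i).
have -> : x ^+ n = \sum_(1 <= i < n.+1) p`_i * x ^+ (n - i).
  rewrite -[LHS]mulr1 {1}pE horner_coef nE mulr_sumr -(big_mkord xpredT (fun i => x ^+ n * (p`_i * x^-1 ^+ i))).
  rewrite big_nat_recl // p0 mul0r mulr0 add0r big_add1 /= big_nat_cond [RHS]big_nat_cond.
  apply: eq_bigr => i; rewrite andbT => /andP[_ lt].
  rewrite mulrCA -{1}(subnK (lt : i.+1 <= n)%N) exprD -mulrA -exprMn mulfV // expr1n mulr1 //.
by rewrite -big_split /= big1 // => i _; rewrite mulNr subrr.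
Qed.

Lemma closure_IM : integral_closure A IM = sections X ZM.
Proof. by rewrite eqEsubset; split=> x; [exact: closure_sections|exact: sections_closure]. Qed.

(** ** Comparison with the Cech cohomology of [O_X] *)

Section Cover.
Variables (r : nat) (B : 'I_r -> set K) (a b : K).
Hypotheses (cB : affine_cover A X B) (gp : gpair a b).
Let Ia : I a. Proof. by case: gp. Qed.
Let gp2 : gen2 Z M a b. Proof. by case: gp. Qed.
Let mb : nonunits A b. Proof. by case: gp2. Qed.
Let a0 : a != 0. Proof. by have [] := gen2_n0 cZ cM gp2. Qed.
Let b0 : b != 0. Proof. by have [] := gen2_n0 cZ cM gp2. Qed.

Lemma chart_pdiv i F : spec (B i) F -> krull_dim F 1 -> prime_divisor X F.
Proof. by move=> sF kF; have [_ _ _ sX] := cover_B i cB; split=> //; exact: sX. Qed.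

(** The [s] for which [s * c] splits on the chart form an ideal. If it were proper, a valuation ring
    would provide a prime containing it; but at that point [a] or [b] is a local generator, and
    clearing denominators gives an element of the ideal outside the prime. *)
Lemma chart_split i c : sections X ZM c -> exists al be, [/\ sections (spec (B i)) Z al,
  sections (spec (B i)) M be & c = a * be + b * al].
Proof.
move=> hc; have [hB AB _ sX] := cover_B i cB; set Bi := B i in hB AB sX *.
have sI : smod Bi (ideal_span Bi I) by exact: ideal_span_smod.
have sm : smod Bi (ideal_span Bi (nonunits A)) by exact: ideal_span_smod.
pose J : set K := [set s | Bi s /\ exists al be, [/\ ideal_span Bi I al, ideal_span Bi (nonunits A) be &
  s * c = a * be + b * al]].
have sJ : smod Bi J.
  split.
  - split; first exact: sr0.
    exists 0, 0; split; [exact: sm0 sI|exact: sm0 sm|by rewrite mul0r !mulr0 addr0].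
  - move=> x y [Bx [al [be [h1 h2 e]]]] [By [al' [be' [h1' h2' e']]]]; split; first exact: srD.
    exists (al + al'), (be + be'); split; [exact: smD sI _ _|exact: smD sm _ _|].
    by rewrite mulrDl e e'; ring.
  - move=> d x Bd [Bx [al [be [h1 h2 e]]]]; split; first exact: srM.
    exists (d * al), (d * be); split; [exact: smM sI _ _|exact: smM sm _ _|].
    by rewrite /GRing.scale /= -mulrA e; ring.
have JB : J `<=` Bi by move=> x [].
have sub W (L : set K) x : generates X L W -> ideal_span Bi L x -> sections (spec Bi) W x.
  move=> gL hx F [sF kF]; have pF := chart_pdiv sF kF.
  have BF : Bi `<=` F by case: sF => Q pQ ->; exact: loc_sub.
  move: hx; apply: ideal_span_min; first by apply: smod_mono BF _; exact: val_ge_smod.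
  move=> y Ly; case: (eqVneq y 0) => [->|y0]; first exact: val_ge_zero.
  by apply/(vv_ge _ pF y0); exact: gen_ge gL pF Ly y0.
have [_ [al [be [h1 h2]]]] : J 1; last first.
  by rewrite mul1r => e; exists al, be; split=> //; [exact: sub gZ h1|exact: sub gM h2].
apply: contrapT => nJ1.
have [|V [vV BV JV]] := @valuation_over _ Bi J hB _ JB.
  by move=> h; apply: nJ1; move: h; exact: ideal_span_min.
have lV := val_local vV; have pP := nu_contr lV hB BV; set P := _ `&` _ in pP.
set R := localization Bi P; have XR : X R by apply: sX; exists P.
have cZM := sections_stalk XR hc; have [_ _ hg] := gp2.
suff [d [Bd nd Jd]] : exists d, [/\ Bi d, ~ P d & J d] by apply: nd; split=> //; exact: JV.
have [lg|lg] := hg R XR.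
- have [s hs] := lgen_ex mA gM XR.
  move: cZM; rewrite (lgen_stalk XR (lgen_mul lg hs)) => -[w Rw cE].
  have : ideal_span R (nonunits A) (s * w) by rewrite gM // (lgen_stalk XR hs); exists w.
  move=> /(loc_denom hB pP) [d [Bd nd hd]]; exists d; split=> //; split=> //.
  exists 0, (d * (s * w)); split=> //; first exact: sm0 sI.
  by rewrite -cE; ring.
- have [t ht] := lgen_ex IA gZ XR.
  move: cZM; rewrite (lgen_stalk XR (lgen_mul ht lg)) => -[w Rw cE].
  have : ideal_span R I (t * w) by rewrite gZ // (lgen_stalk XR ht); exists w.
  move=> /(loc_denom hB pP) [d [Bd nd hd]]; exists d; split=> //; split=> //.
  exists (d * (t * w)), 0; split=> //; first exact: sm0 sm.
  by rewrite -cE; ring.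
Qed.

(** Writing a section [c] of [O_X(-Z-M)] as [a be_i + b al_i] on the [i]-th chart,
    the differences [(be_l - be_i) / b] form a Cech cocycle of [O_X], the image of
    [c] under the connecting map of the exact sequence of a general pair. *)
Definition lift c (al be : 'I_r -> K) := forall i, [/\ sections (spec (B i)) Z (al i),
  sections (spec (B i)) M (be i) & c = a * be i + b * al i].
Definition cochain (be : 'I_r -> K) : 'M[K]_r := \matrix_(i, l) ((be l - be i) / b).
Definition lifted c u := exists al be, lift c al be /\ u = cochain be.

Lemma chart_sections_smod i (W : set K -> int) : smod A (sections (spec (B i)) W).
Proof.
have h F : spec (B i) F /\ krull_dim F 1 -> smod A [set x | val_ge F (W F) x].
  move=> [sF kF]; have pF := chart_pdiv sF kF; apply: smod_mono (val_ge_smod _ pF).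
  by apply: X_A; case: pF.
split.
- by move=> F hF; exact: sm0 (h F hF).
- by move=> x y hx hy F hF; apply: (smD (h F hF)); [exact: hx|exact: hy].
- by move=> d x Ad hx F hF; apply: (smM (h F hF)) => //; exact: hx.
Qed.

Lemma chart_stalk i (W : set K -> int) R x : spec (B i) R -> sections (spec (B i)) W x -> stalk X W R x.
Proof.
move=> [P pP RE] hx; have [hB _ _ sX] := cover_B i cB; have XR : X R by apply: sX; exists P.
apply/stalkP => F pF RF; have [XF kF] := pF; apply: hx; split=> //.
rewrite (X_gen XF XR RF); have lF := pdiv_local pF.
have pQ : prime_ideal R (nonunits F `&` R) by apply: nu_contr => //; exact: X_subring.
rewrite RE in pQ *; rewrite (loc_loc hB pP pQ); exists (nonunits F `&` localization (B i) P `&` B i) => //.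
exact: (prime_contr hB (@loc_sub _ _ _ hB pP) pQ).
Qed.

(** Where [b] generates [O_X(-M)] the quotient by [b] is regular; where [a] generates [O_X(-Z)] it
    equals [(al i - al l) / a], both lifts having the same image [c]. *)
Lemma lifted_cocycle c u : lifted c u -> cech_cocycles B u.
Proof.
move=> [al [be [hl ->]]]; split; last by move=> i l o; rewrite !mxE; field.
move=> i l R [si sl]; rewrite mxE; have [_ _ _ sX] := cover_B i cB; have XR := sX R si.
have hR := X_subring XR; have [_ _ hg] := gp2.
have [ai bi ci] := hl i; have [aL bL cL] := hl l.
have [lg|[_ bE]] := hg R XR; last first.
  have sM : smod R (stalk X M R) by exact: stalk_smod.
  have : stalk X M R (be l - be i).
    by apply: (smB hR sM); [exact: chart_stalk sl bL|exact: chart_stalk si bi].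
  by rewrite (lgen_stalk XR (conj b0 bE)) => /(prinP _ _ b0).
have sZ : smod R (stalk X Z R) by exact: stalk_smod.
have : stalk X Z R (al i - al l).
  by apply: (smB hR sZ); [exact: chart_stalk si ai|exact: chart_stalk sl aL].
rewrite (lgen_stalk XR lg) => /(prinP _ _ a0).
suff -> : (al i - al l) / a = (be l - be i) / b by [].
have e : a * (be l - be i) = b * (al i - al l).
  have -> : a * (be l - be i) = (a * be l + b * al l) - (a * be i + b * al i) + b * (al i - al l) by ring.
  by rewrite -cL -ci subrr add0r.
apply/eqP; rewrite eqr_div //; apply/eqP; rewrite mulrC -e; ring.
Qed.

Lemma lifted_sub c c' u u' : lifted c u -> lifted c' u' -> lifted (c - c') (u - u').
Proof.
move=> [al [be [h ->]]] [al' [be' [h' ->]]].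
exists (fun i => al i - al' i), (fun i => be i - be' i); split; last first.
  by apply/matrixP => i l; rewrite !mxE; ring.
move=> i; have [h1 h2 h3] := h i; have [h1' h2' h3'] := h' i; split.
- by apply: (smB hA (chart_sections_smod i Z)).
- by apply: (smB hA (chart_sections_smod i M)).
- by rewrite {1}h3 {1}h3'; ring.
Qed.

Lemma lifted_scale d c u : A d -> lifted c u -> lifted (d * c) (d *: u).
Proof.
move=> Ad [al [be [h ->]]]; exists (fun i => d * al i), (fun i => d * be i); split; last first.
  by apply/matrixP => i l; rewrite !mxE; ring.
move=> i; have [h1 h2 h3] := h i; split.
- exact: (smM (chart_sections_smod i Z)).
- exact: (smM (chart_sections_smod i M)).
- by rewrite {1}h3; ring.
Qed.

Lemma lifted0 : lifted 0 0.
Proof.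
exists (fun=> 0), (fun=> 0); split; last by apply/matrixP => i l; rewrite !mxE subrr mul0r.
move=> i; split; [exact: sm0 (chart_sections_smod i Z)|exact: sm0 (chart_sections_smod i M)|by rewrite !mulr0 addr0].
Qed.

Lemma lifted_add c c' u u' : lifted c u -> lifted c' u' -> lifted (c + c') (u + u').
Proof.
move=> h h'; rewrite -[c']opprK -[u']opprK; apply: lifted_sub => //.
by rewrite -[- c']sub0r -[- u']sub0r; apply: lifted_sub => //; exact: lifted0.
Qed.

(** Exactness in the middle: the lifts of [0] are the pairs [- a * v], [b * v]. *)
Lemma lifted_cob u : cech_coboundaries B u <-> lifted 0 u.
Proof.
split=> [[v [hv uE]]|[al [be [h ->]]]].
  exists (fun i => - (a * v i)), (fun i => b * v i); split; last first.
    by apply/matrixP => i l; rewrite uE !mxE; field.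
  have vF i F : spec (B i) F -> krull_dim F 1 -> F (v i) by move=> sF _; exact: hv.
  have mulv F x y n : prime_divisor X F -> val_ge F n x -> F y -> val_ge F n (x * y).
    by move=> pF hx Fy; exact: smMr (val_ge_smod n pF) Fy hx.
  move=> i; split; last by ring.
  - move=> F [sF kF]; have pF := chart_pdiv sF kF.
    apply: (smN (pdiv_subring pF) (val_ge_smod _ pF)); apply: mulv => //; last exact: vF.
    by apply/(vv_ge _ pF a0); exact: gen_ge gZ pF Ia a0.
  - move=> F [sF kF]; have pF := chart_pdiv sF kF; apply: mulv => //; last exact: vF.
    by apply/(vv_ge _ pF b0); exact: gen_ge gM pF mb b0.
exists (fun i => be i / b); split; last by move=> i l; rewrite mxE mulrBl.
move=> i R sR; have [_ _ _ sX] := cover_B i cB; have XR := sX R sR.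
have [ai bi ci] := h i; have [_ _ hg] := gp2; have [lg|lg] := hg R XR.
  have := chart_stalk sR ai; rewrite (lgen_stalk XR lg) => /(prinP _ _ a0) h1.
  have -> : be i / b = - (al i / a).
    apply/eqP; rewrite -subr_eq0 opprK; apply/eqP.
    have -> : be i / b + al i / a = (a * be i + b * al i) / (a * b) by field; rewrite a0 b0.
    by rewrite -ci mul0r.
  exact: srN (X_subring XR) h1.
by have := chart_stalk sR bi; rewrite (lgen_stalk XR lg) => /(prinP _ _ b0).
Qed.

(** The coboundary corrects the local lifts by [a * v] and [b * v]; they no longer depend on the
    chart and so are global sections. *)
Lemma lifted_two c u : lifted c u -> cech_coboundaries B u ->
  sadd (prin a (nonunits A)) (prin b I) c.
Proof.
move=> [al [be [h ->]]] [v [hv uE]].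
have [E eE] := exists_exc; have [i0 [Q [_ _]]] := cover_X cB (exc_X eE).
have bE i : be i - b * v i = be i0 - b * v i0.
  have := uE i i0; rewrite mxE => e.
  have : be i0 - be i = b * (v i0 - v i) by rewrite -e mulrC divfK.
  by move=> /eqP; rewrite subr_eq => /eqP ->; ring.
have aE i : al i + a * v i = al i0 + a * v i0.
  have [_ _ ci] := h i; have [_ _ c0] := h i0; apply: (mulfI b0).
  have -> : b * (al i + a * v i) = c - a * (be i - b * v i) by rewrite {1}ci; ring.
  by rewrite bE {1}c0; ring.
have mulv F x y n : prime_divisor X F -> val_ge F n x -> F y -> val_ge F n (x * y).
  by move=> pF hx Fy; exact: smMr (val_ge_smod n pF) Fy hx.
have glue F : prime_divisor X F -> exists i, spec (B i) F.
  by move=> [XF _]; have [i [P [pP FE]]] := cover_X cB XF; exists i, P.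
exists (a * (be i0 - b * v i0)), (b * (al i0 + a * v i0)); split.
- exists (be i0 - b * v i0) => //; rewrite -sections_M; apply/sectionsP => F pF.
  have [i sF] := glue F pF; rewrite -(bE i); have [_ hb _] := h i; have [_ kF] := pF.
  apply: (smB (pdiv_subring pF) (val_ge_smod _ pF)); first exact: hb.
  apply: mulv => //; last exact: hv.
  by apply/(vv_ge _ pF b0); exact: gen_ge gM pF mb b0.
- exists (al i0 + a * v i0) => //; rewrite IZ; apply/sectionsP => F pF.
  have [i sF] := glue F pF; rewrite -(aE i); have [ha _ _] := h i; have [_ kF] := pF.
  apply: (smD (val_ge_smod _ pF)); first exact: ha.
  apply: mulv => //; last exact: hv.
  by apply/(vv_ge _ pF a0); exact: gen_ge gZ pF Ia a0.
- by have [_ _ {1}->] := h i0; ring.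
Qed.

Lemma two_lifted c : sadd (prin a (nonunits A)) (prin b I) c -> lifted c 0.
Proof.
move=> [_ [_ [[v mv <-] [w Iw <-] ->]]]; exists (fun=> w), (fun=> v); split; last first.
  by apply/matrixP => i l; rewrite !mxE subrr mul0r.
move=> i; split=> //.
- move=> F [sF kF]; have pF := chart_pdiv sF kF; case: (eqVneq w 0) => [->|w0]; first exact: val_ge_zero.
  by apply/(vv_ge _ pF w0); exact: gen_ge gZ pF Iw w0.
- move=> F [sF kF]; have pF := chart_pdiv sF kF; case: (eqVneq v 0) => [->|v0]; first exact: val_ge_zero.
  by apply/(vv_ge _ pF v0); exact: gen_ge gM pF mv v0.
Qed.

(** The cocycle attached to [c] depends on chosen lifts, so the map is linear only modulo
    coboundaries, as [len_hom2] allows. Its kernel is [a m + b I] and its image [W] is part of the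
    cocycles. *)
Lemma genus_bound e n : len A (sections X ZM : set K^o) (sadd (prin a (nonunits A)) (prin b I)) e ->
  len A (cech_cocycles B) (cech_coboundaries B) n -> (e <= n)%N.
Proof.
move=> he hn; have [sN' sN N'N] := len_sm he; have [sC sZ1 _] := len_sm hn.
pose W : set 'M[K]_r := [set u | exists2 c, sections X ZM c & lifted c u].
have sW : submodule A W.
  split.
  - by exists 0; [exact: sm0 sN|exact: lifted0].
  - by move=> u u' [c hc h] [c' hc' h']; exists (c + c'); [exact: smD sN _ _|exact: lifted_add].
  - by move=> d u Ad [c hc h]; exists (d * c); [exact: smM sN _ _|exact: lifted_scale].
have CW : cech_coboundaries B `<=` W by move=> u /lifted_cob h; exists 0 => //; exact: sm0 sN.
have WZ : W `<=` cech_cocycles B by move=> u [c _]; exact: lifted_cocycle.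
have [w hw le] := len_sub AN1 hn sW CW WZ.
suff h : len A (sections X ZM : set K^o) (sadd (prin a (nonunits A)) (prin b I)) w by rewrite (len_uniq he h).
have [f hf] : exists f : K -> 'M[K]_r, forall c, sections X ZM c -> lifted c (f c).
  have : forall c, exists u, sections X ZM c -> lifted c u.
    move=> c; case: (pselect (sections X ZM c)) => [hc|hc]; last by exists 0.
    have : forall i, exists p : K * K, [/\ sections (spec (B i)) Z p.1, sections (spec (B i)) M p.2 &
        c = a * p.2 + b * p.1].
      by move=> i; have [al [be h]] := chart_split i hc; exists (al, be).
    move=> /choice [p hp]; exists (cochain (fun i => (p i).2)) => _.
    by exists (fun i => (p i).1), (fun i => (p i).2).
  by move=> /choice [f h]; exists f.
apply: (@len_hom2 K K^o 'M[K]_r A AN1 _ _ W (cech_coboundaries B) f sN sN' N'N sW sC CW _ _ _ _ _ w hw).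
- by move=> c hc; exists c => //; exact: hf.
- move=> x y hx hy; apply/lifted_cob.
  have -> : (0 : K) = (x + y) - x - y by ring.
  by apply: lifted_sub; [apply: lifted_sub|]; apply: hf => //; exact: smD sN _ _.
- move=> d x Ad hx; apply/lifted_cob; have -> : (0 : K) = d * x - d * x by ring.
  by apply: lifted_sub; [apply: hf; exact: smM sN _ _|apply: lifted_scale => //; exact: hf].
- move=> u [c hc h]; exists c => //; apply/lifted_cob; rewrite -(subrr c).
  by apply: lifted_sub => //; exact: hf.
- move=> c hc; split; first exact: lifted_two (hf c hc).
  move=> h; apply/lifted_cob; rewrite -(subrr c) -[f c]subr0; apply: lifted_sub; first exact: hf.
  exact: two_lifted.
Qed.

End Cover.

(** * The bounds for [mu] and the formula with [epsilon] *)

Let MI := ideal_mul A (nonunits A) I.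
Let J := sections X ZM.

Lemma MI_smod : smod A MI. Proof. exact: ideal_span_smod. Qed.

Lemma J_smod : smod A J.
Proof.
have h F : prime_divisor X F -> smod A [set x | val_ge F (ZM F) x].
  by move=> pF; apply: smod_mono (val_ge_smod _ pF); apply: X_A; case: pF.
split.
- by move=> F pF; exact: val_ge_zero.
- by move=> x y hx hy F pF; apply: (smD (h F pF)); [exact: hx|exact: hy].
- by move=> d x Ad hx F pF; apply: (smM (h F pF)) => //; exact: hx.
Qed.

Lemma MI_J : MI `<=` J.
Proof.
apply: ideal_span_min; first exact: J_smod.
move=> _ [v [u [mv Iu ->]]]; apply/sectionsP => F pF.
case: (eqVneq v 0) => [->|v0]; first by rewrite mul0r; exact: val_ge_zero.
case: (eqVneq u 0) => [->|u0]; first by rewrite mulr0; exact: val_ge_zero.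
apply/(vv_ge _ pF (mulf_neq0 v0 u0)); rewrite vvM // addrC /ZM /=.
by apply: lerD; [exact: gen_ge gZ pF Iu u0|exact: gen_ge gM pF mv v0].
Qed.

Lemma two_genE f1 f2 (J1 J2 : set K) : two_gen f1 f2 J1 J2 = sadd (prin f1 J2) (prin f2 J1).
Proof.
rewrite eqEsubset; split=> x.
  by move=> [a [b [ha hb ->]]]; exists (f1 * b), (f2 * a); split=> //; [exists b|exists a].
by move=> [_ [_ [[b hb <-] [a ha <-] ->]]]; exists a, b.
Qed.

Lemma two_MI a b : gpair a b -> sadd (prin a (nonunits A)) (prin b I) `<=` MI.
Proof.
move=> [Ia [_ mb _]]; apply: (sadd_min MI_smod).
  by move=> _ [v mv <-]; apply: ideal_spanS; exists v, a; rewrite mulrC.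
by move=> _ [u Iu <-]; apply: ideal_spanS; exists b, u.
Qed.

Lemma model_main :
  let MZ := intersection A X M Z in
  let Im_closure := integral_closure A (ideal_mul A I (nonunits A)) in
  [/\ ((- MZ + 1)%:E >= mu A I)%E,
      (mu A I >= (- MZ + 1)%:E - geometric_genus A X)%E,
      length A (I : set K^o) Im_closure = ((- MZ + 1)%:E - epsilon A X Z M)%E
    & forall f g : K, general X M Z f g -> Im_closure = two_gen f g (nonunits A) I ->
        mu A I = (- MZ + 1)%:E].
Proof.
move=> MZ Imc; have ImcE : Imc = J by exact: closure_IM.
have [a [b gp]] := gpair_exists; have [n hn nE] := len_gpair gp; rewrite -/MZ in nE.
have colon a' b' : gpair a' b' -> len A (I : set K^o) (sadd (prin a' (nonunits A)) (prin b' I)) n.+1.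
  move=> gp'; have [n' hn' n'E] := len_gpair gp'.
  have -> : n = n' by move: n'E; rewrite -/MZ -nE => -[].
  exact: len_colon.
have JI : J `<=` I by exact: sections_ZM_I.
have two_J a' b' : gpair a' b' -> sadd (prin a' (nonunits A)) (prin b' I) `<=` J.
  by move=> gp'; exact: subset_trans (two_MI gp') MI_J.
have [l [e [hl he le]]] := len_split AN1 (colon a b gp) J_smod (two_J a b gp) JI.
have eps a' b' : gpair a' b' -> len A (J : set K^o) (sadd (prin a' (nonunits A)) (prin b' I)) e.
  move=> gp'; have [l' [e' [hl' he' le']]] := len_split AN1 (colon a' b' gp') J_smod (two_J a' b' gp') JI.
  have el := len_uniq hl hl'; subst l'.
  by have -> : e = e' by move/eqP: le'; rewrite le eqn_add2l => /eqP.
have epsE : epsilon A X Z M = (e%:Z)%:E.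
  rewrite /epsilon; case: xgetP => [x -> [f1 [f2 [/general_gpair g12 ->]]]|/(_ (e%:Z)%:E) []].
    by rewrite sections_M -IZ two_genE; exact: len_length (eps _ _ g12).
  exists a, b; split; first exact/general_gpair.
  by rewrite sections_M -IZ two_genE (len_length (eps _ _ gp)).
have N1 : (- MZ + 1)%:E = ((n.+1)%:Z)%:E by rewrite -nE -addn1.
have [u hu leu] := len_quo AN1 (colon a b gp) MI_smod (two_MI gp) (subset_trans MI_J JI).
have muE : mu A I = (u%:Z)%:E by exact: len_length hu.
(* As [n.+1 = l + e] and [e] is at most the genus, this is the lower bound for [mu]. *)
have lu : (l <= u)%N.
  by have [u' hu' le'] := len_quo AN1 hu J_smod MI_J JI; rewrite (len_uniq hl hu').
split.
- by rewrite N1 muE lee_fin lez_nat.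
(* An infinite genus makes the right side minus infinity; otherwise the genus is a length on some
   cover, and [genus_bound] applies. *)
- rewrite N1 muE /geometric_genus; case: xgetP => [x -> [r [B [cB ->]]]|_]; last by rewrite leNye.
  have [->|[n' hn']] := length_cases A (cech_cocycles B) (cech_coboundaries B); first by rewrite leNye.
  rewrite (len_length hn') -EFinB lee_fin.
  have := genus_bound cB gp he hn'; lia.
- rewrite ImcE N1 epsE (len_length hl) -EFinB; congr EFin; lia.
- move=> f g gen; rewrite ImcE two_genE saddC => E; have gp' := general_gpair' gen.
  have E' : MI = sadd (prin g (nonunits A)) (prin f I).
    rewrite eqEsubset; split; last exact: two_MI.
    by rewrite -E; exact: MI_J.
  by rewrite N1 /mu -/MI E' (len_length (colon _ _ gp')).
Qed.

End Model.

(** * Transfer of the hypotheses to the image of [A] in its field of fractions *)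

Lemma frac_div (A : idomainType) (x : {fraction A}) : exists n d, d != 0 /\ x = tofrac n / tofrac d.
Proof.
rewrite -[x]reprK; set y := repr x; exists (frac y).1, (frac y).2.
have d0 : (frac y).2 != 0 := denom_ratioP y.
split=> //; have d0' : tofrac (frac y).2 != 0 by rewrite tofrac_eq0.
apply: (mulIf d0'); rewrite divfK //.
rewrite /GRing.mul /=; unlock tofrac; rewrite -FracField.pi_mul; apply/eqmodP => /=.
rewrite FracField.equivfE /FracField.mulf /= !numden_Ratio ?mulf_neq0 ?oner_eq0 //.
by rewrite !mulr1 mulrC.
Qed.

(** Transposing the matrix turns the relations into a row eigenvector, so [x] is a root of a monic
    characteristic polynomial over [A]. *)
Lemma normal_eigen (A : idomainType) (x : {fraction A}) n (a : 'I_n -> {fraction A}) b :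
  normal A -> (exists i, a i != 0) -> (forall i j, base A (b i j)) ->
  (forall i, x * a i = \sum_j b i j * a j) -> base A x.
Proof.
move=> nA [i0 ai0] hb hx; apply: nA.
have [c hc] : exists c : 'I_n -> 'I_n -> A, forall i j, tofrac (c i j) = b i j.
  have : forall p : 'I_n * 'I_n, exists c, tofrac c = b p.1 p.2 by move=> p; have [c _ <-] := hb p.1 p.2; exists c.
  by move=> /choice [c hc]; exists (fun i j => c (i, j)) => i j; rewrite hc.
pose C : 'M[A]_n := \matrix_(i, j) c j i; exists (char_poly C); first exact: char_poly_monic.
rewrite map_char_poly -eigenvalue_root_char; apply/eigenvalueP; exists (\row_i a i).
  apply/rowP => i; rewrite !mxE hx; by apply: eq_bigr => j _; rewrite !mxE /= hc mulrC.
by apply/eqP => /rowP /(_ i0); rewrite !mxE => /eqP; rewrite (negPf ai0).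
Qed.

Lemma base_noetherian (A : idomainType) : noetherian [set: A] -> noetherian (base A).
Proof.
move=> nA J [JA [J0 JD JM]]; pose J' : set A := [set a | J (tofrac a)].
have [|s sE] := nA J'.
  split=> //; split; first by rewrite /J' /= rmorph0.
    by move=> x y hx hy; rewrite /J' /= rmorphD; exact: JD.
  by move=> a x _ hx; rewrite /J' /= rmorphM; apply: JM => //; exists a.
exists (map (@tofrac A) s); rewrite eqEsubset; split=> x.
  move=> Jx; have [a _ aE] := JA x Jx; rewrite -aE in Jx *.
  have : J' a by []. rewrite sE => h N sN sub.
  apply: (h [set a | N (tofrac a)]); last by move=> y ys; apply: sub => /=; exact: map_f.
  have [N0 ND NM] := sN; split; first by rewrite /= rmorph0.
    by move=> u v hu hv; rewrite /= rmorphD; exact: ND.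
  by move=> u v _ hv; rewrite /= rmorphM; apply: NM => //; exists u.
apply; first by split.
move=> _ /mapP [y ys ->]; have : J' y by rewrite sE => N _; apply.
by [].
Qed.

Unset Implicit Arguments.
Set Strict Implicit.
Set Printing Implicit Defensive.

Theorem theorem6p1 (A : idomainType) (k : closedFieldType)
    (iota : {rmorphism k -> A})
    (X : set (set {fraction A})) (M Z : set {fraction A} -> int)
    (I : set {fraction A}) :
  let A' := base A in
  let m := nonunits A' in
  let MZ := intersection A' X M Z in
  let Im_closure := integral_closure A' (ideal_mul A' I m) in
  excellent A -> normal A -> local_ring A' -> krull_dim A' 2%N ->
  (forall a : A, exists c : k, m (tofrac (a - iota c))) ->
  resolution A' X ->
  max_ideal_cycle A' X M ->
  max_primary A' I -> integral_closure A' I = I ->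
  represented A' X I Z ->
  generates X m M ->
  [/\ ((- MZ + 1)%:E >= mu A' I)%E,
      (mu A' I >= (- MZ + 1)%:E - geometric_genus A' X)%E,
      length A' (I : set {fraction A}^o) Im_closure
        = ((- MZ + 1)%:E - epsilon A' X Z M)%E
    & forall f g : {fraction A}, general X M Z f g ->
        Im_closure = two_gen f g m I ->
        mu A' I = (- MZ + 1)%:E].
Proof.
move=> A' m MZ Imc [nA _ _ _] norA lA dA res rX [[cM _] _] pI _ [cZ gZ _ IZ] gM.
have [iI rad] := pI; have [IA _] := iI.
have Im : I `<=` m by move=> x Ix; rewrite /m -rad; split; [exact: IA|exists 1%N].
pose j : {rmorphism k -> {fraction A}} := [the {rmorphism k -> {fraction A}} of @tofrac A \o iota].
have jA c : A' (j c) by exists (iota c).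
have resA x : A' x -> exists c, nonunits A' (x - j c).
  by move=> [a _ <-]; have [c hc] := res a; exists c; rewrite /j /= -rmorphB.
have fr x : exists a b, [/\ A' a, A' b, b != 0 & x = a / b].
  have [p [q [q0 ->]]] := frac_div x; exists (tofrac p), (tofrac q).
  by rewrite tofrac_eq0; split=> //; [exists p|exists q].
have cl x n (a : 'I_n -> {fraction A}) b : (exists i, a i != 0) -> (forall i j0, A' (b i j0)) ->
    (forall i, x * a i = \sum_j0 b i j0 * a j0) -> A' x by exact: normal_eigen.
exact: (model_main lA (base_noetherian nA) fr rX dA cl jA resA cM gM cZ gZ iI Im IZ pI).
Qed.
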